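(* Let $\mathbf{u}=(u,v,w)$, with pressure $p$, be a type I weak solution of the hydrostatic Euler equations on $\mathbb{T}^3\times(0,T)$ such that $u,v\in L^4((0,T);L^4(\mathbb{T}^3))$. Then the following equation of local energy balance holds in the sense of distributions (with test functions in $\mathcal{D}(\mathbb{T}^3\times(0,T))$): $$\partial_t(u^2+v^2)+\nabla\cdot\big[(u^2+v^2)\mathbf{u}\big]+2\nabla\cdot(p\mathbf{u})+\frac12D(\mathbf{u})=0,$$ where $$D(\mathbf{u})(x,t):=\lim_{\epsilon\to0}\int_{\mathbb{R}^3}\Big[\nabla\varphi_\epsilon(\xi)\cdot\delta\mathbf{u}(\xi;x,t)\big(|\delta u(\xi;x,t)|^2+|\delta v(\xi;x,t)|^2\big)\Big]d\xi,\qquad \delta u(\xi;x,t):=u(x+\xi,t)-u(x,t)$$ (and similarly for $\delta v$, $\delta\mathbf{u}$). The limit defining $D(\mathbf{u})$ exists with convergence in the space $W^{-1,1}((0,T);W^{-1,1}(\mathbb{T}^3))$, and it is independent of the choice of mollifier $\varphi_\epsilon$.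
   Context: $\mathbb{T}^3$ is the flat unit torus with coordinates $(x,y,z)$ (in integrals over $\mathbb{T}^3$ the spatial variable is also written $x$), $T>0$, and $\Omega\in\mathbb{R}$ is the Coriolis parameter. $\mathcal{D}(\mathbb{T}^3\times(0,T))$ denotes smooth real functions compactly supported in time in $(0,T)$. The hydrostatic Euler equations are $\partial_t u+\nabla\cdot(u\mathbf{u})-\Omega v+\partial_x p=0$, $\partial_t v+\nabla\cdot(v\mathbf{u})+\Omega u+\partial_y p=0$, $\partial_z p=0$, $\nabla\cdot\mathbf{u}=0$, considered on the torus under the symmetry conditions that $u,v,p$ are even in $z$ and $w$ is odd in $z$. Type I weak solution: $\mathbf{u}=(u,v,w):\mathbb{T}^3\times(0,T)\to\mathbb{R}^3$ and $p:\mathbb{T}^3\times(0,T)\to\mathbb{R}$ such that (i) $\mathbf{u}\in L^2(\mathbb{T}^3\times(0,T))$, $u,v\in L^\infty((0,T);L^2(\mathbb{T}^3))$, $p\in L^\infty((0,T);L^1(\mathbb{T}^3))$; (ii) for all $\phi_1,\phi_2,\phi_3,\phi_4\in\mathcal{D}(\mathbb{T}^3\times(0,T))$: $\int_0^T\int_{\mathbb{T}^3}[u\partial_t\phi_1+u\mathbf{u}\cdot\nabla\phi_1+\Omega v\phi_1+p\partial_x\phi_1]\,dx\,dt=0$, $\int_0^T\int_{\mathbb{T}^3}[v\partial_t\phi_2+v\mathbf{u}\cdot\nabla\phi_2-\Omega u\phi_2+p\partial_y\phi_2]\,dx\,dt=0$, $\int_0^T\int_{\mathbb{T}^3}p\,\partial_z\phi_3\,dx\,dt=0$,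 $\int_0^T\int_{\mathbb{T}^3}\mathbf{u}\cdot\nabla\phi_4\,dx\,dt=0$; (iii) $w(x,y,0,t)=w(x,y,1,t)=0$ (in the trace sense) for almost all $(x,y)\in\mathbb{T}^2$, $t\in(0,T)$. Mollifier: $\varphi\in C_c^\infty(\mathbb{R}^3;\mathbb{R})$ is a radial standard mollifier with $\int_{\mathbb{R}^3}\varphi\,dx=1$ and $\varphi_\epsilon(x)=\epsilon^{-3}\varphi(x/\epsilon)$. $W^{-1,1}$ denotes the usual negative-order Sobolev space (sums of $L^1$ functions and first-order distributional derivatives of $L^1$ functions; in time, with values in $W^{-1,1}(\mathbb{T}^3)$). *)

(* Defs.v *)
From HB Require Import structures.
From mathcomp Require Import all_boot all_order all_algebra.
From mathcomp Require Import all_classical all_reals all_analysis.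

Set Implicit Arguments.
Unset Strict Implicit.
Unset Printing Implicit Defensive.

Import Order.TTheory GRing.Theory Num.Theory numFieldNormedType.Exports.

Local Open Scope classical_set_scope.
Local Open Scope ring_scope.

(* A space point is ((x, y), z) and a space-time point is (((x, y), z), t).
   A function on the torus is a function on R^3 with period 1 in each
   variable; [0, 1[^3 is the fundamental domain over which one integrates. *)
Notation pt3 R := (R * R * R)%type.
Notation pt4 R := (R * R * R * R)%type.

Notation leb1 R := (@lebesgue_measure R).
Notation leb3 R := (leb1 R \x leb1 R \x leb1 R)%E.
Notation leb4 R := (leb1 R \x leb1 R \x leb1 R \x leb1 R)%E.

Section domains.
Variable R : realType.

Definition cube : set (pt3 R) := `[0, 1[ `*` `[0, 1[ `*` `[0, 1[.

Definition cylinder (T : R) : set (pt4 R) := cube `*` `]0, T[.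

Definition ex3 : pt3 R := (1, 0, 0).
Definition ey3 : pt3 R := (0, 1, 0).
Definition ez3 : pt3 R := (0, 0, 1).
Definition ex4 : pt4 R := (1, 0, 0, 0).
Definition ey4 : pt4 R := (0, 1, 0, 0).
Definition ez4 : pt4 R := (0, 0, 1, 0).
Definition et4 : pt4 R := (0, 0, 0, 1).

Definition periodic (f : pt3 R -> R) : Prop :=
  forall x, [/\ f (x + ex3) = f x, f (x + ey3) = f x & f (x + ez3) = f x].

Definition field_on_torus (T : R) (f : pt4 R -> R) : Prop :=
  (forall t, periodic (fun x => f (x, t))) /\
  measurable_fun (cylinder T) f.

End domains.

Arguments cube : clear implicits.

Section test_functions.
Variable R : realType.

(* All iterated directional derivatives up to order k exist and are
   continuous. *)
Fixpoint Ck (V : normedModType R) (k : nat) (f : V -> R) : Prop :=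
  continuous f /\
  match k with
  | 0%N => True
  | k'.+1 => forall d : V, (forall x, derivable f x d) /\ Ck k' ('D_d f)
  end.

Definition smooth (V : normedModType R) (f : V -> R) : Prop :=
  forall k, Ck k f.

Definition test_torus (psi : pt3 R -> R) : Prop :=
  smooth psi /\ periodic psi.

Definition test_fun (T : R) (phi : pt4 R -> R) : Prop :=
  [/\ smooth phi,
      forall t, periodic (fun x => phi (x, t)) &
      exists a b : R, [/\ 0 < a, b < T &
        forall x t, phi (x, t) != 0 -> a <= t <= b]].

End test_functions.

Section distributions.
Variable R : realType.

(* Distributions are functionals whose values matter only on the relevant
   test functions (test_torus, resp. test_fun T). *)
Definition distr_torus (g : pt3 R -> R) : (pt3 R -> R) -> R :=
  fun psi => \int[leb3 R]_(x in cube R) (g x * psi x).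

Definition distr (T : R) (f : pt4 R -> R) : (pt4 R -> R) -> R :=
  fun phi => \int[leb4 R]_(q in cylinder T) (f q * phi q).

Definition dderive (V : normedModType R) (d : V) (L : (V -> R) -> R) :
  (V -> R) -> R := fun phi => - L ('D_d phi).

Definition distr_div (T : R) (f g h : pt4 R -> R) :
    (pt4 R -> R) -> R :=
  fun phi => dderive (ex4 R) (distr T f) phi + dderive (ey4 R) (distr T g) phi
           + dderive (ez4 R) (distr T h) phi.

(* Local integrability on the torus times the open interval ]0, T[: what is
   needed for distr T f to be a distribution. *)
Definition loc_integrable (T : R) (f : pt4 R -> R) : Prop :=
  forall a b : R, 0 < a -> b < T ->
    (leb4 R).-integrable (cube R `*` `[a, b]) (EFin \o f).

End distributions.

Section norms.
Variable R : realType.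

(* The norm of L^p((0,T); L^q(torus)). *)
Definition LpLq_norm (T : R) (p q : \bar R) (f : pt4 R -> R) : \bar R :=
  'N[leb1 R]_p[
    (fun t => 'N[leb3 R]_q[(fun x => (f (x, t))%:E) \_ (cube R)]%E)
      \_ `]0%R, T[ ]%E.

Definition L2_norm (T : R) (f : pt4 R -> R) : \bar R :=
  'N[leb4 R]_(2%:E)[(EFin \o f) \_ (cylinder T)]%E.

(* W^{-1,1}(torus): L = g0 + d_x g1 + d_y g2 + d_z g3 with g_i in L^1, normed
   by the infimum over all such decompositions (+oo if there is none). *)
Definition Wm11_decomposition (L : (pt3 R -> R) -> R)
    (g0 g1 g2 g3 : pt3 R -> R) : Prop :=
  [/\ (leb3 R).-integrable (cube R) (EFin \o g0),
      (leb3 R).-integrable (cube R) (EFin \o g1),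
      (leb3 R).-integrable (cube R) (EFin \o g2),
      (leb3 R).-integrable (cube R) (EFin \o g3) &
      forall psi, test_torus psi ->
        L psi = distr_torus g0 psi
              + dderive (ex3 R) (distr_torus g1) psi
              + dderive (ey3 R) (distr_torus g2) psi
              + dderive (ez3 R) (distr_torus g3) psi].

Definition L1_norm_torus (g : pt3 R -> R) : \bar R :=
  (\int[leb3 R]_(x in cube R) `|g x|%:E)%E.

Definition Wm11_norm (L : (pt3 R -> R) -> R) : \bar R :=
  ereal_inf [set N | exists g0 g1 g2 g3, Wm11_decomposition L g0 g1 g2 g3 /\
    N = (L1_norm_torus g0 + L1_norm_torus g1
         + L1_norm_torus g2 + L1_norm_torus g3)%E].

(* L^1((0,T); W^{-1,1}(torus)). As W^{-1,1}(torus) is separable and smooth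
   functions form a norming set for it, Pettis' theorem identifies Bochner
   measurability with measurability of the pairings with smooth functions. *)
Definition L1Wm11_norm (T : R) (G : R -> (pt3 R -> R) -> R) : \bar R :=
  (\int[leb1 R]_(t in `]0%R, T[) Wm11_norm (G t))%E.

Definition L1Wm11 (T : R) (G : R -> (pt3 R -> R) -> R) : Prop :=
  [/\ forall psi, test_torus psi ->
        measurable_fun (`]0, T[ : set (measurableTypeR R))
          (fun t : measurableTypeR R => G t psi),
      {ae leb1 R, forall t, t \in `]0, T[ -> (Wm11_norm (G t) < +oo)%E} &
      (L1Wm11_norm T G < +oo)%E].

Definition distr_time (T : R) (G : R -> (pt3 R -> R) -> R) :
    (pt4 R -> R) -> R :=
  fun phi => \int[leb1 R]_(t in `]0, T[) G t (fun x => phi (x, t)).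

(* W^{-1,1}((0,T); W^{-1,1}(torus)): L = G0 + d_t G1. *)
Definition Wm11Wm11_norm (T : R) (L : (pt4 R -> R) -> R) : \bar R :=
  ereal_inf [set N | exists G0 G1, [/\ L1Wm11 T G0, L1Wm11 T G1,
    (forall phi, test_fun T phi ->
       L phi = distr_time T G0 phi + dderive (et4 R) (distr_time T G1) phi) &
    N = (L1Wm11_norm T G0 + L1Wm11_norm T G1)%E]].

End norms.

Section hydrostatic_euler.
Variable R : realType.
Implicit Types u v w p : pt4 R -> R.

(* w has trace g on {z = z0}, approached from the side s = 1 (z > z0) or
   s = -1 (z < z0): as z tends essentially to z0, the slices of w converge to
   g in the sense of distributions in (x, y, t). *)
Definition has_trace (T : R) w (z0 s : R) (g : R -> R -> R -> R) : Prop :=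
  forall phi, test_fun T phi -> forall eta : R, 0 < eta ->
  exists delta : R, 0 < delta /\
  {ae leb1 R, forall h, 0 < h < delta ->
    `| \int[leb3 R]_(a in `[0, 1[ `*` `[0, 1[ `*` `]0, T[)
         ((w (a.1.1, a.1.2, z0 + s * h, a.2) - g a.1.1 a.1.2 a.2)
          * phi (a.1.1, a.1.2, z0, a.2)) | <= eta}.

Definition type_I_weak_solution (T Omega : R) u v w p : Prop :=
  [/\ [/\ field_on_torus T u, field_on_torus T v,
          field_on_torus T w & field_on_torus T p],
      [/\ (L2_norm T u < +oo)%E, (L2_norm T v < +oo)%E &
          (L2_norm T w < +oo)%E] /\
      [/\ (LpLq_norm T +oo 2%:E u < +oo)%E,
          (LpLq_norm T +oo 2%:E v < +oo)%E &
          (LpLq_norm T +oo 1%:E p < +oo)%E],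
      forall phi1 phi2 phi3 phi4,
        test_fun T phi1 -> test_fun T phi2 ->
        test_fun T phi3 -> test_fun T phi4 ->
      [/\ \int[leb4 R]_(q in cylinder T)
            (u q * 'D_(et4 R) phi1 q
             + u q * (u q * 'D_(ex4 R) phi1 q + v q * 'D_(ey4 R) phi1 q
                      + w q * 'D_(ez4 R) phi1 q)
             + Omega * v q * phi1 q + p q * 'D_(ex4 R) phi1 q) = 0,
          \int[leb4 R]_(q in cylinder T)
            (v q * 'D_(et4 R) phi2 q
             + v q * (u q * 'D_(ex4 R) phi2 q + v q * 'D_(ey4 R) phi2 q
                      + w q * 'D_(ez4 R) phi2 q)
             - Omega * u q * phi2 q + p q * 'D_(ey4 R) phi2 q) = 0,
          \int[leb4 R]_(q in cylinder T) (p q * 'D_(ez4 R) phi3 q) = 0 &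
          \int[leb4 R]_(q in cylinder T)
            (u q * 'D_(ex4 R) phi4 q + v q * 'D_(ey4 R) phi4 q
             + w q * 'D_(ez4 R) phi4 q) = 0] &
      has_trace T w 0 1 (fun _ _ _ => 0) /\
      has_trace T w 1 (-1) (fun _ _ _ => 0)].

Definition reflect_z (q : pt4 R) : pt4 R :=
  (q.1.1.1, q.1.1.2, - q.1.2, q.2).

Definition hydrostatic_symmetry (T : R) u v w p : Prop :=
  {ae leb4 R, forall q, cylinder T q ->
    [/\ u (reflect_z q) = u q, v (reflect_z q) = v q,
        p (reflect_z q) = p q & w (reflect_z q) = - w q]}.

Definition mollifier (rho : pt3 R -> R) : Prop :=
  [/\ smooth rho,
      compact (closure [set xi | rho xi != 0]),
      forall xi zeta : pt3 R,
        xi.1.1 ^+ 2 + xi.1.2 ^+ 2 + xi.2 ^+ 2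
          = zeta.1.1 ^+ 2 + zeta.1.2 ^+ 2 + zeta.2 ^+ 2 ->
        rho xi = rho zeta &
      \int[leb3 R]_xi rho xi = 1].

Definition rescale (rho : pt3 R -> R) (eps : R) : pt3 R -> R :=
  fun xi => eps ^- 3 * rho (eps^-1 *: xi).

Definition increment (f : pt4 R -> R) (xi : pt3 R) (q : pt4 R)
  : R := f (q.1 + xi, q.2) - f q.

Definition defect (rho : pt3 R -> R) (eps : R) u v w (q : pt4 R) : R :=
  \int[leb3 R]_xi
    (('D_(ex3 R) (rescale rho eps) xi * increment u xi q
      + 'D_(ey3 R) (rescale rho eps) xi * increment v xi q
      + 'D_(ez3 R) (rescale rho eps) xi * increment w xi q)
     * (`|increment u xi q| ^+ 2 + `|increment v xi q| ^+ 2)).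

(* d_t (u^2+v^2) + div ((u^2+v^2) (u,v,w)) + 2 div (p (u,v,w)) + D/2 = 0 in
   the sense of distributions; the first conjunct says that the functions
   being differentiated do define distributions. *)
Definition local_energy_balance (T : R) u v w p
    (D : (pt4 R -> R) -> R) : Prop :=
  let E q := u q ^+ 2 + v q ^+ 2 in
  [/\ loc_integrable T E
      /\ [/\ loc_integrable T (E \* u), loc_integrable T (E \* v)
           & loc_integrable T (E \* w)],
      [/\ loc_integrable T (p \* u), loc_integrable T (p \* v)
        & loc_integrable T (p \* w)] &
      forall phi, test_fun T phi ->
        dderive (et4 R) (distr T E) phi
        + distr_div T (E \* u) (E \* v) (E \* w) phi
        + 2 * distr_div T (p \* u) (p \* v) (p \* w) phi
        + 2^-1 * D phi = 0].

End hydrostatic_euler.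

(* Main.v *)
Require Import Defs.
From HB Require Import structures.
From mathcomp Require Import all_boot all_order all_algebra.
From mathcomp Require Import all_classical all_reals all_analysis.
From mathcomp Require Import measurable_realfun ess_sup_inf ring lra.

(** The proof is the argument of Duchon and Robert for the Euler equations, adapted
    to a pressure and a vertical velocity of lower regularity.

    All fields are extended periodically in space and by zero in time. Then each
    equation of the system is tested, at one of two points [Y] and [Y + z], with a
    mollified product of a test function and some field at the other point
    ([doubling_X], [doubling_Y]). A suitable combination of these identities is the
    [increment_identity]: for a smooth compactly supported kernel [K] in space-time,
    the integral of the gradient of [K] against the cubic expression in the increments
    of the velocity equals the integral of [K] against a two-point version of the
    energy and its flux, both tested with the derivatives of the test function. The
    Coriolis force cancels, and the vertical velocity occurs linearly because the
    pressure is independent of the height: [2 * (p u, p v, p w)] arises from the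
    two horizontal pressure gradients, the divergence equation and the vertical
    pressure equation. Concentrating the kernel in time gives [space_identity], where
    both points belong to the same time; its left-hand side is the pairing of the
    smoothed defect with the test function.

    As the kernel concentrates in space, the two-point fluxes tend in L^1 to their
    values on the diagonal, which are twice the energy and its flux
    ([fluxes_small]). Define [dissipation] by these diagonal values. The energy
    balance holds by definition, whatever the kernel, and the difference between the
    smoothed defect and the dissipation is a sum of first derivatives of functions that
    tend to zero in L^1; its norm is bounded by their integrals
    ([Wm11Wm11_norm_le]). This gives the convergence, and shows that the limit does not
    depend on the mollifier.

    For the fluxes to be integrable, and continuous under translations, the products
    of the pressure with the velocity have to be integrable, and [w] is only square
    integrable. So the pressure has to be square integrable ([pressure_L2]). It is
    constant in the vertical direction, and averaging the equations over the height
    shows that it solves a two-dimensional Poisson equation whose right-hand side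
    consists of second derivatives of [u ^+ 2], [u * v] and [v ^+ 2] and of first
    derivatives of the Coriolis force. In Fourier coefficients with respect to a real
    trigonometric basis, the corresponding operator has a bounded symbol
    ([symbol_bound]), and an integrable function with square summable coefficients is
    square integrable ([sqr_integrable_of_coefs]). The products of two fields at two
    points are then handled by three classes of functions that imitate L^4, L^2 and
    L^1 ([L4c], [L2c], [L1c]). *)

Set Implicit Arguments.
Unset Strict Implicit.
Unset Printing Implicit Defensive.

Import Order.TTheory GRing.Theory Num.Theory numFieldNormedType.Exports.

Local Open Scope classical_set_scope.
Local Open Scope ring_scope.

Local Notation periodic := Defs.periodic.

(** * Integrable real functions *)

Section integrable_real_functions.
Context d (X : measurableType d) (R : realType).
Implicit Types (m : {measure set X -> \bar R}) (f g : X -> R).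

Definition L1 m f := m.-integrable setT (EFin \o f).

Lemma L1_measurable m f : L1 m f -> measurable_fun setT f.
Proof. by move=> /measurable_int /measurable_EFinP. Qed.

Lemma L1_le m f g : measurable_fun setT f -> L1 m g ->
  (forall x, `|f x| <= g x) -> L1 m f.
Proof.
move=> mf ig fg; apply: le_integrable ig => //; first exact/measurable_EFinP.
by move=> x _ /=; rewrite lee_fin (le_trans (fg x)) ?ler_norm.
Qed.

Lemma L1D m f g : L1 m f -> L1 m g -> L1 m (fun x => f x + g x).
Proof. by move=> fi gi; apply: eq_integrable (integrableD _ fi gi). Qed.

Lemma L1B m f g : L1 m f -> L1 m g -> L1 m (fun x => f x - g x).
Proof. by move=> fi gi; apply: eq_integrable (integrableB _ fi gi). Qed.

Lemma L1Z m k f : L1 m f -> L1 m (fun x => k * f x).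
Proof.
by move=> fi; apply: eq_integrable (integrableZl _ k fi).
Qed.

Lemma L1N m f : L1 m f -> L1 m (fun x => - f x).
Proof. by move=> fi; apply: eq_integrable (integrableN fi). Qed.

Lemma L1_norm m f : L1 m f -> L1 m (fun x => `|f x|).
Proof. exact: integrable_norm. Qed.

Lemma L1_0 m : L1 m (fun=> 0).
Proof. exact: integrable0. Qed.

Lemma eq_L1 m f g : (forall x, f x = g x) -> L1 m f -> L1 m g.
Proof. by move=> /funext ->. Qed.

Lemma L1_sum (I : Type) (s : seq I) (P : pred I) m (F : I -> X -> R) :
  (forall i, P i -> L1 m (F i)) -> L1 m (fun x => \sum_(i <- s | P i) F i x).
Proof.
move=> iF; elim: s => [|i s ih].
  by apply: eq_L1 (L1_0 m) => x; rewrite big_nil.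
have [Pi|Pi] := boolP (P i).
  by apply: eq_L1 (L1D (iF i Pi) ih) => x; rewrite big_cons Pi.
by apply: eq_L1 ih => x; rewrite big_cons (negbTE Pi).
Qed.

Lemma L1_bounded m f (M : R) : (m setT < +oo)%E -> measurable_fun setT f ->
  (forall x, `|f x| <= M) -> L1 m f.
Proof.
move=> mfin mf fM; apply: measurable_bounded_integrable => //.
by exists M; split; [exact: num_real|move=> z Mz x _; exact: le_trans (fM x) (ltW Mz)].
Qed.

(** Test functions and kernels are bounded, and enter integrals as factors. *)
Lemma L1_Mbounded m f g (M : R) : L1 m f -> measurable_fun setT g ->
  (forall x, `|g x| <= M) -> L1 m (fun x => g x * f x).
Proof.
move=> fi mg gM; apply: (@L1_le _ _ (fun x => M * `|f x|)).
- by apply: measurable_funM => //; exact: L1_measurable fi.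
- exact/L1Z/L1_norm.
- by move=> x; rewrite normrM ler_wpM2r.
Qed.

Lemma IntD m f g : L1 m f -> L1 m g ->
  \int[m]_x (f x + g x) = \int[m]_x f x + \int[m]_x g x.
Proof. exact: RintegralD. Qed.

Lemma IntB m f g : L1 m f -> L1 m g ->
  \int[m]_x (f x - g x) = \int[m]_x f x - \int[m]_x g x.
Proof. exact: RintegralB. Qed.

Lemma IntZ m k f : L1 m f -> \int[m]_x (k * f x) = k * \int[m]_x f x.
Proof. by move=> fi; rewrite RintegralZl. Qed.

Lemma Int0 m : \int[m]_x (0 : R) = 0.
Proof. by rewrite /Rintegral integral0. Qed.

Lemma Int_sum (I : Type) (s : seq I) (P : pred I) m (F : I -> X -> R) :
  (forall i, P i -> L1 m (F i)) ->
  \int[m]_x (\sum_(i <- s | P i) F i x) = \sum_(i <- s | P i) \int[m]_x F i x.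
Proof.
move=> iF; elim: s => [|i s ih].
  by rewrite big_nil -[RHS](Int0 m); apply: eq_Rintegral => x _; rewrite big_nil.
rewrite big_cons; case: ifPn => Pi.
  rewrite -ih -IntD; [|exact: iF|exact: L1_sum].
  by apply: eq_Rintegral => x _; rewrite big_cons Pi.
by rewrite -ih; apply: eq_Rintegral => x _; rewrite big_cons (negbTE Pi).
Qed.

Lemma le_Int m f g : L1 m f -> L1 m g -> (forall x, f x <= g x) ->
  \int[m]_x f x <= \int[m]_x g x.
Proof. by move=> fi gi fg; apply: le_Rintegral. Qed.

Lemma Int_ge0 m f : (forall x, 0 <= f x) -> 0 <= \int[m]_x f x.
Proof. by move=> f0; apply: Rintegral_ge0. Qed.

Lemma norm_Int_le m f g : L1 m f -> L1 m g -> (forall x, `|f x| <= g x) ->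
  `|\int[m]_x f x| <= \int[m]_x g x.
Proof.
move=> fi gi fg; apply: le_trans (le_normr_Rintegral _ fi) _ => //.
by apply: le_Int => //; exact: L1_norm.
Qed.

Lemma eq_Int m f g : (forall x, f x = g x) -> \int[m]_x f x = \int[m]_x g x.
Proof. by move=> fg; apply: eq_Rintegral => x _; exact: fg. Qed.

Lemma EFin_Int m f : L1 m f -> (\int[m]_x f x)%:E = (\int[m]_x (f x)%:E)%E.
Proof. by move=> fi; rewrite /Rintegral fineK//; exact: integrable_fin_num. Qed.

Lemma L1_ge0P m f : measurable_fun setT f -> (forall x, 0 <= f x) ->
  (\int[m]_x (f x)%:E < +oo)%E -> L1 m f.
Proof.
move=> mf f0 foo; apply/integrableP; split; first exact/measurable_EFinP.
by under eq_integral do rewrite gee0_abs ?lee_fin//.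
Qed.

Lemma ae_eq_Int m f g : L1 m f -> L1 m g -> {ae m, forall x, f x = g x} ->
  \int[m]_x f x = \int[m]_x g x.
Proof.
move=> fi gi fg; rewrite /Rintegral; congr fine; apply: ae_eq_integral => //.
- exact: measurable_int fi.
- exact: measurable_int gi.
- by apply: filterS fg => x -> _.
Qed.

(** The integral of a non-negative function is a supremum over simple functions
    below it, so monotonicity needs no measurability. *)
Lemma ge0_le_integral_nonmeasurable m (D : set X) (f g : X -> \bar R) :
  (forall x, D x -> (0 <= f x)%E) -> (forall x, D x -> (f x <= g x)%E) ->
  (\int[m]_(x in D) f x <= \int[m]_(x in D) g x)%E.
Proof.
move=> f0 fg; rewrite !ge0_integralE//; last by move=> x Dx; exact: le_trans (f0 _ Dx) (fg _ Dx).
apply: ereal_sup_le => _ [h hf <-]; exists h => // x.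
apply: le_trans (hf x) _; rewrite /patch; case: ifPn => // xD.
by apply: fg; rewrite inE in xD.
Qed.

End integrable_real_functions.

(** The product of two sigma-finite measures, bundled with its own
    sigma-finiteness so that products can be iterated. *)
Section bundled_product.
Context d1 d2 (X : measurableType d1) (Y : measurableType d2) (R : realType).
Variables (m1 : {sigma_finite_measure set X -> \bar R})
  (m2 : {sigma_finite_measure set Y -> \bar R}).

Lemma sigma_finite_prod : sigma_finite setT (m1 \x m2)%E.
Proof.
have /sigma_finiteP[F [TF ndF Foo]] := sigma_finiteT m1.
have /sigma_finiteP[G [TG ndG Goo]] := sigma_finiteT m2.
exists (fun n => F n `*` G n).
  rewrite -setXTT TF TG predeqE => -[x y]; split.
    move=> [/= [n _ Fnx] [k _ Gky]]; exists (maxn n k) => //; split.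
    - by move: x Fnx; exact/subsetPset/ndF/leq_maxl.
    - by move: y Gky; exact/subsetPset/ndG/leq_maxr.
  by move=> [n _ []/= ? ?]; split; exists n.
move=> k; have [? ?] := Foo k; have [? ?] := Goo k.
split; first exact: measurableX.
by rewrite product_measure1E// lte_mul_pinfty// ge0_fin_numE.
Qed.

Definition prod_set_function : set (X * Y) -> \bar R := (m1 \x m2)%E.

HB.instance Definition _ := Measure.on prod_set_function.
HB.instance Definition _ := Measure_isSigmaFinite.Build _ _ _ prod_set_function
  sigma_finite_prod.

Definition prodm := [the {sigma_finite_measure set _ -> \bar R} of prod_set_function].

Lemma prodmE A B : measurable A -> measurable B -> prodm (A `*` B) = (m1 A * m2 B)%E.
Proof. exact: product_measure1E. Qed.

Lemma prodm_unique (m' : {measure set (X * Y) -> \bar R}) :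
    (forall A B, measurable A -> measurable B -> m' (A `*` B) = (m1 A * m2 B)%E) ->
  forall A, measurable A -> prodm A = m' A.
Proof. exact: product_measure_unique. Qed.

End bundled_product.

Section product_integrals.
Context d1 d2 (X : measurableType d1) (Y : measurableType d2) (R : realType).
Variables (m1 : {sigma_finite_measure set X -> \bar R})
  (m2 : {sigma_finite_measure set Y -> \bar R}).
Implicit Types f : X * Y -> R.

Let integrable_fubini_G f : L1 (prodm m1 m2) f ->
  m2.-integrable setT (fubini_G m1 (EFin \o f)).
Proof.
move=> fi; have mf : measurable_fun setT (EFin \o f) := measurable_int _ fi.
have h := (integrable21ltyP m1 m2 mf).1 fi; apply/integrableP; split.
  exact: (measurable_fubini_G fi).
apply: le_lt_trans h.
apply: ge0_le_integral_nonmeasurable => // y _.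
by apply: le_abse_integral => //; apply: measurableT_comp.
Qed.

Lemma Int_prod12 f : L1 (prodm m1 m2) f ->
  \int[(prodm m1 m2)]_z f z = \int[m1]_x \int[m2]_y f (x, y).
Proof.
move=> fi; rewrite /Rintegral -(integral12_prod_meas1 fi); congr fine.
apply: ae_eq_integral => //.
- by have /integrable_fubini_F/measurable_int := fi.
- apply/measurable_EFinP; apply: measurableT_comp => //.
  by have /integrable_fubini_F/measurable_int := fi.
- apply: filterS (ae_integrable1 fi) => x xi _.
  by rewrite fineK//; exact: integrable_fin_num.
Qed.

Lemma Int_prod21 f : L1 (prodm m1 m2) f ->
  \int[(prodm m1 m2)]_z f z = \int[m2]_y \int[m1]_x f (x, y).
Proof.
move=> fi; rewrite /Rintegral -(integral21_prod_meas1 fi); congr fine.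
apply: ae_eq_integral => //.
- by have /integrable_fubini_G/measurable_int := fi.
- apply/measurable_EFinP; apply: measurableT_comp => //.
  by have /integrable_fubini_G/measurable_int := fi.
- apply: filterS (ae_integrable2 fi) => x xi _.
  by rewrite fineK//; exact: integrable_fin_num.
Qed.

Lemma L1_Int1 f : L1 (prodm m1 m2) f -> L1 m1 (fun x => \int[m2]_y f (x, y)).
Proof.
move=> fi; have iF := integrable_fubini_F fi.
apply/integrableP; split.
  apply/measurable_EFinP; apply: measurableT_comp => //.
  exact: measurable_int iF.
have /integrableP[mF] := iF; apply: le_lt_trans.
apply: ge0_le_integral => //.
- apply: measurableT_comp => //; apply/measurable_EFinP.
  apply: measurableT_comp => //; exact: measurable_int iF.
- exact: measurableT_comp.
- move=> x _ /=; rewrite /Rintegral; rewrite /fubini_F.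
  by case: (integral _ _ _) => [r| |] //=; rewrite leey.
Qed.

Lemma L1_Int2 f : L1 (prodm m1 m2) f -> L1 m2 (fun y => \int[m1]_x f (x, y)).
Proof.
move=> fi; have iF := integrable_fubini_G fi.
apply/integrableP; split.
  apply/measurable_EFinP; apply: measurableT_comp => //.
  exact: measurable_int iF.
have /integrableP[mF] := iF; apply: le_lt_trans.
apply: ge0_le_integral => //.
- apply: measurableT_comp => //; apply/measurable_EFinP.
  apply: measurableT_comp => //; exact: measurable_int iF.
- exact: measurableT_comp.
- move=> x _ /=; rewrite /Rintegral; rewrite /fubini_G.
  by case: (integral _ _ _) => [r| |] //=; rewrite leey.
Qed.

Lemma L1_prod21 f (c : Y -> R) : measurable_fun setT f -> L1 m2 c ->
  (forall y, L1 m1 (fun x => f (x, y))) ->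
  (forall y, \int[m1]_x `|f (x, y)| <= c y) -> L1 (prodm m1 m2) f.
Proof.
move=> mf ci fi fc; apply/integrable21ltyP; first exact/measurable_EFinP.
apply: le_lt_trans (integrable_lty measurableT (L1_norm ci)).
apply: ge0_le_integral_nonmeasurable => [y _|y _]; first exact: integral_ge0.
have := fc y; rewrite -lee_fin EFin_Int; last exact/L1_norm/fi.
by move=> h; apply: le_trans h _; rewrite /= lee_fin ler_norm.
Qed.

Lemma L1_prod12 f (c : X -> R) : measurable_fun setT f -> L1 m1 c ->
  (forall x, L1 m2 (fun y => f (x, y))) ->
  (forall x, \int[m2]_y `|f (x, y)| <= c x) -> L1 (prodm m1 m2) f.
Proof.
move=> mf ci fi fc; apply/integrable12ltyP; first exact/measurable_EFinP.
apply: le_lt_trans (integrable_lty measurableT (L1_norm ci)).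
apply: ge0_le_integral_nonmeasurable => [y _|y _]; first exact: integral_ge0.
have := fc y; rewrite -lee_fin EFin_Int; last exact/L1_norm/fi.
by move=> h; apply: le_trans h _; rewrite /= lee_fin ler_norm.
Qed.

Lemma L1_tensor (f : X -> R) (g : Y -> R) : L1 m1 f -> L1 m2 g ->
  L1 (prodm m1 m2) (fun z => f z.1 * g z.2).
Proof.
move=> fi gi; apply: (@L1_prod12 _ (fun x => `|f x| * \int[m2]_y `|g y|)).
- apply: measurable_funM.
    by apply: (@measurableT_comp _ _ _ _ _ _ f _ fst) => //; exact: L1_measurable fi.
  by apply: (@measurableT_comp _ _ _ _ _ _ g _ snd) => //; exact: L1_measurable gi.
- by apply: eq_L1 (L1Z _ (L1_norm fi)) => x; rewrite mulrC.
- by move=> x; exact: (L1Z (f x) gi).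
- move=> x; rewrite -(IntZ _ (L1_norm gi)) le_eqVlt; apply/orP; left.
  by apply/eqP/eq_Int => y /=; rewrite normrM.
Qed.

End product_integrals.

(** * Measure-preserving maps *)

Section measure_preserving.
Context d (X : measurableType d) (R : realType).
Implicit Types (m : {measure set X -> \bar R}) (S : X -> X).

Definition preserves m S :=
  measurable_fun setT S /\ (forall A, measurable A -> m (S @^-1` A) = m A).

Lemma preserves_ge0 m S (f : X -> \bar R) : preserves m S ->
  measurable_fun setT f -> (forall x, (0 <= f x)%E) ->
  (\int[m]_x f (S x) = \int[m]_x f x)%E.
Proof.
move=> [mS mSE] mf f0; have := ge0_integral_pushforward mS m measurableT mf.
move=> /(_ (fun _ _ => f0 _)); rewrite preimage_setT => <-.
by apply: eq_measure_integral => A mA _; exact: mSE.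
Qed.

Lemma L1_preserves m S f : preserves m S -> L1 m f -> L1 m (f \o S).
Proof.
move=> [mS mSE] fi; have mf := L1_measurable fi.
apply/integrableP; split.
  by apply/measurable_EFinP; exact: measurableT_comp.
have := @preserves_ge0 m S (fun x => `|f x|%:E) (conj mS mSE).
rewrite /= => ->; [by have /integrableP[] := fi| |by move=> x; rewrite lee_fin].
by apply/measurable_EFinP; exact: measurableT_comp.
Qed.

Lemma Int_preserves m S f : preserves m S -> L1 m f ->
  \int[m]_x f (S x) = \int[m]_x f x.
Proof.
move=> mpS fi; have [mS mSE] := mpS; rewrite /Rintegral; congr fine.
have /= := @integral_pushforward _ _ _ _ _ _ mS m setT (EFin \o f).
rewrite preimage_setT => <- //.
- by apply: eq_measure_integral => A mA _; exact: mSE.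
- by apply/measurable_EFinP; exact: L1_measurable fi.
- exact: L1_preserves.
Qed.

Lemma preserves_id m : preserves m id.
Proof. by split. Qed.

End measure_preserving.

Section measure_preserving_product.
Context d1 d2 (X : measurableType d1) (Y : measurableType d2) (R : realType).
Variables (m1 : {sigma_finite_measure set X -> \bar R})
  (m2 : {sigma_finite_measure set Y -> \bar R}).

Lemma preserves_prod (S1 : X -> X) (S2 : Y -> Y) :
  preserves m1 S1 -> preserves m2 S2 ->
  preserves (prodm m1 m2) (fun z => (S1 z.1, S2 z.2)).
Proof.
move=> [mS1 S1E] [mS2 S2E].
have mS : measurable_fun [set: X * Y] (fun z : X * Y => (S1 z.1, S2 z.2)).
  apply: measurable_fun_pair.
    exact: (measurableT_comp mS1 measurable_fst).
  exact: (measurableT_comp mS2 measurable_snd).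
split=> // A mA.
pose S z := (S1 z.1, S2 z.2).
have := @prodm_unique _ _ _ _ _ m1 m2 (pushforward (prodm m1 m2) S).
move=> /(_ mS) E; apply/esym; apply: E => // B C mB mC.
rewrite /= /pushforward/= -[S @^-1` _]/((S1 @^-1` B) `*` (S2 @^-1` C)).
rewrite prodmE.
- by congr (_ * _)%E; [exact: S1E|exact: S2E].
- by rewrite -[_ @^-1` _]setTI; exact: mS1.
- by rewrite -[_ @^-1` _]setTI; exact: mS2.
Qed.

End measure_preserving_product.

(** * The unit circle *)

Section circle.
Variable R : realType.

Definition frac (x : R) : R := x - (Num.floor x)%:~R.

Lemma frac_itv x : 0 <= frac x < 1.
Proof.
by rewrite /frac subr_ge0 ge_floor/= ltrBlDl -[1]/(1%:~R) -intrD1 floorD1_gt.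
Qed.

Lemma frac_id x : 0 <= x < 1 -> frac x = x.
Proof.
by move=> x01; rewrite /frac (_ : Num.floor x = 0) ?subr0//; apply/floor_def.
Qed.

Lemma measurable_frac : measurable_fun setT frac.
Proof.
apply: measurable_funB => //.
apply: (measurability _ (RGenCInfty.measurableE R)) => _ [_ [a ->] <-].
rewrite setTI (_ : _ @^-1` _ = `[(Num.ceil a)%:~R, +oo[%classic).
  exact: measurable_itv.
by apply/seteqP; split => x /=; rewrite !in_itv/= !andbT -ceil_le_int -floor_ge_int.
Qed.

Definition circ : set (measurableTypeR R) -> \bar R :=
  mrestr (leb1 R) (measurable_itv `[0%R, 1%R[).

HB.instance Definition _ := Measure.on circ.

Lemma circ_setT : circ setT = 1%:E.
Proof. by rewrite /circ /mrestr setTI lebesgue_measure_itv/= lte_fin ltr01 oppr0 adde0. Qed.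

HB.instance Definition _ := Measure_isProbability.Build _ _ _ circ circ_setT.

End circle.
Arguments circ : clear implicits.

(** * Restricted measures *)

Section restricted_measures.
Context d (X : measurableType d) (R : realType).
Implicit Types (n m : {measure set X -> \bar R}) (D : set X).

Definition restricts n m D :=
  measurable D /\ (forall A, measurable A -> n A = m (A `&` D)).

Lemma restricts_setT m : restricts m m setT.
Proof. by split=> // A mA; rewrite setIT. Qed.

Lemma integral_restricts n m D (f : X -> \bar R) : restricts n m D ->
  measurable_fun setT f -> (\int[n]_x f x = \int[m]_(x in D) f x)%E.
Proof.
move=> [mD nE].
have pos (g : X -> \bar R) : measurable_fun setT g -> (forall x, (0 <= g x)%E) ->
    (\int[n]_x g x = \int[m]_(x in D) g x)%E.
  move=> mg g0; rewrite (@ge0_negligible_integral _ _ _ n setT (~` D))//.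
  - rewrite setTD setCK; apply: eq_measure_integral => A mA AD.
    by rewrite nE// setIidl.
  - exact: measurableC.
  - by rewrite nE ?setICl//; exact: measurableC.
move=> mf; rewrite integralE [RHS]integralE pos ?pos//.
- exact: measurable_funeneg.
- exact: measurable_funepos.
Qed.

Lemma restricts_L1 n m D f : restricts n m D -> L1 n f ->
  m.-integrable D (EFin \o f).
Proof.
move=> nm fi; have mf := L1_measurable fi; move/integrableP : fi => [_ fi].
apply/integrableP; split; first exact/measurable_EFinP/measurable_funTS.
rewrite -(integral_restricts nm)//; apply: measurableT_comp => //.
exact/measurable_EFinP.
Qed.

Lemma Int_restricts n m D f : restricts n m D -> measurable_fun setT f ->
  \int[n]_x f x = \int[m]_(x in D) f x.
Proof.
by move=> nm mf; rewrite /Rintegral (integral_restricts nm)//; exact/measurable_EFinP.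
Qed.

End restricted_measures.

Section restricted_product.
Context d1 d2 (X : measurableType d1) (Y : measurableType d2) (R : realType).
Variables (n1 m1 : {sigma_finite_measure set X -> \bar R})
  (n2 m2 : {sigma_finite_measure set Y -> \bar R}).

Lemma restricts_prod D1 D2 : restricts n1 m1 D1 -> restricts n2 m2 D2 ->
  restricts (prodm n1 n2) (prodm m1 m2) (D1 `*` D2).
Proof.
move=> [mD1 n1E] [mD2 n2E]; have mD : measurable (D1 `*` D2) by exact: measurableX.
split=> // A mA; have := @prodm_unique _ _ _ _ _ n1 n2 (mrestr (prodm m1 m2) mD).
apply => // B C mB mC; rewrite /= /mrestr -setXI prodmE.
- by rewrite n1E// n2E.
- exact: measurableI.
- exact: measurableI.
Qed.

End restricted_product.

(** * Translations of the line and rotations of the circle *)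

Section translations.
Variable R : realType.

Lemma preserves_shift (s : R) : preserves (leb1 R) (fun x => x + s).
Proof.
have mS : measurable_fun setT (fun x : measurableTypeR R => (x + s : measurableTypeR R)).
  exact: measurable_funD.
split=> // A mA; have := @lebesgue_measure_unique R (pushforward (leb1 R) ((fun x => x + s) : _ -> measurableTypeR R)).
move=> /(_ mS) H; apply/esym; apply: H => // _ [[a b]] _ <-.
rewrite /= /pushforward.
have -> : (fun x : R => x + s) @^-1` `]a, b]%classic = `]a - s, b - s]%classic.
  by apply/seteqP; split => x /=; rewrite !in_itv/= ltrBlDr lerBrDr.
rewrite !lebesgue_measure_itv/= !lte_fin ltrD2r; case: ifPn => // _.
by rewrite -!EFinD; congr EFin; ring.
Qed.

Lemma preserves_opp : preserves (leb1 R) (fun x => - x).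
Proof.
split; last by move=> A mA; exact: lebesgue_measureN.
exact: (@oppr_measurable R setT).
Qed.

Definition rot (s x : R) : R := frac (x + s).

Lemma frac_addz (x : R) (k : int) : frac (x + k%:~R) = frac x.
Proof.
have -> : frac (x + k%:~R) = x + k%:~R - (Num.floor x + k)%:~R.
  by rewrite /frac floorDrz ?intr_int// intrKfloor.
by rewrite intrD /frac; ring.
Qed.

Lemma circ_restricts : restricts (circ R) (leb1 R) `[0, 1[.
Proof. by split; [exact: measurable_itv|]. Qed.

Lemma preserves_rot s : preserves (circ R) (rot s).
Proof.
split; first exact: (measurableT_comp (@measurable_frac R) (preserves_shift s).1).
move=> A mA; rewrite /circ /mrestr.
have /andP[s0 s1] := frac_itv s.
set r := frac s in s0 s1.
have rotE x : rot s x = frac (x + r).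
  have -> : x + r = x + s + (- Num.floor s)%:~R by rewrite /r /frac mulrNz addrA.
  by rewrite frac_addz.
have m1 : measurable (A `&` `[r, 1[) by exact: measurableI.
have m2 : measurable (A `&` `[0, r[) by exact: measurableI.
have [mS1 S1E] := preserves_shift r.
have [mS2 S2E] := preserves_shift (r - 1).
rewrite [X in lebesgue_measure X = _](_ : _ =
    ((fun x => x + r) @^-1` (A `&` `[r, 1[)) `|`
    ((fun x => x + (r - 1)) @^-1` (A `&` `[0, r[))); last first.
  apply/seteqP; split=> x /=; rewrite !in_itv/= rotE.
    move=> [xA /andP[x0 x1]]; have [xr|xr] := ltP (x + r) 1.
      left; move: xA; rewrite frac_id ?xr ?andbT; last by rewrite addr_ge0.
      by split => //; rewrite lerDr x0.
    right; have e : frac (x + r) = x + (r - 1).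
      rewrite (_ : x + r = x + (r - 1) + (1 : int)%:~R); last by ring.
      by rewrite frac_addz frac_id//; apply/andP; split; lra.
    by rewrite -e; split => //; rewrite e; apply/andP; split; lra.
  move=> [|] [xA /andP[x0 x1]].
    rewrite frac_id; last by apply/andP; split; lra.
    by split => //; apply/andP; split; lra.
  rewrite (_ : x + r = x + (r - 1) + (1 : int)%:~R); last by ring.
  rewrite frac_addz frac_id; last by apply/andP; split; lra.
  by split => //; apply/andP; split; lra.
rewrite measureU.
- transitivity (leb1 R (A `&` `[r, 1%R[) + leb1 R (A `&` `[0%R, r[))%E.
    by congr (_ + _)%E; [exact: S1E|exact: S2E].
  rewrite -measureU//.
    congr (lebesgue_measure _); rewrite -setIUr; congr (_ `&` _).
    apply/seteqP; split=> x /=; rewrite !in_itv/=.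
      by move=> [|] /andP[x0 x1]; apply/andP; split; lra.
    move=> /andP[x0 x1]; have [xr|xr] := ltP x r; first by right; rewrite x0.
    by left.
  apply/seteqP; split=> x //=; rewrite !in_itv/=.
  by move=> [[_ /andP[? ?]] [_ /andP[? ?]]]; lra.
- by rewrite -[_ @^-1` _]setTI; exact: mS1.
- by rewrite -[_ @^-1` _]setTI; exact: mS2.
- apply/seteqP; split=> x //=; rewrite !in_itv/=.
  by move=> [[_ /andP[? ?]] [_ /andP[? ?]]]; lra.
Qed.

End translations.

(** * Continuity of translations in the mean *)

Section dominated_convergence_real.
Context d (X : measurableType d) (R : realType).
Variable m : {measure set X -> \bar R}.

Lemma Int_cvg_dominated (F : nat -> X -> R) (f g : X -> R) :
  (forall n, measurable_fun setT (F n)) -> measurable_fun setT f -> L1 m g ->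
  {ae m, forall x, forall n, `|F n x| <= g x} ->
  {ae m, forall x, F ^~ x @ \oo --> f x} ->
  (fun n => \int[m]_x F n x) @ \oo --> \int[m]_x f x.
Proof.
move=> mF mf gi Fg Ff.
have [||||| fi _ cv] := @dominated_convergence _ _ _ m setT measurableT
  (fun n => EFin \o F n) (EFin \o f) (EFin \o g).
- by move=> n; exact/measurable_EFinP.
- exact/measurable_EFinP.
- by apply: filterS Ff => x h _; apply: cvg_EFin => //; exact: nearW.
- exact: gi.
- by apply: filterS Fg => x h n _ /=; rewrite lee_fin.
by apply: fine_cvg; rewrite fineK//; exact: integrable_fin_num.
Qed.

End dominated_convergence_real.

Lemma squeeze0 (R : realType) (a b : nat -> R) :
  (forall n, 0 <= a n <= b n) -> b @ \oo --> (0 : R) -> a @ \oo --> (0 : R).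
Proof.
move=> ab b0; apply: squeeze_cvgr b0; last exact: (cvg_cst (0 : R)).
exact: nearW.
Qed.

Section translation_continuity.
Context d (X : measurableType d) (R : realType).

Definition L1_shift_cvg (m : {measure set X -> \bar R}) (S : nat -> X -> X) :=
  (forall n, preserves m (S n)) /\
  (forall f, L1 m f -> (fun n => \int[m]_x `|f (S n x) - f x|) @ \oo --> (0 : R)).

End translation_continuity.

Section translation_continuity_product.
Context d1 d2 (X : measurableType d1) (Y : measurableType d2) (R : realType).
Variables (m1 : {sigma_finite_measure set X -> \bar R})
  (m2 : {sigma_finite_measure set Y -> \bar R}).

Let moving1 (S1 : nat -> X -> X) f : L1_shift_cvg m1 S1 -> L1 (prodm m1 m2) f ->
  (fun n => \int[(prodm m1 m2)]_z `|f (S1 n z.1, z.2) - f z|) @ \oo --> (0 : R).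
Proof.
move=> [S1p S1c] fi.
have fSi n : L1 (prodm m1 m2) (fun z => f (S1 n z.1, z.2)).
  exact: (L1_preserves (preserves_prod (S1p n) (preserves_id m2)) fi).
have hi n : L1 (prodm m1 m2) (fun z => `|f (S1 n z.1, z.2) - f z|).
  exact/L1_norm/L1B.
under eq_fun do rewrite (Int_prod21 (hi _)).
rewrite -(Int0 m2).
apply: (Int_cvg_dominated (g := fun y => 2 * \int[m1]_x `|f (x, y)|)).
- by move=> n; exact: L1_measurable (L1_Int2 (hi n)).
- by [].
- by apply: L1Z; exact: L1_Int2 (L1_norm fi).
- apply: filterS (ae_integrable2 fi) => y fyi n.
  have fySi : L1 m1 (fun x => f (S1 n x, y)) := L1_preserves (S1p n) fyi.
  rewrite ger0_norm ?Int_ge0//= mulrDl mul1r.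
  rewrite -{1}(Int_preserves (S1p n) (L1_norm fyi)) -IntD//; try exact/L1_norm.
  apply: le_Int; [exact/L1_norm/L1B|by apply: L1D; exact: L1_norm|].
  by move=> x; exact: ler_normB.
- apply: filterS (ae_integrable2 fi) => y fyi.
  exact: (S1c _ fyi).
Qed.

Let moving2 (S2 : nat -> Y -> Y) f : L1_shift_cvg m2 S2 -> L1 (prodm m1 m2) f ->
  (fun n => \int[(prodm m1 m2)]_z `|f (z.1, S2 n z.2) - f z|) @ \oo --> (0 : R).
Proof.
move=> [S2p S2c] fi.
have fSi n : L1 (prodm m1 m2) (fun z => f (z.1, S2 n z.2)).
  exact: (L1_preserves (preserves_prod (preserves_id m1) (S2p n)) fi).
have hi n : L1 (prodm m1 m2) (fun z => `|f (z.1, S2 n z.2) - f z|).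
  exact/L1_norm/L1B.
under eq_fun do rewrite (Int_prod12 (hi _)).
rewrite -(Int0 m1).
apply: (Int_cvg_dominated (g := fun x => 2 * \int[m2]_y `|f (x, y)|)).
- by move=> n; exact: L1_measurable (L1_Int1 (hi n)).
- by [].
- by apply: L1Z; exact: L1_Int1 (L1_norm fi).
- apply: filterS (ae_integrable1 fi) => x fxi n.
  have fxSi : L1 m2 (fun y => f (x, S2 n y)) := L1_preserves (S2p n) fxi.
  rewrite ger0_norm ?Int_ge0//= mulrDl mul1r.
  rewrite -{1}(Int_preserves (S2p n) (L1_norm fxi)) -IntD//; try exact/L1_norm.
  apply: le_Int; [exact/L1_norm/L1B|by apply: L1D; exact: L1_norm|].
  by move=> y; exact: ler_normB.
- apply: filterS (ae_integrable1 fi) => x fxi.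
  exact: (S2c _ fxi).
Qed.

(** Moving one factor at a time, dominated convergence over the other factor
    reduces the product to its factors. *)
Lemma L1_shift_cvg_prod (S1 : nat -> X -> X) (S2 : nat -> Y -> Y) :
  L1_shift_cvg m1 S1 -> L1_shift_cvg m2 S2 ->
  L1_shift_cvg (prodm m1 m2) (fun n z => (S1 n z.1, S2 n z.2)).
Proof.
move=> S1c S2c; split=> [n|f fi]; first exact: preserves_prod (S1c.1 n) (S2c.1 n).
have P1 n := preserves_prod (S1c.1 n) (preserves_id m2).
have P2 n := preserves_prod (preserves_id m1) (S2c.1 n).
have f1i n : L1 (prodm m1 m2) (fun z => f (S1 n z.1, z.2)) := L1_preserves (P1 n) fi.
have f2i n : L1 (prodm m1 m2) (fun z => f (z.1, S2 n z.2)) := L1_preserves (P2 n) fi.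
have f12i n : L1 (prodm m1 m2) (fun z => f (S1 n z.1, S2 n z.2)).
  exact: (L1_preserves (P2 n) (f1i n)).
have h1 n : L1 (prodm m1 m2) (fun z => `|f (S1 n z.1, z.2) - f z|) by exact/L1_norm/L1B.
have H : (fun n => \int[(prodm m1 m2)]_z `|f (S1 n z.1, z.2) - f z| +
    \int[(prodm m1 m2)]_z `|f (z.1, S2 n z.2) - f z|) @ \oo --> (0 : R).
  by rewrite -(addr0 0); apply: cvgD; [exact: moving1|exact: moving2].
apply: squeeze0 H => n; apply/andP; split; first exact: Int_ge0.
rewrite /= -(Int_preserves (P2 n) (h1 n)) -IntD.
- apply: le_Int; first exact/L1_norm/L1B.
    apply: L1D; last exact/L1_norm/L1B.
    exact: (L1_preserves (P2 n) (h1 n)).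
  move=> z /=; rewrite -[X in `|X - _|](subrK (f (z.1, S2 n z.2))) -addrA.
  exact: ler_normD.
- exact: (L1_preserves (P2 n) (h1 n)).
- exact/L1_norm/L1B.
Qed.

End translation_continuity_product.

Section translation_continuity_line.
Variable R : realType.

Lemma L1_patch d (X : measurableType d) (m : {measure set X -> \bar R})
    (D : set X) (f : X -> R) : measurable D ->
  m.-integrable D (EFin \o f) -> L1 m (f \_ D).
Proof. by move=> mD fi; rewrite /L1 -restrict_EFin; exact: (integrable_mkcond _ mD).1. Qed.

Lemma bounded_continuous_itv (g : R -> R) (a b : R) : continuous g ->
  exists M : R, 0 <= M /\ forall x, a <= x <= b -> `|g x| <= M.
Proof.
move=> cg; have /compact_bounded [M [_ HM]] : compact (g @` `[a, b]).
  apply: continuous_compact; last exact: segment_compact.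
  by apply: continuous_subspaceT.
exists (`|M| + 1); split; first by rewrite addr_ge0.
move=> x xab; apply: HM; first by rewrite (le_lt_trans (ler_norm M))// ltrDl.
by exists x => //; rewrite /= in_itv.
Qed.

Lemma L1_dense_continuous (f : R -> R) (e : R) : L1 (leb1 R) f -> 0 < e ->
  exists (g : R -> R) (N : nat), [/\ continuous g,
    L1 (leb1 R) (g \_ `[- N%:R, N%:R]) &
    \int[leb1 R]_x `|f x - (g \_ `[- N%:R, N%:R]) x| <= e].
Proof.
move=> fi e0; have mf := L1_measurable fi.
pose fN (N : nat) := f \_ (`[- N%:R, N%:R] : set R).
have mN (N : nat) : measurable (`[- N%:R, N%:R]%classic : set (measurableTypeR R)) by [].
have fNi N : L1 (leb1 R) (fN N) by apply: L1_patch => //; exact: integrableS fi.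
have : (fun N => \int[leb1 R]_x `|f x - fN N x|) @ \oo --> \int[leb1 R]_x (0 : R).
  apply: (@Int_cvg_dominated _ _ _ (leb1 R) (fun n x => `|f x - fN n x|) (fun=> 0) (fun x => `|f x|)).
  - by move=> n; exact: L1_measurable (L1_norm (L1B fi (fNi n))).
  - by [].
  - exact: L1_norm.
  - apply: aeW => x n; rewrite normr_id /fN /patch; case: ifPn => _.
      by rewrite subrr normr0.
    by rewrite subr0.
  - apply: aeW => x; apply: cvg_near_cst; exists (Num.bound `|x|) => // n /= xn.
    rewrite /fN /patch mem_set ?subrr ?normr0//= in_itv/= -ler_norml.
    have : `|x| < (Num.bound `|x|)%:R by exact: archi_boundP.
    by move=> /ltW /le_trans; apply; rewrite ler_nat.
rewrite Int0 => /cvgrPdist_le/(_ (e / 2)); rewrite divr_gt0// => /(_ isT)[N _ /(_ N (leqnn N))].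
rewrite sub0r normrN ger0_norm ?Int_ge0// => fN_le.
have [|||g_ [cg gi gf]] := @approximation_continuous_integrable R `[- N%:R, N%:R] f.
- by [].
- by rewrite /= lebesgue_measure_itv/= ; case: ifP => _; rewrite ?ltry// -EFinD ltry.
- exact: integrableS fi.
have gi' n : L1 (leb1 R) (g_ n \_ `[- N%:R, N%:R]) by apply: L1_patch.
have gf' n : (\int[leb1 R]_(z in `[(- N%:R)%R, N%:R%R]) `|(f z - g_ n z)%:E|)%E
    = (\int[leb1 R]_x `|fN N x - (g_ n \_ `[- N%:R, N%:R]) x|)%:E.
  rewrite EFin_Int; last exact/L1_norm/L1B.
  rewrite [LHS]integral_mkcond; congr (integral _ _ _); apply/funext => x; rewrite /= /fN !patchE.
  by case: (x \in _) => //; rewrite subrr normr0.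
move: gf; under eq_fun do rewrite gf'.
move=> /fine_cvg /cvgrPdist_le/(_ (e / 2)); rewrite divr_gt0// => /(_ isT)[n _ /(_ n (leqnn n))].
rewrite /= sub0r normrN ger0_norm ?Int_ge0// => g_le.
exists (g_ n), N; split => //; apply: le_trans (_ : e / 2 + e / 2 <= e); last by lra.
apply: le_trans (lerD fN_le g_le); rewrite -IntD; [|exact/L1_norm/L1B..].
apply: le_Int; [exact/L1_norm/L1B|by apply: L1D; exact/L1_norm/L1B|].
by move=> x; rewrite -[f x](subrK (fN N x)) addrK -addrA; exact: ler_normD.
Qed.

Lemma L1_shift_cvg_line (s : nat -> R) : s @ \oo --> (0 : R) ->
  (forall n, `|s n| <= 1) -> L1_shift_cvg (leb1 R) (fun n x => x + s n).
Proof.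
move=> s0 s1; split=> [n|f fi]; first exact: preserves_shift.
have mv n (g : R -> R) : L1 (leb1 R) g -> L1 (leb1 R) (fun x => g (x + s n)).
  exact: (L1_preserves (preserves_shift (s n))).
apply/cvgrPdist_le => e e0; have e4 : 0 < e / 4 by rewrite divr_gt0.
have [g [N [cg hi fh]]] := L1_dense_continuous fi e4.
set h := g \_ _ in hi fh.
have [M [M0 gM]] := bounded_continuous_itv (- N%:R) N%:R cg.
have hM x : `|h x| <= M.
  by rewrite /h /patch; case: ifPn => [|_]; rewrite ?normr0// inE/= in_itv/=; exact: gM.
have : (fun n => \int[leb1 R]_x `|h (x + s n) - h x|) @ \oo --> \int[leb1 R]_x (0 : R).
  apply: (@Int_cvg_dominated _ _ _ (leb1 R) (fun n x => `|h (x + s n) - h x|) (fun=> 0)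
    (fun x => (2 * M) * (\1_`[- N%:R - 1, N%:R + 1] x))).
  - by move=> n; apply: L1_measurable (L1_norm (L1B (mv n _ hi) hi)).
  - by [].
  - by apply: L1Z; apply: integrable_indic_itv.
  - apply: aeW => x n; rewrite normr_id indicE.
    have [_|xN] := boolP (_ \in _); rewrite ?mulr1 ?mulr0.
      by rewrite (le_trans (ler_normB _ _))// mulrDl mul1r lerD.
    have := s1 n; rewrite ler_norml => /andP[sa sb].
    move: xN; rewrite notin_setE/= in_itv/= => /negP; rewrite negb_and -!ltNge => xN.
    rewrite /h /patch !memNset ?subrr ?normr0//= in_itv/= => /andP[xa xb].
      by move: xN => /orP[]; lra.
    by move: xN => /orP[]; lra.
  - have N1 : (leb1 R).-negligible [set (- N%:R : R); N%:R].
      exists [set (- N%:R : R); N%:R]; split => //.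
        by apply: measurableU; exact: measurable_set1.
      apply: null_set_setU => //; exact: lebesgue_measure_set1.
    apply: (negligibleS _ N1) => x /=; apply: contra_notP => /not_orP[xa xb].
    have xs : (fun n => x + s n) @ \oo --> x by rewrite -[X in _ --> X]addr0; apply: cvgD => //; exact: cvg_cst.
    have [xN|xN] := boolP (- N%:R < x < N%:R).
      have hx : (fun n => h (x + s n)) @ \oo --> h x.
        rewrite {2}/h patchE mem_set/=; last by rewrite in_itv/=; move: xN => /andP[/ltW -> /ltW ->].
        have gx : (fun n => g (x + s n)) @ \oo --> g x by exact: (cvg_comp _ _ xs (cg x)).
        apply: cvg_trans gx; apply: near_eq_cvg; move: xN => /andP[x1 x2].
        have l1 : \forall n \near \oo, - N%:R < x + s n by exact: (cvgr_gt _ xs).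
        have l2 : \forall n \near \oo, x + s n < N%:R by exact: (cvgr_lt _ xs).
        near=> n; rewrite /h patchE mem_set//= in_itv/=.
        by apply/andP; split; apply: ltW; near: n.
      rewrite -(@normr0 _ R) -(subrr (h x)); apply: cvg_norm.
      by apply: cvgB => //; exact: cvg_cst.
    apply: cvg_near_cst.
    have far y : (y < - N%:R) || (N%:R < y) -> h y = 0.
      move=> yN; rewrite /h patchE memNset//= in_itv/= => /andP[ya yb].
      by move: yN => /orP[]; lra.
    have {}xN : (x < - N%:R) || (N%:R < x).
      move: xN; rewrite negb_and -!leNgt => /orP[]; rewrite le_eqVlt.
        by case/orP=> [/eqP e1|->//]; exfalso; apply: xa.
      by case/orP=> [/eqP e1|->]; [exfalso; apply: xb|rewrite orbT].
    rewrite (far x)//; case/orP: xN => xN.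
      have l2 : \forall n \near \oo, x + s n < - N%:R by exact: (cvgr_lt _ xs).
      by near=> n; rewrite far ?subrr ?normr0//; apply/orP; left; near: n.
    have l2 : \forall n \near \oo, N%:R < x + s n by exact: (cvgr_gt _ xs).
    by near=> n; rewrite far ?subrr ?normr0//; apply/orP; right; near: n.
rewrite Int0 => /cvgrPdist_le/(_ _ e4); apply: filterS => n.
rewrite !sub0r !normrN !ger0_norm ?Int_ge0// => hn.
have kn : \int[leb1 R]_x `|f (x + s n) - h (x + s n)| <= e / 4.
  by rewrite (Int_preserves (preserves_shift (s n)) (L1_norm (L1B fi hi))).
apply: le_trans (_ : e / 4 + e / 4 + e / 4 <= e); last by lra.
apply: le_trans (lerD (lerD kn hn) fh).
have i1 : L1 (leb1 R) (fun x => `|f (x + s n) - h (x + s n)|) by apply/L1_norm/(L1B (mv n _ fi)); exact: mv.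
have i2 : L1 (leb1 R) (fun x => `|h (x + s n) - h x|) by exact/L1_norm/(L1B (mv n _ hi)).
have i3 : L1 (leb1 R) (fun x => `|f x - h x|) by exact/L1_norm/L1B.
rewrite -(IntD i1 i2) -(IntD (L1D i1 i2) i3).
apply: le_Int; [exact/L1_norm/(L1B (mv n _ fi))|exact: (L1D (L1D i1 i2) i3)|].
move=> x; rewrite [`|f x - _|]distrC.
rewrite (_ : f (x + s n) - f x = f (x + s n) - h (x + s n) + (h (x + s n) - h x) + (h x - f x)); last by ring.
by rewrite (le_trans (ler_normD _ _))// lerD2r ler_normD.
Unshelve. all: by end_near. Qed.

Lemma L1_shift_cvg_circ (s : nat -> R) : s @ \oo --> (0 : R) ->
  (forall n, `|s n| <= 1) -> L1_shift_cvg (circ R) (fun n x => rot (s n) x).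
Proof.
move=> s0 s1; split=> [n|f fi]; first exact: preserves_rot.
have [_ Sl] := L1_shift_cvg_line s0 s1.
have mf := L1_measurable fi.
pose f1 := f \_ (`[0, 1[ : set R).
have f1i : L1 (leb1 R) f1.
  by apply: L1_patch; [exact: measurable_itv|exact: (restricts_L1 (circ_restricts R) fi)].
have mv (t : R) (g : R -> R) : L1 (leb1 R) g -> L1 (leb1 R) (fun x => g (x + t)).
  exact: (L1_preserves (preserves_shift t)).
pose F x := f1 (x + 1) + f1 x + f1 (x + - 1).
have Fi : L1 (leb1 R) F by exact: (L1D (L1D (mv 1 _ f1i) f1i) (mv (-1) _ f1i)).
have FE x : -1 <= x < 2 -> F x = f (frac x).
  have in01 y : 0 <= y < 1 -> f1 y = f y by move=> y01; rewrite /f1 patchE mem_set//= in_itv.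
  have out01 y : (y < 0) || (1 <= y) -> f1 y = 0.
    by move=> y01; rewrite /f1 patchE memNset//= in_itv/= => /andP[? ?]; move: y01 => /orP[]; lra.
  move=> /andP[x1 x2]; rewrite /F; have [x0|x0] := ltP x 0.
    rewrite (out01 x) ?x0// (out01 (x + - 1)) ?addr0; last by apply/orP; left; lra.
    rewrite in01; last by apply/andP; split; lra.
    by rewrite -(frac_addz x 1) frac_id//; apply/andP; split; lra.
  rewrite (out01 (x + 1)) ?add0r; last by apply/orP; right; lra.
  have [x3|x3] := ltP x 1.
    rewrite (out01 (x + - 1)) ?addr0; last by apply/orP; left; lra.
    by rewrite in01 ?frac_id// x0.
  rewrite (out01 x) ?add0r ?x3 ?orbT// in01; last by apply/andP; split; lra.
  by rewrite -(frac_addz x (-1)) frac_id//; apply/andP; split; lra.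
have := Sl F Fi; move=> H; apply: squeeze0 H => n; apply/andP; split; first exact: Int_ge0.
have i1 : L1 (circ R) (fun x => `|f (rot (s n) x) - f x|).
  by exact: (L1_norm (L1B (L1_preserves (preserves_rot (s n)) fi) fi)).
have i2 : L1 (leb1 R) (fun x => `|F (x + s n) - F x|) by exact: (L1_norm (L1B (mv (s n) _ Fi) Fi)).
have -> : \int[circ R]_x `|f (rot (s n) x) - f x| =
    \int[leb1 R]_x ((fun x => `|f (rot (s n) x) - f x|) \_ `[0, 1[) x.
  rewrite -Rintegral_mkcond; apply: Int_restricts; first exact: circ_restricts.
  exact: L1_measurable i1.
apply: le_Int => //.
  by apply: L1_patch; [exact: measurable_itv|exact: (restricts_L1 (circ_restricts R) i1)].
move=> x; rewrite patchE; case: ifPn => [/set_mem|_]; last exact: normr_ge0.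
rewrite /= in_itv/= => /andP[x0 x1].
have := s1 n; rewrite ler_norml => /andP[sa sb].
by rewrite !FE ?(frac_id (x := x)) ?x0//; apply/andP; split; lra.
Qed.

End translation_continuity_line.

(** * The torus *)

Section torus.
Variable R : realType.

Definition tor2 := prodm (circ R) (circ R).
Definition tor3 := prodm tor2 (circ R).
Definition tor4 := prodm tor3 (leb1 R).

Definition leb2m := prodm (leb1 R) (leb1 R).
Definition leb3m := prodm leb2m (leb1 R).
Definition leb4m := prodm leb3m (leb1 R).

Lemma tor3_restricts : restricts tor3 leb3m (cube R).
Proof.
apply: (@restricts_prod _ _ _ _ _ tor2 leb2m (circ R) (leb1 R)).
  exact: (@restricts_prod _ _ _ _ _ (circ R) (leb1 R) (circ R) (leb1 R) _ _
    (circ_restricts R) (circ_restricts R)).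
exact: circ_restricts.
Qed.

Lemma tor4_restricts : restricts tor4 leb4m (cube R `*` setT).
Proof.
exact: (@restricts_prod _ _ _ _ _ tor3 leb3m (leb1 R) (leb1 R) _ _
  tor3_restricts (restricts_setT (leb1 R))).
Qed.

Lemma tor3_setT : tor3 setT = 1%:E.
Proof.
rewrite -setXTT prodmE// -setXTT prodmE//.
transitivity (1 * 1 * 1 : R)%:E; last by rewrite !mulr1.
by rewrite !EFinM; congr (_ * _ * _)%E; exact: circ_setT.
Qed.

Definition rot3 (xi x : pt3 R) : pt3 R :=
  ((rot xi.1.1 x.1.1, rot xi.1.2 x.1.2), rot xi.2 x.2).

Definition rot4 (z q : pt4 R) : pt4 R := (rot3 z.1 q.1, q.2 + z.2).

Lemma preserves_rot3 xi : preserves tor3 (rot3 xi).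
Proof.
exact: (@preserves_prod _ _ _ _ _ tor2 (circ R) _ _ (@preserves_prod _ _ _ _ _ (circ R) (circ R)
  _ _ (preserves_rot xi.1.1) (preserves_rot xi.1.2)) (preserves_rot xi.2)).
Qed.

Lemma preserves_rot4 z : preserves tor4 (rot4 z).
Proof.
exact: (@preserves_prod _ _ _ _ _ tor3 (leb1 R) _ _ (preserves_rot3 z.1) (preserves_shift z.2)).
Qed.

Definition per4 (f : pt4 R -> R) : Prop := forall t, periodic (fun x => f (x, t)).

Lemma period_frac (g : R -> R) (x : R) : (forall y, g (y + 1) = g y) -> g (frac x) = g x.
Proof.
move=> g1; have gn (n : nat) y : g (y + n%:R) = g y.
  by elim: n y => [|n ih] y; rewrite ?addr0// -natr1 addrA g1.
rewrite /frac; case: (Num.floor x) => n.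
  by rewrite -(gn n (x - _)) subrK.
by rewrite NegzE mulrNz opprK (_ : n.+1%:~R = n.+1%:R)// gn.
Qed.

Lemma periodicP (f : pt3 R -> R) : periodic f <-> forall x y z,
  [/\ f (x + 1, y, z) = f (x, y, z), f (x, y + 1, z) = f (x, y, z)
    & f (x, y, z + 1) = f (x, y, z)].
Proof.
have e1 (x y z : R) : ((x, y), z) + ex3 R = ((x + 1, y), z).
  by congr ((_, _), _); rewrite /= addr0.
have e2 (x y z : R) : ((x, y), z) + ey3 R = ((x, y + 1), z).
  by congr ((_, _), _); rewrite /= addr0.
have e3 (x y z : R) : ((x, y), z) + ez3 R = ((x, y), z + 1).
  by congr ((_, _), _); rewrite /= addr0.
split=> [pf x y z|pf [[x y] z]].
  by have := pf ((x, y), z); rewrite e1 e2 e3.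
by rewrite e1 e2 e3; exact: pf.
Qed.

Definition frac3 (x : pt3 R) : pt3 R := ((frac x.1.1, frac x.1.2), frac x.2).

Lemma periodic_frac f x : periodic f -> f (frac3 x) = f x.
Proof.
move=> /periodicP pf; case: x => [[x y] z]; rewrite /frac3/=.
rewrite (@period_frac (fun x => f (x, frac y, frac z))) => [|a]; last by have [] := pf a (frac y) (frac z).
rewrite (@period_frac (fun y => f (x, y, frac z))) => [|a]; last by have [] := pf x a (frac z).
by rewrite (@period_frac (fun z => f (x, y, z))) => [//|a]; have [] := pf x y a.
Qed.

Lemma periodic_rot f xi x : periodic f -> f (rot3 xi x) = f (x + xi).
Proof. by move=> pf; rewrite -(periodic_frac (x + xi) pf). Qed.

Lemma periodic_shift (f : pt3 R -> R) xi : periodic f -> periodic (fun x => f (x + xi)).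
Proof.
by move=> pf x; have [h1 h2 h3] := pf (x + xi); rewrite -!(addrAC _ xi).
Qed.

Lemma per4_rot f z q : per4 f -> f (rot4 z q) = f (q + z).
Proof. by move=> pf; rewrite /rot4 (periodic_rot z.1 q.1 (pf (q.2 + z.2))). Qed.

Lemma per4_shift f z : per4 f -> per4 (fun q => f (q + z)).
Proof. by move=> pf t; exact: (periodic_shift z.1 (pf (t + z.2))). Qed.

Lemma L1_shift3 f xi : periodic f -> L1 tor3 f -> L1 tor3 (fun x => f (x + xi)).
Proof.
move=> pf fi; apply: eq_L1 (L1_preserves (preserves_rot3 xi) fi) => x.
exact: periodic_rot.
Qed.

Lemma Int_shift3 f xi : periodic f -> L1 tor3 f ->
  \int[tor3]_x f (x + xi) = \int[tor3]_x f x.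
Proof.
move=> pf fi; rewrite -(Int_preserves (preserves_rot3 xi) fi).
by apply: eq_Int => x; rewrite periodic_rot.
Qed.

Lemma L1_shift4 f z : per4 f -> L1 tor4 f -> L1 tor4 (fun q => f (q + z)).
Proof.
move=> pf fi; apply: eq_L1 (L1_preserves (preserves_rot4 z) fi) => x.
exact: per4_rot.
Qed.

Lemma Int_shift4 f z : per4 f -> L1 tor4 f ->
  \int[tor4]_q f (q + z) = \int[tor4]_q f q.
Proof.
move=> pf fi; rewrite -(Int_preserves (preserves_rot4 z) fi).
by apply: eq_Int => x; rewrite per4_rot.
Qed.

Lemma norm_pair_le (U V : normedModType R) (u : U) (v : V) (r : R) :
  `|(u, v)| <= r -> `|u| <= r /\ `|v| <= r.
Proof. by rewrite /Num.norm/= ge_max => /andP[]. Qed.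

Lemma norm_pair_ge (U V : normedModType R) (u : U) (v : V) (r : R) :
  `|u| <= r -> `|v| <= r -> `|(u, v)| <= r.
Proof. by move=> ur vr; rewrite {1}/Num.norm/= ge_max ur vr. Qed.

Let small_cvg (s : nat -> R) : (forall n, `|s n| <= n.+1%:R^-1) ->
  s @ \oo --> (0 : R) /\ (forall n, `|s n| <= 1).
Proof.
move=> sn; split=> [|n]; last first.
  by rewrite (le_trans (sn n))// invf_le1 ?ler1n.
apply/cvgr0Pnorm_le => e e0; near=> n; rewrite (le_trans (sn n))//.
near: n; have := near_infty_natSinv_lt (PosNum e0).
by apply: filterS => n /ltW.
Unshelve. all: by end_near. Qed.

Lemma shift_small3 f (e : R) : periodic f -> L1 tor3 f -> 0 < e ->
  exists2 d : R, 0 < d & forall xi, `|xi| <= d ->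
    \int[tor3]_x `|f (x + xi) - f x| <= e.
Proof.
move=> pf fi e0; apply: contrapT => nd.
have /choice[xi xin] : forall n : nat, exists xi : pt3 R, `|xi| <= n.+1%:R^-1 /\
    ~~ (\int[tor3]_x `|f (x + xi) - f x| <= e).
  move=> n; apply: contrapT => nx; apply: nd; exists n.+1%:R^-1 => // xi xin.
  by apply: contrapT => /negP h; apply: nx; exists xi.
have xi1 n := (norm_pair_le (norm_pair_le (xin n).1).1).1.
have xi2 n := (norm_pair_le (norm_pair_le (xin n).1).1).2.
have xi3 n := (norm_pair_le (xin n).1).2.
have [s1 b1] := small_cvg xi1; have [s2 b2] := small_cvg xi2; have [s3 b3] := small_cvg xi3.
have [_ /(_ f fi)] := L1_shift_cvg_prod (L1_shift_cvg_prod (L1_shift_cvg_circ s1 b1)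
  (L1_shift_cvg_circ s2 b2)) (L1_shift_cvg_circ s3 b3).
move=> /cvgr0Pnorm_le/(_ _ e0)[N _ /(_ N (leqnn N))].
rewrite ger0_norm ?Int_ge0// => h; have [_ /negP] := xin N; apply.
apply: le_trans h; rewrite le_eqVlt; apply/orP; left; apply/eqP/eq_Int => x.
by rewrite -periodic_rot.
Qed.

Lemma shift_small4 f (e : R) : per4 f -> L1 tor4 f -> 0 < e ->
  exists2 d : R, 0 < d & forall z, `|z| <= d ->
    \int[tor4]_q `|f (q + z) - f q| <= e.
Proof.
move=> pf fi e0; apply: contrapT => nd.
have /choice[z zn] : forall n : nat, exists z : pt4 R, `|z| <= n.+1%:R^-1 /\
    ~~ (\int[tor4]_q `|f (q + z) - f q| <= e).
  move=> n; apply: contrapT => nx; apply: nd; exists n.+1%:R^-1 => // z zn.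
  by apply: contrapT => /negP h; apply: nx; exists z.
have z123 n := (norm_pair_le (zn n).1).1.
have z1 n := (norm_pair_le (norm_pair_le (z123 n)).1).1.
have z2 n := (norm_pair_le (norm_pair_le (z123 n)).1).2.
have z3 n := (norm_pair_le (z123 n)).2.
have z4 n := (norm_pair_le (zn n).1).2.
have [s1 b1] := small_cvg z1; have [s2 b2] := small_cvg z2.
have [s3 b3] := small_cvg z3; have [s4 b4] := small_cvg z4.
have [_ /(_ f fi)] := L1_shift_cvg_prod (L1_shift_cvg_prod (L1_shift_cvg_prod (L1_shift_cvg_circ s1 b1)
  (L1_shift_cvg_circ s2 b2)) (L1_shift_cvg_circ s3 b3)) (L1_shift_cvg_line s4 b4).
move=> /cvgr0Pnorm_le/(_ _ e0)[N _ /(_ N (leqnn N))].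
rewrite ger0_norm ?Int_ge0// => h; have [_ /negP] := zn N; apply.
apply: le_trans h; rewrite le_eqVlt; apply/orP; left; apply/eqP/eq_Int => q.
by rewrite -per4_rot.
Qed.

(** The signed square [a * `|a|] turns mean-square continuity into continuity in
    the mean. *)
Lemma sqr_diff_le (a b : R) : (a - b) ^+ 2 <= 2 * `|a * `|a| - b * `|b| |.
Proof.
have h : 0 <= (a + b) ^+ 2 by exact: sqr_ge0.
have [a0|a0] := leP 0 a; have [b0|b0] := leP 0 b.
- rewrite (ger0_norm a0) (ger0_norm b0); have [ab|ab] := leP b a.
    rewrite ger0_norm; last by nra.
    by nra.
  rewrite ler0_norm; last by nra.
  by nra.
- rewrite (ger0_norm a0) (ltr0_norm b0) ger0_norm; last by nra.
  by nra.
- rewrite (ltr0_norm a0) (ger0_norm b0) ler0_norm; last by nra.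
  by nra.
- rewrite (ltr0_norm a0) (ltr0_norm b0); have [ab|ab] := leP b a.
    rewrite ger0_norm; last by nra.
    by nra.
  rewrite ler0_norm; last by nra.
  by nra.
Qed.

Lemma pow4_diff_le (a b : R) :
  (a - b) ^+ 4 <= 8 * `|a ^+ 3 * `|a| - b ^+ 3 * `|b| |.
Proof.
have h1 := sqr_diff_le a b; have h2 := sqr_diff_le (a * `|a|) (b * `|b|).
have s3 (c : R) : (c * `|c|) * `|c * `|c| | = c ^+ 3 * `|c|.
  rewrite normrM normr_id; have : `|c| * `|c| = c * c by rewrite -normrM ger0_norm// -expr2 sqr_ge0.
  by move=> e; rewrite e; ring.
rewrite !s3 in h2.
have : ((a - b) ^+ 2) ^+ 2 <= (2 * `|a * `|a| - b * `|b| |) ^+ 2.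
  by rewrite ler_pXn2r// nnegrE ?sqr_ge0// mulr_ge0.
have N2 (c : R) : (2 * `|c|) ^+ 2 = 4 * c ^+ 2.
  rewrite exprMn -normrX ger0_norm ?sqr_ge0//; ring.
rewrite N2 -exprM => /le_trans; apply.
by rewrite (_ : 8 = 4 * 2 :> R); [rewrite -mulrA ler_wpM2l|ring].
Qed.

Lemma measurable_shift4 f (z : pt4 R) : per4 f -> measurable_fun setT f ->
  measurable_fun setT (fun q : pt4 R => f (q + z)).
Proof.
move=> pf mf; rewrite (_ : (fun q => _) = f \o rot4 z).
  exact: (measurableT_comp mf (preserves_rot4 z).1).
by apply/funext => q; rewrite /= per4_rot.
Qed.

Lemma shift_small_pow f (k : nat) (C e : R) : per4 f -> measurable_fun setT f ->
  ~~ odd k -> (0 < k)%N -> 0 < C ->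
  (forall a b : R, (a - b) ^+ k <= C * `|a ^+ k.-1 * `|a| - b ^+ k.-1 * `|b| |) ->
  L1 tor4 (fun q => f q ^+ k) -> 0 < e ->
  exists2 d : R, 0 < d & forall z, `|z| <= d ->
    L1 tor4 (fun q => (f (q + z) - f q) ^+ k) /\
    \int[tor4]_q (f (q + z) - f q) ^+ k <= e.
Proof.
move=> pf mf ek k0 C0 HC fi e0; pose g q := f q ^+ k.-1 * `|f q|.
have pg : per4 g by move=> t x; rewrite /g; have [-> -> ->] := pf t x.
have mg : measurable_fun setT g.
  by apply: measurable_funM; [exact: measurable_funX|exact: measurableT_comp].
have gi : L1 tor4 g.
  apply: (L1_le _ fi) => [|q]; first exact: mg.
  rewrite normrM normr_id normrX -exprSr prednK//.
  by rewrite -normrX ger0_norm// exprn_even_ge0.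
have [d d0 Hd] := shift_small4 pg gi (divr_gt0 e0 C0).
exists d => // z /Hd hz.
have gz : L1 tor4 (fun q => C * `|g (q + z) - g q|).
  exact/L1Z/L1_norm/(L1B (L1_shift4 z pg gi) gi).
have fk : L1 tor4 (fun q => (f (q + z) - f q) ^+ k).
  apply: (L1_le _ gz) => [|q].
    by apply: measurable_funX; apply: measurable_funB => //; exact: measurable_shift4.
  by rewrite ger0_norm ?exprn_even_ge0//; exact: HC.
split=> //; apply: le_trans (le_Int fk gz (fun q => HC _ _)) _.
rewrite IntZ; last exact/L1_norm/(L1B (L1_shift4 z pg gi) gi).
by rewrite mulrC -ler_pdivlMr.
Qed.

(** ** From a box to the torus *)

Definition ext (T : R) (f : pt4 R -> R) (q : pt4 R) : R :=
  (f \_ (cylinder T)) (frac3 q.1, q.2).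

Lemma frac3_cube x : cube R (frac3 x).
Proof.
split => /=; [split|]; rewrite /= in_itv/=; exact: frac_itv.
Qed.

Lemma frac3_id x : cube R x -> frac3 x = x.
Proof.
case: x => [[x y] z] [[/=]]; rewrite !in_itv/= => hx hy hz.
by rewrite /frac3/= !frac_id.
Qed.

Lemma measurable_cube : measurable (cube R).
Proof. by apply: measurableX; [apply: measurableX|]; exact: measurable_itv. Qed.

Lemma measurable_cylinder (T : R) : measurable (cylinder T).
Proof. by apply: measurableX; [exact: measurable_cube|exact: measurable_itv]. Qed.

Lemma measurable_frac3 : measurable_fun setT frac3.
Proof.
apply: measurable_fun_pair.
  apply: measurable_fun_pair; apply: measurableT_comp; do 1?exact: measurable_frac.
    exact: (measurableT_comp measurable_fst measurable_fst).
  exact: (measurableT_comp measurable_snd measurable_fst).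
by apply: measurableT_comp => //; exact: measurable_frac.
Qed.

Lemma measurable_ext (T : R) f : measurable_fun (cylinder T) f -> measurable_fun setT (ext T f).
Proof.
move=> mf; apply: (@measurableT_comp _ _ _ _ _ _ (f \_ (cylinder T)) _ (fun q : pt4 R => (frac3 q.1, q.2))).
  by apply/(measurable_restrictT _ _).1 => //; exact: measurable_cylinder.
apply: measurable_fun_pair => //.
exact: (measurableT_comp measurable_frac3 measurable_fst).
Qed.

Lemma per4_ext (T : R) f : per4 (ext T f).
Proof.
have fr1 (y : R) : frac (y + 1) = frac y by exact: (frac_addz y 1).
by move=> t; apply/periodicP => x y z; rewrite /ext /frac3/= !fr1.
Qed.

Lemma extE (T : R) f q : per4 f -> 0 < q.2 < T -> ext T f q = f q.
Proof.
move=> pf qT; rewrite /ext patchE mem_set; last first.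
  by split; [exact: frac3_cube|rewrite /= in_itv].
by rewrite (periodic_frac q.1 (pf q.2)); case: q {qT}.
Qed.

Lemma ext_out (T : R) f q : ~~ (0 < q.2 < T) -> ext T f q = 0.
Proof. by move=> qT; rewrite /ext patchE memNset// => -[_ /=]; rewrite in_itv/= (negbTE qT). Qed.

Lemma integral_cylinder (T : R) (F : pt4 R -> \bar R) (G : pt4 R -> \bar R) :
  measurable_fun setT G -> (forall q, 0 < q.2 < T -> G q = F q) ->
  (forall q, ~~ (0 < q.2 < T) -> G q = 0%E) ->
  (\int[leb4 R]_(q in cylinder T) F q = \int[tor4]_q G q)%E.
Proof.
move=> mG GF G0; transitivity (\int[leb4m]_(q in cylinder T) F q)%E; first by [].
transitivity (\int[leb4m]_(q in cube R `*` setT) G q)%E; last first.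
  exact/esym/(integral_restricts tor4_restricts mG).
rewrite [LHS]integral_mkcond [RHS]integral_mkcond; apply: eq_integral => q _.
rewrite !patchE; have [qT|qT] := boolP (0 < q.2 < T).
  have [qc|qc] := pselect (cube R q.1).
    have h1 : cylinder T q by split=> //=; rewrite in_itv.
    have h2 : (cube R `*` setT) q by split.
    by rewrite (mem_set h1) (mem_set h2) GF.
  have h1 : ~ cylinder T q by move=> [].
  have h2 : ~ (cube R `*` setT) q by move=> [].
  by rewrite (memNset h1) (memNset h2).
have h1 : ~ cylinder T q by case=> _ /=; rewrite in_itv/= (negbTE qT).
by rewrite G0// (memNset h1) if_same.
Qed.

Lemma Int_cylinder (T : R) (F G : pt4 R -> R) :
  measurable_fun setT G -> (forall q, 0 < q.2 < T -> G q = F q) ->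
  (forall q, ~~ (0 < q.2 < T) -> G q = 0) ->
  \int[leb4 R]_(q in cylinder T) F q = \int[tor4]_q G q.
Proof.
move=> mG GF G0.
have mG' : measurable_fun setT (EFin \o G) by exact/measurable_EFinP.
have GF' q : 0 < q.2 < T -> (EFin \o G) q = (EFin \o F) q by move=> /GF /= ->.
have G0' q : ~~ (0 < q.2 < T) -> (EFin \o G) q = 0%E by move=> /G0 /= ->.
exact: (congr1 fine (integral_cylinder mG' GF' G0')).
Qed.

End torus.
Arguments tor2 : clear implicits.
Arguments tor3 : clear implicits.
Arguments tor4 : clear implicits.
Arguments leb3m : clear implicits.
Arguments leb4m : clear implicits.

(** * Smooth functions *)

Section smooth_functions.
Variables (R : realType) (V : normedModType R).
Implicit Types f g : V -> R.

Lemma CkS k f : Ck k.+1 f -> Ck k f.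
Proof.
elim: k f => [|k ih] f [cf df]; first by split.
by split=> // d; have [dfd Cf] := df d; split=> //; exact: ih.
Qed.

Lemma CkD k f g : Ck k f -> Ck k g -> Ck k (fun x => f x + g x).
Proof.
elim: k f g => [|k ih] f g [cf df] [cg dg].
  by split=> // x; apply: cvgD; [exact: cf|exact: cg].
split=> [x|d]; first by apply: cvgD; [exact: cf|exact: cg].
have [fd Cf] := df d; have [gd Cg] := dg d.
split=> [x|]; first exact: derivableD.
rewrite (_ : 'D_d _ = fun x => 'D_d f x + 'D_d g x); first exact: ih.
by apply/funext => x; exact: deriveD.
Qed.

Lemma CkM k f g : Ck k f -> Ck k g -> Ck k (fun x => f x * g x).
Proof.
elim: k f g => [|k ih] f g Cf Cg.
  by split=> // x; apply: cvgM; [exact: Cf.1|exact: Cg.1].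
have [cf df] := Cf; have [cg dg] := Cg.
split=> [x|d]; first by apply: cvgM; [exact: cf|exact: cg].
have [fd Cdf] := df d; have [gd Cdg] := dg d.
split=> [x|]; first exact: derivableM.
rewrite (_ : 'D_d _ = fun x => f x * 'D_d g x + g x * 'D_d f x).
  by apply: CkD; apply: ih => //; exact: CkS.
by apply/funext => x; exact: deriveM.
Qed.

Lemma Ck_cst k (c : R) : Ck k (fun _ : V => c).
Proof.
elim: k c => [|k ih] c; split=> //; try by move=> x; exact: cvg_cst.
move=> d; split=> [x|]; first exact: derivable_cst.
rewrite (_ : 'D_d _ = fun=> 0); first exact: ih.
by apply/funext => x; exact: derive_cst.
Qed.

Lemma smoothM f g : smooth f -> smooth g -> smooth (fun x => f x * g x).
Proof. by move=> sf sg k; exact: CkM. Qed.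

Lemma smooth_cst (c : R) : smooth (fun _ : V => c).
Proof. by move=> k; exact: Ck_cst. Qed.

Lemma smooth_continuous f : smooth f -> continuous f.
Proof. by move=> /(_ 0%N) []. Qed.

Lemma smooth_derivable f x d : smooth f -> derivable f x d.
Proof. by move=> /(_ 1%N) [_ /(_ d) []]. Qed.

Lemma smooth_derive f d : smooth f -> smooth ('D_d f).
Proof. by move=> sf k; have [_ /(_ d) []] := sf k.+1. Qed.

Lemma smooth_deriveM f g d x : smooth f -> smooth g ->
  'D_d (fun x => f x * g x) x = f x * 'D_d g x + g x * 'D_d f x.
Proof. by move=> sf sg; apply: deriveM; exact: smooth_derivable. Qed.

End smooth_functions.

Section affine_composition.
Variables (R : realType) (V W : normedModType R).

Lemma derivable_affine (A : W -> V) (f : V -> R) (d : W) (e : V) (y : W) :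
  (forall h : R, A (h *: d + y) = h *: e + A y) ->
  derivable f (A y) e -> derivable (f \o A) y d.
Proof.
move=> Ad; rewrite /derivable.
suff -> : (fun h : R => h^-1 *: ((f \o A \o shift y) (h *: d) - (f \o A) y)) =
  (fun h => h^-1 *: ((f \o shift (A y)) (h *: e) - f (A y))) by [].
by apply/funext => h /=; rewrite Ad.
Qed.

Lemma derive_affine (A : W -> V) (f : V -> R) (d : W) (e : V) (y : W) :
  (forall h : R, A (h *: d + y) = h *: e + A y) ->
  'D_d (f \o A) y = 'D_e f (A y).
Proof.
move=> Ad; rewrite /derive.
suff -> : (fun h : R => h^-1 *: ((f \o A \o shift y) (h *: d) - (f \o A) y)) =
  (fun h => h^-1 *: ((f \o shift (A y)) (h *: e) - f (A y))) by [].
by apply/funext => h /=; rewrite Ad.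
Qed.

Lemma smooth_affine (A : W -> V) (L : W -> V) (f : V -> R) : continuous A ->
  (forall h d y, A (h *: d + y) = h *: L d + A y) -> smooth f -> smooth (f \o A).
Proof.
move=> cA AL sf k; elim: k f sf => [|k ih] f sf.
  by split=> // x; apply: continuous_comp; [exact: cA|exact: smooth_continuous].
split=> [x|d]; first by apply: continuous_comp; [exact: cA|exact: smooth_continuous].
split=> [x|]; first by apply: (derivable_affine (e := L d)) => //; exact: smooth_derivable.
rewrite (_ : 'D_d _ = 'D_(L d) f \o A); first by apply: ih; exact: smooth_derive.
by apply/funext => y; exact: derive_affine.
Qed.

End affine_composition.

Section smooth_line.
Variable R : realType.

Lemma is_derive_dir (f : R -> R) (x d a : R) :
  is_derive x 1 f a -> derivable f x d /\ 'D_d f x = d * a.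
Proof.
move=> fa; have df : differentiable f x by apply/derivable1_diffP; exact: ex_derive.
split; first exact: diff_derivable.
rewrite deriveE//; have -> : 'd f x d = d *: 'd f x 1 by rewrite -linearZ/= [_ *: _]mulr1.
by rewrite -deriveE// derive_val.
Qed.

(** A family of functions whose derivatives are combinations of members of the family
    is smooth by induction on the order; this covers the bumps and the
    trigonometric functions. *)
Lemma smooth_family (I : Type) (F : I -> R -> R) :
  (forall i, exists (a b : R) (j l : I),
    forall x : R, is_derive x 1 (F i) (a * F j x + b * F l x)) ->
  forall i, smooth (F i).
Proof.
move=> FD i k; elim: k i => [|k ih] i; have [a [b [j [l Fi]]]] := FD i;
  have cF : continuous (F i) by (move=> x; apply/differentiable_continuous/derivable1_diffP;
    exact: ex_derive).
  by split.
split=> // d; split=> [x|]; first exact: (is_derive_dir d (Fi x)).1.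
rewrite (_ : 'D_d _ = fun x => d * (a * F j x + b * F l x)).
  exact: (CkM (Ck_cst _ k d) (CkD (CkM (Ck_cst _ k a) (ih j)) (CkM (Ck_cst _ k b) (ih l)))).
by apply/funext => x; exact: (is_derive_dir d (Fi x)).2.
Qed.

(** ** Bump functions *)

Definition flat (n : nat) (x : R) : R := if 0 < x then x^-1 ^+ n * expR (- x^-1) else 0.

Lemma flat_ge0 n x : 0 <= flat n x.
Proof.
rewrite /flat; case: ifPn => // x0.
by rewrite mulr_ge0 ?expR_ge0// exprn_ge0// invr_ge0 ltW.
Qed.

Lemma flat_out n x : x <= 0 -> flat n x = 0.
Proof. by move=> x0; rewrite /flat ltNge x0. Qed.

(** Bounding the exponential below by one term of its series shows that [flat]
    vanishes at the origin faster than the identity. *)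
Lemma flat_le n x : 0 < x -> flat n x <= n.+1`!%:R * x.
Proof.
move=> x0; rewrite /flat x0.
have y0 : 0 < x^-1 by rewrite invr_gt0.
have h : x^-1 ^+ n.+1 / n.+1`!%:R <= expR x^-1.
  by apply: le_trans (expR_ge1Dxn n (ltW y0)); rewrite lerDr.
rewrite expRN ler_pdivrMr ?expR_gt0//.
have f0 : 0 < n.+1`!%:R :> R by rewrite ltr0n fact_gt0.
rewrite ler_pdivrMr// in h.
have -> : x^-1 ^+ n = x * x^-1 ^+ n.+1.
  by rewrite exprS mulrA divff ?mul1r// gt_eqF.
rewrite [leRHS](_ : _ = x * (expR x^-1 * n.+1`!%:R)); last by ring.
by rewrite ler_pM2l.
Qed.

Let flat_pos_derive n (x : R) : 0 < x ->
  is_derive x 1 (flat n) (- n%:R * flat n.+1 x + 1 * flat n.+2 x).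
Proof.
move=> x0; have xn0 : x != 0 by rewrite gt_eqF.
pose g (y : R) := (y^-1) ^+ n * expR (- y^-1).
have dV : is_derive x 1 (fun y : R => y^-1) (- x ^- 2).
  have := @is_deriveV R id x 1 1 xn0 (is_derive_id _ _).
  by rewrite /= [_ *: _]mulr1.
have dg : is_derive x 1 g (- n%:R * flat n.+1 x + 1 * flat n.+2 x).
  have dE : is_derive x 1 (fun y : R => expR (- y^-1)) (expR (- x^-1) * (- - x ^- 2)).
    exact: (@is_derive1_comp _ expR (fun y : R => - y^-1) x _ _ (is_derive_expR _) (is_deriveN dV)).
  have dX : is_derive x 1 (fun y : R => (y^-1) ^+ n) (n%:R * x^-1 ^+ n.-1 * (- x ^- 2)).
    have := @is_deriveX _ _ (fun y : R => y^-1) n x 1 _ dV.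
    rewrite exprfctE => H; apply: DeriveDef; first exact: ex_derive.
    by rewrite derive_val.
  apply: is_derive_eq (is_deriveM dX dE) _.
  rewrite /flat x0 -!exprVn opprK /GRing.scale/=.
  move: {dV dE dX} (expR (- x^-1)) => E; move: (x^-1) => y; case: n {g} => [|n] /=.
    by rewrite expr0 !exprS !expr0; ring.
  by rewrite !exprS; ring.
have e : \forall y \near x, g y = flat n y.
  near=> y; rewrite /g /flat ifT//; near: y; exact: lt_nbhsr.
exact: near_eq_is_derive e dg.
Unshelve. all: by end_near. Qed.

Let flat_neg_derive n (x : R) : x < 0 ->
  is_derive x 1 (flat n) (- n%:R * flat n.+1 x + 1 * flat n.+2 x).
Proof.
move=> x0; rewrite !flat_out ?(ltW x0)// !mulr0 addr0.
have e : \forall y \near x, (fun _ : R => 0 : R) y = flat n y.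
  near=> y; rewrite flat_out// ltW//; near: y; exact: lt_nbhsl.
exact: near_eq_is_derive e (is_derive_cst _ _ _).
Unshelve. all: by end_near. Qed.

Let flat_zero_derive n :
  is_derive (0 : R) 1 (flat n) (- n%:R * flat n.+1 0 + 1 * flat n.+2 0).
Proof.
rewrite (@flat_out n.+1) ?(@flat_out n.+2)// !mulr0 addr0.
suff H : (fun h : R => h^-1 *: ((flat n \o shift (0 : R)) (h *: (1 : R)) - flat n 0)) @ 0^' --> (0 : R).
  by apply: DeriveDef; [apply/cvg_ex; exists 0|exact: cvg_lim H].
have C0 : 0 < n.+2`!%:R :> R by rewrite ltr0n fact_gt0.
apply/cvgr0Pnorm_le => e e0; near=> h.
rewrite /= addr0 (@flat_out n 0)// subr0 /GRing.scale/= mulr1.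
have [h0|h0] := leP h 0; first by rewrite flat_out// mulr0 normr0 ltW.
have -> : h^-1 * flat n h = flat n.+1 h by rewrite /flat h0 exprS mulrA.
rewrite ger0_norm ?flat_ge0// (le_trans (flat_le _ h0))// mulrC -ler_pdivlMr//.
rewrite ltW// (le_lt_trans (ler_norm h))//; near: h.
by apply: dnbhs0_lt; rewrite divr_gt0.
Unshelve. all: by end_near. Qed.

Lemma smooth_flat n : smooth (flat n).
Proof.
apply: smooth_family => i; exists (- i%:R), 1, i.+1, i.+2 => x.
have [x0|x0|->] := ltgtP x 0; [exact: flat_neg_derive|exact: flat_pos_derive|].
exact: flat_zero_derive.
Qed.

Definition bump (a b : R) (n : nat) (x : R) : R :=
  flat 0 (n.+1%:R * (x - a)) * flat 0 (n.+1%:R * (b - x)).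

Lemma smooth_affine_line (c e : R) (f : R -> R) : smooth f -> smooth (fun x => f (c * x + e)).
Proof.
move=> sf; apply: (smooth_affine (A := fun x => c * x + e) (L := fun x => c * x) _ _ sf).
  move=> x; apply: cvgD; last exact: cvg_cst.
  by apply: cvgM; [exact: cvg_cst|exact: cvg_id].
by move=> h d y; rewrite /GRing.scale/=; ring.
Qed.

Lemma smooth_bump a b n : smooth (bump a b n).
Proof.
apply: smoothM.
  rewrite (_ : (fun x => _) = (fun x => flat 0 (n.+1%:R * x + - (n.+1%:R * a)))).
    exact: smooth_affine_line (smooth_flat 0).
  by apply/funext => x; rewrite mulrBr.
rewrite (_ : (fun x => _) = (fun x => flat 0 (- n.+1%:R * x + n.+1%:R * b))).
  exact: smooth_affine_line (smooth_flat 0).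
by apply/funext => x; congr flat; ring.
Qed.

Lemma flat0_le1 x : flat 0 x <= 1.
Proof.
rewrite /flat; case: ifPn => // x0.
by rewrite expr0 mul1r -expR0 ler_expR oppr_le0 invr_ge0 ltW.
Qed.

Lemma bump_itv a b n x : 0 <= bump a b n x <= 1.
Proof.
rewrite /bump mulr_ge0 ?flat_ge0//=.
by rewrite mulr_ile1 ?flat_ge0// flat0_le1.
Qed.

Lemma bump_out a b n x : ~~ (a < x < b) -> bump a b n x = 0.
Proof.
rewrite negb_and -!leNgt => /orP[xa|xb]; rewrite /bump.
  by rewrite (@flat_out 0 (_ * _)) ?mul0r// pmulr_rle0// subr_le0.
by rewrite (@flat_out 0 (_ * (b - x))) ?mulr0// pmulr_rle0// subr_le0.
Qed.

(** Bumps approximate the indicator of an interval, which lets test functions in time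
    detect functions of time. *)
Lemma bump_cvg a b x : bump a b ^~ x @ \oo --> (if a < x < b then 1 else 0 : R).
Proof.
case: ifPn => [/andP[xa xb]|xab]; last first.
  by apply: cvg_near_cst; apply: nearW => n; rewrite bump_out.
have fl (y : R) : 0 < y -> (fun n : nat => flat 0 (n.+1%:R * y)) @ \oo --> (1 : R).
  move=> y0; rewrite (_ : (fun n => _) = (fun n : nat => expR (- y^-1 * n.+1%:R^-1))).
    have H : (fun n : nat => - y^-1 * n.+1%:R^-1) @ \oo --> (0 : R).
      by rewrite -(mulr0 (- y^-1)); apply: cvgM; [exact: cvg_cst|exact: cvg_harmonic].
    by have := cvg_comp _ _ H (@continuous_expR R 0); rewrite expR0.
  apply/funext => n; rewrite /flat pmulr_rgt0// y0 expr0 mul1r; congr expR.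
  by rewrite invfM mulrC mulNr.
have xa' : 0 < x - a by rewrite subr_gt0.
have xb' : 0 < b - x by rewrite subr_gt0.
by have := cvgM (fl _ xa') (fl _ xb'); rewrite mulr1; exact.
Qed.

End smooth_line.

(** * Measurability of continuous functions *)

Section measurability_of_continuous_functions.
Variable R : realType.

Lemma floor_approx (r : R) :
  (fun n : nat => (Num.floor (n.+1%:R * r))%:~R / n.+1%:R) @ \oo --> r.
Proof.
apply/cvgrPdist_le => e e0; near=> n.
have n0 : 0 < n.+1%:R :> R by [].
have /andP[l1 l2] := floor_itv (n.+1%:R * r).
rewrite intrD in l2.
have -> : r - (Num.floor (n.+1%:R * r))%:~R / n.+1%:R =
    (n.+1%:R * r - (Num.floor (n.+1%:R * r))%:~R) / n.+1%:R.
  by field; rewrite gt_eqF.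
rewrite ger0_norm; last by rewrite divr_ge0 ?subr_ge0// ltW.
apply: (@le_trans _ _ (1 / n.+1%:R)).
  by rewrite ler_pM2r ?invr_gt0//; lra.
rewrite div1r; near: n; have := near_infty_natSinv_lt (PosNum e0).
by apply: filterS => n /ltW.
Unshelve. all: by end_near. Qed.

Lemma continuous_floor (g : R -> R) (r : R) : continuous g ->
  (fun n : nat => g ((Num.floor (n.+1%:R * r))%:~R / n.+1%:R)) @ \oo --> g r.
Proof. by move=> cg; apply: cvg_comp; [exact: floor_approx|exact: cg]. Qed.

(** A function that is measurable in the first variable and continuous in the
    second is a limit of functions that are piecewise constant in the second. *)
Lemma measurable_caratheodory d (X : measurableType d) (f : X * R -> R) :
  (forall r, measurable_fun setT (fun x => f (x, r))) ->
  (forall x, continuous (fun r => f (x, r))) -> measurable_fun setT f.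
Proof.
move=> mf cf.
pose F (n : nat) (z : X * R) := f (z.1, (Num.floor (n.+1%:R * z.2))%:~R / n.+1%:R).
apply: (measurable_fun_cvg (h := F)) => [n|[x r] _]; last first.
  exact: (@continuous_floor (fun r => f (x, r)) r (cf x)).
move=> _ B mB; rewrite setTI.
rewrite (_ : F n @^-1` B = \bigcup_(k in [set: int])
    (((fun x => f (x, k%:~R / n.+1%:R)) @^-1` B) `*`
      `[k%:~R / n.+1%:R, (k + 1)%:~R / n.+1%:R[)).
  apply: countable_bigcupT_measurable => // k.
  apply: measurableX; last exact: measurable_itv.
  by rewrite -[X in measurable X]setTI; exact: mf.
have n0 : 0 < n.+1%:R :> R by [].
apply/seteqP; split => [[x r] /= Bx|[x r] [k _ [/= Bk]]].
  exists (Num.floor (n.+1%:R * r)) => //; split => //=.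
  by rewrite in_itv/= ler_pdivrMr// ltr_pdivlMr// mulrC floor_itv.
rewrite in_itv/= ler_pdivrMr// ltr_pdivlMr// mulrC => /floor_def kE.
by rewrite /F /= kE.
Qed.

Lemma continuous_pair2 (U V W : topologicalType) (f : U * V -> W) (x : U) :
  continuous f -> continuous (fun r => f (x, r)).
Proof.
by move=> cf r; apply: (@cvg_comp _ _ _ (fun r => (x, r)) f _ (nbhs (x, r))); [apply: cvg_pair; [exact: cvg_cst|exact: cvg_id]|exact: cf].
Qed.

Lemma continuous_pair1 (U V W : topologicalType) (f : U * V -> W) (r : V) :
  continuous f -> continuous (fun x => f (x, r)).
Proof.
by move=> cf x; apply: (@cvg_comp _ _ _ (fun x => (x, r)) f _ (nbhs (x, r))); [apply: cvg_pair; [exact: cvg_id|exact: cvg_cst]|exact: cf].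
Qed.

Lemma measurable_continuous3 (f : pt3 R -> R) : continuous f -> measurable_fun setT f.
Proof.
move=> cf; apply: measurable_caratheodory => [z|xy]; last exact: continuous_pair2.
apply: (@measurable_caratheodory _ _ (fun xy : R * R => f (xy, z))) => [y|x].
  have cy : continuous (fun x : R => f ((x, y), z)).
    by move=> x; exact: (@continuous_pair1 R R R (fun xy : R * R => f (xy, z)) y (@continuous_pair1 (R * R)%type R R f z cf) x).
  exact: (continuous_measurable_fun cy).
by move=> y; exact: (@continuous_pair2 R R R (fun xy : R * R => f (xy, z)) x (@continuous_pair1 (R * R)%type R R f z cf) y).
Qed.

Lemma measurable_continuous4 (f : pt4 R -> R) : continuous f -> measurable_fun setT f.
Proof.
move=> cf; apply: measurable_caratheodory => [t|x]; last exact: continuous_pair2.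
by apply: measurable_continuous3; exact: continuous_pair1.
Qed.

End measurability_of_continuous_functions.

(** * Compactly supported kernels *)

Section kernels.
Variable R : realType.

Definition supported (V : normedModType R) (M : R) (K : V -> R) : Prop :=
  forall z, M < `|z| -> K z = 0.

Lemma supported_derive (V : normedModType R) M (K : V -> R) d :
  supported M K -> supported M ('D_d K).
Proof.
move=> sK z zM; have -> : 'D_d K z = 'D_d (fun _ : V => 0 : R) z; last exact: derive_cst.
apply: near_eq_derive.
have : \forall y \near z, M < `|y| by apply: (cvgr_gt `|z|) => //; exact: norm_continuous.
by apply: filterS => y yM; rewrite sK.
Qed.

Lemma bounded_kernel4 M (K : pt4 R -> R) : continuous K -> supported M K ->
  exists2 C : R, 0 <= C & forall z, `|K z| <= C.
Proof.
move=> cK sK.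
pose B : set (pt4 R) := `[- M, M] `*` `[- M, M] `*` `[- M, M] `*` `[- M, M].
have cB : compact B by do 3 (apply: compact_setX; last exact: segment_compact); exact: segment_compact.
have /compact_bounded [C [_ HC]] : compact (K @` B).
  by apply: continuous_compact => //; exact: continuous_subspaceT.
exists (`|C| + 1) => [|z]; first by rewrite addr_ge0.
have [zM|zM] := ltP M `|z|; first by rewrite sK// normr0 addr_ge0.
apply: HC; first by rewrite (le_lt_trans (ler_norm C))// ltrDl.
exists z => //; case: z zM => [[[x y] z] t] /norm_pair_le[/norm_pair_le[/norm_pair_le[hx hy] hz] ht].
by split; [split; [split|]|]; rewrite /= in_itv/= -ler_norml.
Qed.

Definition box1 (M r : R) : R := \1_(`[- M, M] : set R) r.
Definition box3 (M : R) (x : pt3 R) : R := box1 M x.1.1 * box1 M x.1.2 * box1 M x.2.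
Definition box4 (M : R) (z : pt4 R) : R := box3 M z.1 * box1 M z.2.

Lemma box1_in M r : `|r| <= M -> box1 M r = 1.
Proof. by move=> rM; rewrite /box1 indicE mem_set//= in_itv/= -ler_norml. Qed.

Lemma box1_ge0 M r : 0 <= box1 M r.
Proof. by rewrite /box1 indicE. Qed.

Lemma box3_in M x : `|x| <= M -> box3 M x = 1.
Proof.
case: x => [[x y] z] /norm_pair_le[/norm_pair_le[hx hy] hz].
by rewrite /box3/= !box1_in// !mulr1.
Qed.

Lemma box3_ge0 M x : 0 <= box3 M x.
Proof. by rewrite /box3 !mulr_ge0 ?box1_ge0. Qed.

Lemma box4_in M z : `|z| <= M -> box4 M z = 1.
Proof. by case: z => [x t] /norm_pair_le[hx ht]; rewrite /box4/= box3_in// box1_in// mulr1. Qed.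

Lemma box4_ge0 M z : 0 <= box4 M z.
Proof. by rewrite /box4 mulr_ge0 ?box1_ge0 ?box3_ge0. Qed.

Lemma L1_box1 M : L1 (leb1 R) (box1 M).
Proof. exact: integrable_indic_itv. Qed.

Lemma L1_box3 M : L1 (leb3m R) (box3 M).
Proof. exact: (L1_tensor (L1_tensor (L1_box1 M) (L1_box1 M)) (L1_box1 M)). Qed.

Lemma L1_box4 M : L1 (leb4m R) (box4 M).
Proof. exact: (L1_tensor (L1_box3 M) (L1_box1 M)). Qed.

Lemma kernel_le_box4 M (K : pt4 R -> R) (C : R) : 0 <= C -> supported M K ->
  (forall z, `|K z| <= C) -> forall z, `|K z| <= C * box4 M z.
Proof.
move=> C0 sK KC z; have [zM|zM] := leP `|z| M; first by rewrite box4_in// mulr1.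
by rewrite sK// normr0 mulr_ge0// box4_ge0.
Qed.

Lemma L1_kernel4 M (K : pt4 R -> R) : continuous K -> supported M K -> L1 (leb4m R) K.
Proof.
move=> cK sK; have [C C0 KC] := bounded_kernel4 cK sK.
apply: (L1_le _ (L1Z C (L1_box4 M))); first exact: measurable_continuous4.
exact: kernel_le_box4.
Qed.

(** ** Reflections and translations of the whole space *)

Definition refl4 (X Z : pt4 R) : pt4 R := X - Z.

Lemma preserves_refl1 (a : R) : preserves (leb1 R) (fun x => a - x).
Proof.
have [m1 e1] := preserves_opp R; have [m2 e2] := preserves_shift a.
split=> [|A mA].
  rewrite (_ : (fun x => _) = (fun x => x + a) \o -%R); first exact: (measurableT_comp m2 m1).
  by apply/funext => x /=; rewrite addrC.
rewrite -(e2 A mA) -[RHS]e1; last by rewrite -[X in measurable X]setTI; exact: m2.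
by congr (leb1 R _); apply/seteqP; split=> x /=; rewrite addrC.
Qed.

Lemma preserves_refl4 (X : pt4 R) : preserves (leb4m R) (refl4 X).
Proof.
exact: (@preserves_prod _ _ _ _ _ (leb3m R) (leb1 R) _ _
  (@preserves_prod _ _ _ _ _ (leb2m R) (leb1 R) _ _
    (@preserves_prod _ _ _ _ _ (leb1 R) (leb1 R) _ _
      (preserves_refl1 X.1.1.1) (preserves_refl1 X.1.1.2)) (preserves_refl1 X.1.2))
  (preserves_refl1 X.2)).
Qed.

Lemma L1_refl4 (X : pt4 R) F : L1 (leb4m R) F -> L1 (leb4m R) (fun Z => F (X - Z)).
Proof. by move=> Fi; exact: (L1_preserves (preserves_refl4 X) Fi). Qed.

Lemma Int_refl4 (X : pt4 R) F : L1 (leb4m R) F ->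
  \int[leb4m R]_Z F (X - Z) = \int[leb4m R]_Z F Z.
Proof. by move=> Fi; exact: (Int_preserves (preserves_refl4 X) Fi). Qed.

(** ** The mean value theorem along a direction *)

Lemma smooth_MVT_eq (V : normedModType R) (K : V -> R) (z d : V) (s : R) : smooth K ->
  exists2 c : R, `|c| <= `|s| & K (z + s *: d) - K z = s * 'D_d K (z + c *: d).
Proof.
move=> sK; pose g (r : R) := K (r *: d + z).
have dg (r : R) : is_derive r 1 g ('D_d K (r *: d + z)).
  have Ad (h : R) : (h *: (1 : R) + r) *: d + z = h *: d + (r *: d + z).
    by rewrite [_ *: 1]mulr1 scalerDl addrA.
  apply: DeriveDef.
    by apply: (@derivable_affine _ _ _ (fun r : R => r *: d + z) K 1 d r Ad); exact: smooth_derivable.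
  exact: (@derive_affine _ _ _ (fun r : R => r *: d + z) K 1 d r Ad).
have cg : continuous g.
  by move=> r; apply/differentiable_continuous/derivable1_diffP; exact: ex_derive.
have -> : K (z + s *: d) - K z = g s - g 0 by rewrite /g scale0r add0r [z + _]addrC.
have [s0|s0|s0] := ltgtP s 0; last first.
- by exists 0; rewrite s0 ?normr0// subrr mul0r.
- have [c /itvP cs ->] := @MVT R g _ 0 s s0 (fun r _ => dg r) (continuous_subspaceT cg).
  exists c; last by rewrite subr0 mulrC addrC.
  by rewrite !ger0_norm ?cs// ltW.
- have [c /itvP cs] := @MVT R g _ s 0 s0 (fun r _ => dg r) (continuous_subspaceT cg).
  rewrite -[g s - _]opprB => ->; exists c; last by rewrite sub0r mulrN opprK mulrC [z + _]addrC.
  by rewrite !ler0_norm ?lerN2 ?cs// ltW.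
Qed.

Lemma smooth_MVT (V : normedModType R) (K : V -> R) (z d : V) (s C : R) : smooth K ->
  (forall y, `|'D_d K y| <= C) -> `|K (z + s *: d) - K z| <= `|s| * C.
Proof.
by move=> sK DC; have [c _ ->] := smooth_MVT_eq z d s sK; rewrite normrM ler_wpM2l.
Qed.

Lemma smooth_taylor (V : normedModType R) (K : V -> R) (z d : V) (s C : R) : smooth K ->
  (forall y, `|'D_d ('D_d K) y| <= C) ->
  `|K (z + s *: d) - K z - s * 'D_d K z| <= `|s| ^+ 2 * C.
Proof.
move=> sK DC; have [c cs ->] := smooth_MVT_eq z d s sK.
rewrite -mulrBr normrM expr2 -mulrA ler_wpM2l//.
apply: le_trans (smooth_MVT z c (smooth_derive d sK) DC) _.
by rewrite ler_wpM2r// (le_trans _ (DC z)).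
Qed.

Lemma kernel4_lipschitz M (K : pt4 R -> R) : smooth K -> supported M K ->
  exists2 C : R, 0 <= C & forall z h, `|K (z + h) - K z| <= C * `|h|.
Proof.
move=> sK suK.
have bd d : exists2 C : R, 0 <= C & forall z, `|'D_d K z| <= C.
  apply: (bounded_kernel4 (M := M)); last exact: supported_derive.
  by apply: smooth_continuous; exact: smooth_derive.
have [C1 C10 H1] := bd (ex4 R); have [C2 C20 H2] := bd (ey4 R).
have [C3 C30 H3] := bd (ez4 R); have [C4 C40 H4] := bd (et4 R).
exists (C1 + C2 + C3 + C4) => [|z h]; first by rewrite !addr_ge0.
have /norm_pair_le[/norm_pair_le[/norm_pair_le[hx hy] hz] ht] :
  `|(((h.1.1.1, h.1.1.2), h.1.2), h.2)| <= `|h| by case: h => [[[]]].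
pose z1 := z + h.1.1.1 *: ex4 R; pose z2 := z1 + h.1.1.2 *: ey4 R.
pose z3 := z2 + h.1.2 *: ez4 R; pose z4 := z3 + h.2 *: et4 R.
have -> : z + h = z4.
  rewrite /z4 /z3 /z2 /z1; case: z {z1 z2 z3 z4} => [[[a b] c] e]; case: h {hx hy hz ht} => [[[x y] w] t].
  congr ((_, _), _, _); rewrite /= /GRing.scale/= ?mulr1 ?mulr0 ?addr0//.
have -> : K z4 - K z = (K z1 - K z) + (K z2 - K z1) + (K z3 - K z2) + (K z4 - K z3) by ring.
have a1 := smooth_MVT z h.1.1.1 sK H1; have a2 := smooth_MVT z1 h.1.1.2 sK H2.
have a3 := smooth_MVT z2 h.1.2 sK H3; have a4 := smooth_MVT z3 h.2 sK H4.
have b1 : `|h.1.1.1| * C1 <= C1 * `|h| by rewrite mulrC ler_wpM2l.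
have b2 : `|h.1.1.2| * C2 <= C2 * `|h| by rewrite mulrC ler_wpM2l.
have b3 : `|h.1.2| * C3 <= C3 * `|h| by rewrite mulrC ler_wpM2l.
have b4 : `|h.2| * C4 <= C4 * `|h| by rewrite mulrC ler_wpM2l.
rewrite !mulrDl; apply: le_trans (ler_normD _ _) _; apply: lerD; last exact: le_trans b4.
apply: le_trans (ler_normD _ _) _; apply: lerD; last exact: le_trans b3.
apply: le_trans (ler_normD _ _) _; apply: lerD; last exact: le_trans b2.
exact: le_trans b1.
Qed.

End kernels.

(** * Convolution with a smooth kernel *)

Section convolution.
Variable R : realType.
Implicit Types (K g : pt4 R -> R).

Definition conv K g (X : pt4 R) : R := \int[leb4m R]_Z (K (X - Z) * g Z).

Variables (g : pt4 R -> R) (B : R).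
Hypotheses (mg : measurable_fun setT g) (gB : forall Z, `|g Z| <= B).

Let B0 : 0 <= B. Proof. exact: le_trans (gB 0). Qed.

Lemma conv_L1 K M X : continuous K -> supported M K ->
  L1 (leb4m R) (fun Z => K (X - Z) * g Z).
Proof.
move=> cK sK; have Ki := L1_refl4 X (L1_kernel4 cK sK).
by apply: eq_L1 (L1_Mbounded Ki mg gB) => Z; rewrite mulrC.
Qed.

Let conv_le F (c r : R) (X : pt4 R) : L1 (leb4m R) (fun Z => F (X - Z) * g Z) ->
  0 <= c -> (forall y, `|F y| <= c * box4 r y) ->
  `|\int[leb4m R]_Z (F (X - Z) * g Z)| <= c * (B * \int[leb4m R]_Z box4 r Z).
Proof.
move=> Fi c0 FC; rewrite mulrA.
rewrite -[in leRHS](Int_refl4 X (L1_box4 r)) -IntZ; last exact: (L1_refl4 X (L1_box4 r)).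
apply: norm_Int_le => //; first exact: (L1Z _ (L1_refl4 X (L1_box4 r))).
move=> Z; rewrite normrM mulrAC; apply: ler_pM => //.
Qed.

Lemma conv_continuous K M : smooth K -> supported M K -> continuous (conv K g).
Proof.
move=> sK suK X; have cK := smooth_continuous sK.
have [C C0 KC] := kernel4_lipschitz sK suK.
set v := \int[leb4m R]_Z box4 (M + 1) Z.
have v0 : 0 <= v by apply: Int_ge0 => Z; exact: box4_ge0.
have P0 : 0 < C * B * v + 1 by rewrite ltr_pwDr// !mulr_ge0.
apply/cvgrPdist_le => e e0; near=> X'.
have hX : `|X - X'| <= 1 by near: X'; apply: cvgr_dist_le.
have cB0 : 0 <= C * `|X - X'| by rewrite mulr_ge0.
have D1 := conv_L1 X cK suK; have D2 := conv_L1 X' cK suK.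
rewrite /conv -(IntB D1 D2).
pose F y := K y - K (y + (X' - X)).
have FE Z : K (X - Z) * g Z - K (X' - Z) * g Z = F (X - Z) * g Z.
  by rewrite /F -mulrBl; congr ((_ - K _) * _); rewrite [RHS]addrC addrA subrK.
have Fi : L1 (leb4m R) (fun Z => F (X - Z) * g Z) by apply: eq_L1 (L1B D1 D2) => Z; exact: FE.
rewrite (_ : Rintegral _ _ _ = \int[leb4m R]_Z (F (X - Z) * g Z)); last by apply: eq_Int => Z; exact: FE.
apply: le_trans (@conv_le F (C * `|X - X'|) (M + 1) X Fi cB0 _) _.
  move=> y; have [yM|yM] := leP `|y| (M + 1).
    by rewrite box4_in// mulr1 distrC -(distrC X'); exact: KC.
  have yX : `|y| <= `|y + (X' - X)| + `|X - X'|.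
    by rewrite -{1}[y](addrK (X' - X)) (distrC X); exact: ler_normB.
  by rewrite /F !suK ?subr0 ?normr0 ?mulr_ge0 ?box4_ge0//; lra.
have hX2 : `|X - X'| <= e / (C * B * v + 1).
  near: X'; apply: cvgr_dist_le; first exact: cvg_id.
  exact: divr_gt0.
rewrite -/v; rewrite ler_pdivlMr// in hX2; apply: le_trans hX2.
rewrite [leLHS](_ : _ = `|X - X'| * (C * B * v)); last by ring.
by rewrite ler_wpM2l// lerDl.
Unshelve. all: by end_near. Qed.

Let conv_quotient K M X d : smooth K -> supported M K ->
  (fun h : R => h^-1 *: ((conv K g \o shift X) (h *: d) - conv K g X)) @ 0^' -->
    conv ('D_d K) g X.
Proof.
move=> sK suK; have cK := smooth_continuous sK.
have sD := smooth_derive d sK; have suD := supported_derive d suK.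
have cD := smooth_continuous sD.
have [C C0 KC] := bounded_kernel4 (smooth_continuous (smooth_derive d sD)) (supported_derive d suD).
set v := \int[leb4m R]_Z box4 (M + `|d|) Z.
have v0 : 0 <= v by apply: Int_ge0 => Z; exact: box4_ge0.
have P0 : 0 < C * B * v + 1 by rewrite ltr_pwDr// !mulr_ge0.
apply/cvgrPdist_le => e e0; near=> h.
have h0 : h != 0 by near: h; exact: nbhs_dnbhs_neq.
have h1 : `|h| <= 1 by apply: ltW; near: h; exact: dnbhs0_lt.
have h2 : `|h| * (C * B * v + 1) <= e.
  rewrite -ler_pdivlMr//; apply: ltW; near: h; apply: dnbhs0_lt.
  by rewrite divr_gt0.
have D1 := conv_L1 X cD suD.
have D2 := conv_L1 (h *: d + X) cK suK; have D3 := conv_L1 X cK suK.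
have D4 := L1Z h^-1 (L1B D2 D3).
rewrite /= /GRing.scale/= /conv -(IntB D2 D3) -(IntZ _ (L1B D2 D3)) -(IntB D1 D4).
pose F y := 'D_d K y - h^-1 * (K (y + h *: d) - K y).
have FE Z : 'D_d K (X - Z) * g Z -
    h^-1 * (K (h *: d + X - Z) * g Z - K (X - Z) * g Z) = F (X - Z) * g Z.
  by rewrite /F (_ : h *: d + X - Z = X - Z + h *: d); [ring|rewrite [RHS]addrC addrA].
have Fi : L1 (leb4m R) (fun Z => F (X - Z) * g Z) by apply: eq_L1 (L1B D1 D4) => Z; exact: FE.
have hC0 : 0 <= `|h| * C by rewrite mulr_ge0.
rewrite (_ : Rintegral _ _ _ = \int[leb4m R]_Z (F (X - Z) * g Z)); last by apply: eq_Int => Z; exact: FE.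
apply: le_trans (@conv_le F (`|h| * C) (M + `|d|) X Fi hC0 _) _; last first.
  apply: le_trans h2; rewrite -/v -!mulrA ler_wpM2l// !mulrA lerDl//.
move=> y; have [yM|yM] := leP `|y| (M + `|d|).
  have := @smooth_taylor _ _ K y d h C sK KC; rewrite box4_in// mulr1.
  have hp : 0 < `|h| by rewrite normr_gt0.
  rewrite -(ler_pM2l hp) => T; rewrite -(ler_pM2l hp) /F.
  rewrite -normrM mulrBr mulrA divff// mul1r distrC.
  by rewrite -(ler_pM2l hp); move: T; rewrite expr2 !mulrA.
have d0 : 0 <= `|d| by [].
have yh : `|y| <= `|y + h *: d| + `|h| * `|d|.
  by rewrite -normrZ -{1}[y](addrK (h *: d)); exact: ler_normB.
have hd : `|h| * `|d| <= `|d| by rewrite ler_piMl.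
by rewrite /F suD ?suK ?subr0 ?mulr0 ?subr0 ?normr0 ?mulr_ge0 ?box4_ge0//; lra.
Unshelve. all: by end_near. Qed.

Lemma conv_derive K M d : smooth K -> supported M K ->
  'D_d (conv K g) = conv ('D_d K) g.
Proof. by move=> sK suK; apply/funext => X; apply: cvg_lim => //; exact: conv_quotient sK suK. Qed.

(** Derivatives fall on the kernel, so convolutions with a merely bounded function are
    admissible as test functions. *)
Lemma conv_smooth K M : smooth K -> supported M K -> smooth (conv K g).
Proof.
move=> sK suK k; elim: k K sK suK => [|k ih] K sK suK.
  by split=> //; exact: conv_continuous sK suK.
split=> [|d]; first exact: conv_continuous sK suK.
split=> [X|]; last first.
  by rewrite (conv_derive _ sK suK); apply: ih; [exact: smooth_derive|exact: supported_derive].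
by apply/cvg_ex; exists (conv ('D_d K) g X); exact: conv_quotient sK suK.
Qed.

End convolution.

(** * Test functions *)

Section test_functions.
Variable R : realType.
Implicit Types (phi theta K f g : pt4 R -> R).

Lemma per4_derive f d : per4 f -> smooth f -> per4 ('D_d f).
Proof.
move=> pf sf.
have key (e : pt4 R) : (forall q, f (q + e) = f q) -> forall q, 'D_d f (q + e) = 'D_d f q.
  move=> fe q; have Ad (h : R) : h *: d + q + e = h *: d + (q + e) by rewrite addrA.
  rewrite -(@derive_affine _ _ _ (fun q => q + e) f d d q Ad); congr ('D_d _ q).
  by apply/funext => y /=; rewrite fe.
have sh (e : pt3 R) : (forall t x, f (x + e, t) = f (x, t)) ->
    forall x t, 'D_d f (x + e, t) = 'D_d f (x, t).
  move=> fe x t; have := key (e, 0) _ (x, t); rewrite /= => <-.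
    by congr ('D_d f (_, _)); rewrite /= addr0.
  move=> [y s]; rewrite -[RHS]fe; congr (f (_, _)); by rewrite /= addr0.
move=> t x; split; apply: sh => s y; by have [] := pf s y.
Qed.

Lemma test_fun_smooth T phi : test_fun T phi -> smooth phi. Proof. by case. Qed.

Lemma test_fun_per4 T phi : test_fun T phi -> per4 phi. Proof. by case. Qed.

Lemma test_fun_derive T phi d : test_fun T phi -> test_fun T ('D_d phi).
Proof.
move=> [sf pf [a [b [a0 bT ab]]]]; split; [exact: smooth_derive|exact: per4_derive|].
exists a, b; split => // x t; apply: contraNT; rewrite negb_and -!ltNge => tab.
suff -> : 'D_d phi (x, t) = 'D_d (fun _ : pt4 R => 0 : R) (x, t) by rewrite derive_cst.
apply: near_eq_derive.
have cs : (fun q : pt4 R => q.2) @ (x, t) --> t by exact: cvg_snd.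
case/orP: tab => tab.
  have : \forall q \near (x, t), q.2 < a by exact: (cvgr_lt t cs).
  apply: filterS => -[y s] /= sa; apply/eqP; apply: contraTT sa => /ab /andP[sa _].
  by rewrite -leNgt.
have : \forall q \near (x, t), b < q.2 by exact: (cvgr_gt t cs).
apply: filterS => -[y s] /= sa; apply/eqP; apply: contraTT sa => /ab /andP[_ sb].
by rewrite -leNgt.
Qed.

Lemma test_fun_bounded T phi : test_fun T phi ->
  exists2 C : R, 0 <= C & forall q, `|phi q| <= C.
Proof.
move=> [sf pf [a [b [a0 bT ab]]]].
pose B : set (pt4 R) := `[0, 1] `*` `[0, 1] `*` `[0, 1] `*` `[a, b].
have cB : compact B by do 3 (apply: compact_setX; last exact: segment_compact); exact: segment_compact.
have /compact_bounded [C [_ HC]] : compact (phi @` B).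
  by apply: continuous_compact => //; apply: continuous_subspaceT; exact: smooth_continuous.
exists (`|C| + 1) => [|q]; first by rewrite addr_ge0.
have [->|q0] := eqVneq (phi q) 0; first by rewrite normr0 addr_ge0.
apply: HC; first by rewrite (le_lt_trans (ler_norm C))// ltrDl.
exists (frac3 q.1, q.2); last by rewrite (periodic_frac q.1 (pf q.2)); case: q {q0}.
have /andP[ta tb] : a <= q.2 <= b by apply: (ab q.1); case: q q0.
have fr (x : R) : 0 <= frac x <= 1 by have /andP[-> /ltW ->] := frac_itv x.
by split; [split; [split|]|]; rewrite /= in_itv/= ?fr// ta.
Qed.

Lemma test_fun_measurable T phi : test_fun T phi -> measurable_fun setT phi.
Proof. by move=> [sf _ _]; apply: measurable_continuous4; exact: smooth_continuous. Qed.

Lemma test_fun_out T phi q : test_fun T phi -> ~~ (0 < q.2 < T) -> phi q = 0.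
Proof.
move=> [_ _ [a [b [a0 bT ab]]]]; apply: contraNeq => q0.
have /andP[ta tb] : a <= q.2 <= b by apply: (ab q.1); case: q q0.
by rewrite (lt_le_trans a0 ta) (le_lt_trans tb bT).
Qed.

(** The identity and the four partial derivatives, numbered so that an equation
    in divergence form is a sum over its five slots. *)
Definition Dop (i : 'I_5) (f : pt4 R -> R) : pt4 R -> R :=
  match val i with
  | 0%N => f
  | 1%N => 'D_(et4 R) f
  | 2%N => 'D_(ex4 R) f
  | 3%N => 'D_(ey4 R) f
  | _ => 'D_(ez4 R) f
  end.

Lemma Dop_ind (P : (pt4 R -> R) -> Prop) f i :
  P f -> (forall d, P ('D_d f)) -> P (Dop i f).
Proof. by move=> Pf PD; rewrite /Dop; case: (val i) => [|[|[|[|]]]]. Qed.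

Lemma Dop_smooth i f : smooth f -> smooth (Dop i f).
Proof. by move=> sf; apply: (@Dop_ind (@smooth R _)) => // d; exact: smooth_derive. Qed.

Lemma Dop_supported i M K : supported M K -> supported M (Dop i K).
Proof. by move=> sK; apply: (@Dop_ind (supported M)) => // d; exact: supported_derive. Qed.

Lemma Dop_test T i phi : test_fun T phi -> test_fun T (Dop i phi).
Proof. by move=> tp; apply: (@Dop_ind (test_fun T)) => // d; exact: test_fun_derive. Qed.

(** ** Domination on pairs of points *)

Definition kappa K (z : pt4 R) : R := \sum_(i < 5) `|Dop i K z|.

Lemma kappa_ge i K z : `|Dop i K z| <= kappa K z.
Proof. by rewrite /kappa (bigD1 i)//= lerDl sumr_ge0. Qed.

Lemma L1_Dop i M K : smooth K -> supported M K -> L1 (leb4m R) (Dop i K).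
Proof.
move=> sK suK; apply: (@L1_kernel4 R M); last exact: Dop_supported.
by apply: smooth_continuous; exact: Dop_smooth.
Qed.

Lemma L1_kappa M K : smooth K -> supported M K -> L1 (leb4m R) (kappa K).
Proof. by move=> sK suK; apply: L1_sum => i _; apply: L1_norm; exact: L1_Dop sK suK. Qed.

Definition pairs := prodm (tor4 R) (leb4m R).

Lemma measurable_add4 : measurable_fun setT (fun z : pt4 R * pt4 R => z.1 + z.2).
Proof.
pose c1 (q : pt4 R) := q.1.1.1; pose c2 (q : pt4 R) := q.1.1.2.
pose c3 (q : pt4 R) := q.1.2; pose c4 (q : pt4 R) := q.2.
have m1 : measurable_fun setT c1 := measurableT_comp measurable_fst (measurableT_comp measurable_fst measurable_fst).
have m2 : measurable_fun setT c2 := measurableT_comp measurable_snd (measurableT_comp measurable_fst measurable_fst).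
have m3 : measurable_fun setT c3 := measurableT_comp measurable_snd measurable_fst.
have m4 : measurable_fun setT c4 := measurable_snd.
have mc (c : pt4 R -> R) : measurable_fun setT c ->
    measurable_fun setT (fun z : pt4 R * pt4 R => c z.1 + c z.2).
  move=> mc; apply: measurable_funD.
    exact: (measurableT_comp mc measurable_fst).
  exact: (measurableT_comp mc measurable_snd).
exact: (measurable_fun_pair (measurable_fun_pair (measurable_fun_pair (mc c1 m1) (mc c2 m2)) (mc c3 m3)) (mc c4 m4)).
Qed.

Lemma measurable_opp4 : measurable_fun setT (fun z : pt4 R => - z).
Proof.
have := (preserves_refl4 (0 : pt4 R)).1; rewrite (_ : refl4 0 = (fun z => - z))//.
by apply/funext => z; rewrite /refl4 sub0r.
Qed.

Lemma measurable_sub4 : measurable_fun setT (fun z : pt4 R * pt4 R => z.1 - z.2).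
Proof.
have m : measurable_fun setT (fun z : pt4 R * pt4 R => (z.1, - z.2)).
  by apply: measurable_fun_pair => //; exact: (measurableT_comp measurable_opp4 measurable_snd).
exact: (measurableT_comp measurable_add4 m).
Qed.

Lemma measurable_at1 f : measurable_fun setT f ->
  measurable_fun setT (fun z : pt4 R * pt4 R => f z.1).
Proof. by move=> mf; exact: (measurableT_comp mf measurable_fst). Qed.

Lemma measurable_at2 f : measurable_fun setT f ->
  measurable_fun setT (fun z : pt4 R * pt4 R => f z.2).
Proof. by move=> mf; exact: (measurableT_comp mf measurable_snd). Qed.

Lemma measurable_at12 f : measurable_fun setT f ->
  measurable_fun setT (fun z : pt4 R * pt4 R => f (z.1 + z.2)).
Proof. by move=> mf; exact: (measurableT_comp mf measurable_add4). Qed.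

Lemma L1_pairs1 k F : L1 (leb4m R) k -> L1 (tor4 R) F ->
  L1 pairs (fun z => k z.2 * F z.1).
Proof. by move=> ki Fi; apply: eq_L1 (L1_tensor Fi ki) => z; rewrite mulrC. Qed.

Lemma L1_pairs12 k F : L1 (leb4m R) k -> L1 (tor4 R) F -> per4 F ->
  L1 pairs (fun z => k z.2 * F (z.1 + z.2)).
Proof.
move=> ki Fi pF.
apply: (@L1_prod21 _ _ _ _ _ (tor4 R) (leb4m R) _ (fun z => (\int[tor4 R]_q `|F q|) * `|k z|)).
- apply: measurable_funM.
    by apply: measurable_at2; exact: L1_measurable ki.
  by apply: measurable_at12; exact: L1_measurable Fi.
- exact: (L1Z _ (L1_norm ki)).
- by move=> z; exact: (L1Z (k z) (L1_shift4 z pF Fi)).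
- move=> z /=; have Fn := L1_norm Fi.
  have pn : per4 (fun q => `|F q|) by move=> t x; have [-> -> ->] := pF t x.
  rewrite -(Int_shift4 z pn Fn) mulrC -IntZ; last exact: (L1_shift4 z pn Fn).
  by rewrite le_eqVlt; apply/orP; left; apply/eqP/eq_Int => q; rewrite normrM.
Qed.

(** ** Testing against a mollified weight *)

Variables (g : pt4 R -> R) (B M : R) (K : pt4 R -> R).
Hypotheses (mg : measurable_fun setT g) (pg : per4 g) (gB : forall Z, `|g Z| <= B).
Hypotheses (sK : smooth K) (suK : supported M K).
Variable F : pt4 R -> R.
Hypotheses (Fi : L1 (tor4 R) F) (pF : per4 F).

Let cK : continuous K. Proof. exact: smooth_continuous. Qed.
Let Ki : L1 (leb4m R) K. Proof. exact: L1_kernel4 cK suK. Qed.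
Let mF : measurable_fun setT F. Proof. exact: L1_measurable Fi. Qed.

Lemma conv_shiftE X : conv K g X = \int[leb4m R]_z (K z * g (X - z)).
Proof.
have h : L1 (leb4m R) (fun z => K z * g (X - z)).
  apply: eq_L1 (L1_Mbounded Ki _ (fun z => gB (X - z))) => [z|]; first by rewrite mulrC.
  exact: (measurableT_comp mg (preserves_refl4 X).1).
rewrite -(Int_refl4 X h); apply: eq_Int => Z.
by rewrite opprB [X + (Z - X)]addrC subrK.
Qed.

Lemma conv_per4 : per4 (conv K g).
Proof.
move=> t x; have key (e : pt3 R) : (forall y s, g (y + e, s) = g (y, s)) ->
    conv K g (x + e, t) = conv K g (x, t).
  move=> ge; rewrite !conv_shiftE; apply: eq_Int => -[z s].
  congr (_ * _); rewrite -[RHS]ge; congr (g (_, _)).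
  by rewrite /= addrAC.
by split; apply: key => y s; have [] := pg s y.
Qed.

(** Mollifying the weight amounts to shifting the field against it. *)
Lemma Int_conv :
  \int[tor4 R]_X (F X * conv K g X) = \int[pairs]_z (K z.2 * (F (z.1 + z.2) * g z.1))
  /\ L1 pairs (fun z => K z.2 * (F (z.1 + z.2) * g z.1)).
Proof.
have i2 : L1 pairs (fun z => K z.2 * (F (z.1 + z.2) * g z.1)).
  apply: eq_L1 (L1_Mbounded (L1_pairs12 Ki Fi pF) (measurable_at1 mg) (fun z => gB z.1)) => z.
  by ring.
have i1 : L1 pairs (fun z => K z.2 * (F z.1 * g (z.1 - z.2))).
  have mgs : measurable_fun setT (fun z : pt4 R * pt4 R => g (z.1 - z.2)) := measurableT_comp mg measurable_sub4.
  apply: eq_L1 (L1_Mbounded (L1_pairs1 Ki Fi) mgs (fun z => gB (z.1 - z.2))) => z.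
  by ring.
split=> //; rewrite (Int_prod21 i2).
transitivity (\int[pairs]_z (K z.2 * (F z.1 * g (z.1 - z.2)))).
  rewrite (Int_prod12 i1); apply: eq_Int => X; rewrite conv_shiftE -IntZ.
    by apply: eq_Int => z /=; ring.
  apply: eq_L1 (L1_Mbounded Ki _ (fun z => gB (X - z))) => [z|]; first by rewrite mulrC.
  exact: (measurableT_comp mg (preserves_refl4 X).1).
rewrite (Int_prod21 i1); apply: eq_Int => z /=.
have h : L1 (tor4 R) (fun X => K z * (F X * g (X - z))).
  apply: L1Z; apply: eq_L1 (L1_Mbounded Fi (measurable_shift4 (- z) pg mg) (fun X => gB (X - z))) => X.
  by rewrite mulrC.
have ph : per4 (fun X => K z * (F X * g (X - z))).
  by move=> t x; have [-> -> ->] := pF t x; have [h1 h2 h3] := per4_shift (- z) pg t x; rewrite h1 h2 h3.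
rewrite -(Int_shift4 z ph h); apply: eq_Int => X.
by rewrite addrK.
Qed.

(** Mollifying with the reflected kernel instead shifts the weight. *)
Lemma conv_reflE Y : conv (fun z => K (- z)) g Y = \int[leb4m R]_z (K z * g (Y + z)).
Proof.
have h : L1 (leb4m R) (fun z => K z * g (Y + z)).
  apply: eq_L1 (L1_Mbounded Ki _ (fun z => gB (Y + z))) => [z|]; first by rewrite mulrC.
  rewrite (_ : (fun z => _) = g \o refl4 Y \o refl4 0); last first.
    by apply/funext => z; rewrite /refl4 /= sub0r opprK.
  apply: measurableT_comp (preserves_refl4 0).1.
  exact: (measurableT_comp mg (preserves_refl4 Y).1).
rewrite -[RHS](Int_refl4 0 h); pose H z := K (0 - z) * g (Y + (0 - z)).
have hH : L1 (leb4m R) H := L1_refl4 0 h.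
rewrite -[RHS](Int_refl4 Y hH); apply: eq_Int => Z.
by rewrite /H !sub0r !opprB [Y + (Z - Y)]addrC subrK.
Qed.

Lemma Int_conv_refl :
  \int[tor4 R]_Y (F Y * conv (fun z => K (- z)) g Y) =
    \int[pairs]_z (K z.2 * (F z.1 * g (z.1 + z.2)))
  /\ L1 pairs (fun z => K z.2 * (F z.1 * g (z.1 + z.2))).
Proof.
have i1 : L1 pairs (fun z => K z.2 * (F z.1 * g (z.1 + z.2))).
  apply: eq_L1 (L1_Mbounded (L1_pairs1 Ki Fi) (measurable_at12 mg) (fun z => gB (z.1 + z.2))) => z.
  by ring.
split=> //; rewrite (Int_prod12 i1); apply: eq_Int => Y; rewrite conv_reflE -IntZ.
  by apply: eq_Int => z /=; ring.
apply: eq_L1 (L1_Mbounded Ki _ (fun z => gB (Y + z))) => [z|]; first by rewrite mulrC.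
rewrite (_ : (fun z => _) = g \o refl4 Y \o refl4 0); last first.
  by apply/funext => z; rewrite /refl4 /= sub0r opprK.
apply: measurableT_comp (preserves_refl4 0).1.
exact: (measurableT_comp mg (preserves_refl4 Y).1).
Qed.

End test_functions.

(** * Doubling the variables in an equation in divergence form *)

Section truncation.
Variable R : realType.

Definition trunc (N : nat) (x : R) : R := Num.max (- N%:R) (Num.min N%:R x).

Lemma trunc_bound N x : `|trunc N x| <= N%:R.
Proof.
rewrite ler_norml /trunc le_max lexx/= ge_max ge_min lexx/= andbT.
by rewrite (le_trans _ (ler0n R N))// oppr_le0.
Qed.

Lemma trunc_id N x : `|x| <= N%:R -> trunc N x = x.
Proof. by rewrite ler_norml => /andP[xl xr]; rewrite /trunc min_r// max_r. Qed.

Lemma trunc_le N x : `|trunc N x| <= `|x|.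
Proof.
have [xN|xN] := leP `|x| N%:R; first by rewrite trunc_id.
exact: le_trans (trunc_bound N x) (ltW xN).
Qed.

Lemma trunc_cvg x : trunc ^~ x @ \oo --> x.
Proof.
apply: cvg_near_cst; exists (Num.bound `|x|) => // n /= xn; apply: trunc_id.
have : `|x| < (Num.bound `|x|)%:R by exact: archi_boundP.
by move=> /ltW /le_trans; apply; rewrite ler_nat.
Qed.

(** The sign of the truncation is that of the argument. *)
Lemma trunc_sqr_le N x : trunc N x ^+ 2 <= x * trunc N x.
Proof.
have N0 : 0 <= N%:R :> R by [].
rewrite /trunc; have [xN|xN] := leP N%:R x.
  by rewrite max_r; [nra|lra].
have [xM|xM] := leP (- N%:R) x; nra.
Qed.

Lemma measurable_trunc N : measurable_fun setT (trunc N).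
Proof. by apply: measurable_maxr => //; apply: measurable_minr. Qed.

End truncation.

Lemma cvg_sumr (R : realType) (I : Type) (s : seq I) (P : pred I) (f : nat -> I -> R) (l : I -> R) :
  (forall i, P i -> f ^~ i @ \oo --> l i) ->
  (fun n => \sum_(i <- s | P i) f n i) @ \oo --> \sum_(i <- s | P i) l i.
Proof.
move=> fl; elim: s => [|i s ih].
  by under eq_fun do rewrite big_nil; rewrite big_nil; exact: cvg_cst.
under eq_fun do rewrite big_cons; rewrite big_cons; case: ifPn => // Pi.
by apply: cvgD => //; exact: fl.
Qed.

Section limits_of_null_integrals.
Context d (X : measurableType d) (R : realType).
Variable m : {measure set X -> \bar R}.

(** Dominated convergence for integrals that all vanish: it passes from truncated to
    unbounded weights. *)
Lemma null_integral_limit (J : nat -> X -> R) (Jl D : X -> R) :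
  (forall N, L1 m (J N) /\ \int[m]_z J N z = 0) -> L1 m D ->
  (forall N z, `|J N z| <= D z) -> (forall z, J ^~ z @ \oo --> Jl z) ->
  L1 m Jl /\ \int[m]_z Jl z = 0.
Proof.
move=> J0 Di JD Jc.
have mJl : measurable_fun setT Jl.
  by apply: (measurable_fun_cvg (h := J)) => [N|z _]; [exact: L1_measurable (J0 N).1|exact: Jc].
have JlD z : `|Jl z| <= D z.
  have := cvg_norm (Jc z) => Jn; apply: (@cvgr_to_le _ \oo _ _ (fun N => `|J N z|)).
    exact: Jn.
  by apply: nearW => N; exact: JD.
split; first exact: L1_le mJl Di JlD.
have C := @Int_cvg_dominated _ _ _ m J Jl D (fun N => L1_measurable (J0 N).1) mJl Di
  (aeW m (fun z N => JD N z)) (aeW m Jc).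
have E : (fun N => \int[m]_z J N z) = (fun=> 0) by apply/funext => N; exact: (J0 N).2.
rewrite E in C; exact: (cvg_unique _ C (cvg_cst _)).
Qed.

End limits_of_null_integrals.

Section reflection.
Variable R : realType.

Lemma derive_oppdir (V : normedModType R) (f : V -> R) d z : smooth f ->
  'D_(- d) f z = - 'D_d f z.
Proof.
move=> sf; pose A (r : R) := r *: d + z.
have A1 (h : R) : A (h *: (1 : R) + 0) = h *: d + A 0.
  by rewrite /A scale0r add0r addr0 [_ *: 1]mulr1.
have AN (h : R) : A (h *: (-1 : R) + 0) = h *: (- d) + A 0.
  by rewrite /A scale0r add0r addr0 [_ *: -1]mulrN1 scalerN scaleNr.
have z0 : z = A 0 by rewrite /A scale0r add0r.
have E1 := @derive_affine _ _ _ A f 1 d 0 A1.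
have EN := @derive_affine _ _ _ A f (-1) (- d) 0 AN.
have D1 : is_derive (0 : R) 1 (f \o A) ('D_d f z).
  apply: DeriveDef; last by rewrite E1 -z0.
  apply: (derivable_affine (e := d)) => //; exact: smooth_derivable.
by rewrite {1}z0 -EN (is_derive_dir (-1) D1).2 mulN1r.
Qed.

Lemma smooth_reflect (V : normedModType R) (K : V -> R) : smooth K -> smooth (fun z => K (- z)).
Proof.
move=> sK; apply: (smooth_affine (A := -%R) (L := -%R) _ _ sK).
  by move=> x; exact: opp_continuous.
by move=> h d y; rewrite opprD scalerN.
Qed.

Lemma derive_reflect (V : normedModType R) (K : V -> R) d z : smooth K ->
  'D_d (fun z => K (- z)) z = - 'D_d K (- z).
Proof.
move=> sK; rewrite -derive_oppdir//.
by apply: (@derive_affine _ _ _ -%R K d (- d) z) => h; rewrite opprD scalerN.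
Qed.

End reflection.

Lemma far_time (R : realType) (a b h t s : R) : 0 < h ->
  (t < a - h) || (b + h < t) -> a <= s -> s <= b -> h < `|t - s|.
Proof.
move=> h0 tab sa sb; case/orP: tab => tab.
  have tZ : t - s < 0 by lra.
  by rewrite (ltr0_norm tZ); lra.
have tZ : 0 < t - s by lra.
by rewrite (gtr0_norm tZ); lra.
Qed.

Section doubling.
Variables (R : realType) (T : R) (F : 'I_5 -> pt4 R -> R).

Definition flux_eq := forall theta, test_fun T theta ->
  \int[tor4 R]_q (\sum_(i < 5) F i q * Dop i theta q) = 0.

Hypotheses (Fi : forall i, L1 (tor4 R) (F i)) (pF : forall i, per4 (F i)).
Hypothesis FE : flux_eq.

Variables (K : pt4 R -> R) (M h : R).
Hypotheses (sK : smooth K) (suK : supported M K).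
Hypothesis Kh : forall z, h < `|z.2| -> K z = 0.

Variables (phi : pt4 R -> R) (a b : R).
Hypotheses (tphi : test_fun T phi) (h0 : 0 < h) (ah : 0 < a - h) (bh : b + h < T).
Hypothesis phi_ab : forall x t, phi (x, t) != 0 -> a <= t <= b.

Let mphi := test_fun_measurable tphi.
Let pphi := test_fun_per4 tphi.

Definition Xterm (g : pt4 R -> R) (z : pt4 R * pt4 R) : R :=
  \sum_(i < 5) Dop i K z.2 * (F i (z.1 + z.2) * (phi z.1 * g z.1)).

Definition Yterm (g : pt4 R -> R) (z : pt4 R * pt4 R) : R :=
  F ord0 z.1 * phi z.1 * K z.2 * g (z.1 + z.2) +
  \sum_(i < 5 | i != ord0) F i z.1 * (Dop i phi z.1 * K z.2 - phi z.1 * Dop i K z.2) * g (z.1 + z.2).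

Let conv_Dop i (g : pt4 R -> R) (B : R) : measurable_fun setT g -> (forall Z, `|g Z| <= B) ->
  Dop i (conv K g) = conv (Dop i K) g.
Proof.
move=> mg gB; rewrite /Dop; case: (val i) => [//|k].
by case: k => [|[|[|k]]]; exact: (conv_derive mg gB _ sK suK).
Qed.

Let doubling_X_bounded (g : pt4 R -> R) (B : R) : measurable_fun setT g -> per4 g ->
  (forall Z, `|g Z| <= B) ->
  L1 (pairs R) (Xterm g) /\ \int[pairs R]_z Xterm g z = 0.
Proof.
move=> mg pg gB; pose w q := phi q * g q.
have [C C0 phiC] := test_fun_bounded tphi.
have mw : measurable_fun setT w by exact: measurable_funM.
have pw : per4 w by move=> t x; rewrite /w; have [-> -> ->] := pphi t x; have [-> -> ->] := pg t x.
have wB Z : `|w Z| <= C * B by rewrite normrM ler_pM.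
have tth : test_fun T (conv K w).
  split; first exact: (conv_smooth mw wB sK suK).
    exact: conv_per4 mw pw wB sK suK.
  exists (a - h), (b + h); split => // x t; apply: contraNT; rewrite negb_and -!ltNge => tab.
  apply/eqP; rewrite /conv -[RHS](Int0 (leb4m R)); apply: eq_Int => Z.
  have [Z0|Z0] := eqVneq (phi Z) 0; first by rewrite /w Z0 mul0r mulr0.
  have /andP[Za Zb] : a <= Z.2 <= b by apply: (@phi_ab Z.1); case: (Z) Z0.
  by rewrite (Kh (z := (x, t) - Z) (far_time h0 tab Za Zb)) mul0r.
have /= E := FE tth.
have term i := Int_conv mw pw wB (Dop_smooth i sK) (Dop_supported i suK) (Fi i) (pF i).
split.
  by rewrite /Xterm; apply: L1_sum => i _; exact: (term i).2.
rewrite -[RHS]E /Xterm Int_sum; last by move=> i _; exact: (term i).2.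
rewrite Int_sum.
  apply: eq_bigr => i _; rewrite -(term i).1; apply: eq_Int => q.
  by rewrite (conv_Dop i mw wB).
move=> i _.
have [D D0 thD] := test_fun_bounded (Dop_test i tth).
apply: eq_L1 (L1_Mbounded (Fi i) (test_fun_measurable (Dop_test i tth)) thD) => q.
by rewrite mulrC.
Qed.

Let Dop_reflect (i : 'I_5) (z : pt4 R) : i != ord0 -> Dop i (fun z => K (- z)) z = - Dop i K (- z).
Proof.
by case: i => -[|[|[|[|[|]]]]]//= i5 _; rewrite /Dop/= derive_reflect.
Qed.

Let Dop_M (i : 'I_5) (f g : pt4 R -> R) (q : pt4 R) : i != ord0 -> smooth f -> smooth g ->
  Dop i (fun x => f x * g x) q = f q * Dop i g q + g q * Dop i f q.
Proof.
by case: i => -[|[|[|[|[|]]]]]//= i5 _ sf sg; rewrite /Dop/= smooth_deriveM.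
Qed.

Let doubling_Y_bounded (g : pt4 R -> R) (B : R) : measurable_fun setT g -> per4 g ->
  (forall Z, `|g Z| <= B) ->
  L1 (pairs R) (Yterm g) /\ \int[pairs R]_z Yterm g z = 0.
Proof.
move=> mg pg gB; pose Kr z := K (- z).
have sKr : smooth Kr := smooth_reflect sK.
have suKr : supported M Kr by move=> z zM; rewrite /Kr suK// normrN.
have cs : smooth (conv Kr g) := conv_smooth mg gB sKr suKr.
have tth : test_fun T (fun q => phi q * conv Kr g q).
  split; first exact: (smoothM (test_fun_smooth tphi) cs).
    by move=> t x; have [-> -> ->] := pphi t x; have [-> -> ->] := conv_per4 mg pg gB sKr suKr t x.
  have [sf pf [a1 [b1 [a10 b1T ab1]]]] := tphi.
  exists a1, b1; split => // x t ne; apply: (ab1 x t).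
  by apply: contra_neq ne => ->; rewrite mul0r.
have /= E := FE tth.
have term i (k : pt4 R -> R) (sk : smooth k) (suk : supported M k) (f : pt4 R -> R) (tf : test_fun T f) :
    let J z := k z.2 * (F i z.1 * f z.1 * g (z.1 + z.2)) in
    \int[tor4 R]_q (F i q * f q * conv (fun z => k (- z)) g q) = \int[pairs R]_z J z /\ L1 (pairs R) J.
  have [D D0 fD] := test_fun_bounded tf.
  have Ffi : L1 (tor4 R) (fun q => F i q * f q).
    by apply: eq_L1 (L1_Mbounded (Fi i) (test_fun_measurable tf) fD) => q; rewrite mulrC.
  have pFf : per4 (fun q => F i q * f q).
    by move=> t x; have [-> -> ->] := pF i t x; have [-> -> ->] := test_fun_per4 tf t x.
  exact: (Int_conv_refl mg gB sk suk Ffi).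
have t0 := term ord0 K sK suK phi tphi.
have t1 i := term i K sK suK (Dop i phi) (Dop_test i tphi).
have t2 i := term i (Dop i K) (Dop_smooth i sK) (Dop_supported i suK) phi tphi.
pose J0 z := K z.2 * (F ord0 z.1 * phi z.1 * g (z.1 + z.2)).
pose J1 i z := K z.2 * (F i z.1 * Dop i phi z.1 * g (z.1 + z.2)).
pose J2 i z := Dop i K z.2 * (F i z.1 * phi z.1 * g (z.1 + z.2)).
have YE z : J0 z + \sum_(i < 5 | i != ord0) (J1 i z - J2 i z) = Yterm g z.
  rewrite /Yterm /J0 /J1 /J2; congr (_ + _); first by ring.
  by apply: eq_bigr => i _; ring.
have i12 i : L1 (pairs R) (fun z => J1 i z - J2 i z) by exact: (L1B (t1 i).2 (t2 i).2).
have iS : L1 (pairs R) (fun z => \sum_(i < 5 | i != ord0) (J1 i z - J2 i z)).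
  by apply: L1_sum => i _.
have i0 : L1 (pairs R) J0 by exact: t0.2.
split; first by apply: (@eq_L1 _ _ _ (pairs R) _ _ _ (L1D i0 iS)) => z; exact: YE.
transitivity (\int[pairs R]_z (J0 z + \sum_(i < 5 | i != ord0) (J1 i z - J2 i z))).
  by apply: eq_Int => z; rewrite YE.
rewrite (IntD i0 iS) Int_sum//.
rewrite -[RHS]E Int_sum; last first.
  move=> i _; have [D D0 thD] := test_fun_bounded (Dop_test i tth).
  apply: eq_L1 (L1_Mbounded (Fi i) (test_fun_measurable (Dop_test i tth)) thD) => q.
  by rewrite mulrC.
rewrite [RHS](bigD1 ord0)//=; congr (_ + _).
  by rewrite -t0.1; apply: eq_Int => q; rewrite /Dop/= mulrA.
apply: eq_bigr => i in0; rewrite (IntB (t1 i).2 (t2 i).2) -(t1 i).1 -(t2 i).1.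
have bd (f k : pt4 R -> R) : test_fun T f -> smooth k -> supported M k ->
    L1 (tor4 R) (fun q => F i q * f q * conv (fun z => k (- z)) g q).
  move=> tf sk suk.
  have tt : test_fun T (fun q => f q * conv (fun z => k (- z)) g q).
    have suk' : supported M (fun z => k (- z)) by move=> z zM; rewrite suk// normrN.
    have csk := conv_smooth mg gB (smooth_reflect sk) suk'.
    split; first exact: (smoothM (test_fun_smooth tf) csk).
      move=> t x; have [-> -> ->] := test_fun_per4 tf t x.
      by have [-> -> ->] := conv_per4 mg pg gB (smooth_reflect sk) suk' t x.
    have [sf pf [a1 [b1 [a10 b1T ab1]]]] := tf.
    exists a1, b1; split => // x t ne; apply: (ab1 x t).
    by apply: contra_neq ne => ->; rewrite mul0r.
  have [D D0 thD] := test_fun_bounded tt.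
  apply: eq_L1 (L1_Mbounded (Fi i) (test_fun_measurable tt) thD) => q.
  by rewrite mulrC mulrA.
rewrite -(IntB (bd _ _ (Dop_test i tphi) sK suK) (bd _ _ tphi (Dop_smooth i sK) (Dop_supported i suK))).
apply: eq_Int => q; rewrite Dop_M//; last exact: (test_fun_smooth tphi).
have -> : Dop i (conv Kr g) q = - conv (fun z => Dop i K (- z)) g q.
  have -> : Dop i (conv Kr g) = conv (Dop i Kr) g.
    by rewrite /Dop; case: (val i) => [//|k]; case: k => [|[|[|k]]]; exact: (conv_derive mg gB _ sKr suKr).
  rewrite /conv -mulN1r -IntZ.
    apply: eq_Int => Z; rewrite (_ : Dop i Kr = fun z => - Dop i K (- z)); first by rewrite mulN1r mulNr.
    by apply/funext => z; exact: Dop_reflect.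
  apply: (@conv_L1 R g B mg gB (fun z => Dop i K (- z)) M q); last first.
    by move=> z zM; rewrite (Dop_supported i suK)// normrN.
  by apply: smooth_continuous; apply: smooth_reflect; exact: Dop_smooth.
by rewrite /Kr; ring.
Qed.

(** ** Unbounded weights *)

Variables (G g : pt4 R -> R) (C : R).
Hypotheses (Gi : L1 (tor4 R) G) (pG : per4 G) (mg : measurable_fun setT g) (pg : per4 g).
Hypothesis FgG : forall i A B, `|F i A * g B| <= C * (G A + G B).

Let gN N q := trunc N (g q).

Let mgN N : measurable_fun setT (gN N).
Proof. exact: (measurableT_comp (measurable_trunc N) mg). Qed.

Let pgN N : per4 (gN N).
Proof. by move=> t x; rewrite /gN; have [-> -> ->] := pg t x. Qed.

Let FgNG N i A B : `|F i A * gN N B| <= C * (G A + G B).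
Proof.
by apply: le_trans (FgG i A B); rewrite !normrM ler_wpM2l// trunc_le.
Qed.

Definition dom (z : pt4 R * pt4 R) : R := kappa K z.2 * G z.1 + kappa K z.2 * G (z.1 + z.2).

Lemma L1_dom : L1 (pairs R) dom.
Proof.
have ki := L1_kappa sK suK.
exact: (L1D (L1_pairs1 ki Gi) (L1_pairs12 ki Gi pG)).
Qed.

(** The test function is [phi g] mollified by [K]; the equation is then evaluated at
    the shifted point [z.1 + z.2], the weight at [z.1]. Truncations of [g] are
    covered by the bounded case. *)
Lemma doubling_X : L1 (pairs R) (Xterm g) /\ \int[pairs R]_z Xterm g z = 0.
Proof.
have [D D0 phD] := test_fun_bounded tphi.
apply: (@null_integral_limit _ _ _ (pairs R) (fun N => Xterm (gN N)) _ (fun z => D * C * dom z)).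
- by move=> N; exact: (doubling_X_bounded (mgN N) (pgN N) (fun Z => trunc_bound N (g Z))).
- exact: (L1Z _ L1_dom).
- move=> N z; apply: le_trans (ler_norm_sum _ _ _) _.
  have S0 : 0 <= C * (G z.1 + G (z.1 + z.2)).
    by rewrite addrC; apply: le_trans (FgG ord0 (z.1 + z.2) z.1).
  rewrite (_ : D * C * dom z = \sum_(i < 5) `|Dop i K z.2| * (D * (C * (G z.1 + G (z.1 + z.2))))).
    apply: ler_sum => i _; rewrite normrM ler_wpM2l// mulrCA normrM ler_pM//.
    by rewrite [G z.1 + _]addrC; exact: FgNG.
  by rewrite -mulr_suml /dom -/(kappa K z.2); ring.
- move=> z; apply: cvg_sumr => i _; apply: cvgM; first exact: cvg_cst.
  by apply: cvgM; [exact: cvg_cst|apply: cvgM; [exact: cvg_cst|exact: trunc_cvg]].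
Qed.

(** The test function is [phi] times the mollified weight; here the equation is
    evaluated at [z.1] and the weight at the shifted point. *)
Lemma doubling_Y : L1 (pairs R) (Yterm g) /\ \int[pairs R]_z Yterm g z = 0.
Proof.
have /choice[D Dphi] : forall i : 'I_5, exists D : R, 0 <= D /\ forall q, `|Dop i phi q| <= D.
  by move=> i; have [D D0 DD] := test_fun_bounded (Dop_test i tphi); exists D.
pose D' := \sum_(i < 5) D i.
have DD i q : `|Dop i phi q| <= D'.
  apply: le_trans ((Dphi i).2 q) _; rewrite /D' (bigD1 i)//= lerDl sumr_ge0// => j _.
  exact: (Dphi j).1.
have phD q : `|phi q| <= D' by exact: (DD ord0 q).
have D'0 : 0 <= D' := le_trans (normr_ge0 _) (phD 0).
apply: (@null_integral_limit _ _ _ (pairs R) (fun N => Yterm (gN N)) _ (fun z => 9 * D' * C * dom z)).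
- by move=> N; exact: (doubling_Y_bounded (mgN N) (pgN N) (fun Z => trunc_bound N (g Z))).
- exact: (L1Z _ L1_dom).
- move=> N z; set S := C * (G z.1 + G (z.1 + z.2)).
  have S0 : 0 <= S by apply: le_trans (FgG ord0 z.1 (z.1 + z.2)).
  have k0 : 0 <= kappa K z.2 by rewrite sumr_ge0.
  have Kk : `|K z.2| <= kappa K z.2 by exact: (kappa_ge ord0).
  rewrite (_ : 9 * D' * C * dom z = D' * kappa K z.2 * S + \sum_(i < 5 | i != ord0) (2 * D' * kappa K z.2 * S)).
    apply: le_trans (ler_normD _ _) _; apply: lerD.
      rewrite (_ : _ * _ * _ * _ = phi z.1 * K z.2 * (F ord0 z.1 * gN N (z.1 + z.2))); last by ring.
      by rewrite normrM ler_pM// ?normrM ?ler_pM//; exact: FgNG.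
    apply: le_trans (ler_norm_sum _ _ _) _; apply: ler_sum => i _.
    rewrite (_ : _ * _ * _ = (Dop i phi z.1 * K z.2 - phi z.1 * Dop i K z.2) * (F i z.1 * gN N (z.1 + z.2))); last by ring.
    have h1 : `|Dop i phi z.1 * K z.2 - phi z.1 * Dop i K z.2| <= 2 * D' * kappa K z.2.
      apply: le_trans (ler_normB _ _) _; rewrite -[2 * D' * _]mulrA mulr_natl mulr2n.
      by apply: lerD; rewrite normrM; apply: ler_pM => //; exact: kappa_ge.
    rewrite normrM; exact: ler_pM (normr_ge0 _) (normr_ge0 _) h1 (FgNG N i _ _).
  by rewrite (big_mkcond (fun i => i != ord0)) !big_ord_recl big_ord0/= /S /dom; ring.
- move=> z; apply: cvgD.
    by apply: cvgM; [exact: cvg_cst|exact: trunc_cvg].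
  apply: cvg_sumr => i _; apply: cvgM; [exact: cvg_cst|exact: trunc_cvg].
Qed.

End doubling.

(** * Fourier series on the torus *)

Section hartley_line.
Variable R : realType.

Definition wave (m : int) (s : R) : R := 2 * pi * m%:~R * s.

(** The Hartley functions are a real orthonormal basis whose derivatives are
    multiples of basis functions again. *)
Definition cas (k : int) (s : R) : R := cos (wave k s) + sin (wave k s).

Let turn (m : int) : cos (2 * pi * m%:~R : R) = 1 /\ sin (2 * pi * m%:~R : R) = 0.
Proof.
have nat_turn (n : nat) : cos (2 * pi * n%:R : R) = 1 /\ sin (2 * pi * n%:R : R) = 0.
  elim: n => [|n [c s]]; first by rewrite mulr0 cos0 sin0.
  rewrite -[n.+1%:R]natr1 mulrDr mulr1 cosD sinD c s (mulr_natl pi 2) cos2pi sin2pi.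
  by split; ring.
case: m => n; first exact: nat_turn.
have [c s] := nat_turn n.+1.
by rewrite NegzE mulrNz mulrN cosN sinN c s oppr0.
Qed.

Lemma cos_wave_per m (s : R) : cos (wave m (s + 1)) = cos (wave m s).
Proof. by rewrite /wave mulrDr mulr1 cosD (turn m).1 (turn m).2; ring. Qed.

Lemma sin_wave_per m (s : R) : sin (wave m (s + 1)) = sin (wave m s).
Proof. by rewrite /wave mulrDr mulr1 sinD (turn m).1 (turn m).2; ring. Qed.

Lemma cas_per m (s : R) : cas m (s + 1) = cas m s.
Proof. by rewrite /cas cos_wave_per sin_wave_per. Qed.

Lemma continuous_wave m : continuous (wave m).
Proof. by move=> s; apply: cvgM; [exact: cvg_cst|exact: cvg_id]. Qed.

Let ccos m : continuous (fun s : R => cos (wave m s)).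
Proof. by move=> s; apply: continuous_comp; [exact: continuous_wave|exact: continuous_cos]. Qed.

Let csin m : continuous (fun s : R => sin (wave m s)).
Proof. by move=> s; apply: continuous_comp; [exact: continuous_wave|exact: continuous_sin]. Qed.

Lemma continuous_cas m : continuous (cas m).
Proof. by move=> s; apply: cvgD; [exact: ccos|exact: csin]. Qed.

Lemma cas_bound m (s : R) : `|cas m s| <= 2.
Proof.
by rewrite (_ : 2 = 1 + 1 :> R)// (le_trans (ler_normD _ _))// lerD ?cos_max ?sin_max.
Qed.

Lemma L1_circ (f : R -> R) (M : R) : continuous f -> (forall s, `|f s| <= M) ->
  L1 (circ R) f.
Proof.
move=> cf fM; apply: (@L1_bounded _ _ _ (circ R) f M) => //.
  by have := circ_setT R => /= ->; exact: ltry.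
exact: continuous_measurable_fun.
Qed.

Lemma L1_cos_wave m : L1 (circ R) (fun s : R => cos (wave m s)).
Proof. by apply: (L1_circ (M := 1)); [exact: ccos|move=> s; exact: cos_max]. Qed.

Lemma L1_sin_wave m : L1 (circ R) (fun s : R => sin (wave m s)).
Proof. by apply: (L1_circ (M := 1)); [exact: csin|move=> s; exact: sin_max]. Qed.

Let opp_fix (x : R) : x = - x -> x = 0.
Proof. by move=> h; lra. Qed.

(** A half period changes the sign of a nonconstant wave. *)
Let half_turn (f : R -> R) (m : int) : m != 0 -> (forall s, f (wave m (s + 1)) = f (wave m s)) ->
  alternating f pi -> L1 (circ R) (fun s => f (wave m s)) ->
  \int[circ R]_s f (wave m s) = 0.
Proof.
move=> m0 f1 fpi fi; have mR0 : m%:~R != 0 :> R by rewrite intr_eq0.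
apply: opp_fix.
rewrite -[in LHS](Int_preserves (preserves_rot (2 * m%:~R : R)^-1) fi) -mulN1r -IntZ//.
apply: eq_Int => s; rewrite mulN1r -fpi /rot (period_frac (g := fun s => f (wave m s)))//.
congr f; rewrite /wave; field; exact: mR0.
Qed.

Lemma Int_cos_wave m : \int[circ R]_s cos (wave m s) = (m == 0)%:R.
Proof.
have [->|m0] := eqVneq m 0; last first.
  by apply: half_turn => //; [exact: cos_wave_per|exact: cosDpi|exact: L1_cos_wave].
transitivity (\int[circ R]_s (1 : R)).
  by apply: eq_Int => s; rewrite /wave mulr0 mul0r cos0.
by rewrite /Rintegral integral_cst//= mul1e; have := circ_setT R => /= ->.
Qed.

Lemma Int_sin_wave m : \int[circ R]_s sin (wave m s) = 0.
Proof.
have [->|m0] := eqVneq m 0; last first.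
  by apply: half_turn => //; [exact: sin_wave_per|exact: sinDpi|exact: L1_sin_wave].
by rewrite -[RHS](Int0 (circ R)); apply: eq_Int => s; rewrite /wave mulr0 mul0r sin0.
Qed.

Lemma Int_cas k l : \int[circ R]_s (cas k s * cas l s) = (k == l)%:R.
Proof.
transitivity (\int[circ R]_s (cos (wave (k - l) s) + sin (wave (k + l) s))).
  apply: eq_Int => s; have -> : wave (k - l) s = wave k s - wave l s by rewrite /wave intrB; ring.
  have -> : wave (k + l) s = wave k s + wave l s by rewrite /wave intrD; ring.
  by rewrite cosB sinD /cas; ring.
rewrite (IntD (L1_cos_wave _) (L1_sin_wave _)) Int_cos_wave Int_sin_wave addr0.
by rewrite subr_eq0.
Qed.

Lemma cos_wave_cas k (x y : R) :
  cas k x * cas k y + cas (- k) x * cas (- k) y = 2 * cos (wave k (y - x)).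
Proof.
have wN s : wave (- k) s = - wave k s by rewrite /wave mulrNz mulrN mulNr.
have -> : wave k (y - x) = wave k y - wave k x by rewrite /wave; ring.
by rewrite /cas !wN !cosN !sinN cosB; ring.
Qed.

(** ** The Fejer kernel *)

Definition fejer (N : nat) (s : R) : R :=
  N%:R^-1 * \sum_(i < N) \sum_(j < N) cos (wave (i%:Z - j%:Z) s).

Let C N (s : R) := \sum_(i < N) cos (wave i s).
Let S N (s : R) := \sum_(i < N) sin (wave i s).

(** A square modulus, whence positivity. *)
Lemma fejer_sqr N s : fejer N s = N%:R^-1 * (C N s ^+ 2 + S N s ^+ 2).
Proof.
congr (_ * _); rewrite !expr2 /C /S !big_distrlr/= -big_split/=.
apply: eq_bigr => i _; rewrite -big_split/=; apply: eq_bigr => j _.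
have -> : wave (i%:Z - j%:Z) s = wave i s - wave j s by rewrite /wave intrB; ring.
by rewrite cosB.
Qed.

Lemma fejer_ge0 N s : 0 <= fejer N s.
Proof. by rewrite fejer_sqr mulr_ge0// addr_ge0// sqr_ge0. Qed.

(** Summing the geometric series. *)
Lemma fejer_decay N s : (0 < N)%N -> fejer N s * (1 - cos (wave 1 s)) <= 2 / N%:R.
Proof.
move=> N0; set c := cos (wave 1 s); set d := sin (wave 1 s).
have wS n : wave n.+1 s = wave n s + wave 1 s.
  by rewrite /wave -mulrDl -mulrDr -intrD; congr (_ * _%:~R * _); rewrite -addn1 PoszD.
have geo : (c - 1) * C N s - d * S N s = cos (wave N s) - 1 /\
           (c - 1) * S N s + d * C N s = sin (wave N s).
  elim: (N) => [|n [hC hS]].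
    have -> : wave 0%N s = 0 by rewrite /wave mulr0 mul0r.
    by rewrite /C /S !big_ord0 cos0 sin0; split; ring.
  rewrite /C /S !big_ord_recr/= -/(C n s) -/(S n s) wS cosD sinD -/c -/d.
  by split; [rewrite mulrDr mulrDr|rewrite mulrDr mulrDr]; lra.
have [hC hS] := geo.
have cd : c ^+ 2 + d ^+ 2 = 1 := cos2Dsin2 _.
have csN : cos (wave N s) ^+ 2 + sin (wave N s) ^+ 2 = 1 := cos2Dsin2 _.
have N1 := cos_geN1 (wave N s).
have e : 2 * (1 - c) * (C N s ^+ 2 + S N s ^+ 2) = (cos (wave N s) - 1) ^+ 2 + sin (wave N s) ^+ 2.
  rewrite -hC -hS (_ : 2 * (1 - c) = (c - 1) ^+ 2 + d ^+ 2); last by lra.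
  by ring.
have e2 : (1 - c) * (C N s ^+ 2 + S N s ^+ 2) <= 2 by lra.
rewrite fejer_sqr -mulrA [X in _ * X]mulrC [2 / _]mulrC ler_wpM2l// invr_ge0; exact: ler0n.
Qed.

Lemma L1_fejer N : L1 (circ R) (fejer N).
Proof. by apply: L1Z; apply: L1_sum => i _; apply: L1_sum => j _; exact: L1_cos_wave. Qed.

Lemma Int_fejer N : (0 < N)%N -> \int[circ R]_s fejer N s = 1.
Proof.
move=> N0; rewrite IntZ; last by apply: L1_sum => i _; apply: L1_sum => j _; exact: L1_cos_wave.
rewrite Int_sum; last by move=> i _; apply: L1_sum => j _; exact: L1_cos_wave.
rewrite (eq_bigr (fun=> 1)) => [|i _].
  by rewrite sumr_const card_ord mulVf// pnatr_eq0 -lt0n.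
rewrite Int_sum => [|j _]; last exact: L1_cos_wave.
rewrite (bigD1 i)//= Int_cos_wave subrr eqxx big1 ?addr0// => j ji.
by rewrite Int_cos_wave subr_eq0 eqz_nat eq_sym (negbTE (_ : (j != i :> nat))).
Qed.

Lemma fejer_cas N (x y : R) : fejer N (y - x) =
  N%:R^-1 * \sum_(i < N) \sum_(j < N) cas (i%:Z - j%:Z) x * cas (i%:Z - j%:Z) y.
Proof.
congr (_ * _); set A := LHS; set B := RHS.
have BB : B = \sum_(i < N) \sum_(j < N) cas (- (i%:Z - j%:Z)) x * cas (- (i%:Z - j%:Z)) y.
  rewrite /B exchange_big/=; apply: eq_bigr => i _; apply: eq_bigr => j _.
  by rewrite opprB.
suff : B + B = 2 * A by move=> h; lra.
rewrite {2}BB /B -big_split/= /A mulr_sumr; apply: eq_bigr => i _.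
rewrite -big_split/= mulr_sumr; apply: eq_bigr => j _; exact: cos_wave_cas.
Qed.

End hartley_line.

Lemma half_period (R : realType) (P e r : R) : 0 < P -> 0 < e -> e < r -> r <= 2^-1 ->
  2 * P * e < 2 * P * r /\ 0 <= 2 * P * r <= P.
Proof.
move=> p0 e0 er r2; have a1 : 0 < P * (r - e) by rewrite mulr_gt0// subr_gt0.
have a2 : 0 < P * e by rewrite mulr_gt0.
have a3 : 0 <= P * (2^-1 - r) by rewrite mulr_ge0 ?subr_ge0// ltW.
rewrite mulrBr in a1; rewrite mulrBr in a3.
by rewrite -!mulrA; split; [|apply/andP; split]; lra.
Qed.

Section hartley_torus.
Variable R : realType.
Notation freq := (int * int * int)%type.
Implicit Types (k l : freq) (p g : pt3 R -> R).

Lemma Int_tensor d1 d2 (X : measurableType d1) (Y : measurableType d2)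
    (m1 : {sigma_finite_measure set X -> \bar R}) (m2 : {sigma_finite_measure set Y -> \bar R})
    (f : X -> R) (h : Y -> R) : L1 m1 f -> L1 m2 h ->
  \int[prodm m1 m2]_z (f z.1 * h z.2) = (\int[m1]_x f x) * \int[m2]_y h y.
Proof.
move=> fi hi; rewrite (Int_prod12 (L1_tensor fi hi)) mulrC -(IntZ _ fi).
by apply: eq_Int => x /=; rewrite (IntZ _ hi) mulrC.
Qed.

Definition tens (a b c : R -> R) (x : pt3 R) : R := a x.1.1 * b x.1.2 * c x.2.

Lemma L1_tens a b c : L1 (circ R) a -> L1 (circ R) b -> L1 (circ R) c ->
  L1 (tor3 R) (tens a b c).
Proof.
move=> ai bi ci.
exact: (@L1_tensor _ _ _ _ _ (tor2 R) (circ R) _ _ (@L1_tensor _ _ _ _ _ (circ R) (circ R) _ _ ai bi) ci).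
Qed.

Lemma Int_tens a b c : L1 (circ R) a -> L1 (circ R) b -> L1 (circ R) c ->
  \int[tor3 R]_x tens a b c x =
  (\int[circ R]_x a x) * (\int[circ R]_x b x) * \int[circ R]_x c x.
Proof.
move=> ai bi ci.
have := @Int_tensor _ _ _ _ (tor2 R) (circ R) _ _ (@L1_tensor _ _ _ _ _ (circ R) (circ R) _ _ ai bi) ci.
by rewrite (Int_tensor ai bi).
Qed.

Definition hart k : pt3 R -> R := tens (cas k.1.1) (cas k.1.2) (cas k.2).

Let L1_cas2 (a b : int) : L1 (circ R) (fun s : R => cas a s * cas b s).
Proof.
apply: (L1_circ (M := 4)) => s.
  by apply: cvgM; exact: continuous_cas.
by rewrite normrM (_ : 4 = 2 * 2 :> R) ?ler_pM ?cas_bound//; ring.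
Qed.

Let hart2E k l x : hart k x * hart l x = tens (fun s => cas k.1.1 s * cas l.1.1 s)
  (fun s => cas k.1.2 s * cas l.1.2 s) (fun s => cas k.2 s * cas l.2 s) x.
Proof. by rewrite /hart /tens; ring. Qed.

Lemma L1_hart2 k l : L1 (tor3 R) (fun x => hart k x * hart l x).
Proof.
apply: eq_L1 (L1_tens (L1_cas2 k.1.1 l.1.1) (L1_cas2 k.1.2 l.1.2) (L1_cas2 k.2 l.2)) => x.
by rewrite hart2E.
Qed.

Lemma Int_hart k l : \int[tor3 R]_x (hart k x * hart l x) = (k == l)%:R.
Proof.
transitivity (\int[tor3 R]_x tens (fun s => cas k.1.1 s * cas l.1.1 s)
  (fun s => cas k.1.2 s * cas l.1.2 s) (fun s => cas k.2 s * cas l.2 s) x).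
  by apply: eq_Int => x; exact: hart2E.
rewrite (Int_tens (L1_cas2 _ _) (L1_cas2 _ _) (L1_cas2 _ _)) !Int_cas.
by case: k l => [[k1 k2] k3] [[l1 l2] l3]; rewrite !xpair_eqE -!natrM !mulnb.
Qed.

Lemma measurable_tens a b c : measurable_fun setT a -> measurable_fun setT b ->
  measurable_fun setT c -> measurable_fun setT (tens a b c).
Proof.
move=> ma mb mc; apply: measurable_funM; first apply: measurable_funM.
- exact: (measurableT_comp ma (measurableT_comp measurable_fst measurable_fst)).
- exact: (measurableT_comp mb (measurableT_comp measurable_snd measurable_fst)).
- exact: (measurableT_comp mc measurable_snd).
Qed.

Lemma measurable_hart k : measurable_fun setT (hart k).
Proof.
by apply: measurable_tens; apply: continuous_measurable_fun; exact: continuous_cas.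
Qed.

Lemma hart_bound k x : `|hart k x| <= 8.
Proof.
rewrite /hart /tens !normrM (_ : 8 = 2 * 2 * 2 :> R); last by ring.
by apply: ler_pM; [rewrite mulr_ge0|exact: normr_ge0|apply: ler_pM|]; rewrite ?cas_bound.
Qed.

Lemma L1_Mhart g k : L1 (tor3 R) g -> L1 (tor3 R) (fun x => g x * hart k x).
Proof.
move=> gi; apply: eq_L1 (L1_Mbounded gi (measurable_hart k) (hart_bound k)) => x.
by rewrite mulrC.
Qed.

Definition coef g k : R := \int[tor3 R]_x (g x * hart k x).

(** ** Bessel's inequality *)
(** Expand the square of the difference between [g] and its partial sum. *)
Lemma bessel g (J : finType) (f : J -> freq) : injective f -> L1 (tor3 R) g ->
  L1 (tor3 R) (fun x => g x ^+ 2) ->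
  \sum_j coef g (f j) ^+ 2 <= \int[tor3 R]_x g x ^+ 2.
Proof.
move=> fI gi g2; pose c j := coef g (f j).
have i1 : L1 (tor3 R) (fun x => \sum_j (2 * c j) * (g x * hart (f j) x)).
  by apply: L1_sum => j _; apply: L1Z; exact: L1_Mhart.
have i2j j : L1 (tor3 R) (fun x => \sum_i (c i * c j) * (hart (f i) x * hart (f j) x)).
  by apply: L1_sum => i _; apply: L1Z; exact: L1_hart2.
have i2 : L1 (tor3 R) (fun x => \sum_j \sum_i (c i * c j) * (hart (f i) x * hart (f j) x)).
  by apply: L1_sum => j _; exact: i2j.
have e1 : \int[tor3 R]_x (\sum_j (2 * c j) * (g x * hart (f j) x)) = 2 * \sum_j c j ^+ 2.
  rewrite Int_sum; last by move=> j _; apply: L1Z; exact: L1_Mhart.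
  rewrite mulr_sumr; apply: eq_bigr => j _; rewrite (IntZ _ (L1_Mhart _ gi)) -/(coef g (f j)) -/(c j).
  by ring.
have e2 : \int[tor3 R]_x (\sum_j \sum_i (c i * c j) * (hart (f i) x * hart (f j) x)) = \sum_j c j ^+ 2.
  rewrite Int_sum; last by move=> j _; exact: i2j.
  apply: eq_bigr => j _; rewrite Int_sum; last by move=> i _; apply: L1Z; exact: L1_hart2.
  rewrite (bigD1 j)//= (IntZ _ (L1_hart2 _ _)) Int_hart eqxx mulr1 big1 ?addr0// => i ij.
  by rewrite (IntZ _ (L1_hart2 _ _)) Int_hart (inj_eq fI) (negbTE ij) mulr0.
have i0 := L1B g2 i1; have iE := L1D i0 i2.
have := @Int_ge0 _ _ _ (tor3 R) (fun x => g x ^+ 2 - \sum_j (2 * c j) * (g x * hart (f j) x)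
   + \sum_j \sum_i (c i * c j) * (hart (f i) x * hart (f j) x)).
rewrite (IntD i0 i2) (IntB g2 i1) e1 e2 => H.
have {}H : 0 <= \int[tor3 R]_x g x ^+ 2 - 2 * \sum_j c j ^+ 2 + \sum_j c j ^+ 2.
  apply: H => x; rewrite (_ : _ + _ = (g x - \sum_j c j * hart (f j) x) ^+ 2) ?sqr_ge0//.
  rewrite sqrrB; congr (_ + _); last first.
    rewrite expr2 big_distrlr/= exchange_big/=; apply: eq_bigr => i _; apply: eq_bigr => j _; ring.
  congr (_ - _); rewrite -mulrnAl mulr_sumr; apply: eq_bigr => j _; rewrite mulr2n; ring.
move: H; rewrite -/(c _); set A := \int[_]_x _; rewrite (eq_bigr (fun j => c j ^+ 2))//.
by set B := \sum_(j : J) _; rewrite (_ : A - 2 * B + B = A - B) ?subr_ge0//; ring.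
Qed.

(** ** Square integrability from the coefficients *)

Definition fejer3 N : pt3 R -> R := tens (fejer N) (fejer N) (fejer N).

Lemma fejer3_ge0 N x : 0 <= fejer3 N x.
Proof. by apply: mulr_ge0; [apply: mulr_ge0|]; exact: fejer_ge0. Qed.

Lemma L1_fejer3 N : L1 (tor3 R) (fejer3 N).
Proof. by apply: L1_tens; exact: L1_fejer. Qed.

Lemma Int_fejer3 N : (0 < N)%N -> \int[tor3 R]_x fejer3 N x = 1.
Proof.
move=> N0; rewrite (Int_tens (L1_fejer R N) (L1_fejer R N) (L1_fejer R N)).
by rewrite !Int_fejer// !mulr1.
Qed.

Definition gap (s : R) : R := 1 - cos (wave 1 s).

Lemma gap_ge0 s : 0 <= gap s. Proof. by rewrite subr_ge0 cos_le1. Qed.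

Let mgap : measurable_fun setT gap.
Proof.
apply: continuous_measurable_fun => s; apply: cvgB; first exact: cvg_cst.
by apply: continuous_comp; [exact: continuous_wave|exact: continuous_cos].
Qed.

Let L1_fejer_gap N : L1 (circ R) (fun s => fejer N s * gap s).
Proof.
have gb (s : R) : `|gap s| <= 2.
  by rewrite (_ : 2 = 1 + 1 :> R)// (le_trans (ler_normB _ _))// lerD ?cos_max ?normr1.
by apply: eq_L1 (L1_Mbounded (L1_fejer R N) mgap gb) => s; rewrite mulrC.
Qed.

Let Int_fejer_gap N : (0 < N)%N -> \int[circ R]_s (fejer N s * gap s) <= 2 / N%:R.
Proof.
move=> N0; have ic : L1 (circ R) (fun=> 2 / N%:R).
  by apply: (L1_circ (M := `|2 / N%:R|)) => // s; exact: cvg_cst.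
apply: le_trans (le_Int (L1_fejer_gap N) ic (fun s => fejer_decay s N0)) _.
by rewrite /Rintegral integral_cst//=; have := circ_setT R => /= ->; rewrite mule1.
Qed.

Definition gap3 (x : pt3 R) : R := gap x.1.1 + gap x.1.2 + gap x.2.

Let fejer_gap3E N x : fejer3 N x * gap3 x = tens (fun s => fejer N s * gap s) (fejer N) (fejer N) x +
  tens (fejer N) (fun s => fejer N s * gap s) (fejer N) x + tens (fejer N) (fejer N) (fun s => fejer N s * gap s) x.
Proof. by rewrite /fejer3 /gap3 /tens; ring. Qed.

(** The Fejer kernels concentrate at the lattice points: their mean of a function
    vanishing exactly there tends to zero. *)
Lemma fejer_gap3 N : (0 < N)%N -> L1 (tor3 R) (fun x => fejer3 N x * gap3 x) /\
  \int[tor3 R]_x (fejer3 N x * gap3 x) <= 6 / N%:R.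
Proof.
move=> N0; have f1 := L1_fejer R N; have fg := L1_fejer_gap N.
have i1 := L1_tens fg f1 f1; have i2 := L1_tens f1 fg f1; have i3 := L1_tens f1 f1 fg.
have i12 := L1D i1 i2; have i := L1D i12 i3.
split; first by apply: eq_L1 i => x; rewrite fejer_gap3E.
rewrite (_ : \int[tor3 R]_x _ = \int[tor3 R]_x (tens (fun s => fejer N s * gap s) (fejer N) (fejer N) x +
  tens (fejer N) (fun s => fejer N s * gap s) (fejer N) x + tens (fejer N) (fejer N) (fun s => fejer N s * gap s) x)); last first.
  by apply: eq_Int => x; exact: fejer_gap3E.
rewrite (IntD i12 i3) (IntD i1 i2) !Int_tens// !Int_fejer// !mulr1 !mul1r.
have := Int_fejer_gap N0; set A := \int[_]_s _ => h.
by rewrite (_ : 6 / N%:R = 2 / N%:R + 2 / N%:R + 2 / N%:R); [rewrite !lerD|ring].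
Qed.

(** Away from the lattice points the gap is bounded below. *)
Lemma gap_away (e : R) : 0 < e -> e < 2^-1 ->
  exists2 c : R, 0 < c & forall s, 0 <= s < 1 -> e < s -> s < 1 - e -> c <= gap s.
Proof.
move=> e0 e2; have p0 : 0 < pi :> R := pi_gt0 R.
have ein : 2 * pi * e \in `[0, pi].
  by rewrite in_itv/= !mulr_ge0 ?ltW//=; nra.
exists (1 - cos (2 * pi * e)).
  rewrite subr_gt0 -[ltRHS]cos0 ltr_cos// ?in_itv/= ?lexx ?ltW//.
  by rewrite !mulr_gt0.
have key (r : R) : e < r -> r <= 2^-1 -> cos (2 * pi * r) <= cos (2 * pi * e).
  move=> er r2; have [l1 l2] := half_period p0 e0 er r2.
  by apply/ltW; rewrite ltr_cos// in_itv.
move=> s /andP[s0 s1] es s1e; rewrite /gap lerD2l lerN2 /wave mulr1.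
have [sh|sh] := leP s 2^-1; first exact: key.
have -> : cos (2 * pi * s) = cos (2 * pi * (1 - s)).
  rewrite -[RHS]cosN (_ : - (2 * pi * (1 - s)) = wave (- 1) (1 - s)); last by rewrite /wave mulrNz; ring.
  rewrite (_ : 1 - s = - s + 1); last by ring.
  by rewrite cos_wave_per /wave mulrNz; congr cos; ring.
by apply: key; lra.
Qed.

End hartley_torus.

Lemma trunc_mono (R : realType) (n m : nat) (x : R) : (n <= m)%N ->
  trunc n x ^+ 2 <= trunc m x ^+ 2.
Proof.
move=> nm; have nmR : n%:R <= m%:R :> R by rewrite ler_nat.
have n0 : 0 <= n%:R :> R by [].
suff -> : trunc n x = trunc n (trunc m x).
  by rewrite -[leLHS]real_normK ?num_real// -[leRHS]real_normK ?num_real// lerXn2r ?nnegrE// trunc_le.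
have [xm|xm] := leP `|x| m%:R; first by rewrite (trunc_id xm).
have [x0|x0] := leP 0 x.
  rewrite (ger0_norm x0) in xm.
  rewrite /trunc (min_l (ltW xm)) (min_l (le_trans nmR (ltW xm))).
  rewrite (@max_r _ _ (- m%:R) m%:R); last by lra.
  by rewrite (min_l nmR).
rewrite (ltr0_norm x0) in xm.
have h1 : x <= - m%:R by lra.
rewrite /trunc !(@min_r _ _ _ x) ?(@max_l _ _ _ x); [|lra|lra|lra|lra].
by rewrite (@min_r _ _ n%:R (- m%:R)) ?max_l//; lra.
Qed.

Lemma L1_sqr_trunc d (X : measurableType d) (R : realType) (m : {measure set X -> \bar R})
    (f : X -> R) (M : R) : measurable_fun setT f ->
  (forall n, L1 m (fun x => trunc n (f x) ^+ 2)) ->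
  (forall n, \int[m]_x trunc n (f x) ^+ 2 <= M) ->
  L1 m (fun x => f x ^+ 2) /\ \int[m]_x f x ^+ 2 <= M.
Proof.
move=> mf ti tM.
have mt n : measurable_fun setT (fun x => (trunc n (f x) ^+ 2)%:E).
  exact: measurable_int (ti n).
have C := @cvg_monotone_convergence _ _ _ m setT measurableT (fun n x => (trunc n (f x) ^+ 2)%:E) mt.
have {}C : (fun n => \int[m]_x (trunc n (f x) ^+ 2)%:E)%E @ \oo -->
    (\int[m]_x (f x ^+ 2)%:E)%E.
  have -> : (fun x => (f x ^+ 2)%:E) = (fun x => limn (fun n => (trunc n (f x) ^+ 2)%:E)).
    apply/funext => x; apply/esym/cvg_lim => //; apply: cvg_EFin; first exact: nearW.
    by apply: cvgM; exact: trunc_cvg.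
  apply: C => [n x _|x _ n k nk]; first by rewrite lee_fin; exact: sqr_ge0.
  by rewrite lee_fin; exact: trunc_mono.
have le : (\int[m]_x (f x ^+ 2)%:E <= M%:E)%E.
  apply: (cvge_to_le C); apply: nearW => n.
  by rewrite -(EFin_Int (ti n)) lee_fin.
have i : L1 m (fun x => f x ^+ 2).
  apply: L1_ge0P => [|x|]; [exact: measurable_funX|exact: sqr_ge0|].
  exact: le_lt_trans le (ltry _).
by split=> //; rewrite -lee_fin (EFin_Int i).
Qed.

Section square_summable_coefficients.
Variable R : realType.
Notation freq := (int * int * int)%type.
Implicit Types (p g : pt3 R -> R).

Lemma measurable_add3 : measurable_fun setT (fun z : pt3 R * pt3 R => z.1 + z.2).
Proof.
pose c1 (q : pt3 R) := q.1.1; pose c2 (q : pt3 R) := q.1.2; pose c3 (q : pt3 R) := q.2.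
have m1 : measurable_fun setT c1 := measurableT_comp measurable_fst measurable_fst.
have m2 : measurable_fun setT c2 := measurableT_comp measurable_snd measurable_fst.
have m3 : measurable_fun setT c3 := measurable_snd.
have mc (c : pt3 R -> R) : measurable_fun setT c ->
    measurable_fun setT (fun z : pt3 R * pt3 R => c z.1 + c z.2).
  move=> mc; apply: measurable_funD.
    exact: (measurableT_comp mc measurable_fst).
  exact: (measurableT_comp mc measurable_snd).
exact: (measurable_fun_pair (measurable_fun_pair (mc c1 m1) (mc c2 m2)) (mc c3 m3)).
Qed.

Let near_lattice (e c : R) : 0 < e -> e < 2^-1 ->
  (forall s, 0 <= s < 1 -> e < s -> s < 1 - e -> c <= gap s) ->
  forall s : R, exists2 s' : R, frac s' = frac s & `|s'| <= e \/ c <= gap s.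
Proof.
move=> e0 e2 H s; have /andP[f0 f1] := frac_itv s.
have gE : gap s = gap (frac s).
  by rewrite /gap; congr (_ - _); apply/esym/(period_frac (g := fun s => cos (wave 1 s))) => y; exact: cos_wave_per.
have ff : frac (frac s) = frac s by rewrite frac_id ?f0.
have [fe|fe] := leP (frac s) e.
  by exists (frac s) => //; left; rewrite ger0_norm.
have [fe2|fe2] := leP (1 - e) (frac s).
  exists (frac s + (-1)%:~R); first by rewrite frac_addz.
  left; rewrite intrN mulr1z ler0_norm; lra.
by exists s => //; right; rewrite gE; apply: H => //; rewrite f0.
Qed.

Variables (p : pt3 R -> R).
Hypotheses (pp : periodic p) (pi : L1 (tor3 R) p).

Let np := \int[tor3 R]_x `|p x|.
Let om (y : pt3 R) := \int[tor3 R]_x `|p (x + y) - p x|.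

Let om_le y : om y <= 2 * np.
Proof.
have i1 := L1_norm (L1_shift3 y pp pi); have i2 := L1_norm pi.
apply: le_trans (le_Int (L1_norm (L1B (L1_shift3 y pp pi) pi)) (L1D i1 i2) (fun x => ler_normB _ _)) _.
rewrite (IntD i1 i2) (Int_shift3 (f := fun x => `|p x|))//; last first.
  by move=> x; have [-> -> ->] := pp x.
by rewrite -/np; lra.
Qed.

Let modulus (e : R) : 0 < e -> exists2 C : R, 0 <= C & forall y, om y <= e + C * gap3 y.
Proof.
move=> e0; have [d d0 dP] := shift_small3 pp pi e0.
pose r := Num.min d (4^-1).
have r0 : 0 < r by rewrite lt_min d0/=.
have r2 : r < 2^-1 by rewrite /r gt_min; apply/orP; right; lra.
have rd : r <= d by rewrite ge_min lexx.
have [c c0 cP] := gap_away r0 r2.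
have np0 : 0 <= np by apply: Int_ge0 => x.
exists (2 * np / c); first by rewrite divr_ge0 ?mulr_ge0// ltW.
move=> y; have g1 := gap_ge0 y.1.1; have g2 := gap_ge0 y.1.2; have g3 := gap_ge0 y.2.
have far : c <= gap3 y -> om y <= e + 2 * np / c * gap3 y.
  move=> cg; apply: (le_trans (om_le y)); rewrite -[leLHS]add0r lerD ?(ltW e0)//.
  rewrite -mulrA ler_peMr// ?mulr_ge0// mulrC ler_pdivlMr// mul1r //.
have [a1 e1 [h1|h1]] := near_lattice r0 r2 cP y.1.1; last by apply: far; rewrite /gap3; lra.
have [a2 e2 [h2|h2]] := near_lattice r0 r2 cP y.1.2; last by apply: far; rewrite /gap3; lra.
have [a3 e3 [h3|h3]] := near_lattice r0 r2 cP y.2; last by apply: far; rewrite /gap3; lra.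
have -> : om y = om ((a1, a2), a3).
  apply: eq_Int => x; congr (`|_ - _|).
  have ps : periodic (fun y => p (x + y)).
    by rewrite (_ : (fun y => _) = (fun y => p (y + x))); [exact: periodic_shift|apply/funext => z; rewrite addrC].
  rewrite -(periodic_frac y ps) -(periodic_frac ((a1, a2), a3) ps); congr (p (x + _)).
  by rewrite /frac3/= e1 e2 e3.
apply: (@le_trans _ _ e); last first.
  rewrite lerDl; apply: mulr_ge0; first by rewrite divr_ge0 ?mulr_ge0// ltW.
  by apply: addr_ge0; first exact: addr_ge0.
by apply: dP; apply: norm_pair_ge; first apply: norm_pair_ge; apply: le_trans rd.
Qed.

Let H N (z : pt3 R * pt3 R) : R := fejer3 N z.2 * (p (z.1 + z.2) - p z.1).

Let mp : measurable_fun setT p. Proof. exact: L1_measurable pi. Qed.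

Let mH N : measurable_fun setT (H N).
Proof.
apply: measurable_funM.
  exact: (measurableT_comp (L1_measurable (L1_fejer3 R N)) measurable_snd).
apply: measurable_funB; first exact: (measurableT_comp mp measurable_add3).
exact: (measurableT_comp mp measurable_fst).
Qed.

Let L1_shiftB y : L1 (tor3 R) (fun x => p (x + y) - p x).
Proof. exact: (L1B (L1_shift3 y pp pi) pi). Qed.

Let om_int N y : \int[tor3 R]_x `|H N (x, y)| = fejer3 N y * om y.
Proof.
rewrite -(IntZ _ (L1_norm (L1_shiftB y))); apply: eq_Int => x.
by rewrite /H normrM ger0_norm// fejer3_ge0.
Qed.

Let L1_H N : L1 (prodm (tor3 R) (tor3 R)) (H N).
Proof.
apply: (@L1_prod21 _ _ _ _ _ (tor3 R) (tor3 R) _ (fun y => (2 * np) * fejer3 N y)).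
- exact: mH.
- exact: (L1Z _ (L1_fejer3 R N)).
- by move=> y; exact: (L1Z (fejer3 N y) (L1_shiftB y)).
- by move=> y; rewrite om_int mulrC ler_wpM2r ?fejer3_ge0.
Qed.

Let fejer_close (e : R) : 0 < e -> exists2 N : nat, (0 < N)%N &
  \int[prodm (tor3 R) (tor3 R)]_z `|H N z| <= e.
Proof.
move=> e0; have e2 : 0 < e / 2 by rewrite divr_gt0.
have [C C0 CP] := modulus e2.
pose N := (Num.bound (12 * C / e)).+1.
have N0 : 0 < N%:R :> R by [].
exists N => //; have [gi gN] := @fejer_gap3 R N isT.
have ib : L1 (tor3 R) (fun y => (e / 2) * fejer3 N y + C * (fejer3 N y * gap3 y)).
  exact: (L1D (L1Z _ (L1_fejer3 R N)) (L1Z _ gi)).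
rewrite (Int_prod21 (L1_norm (L1_H N))).
apply: (@le_trans _ _ (\int[tor3 R]_y ((e / 2) * fejer3 N y + C * (fejer3 N y * gap3 y)))).
  apply: (le_Int (L1_Int2 (L1_norm (L1_H N))) ib) => y; rewrite om_int.
  apply: le_trans (ler_wpM2l (fejer3_ge0 _ _) (CP y)) _.
  by rewrite le_eqVlt; apply/orP; left; apply/eqP; ring.
rewrite (IntD (L1Z _ (L1_fejer3 R N)) (L1Z _ gi)) (IntZ _ (L1_fejer3 R N)) (IntZ _ gi) Int_fejer3// mulr1.
have h : C * (6 / N%:R) <= e / 2.
  have : 12 * C / e < N%:R.
    have := archi_boundP (_ : 0 <= 12 * C / e); rewrite divr_ge0 ?mulr_ge0 ?(ltW e0)//.
    by move=> /(_ isT) /lt_le_trans; apply; rewrite ler_nat.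
  rewrite ltr_pdivrMr// => h; rewrite mulrA ler_pdivrMr//; lra.
have := ler_wpM2l C0 gN; lra.
Qed.

Let dbl (I I' J J' : finType) (a : I -> J -> R) (b : I' -> J' -> R) :
  (\sum_i \sum_j a i j) * (\sum_i \sum_j b i j) =
  \sum_(i : I * I') \sum_(j : J * J') a i.1 j.1 * b i.2 j.2.
Proof.
rewrite big_distrlr/= pair_bigA/=; apply: eq_bigr => i _.
by rewrite big_distrlr/= pair_bigA.
Qed.

Let fr N (i j : 'I_N * 'I_N * 'I_N) : freq :=
  ((i.1.1%:Z - j.1.1%:Z, i.1.2%:Z - j.1.2%:Z), i.2%:Z - j.2%:Z).

Let fr_inj N i : injective (@fr N i).
Proof.
have key (m : int) : injective (fun j : 'I_N => m - j%:Z).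
  by move=> j k /addrI /oppr_inj [] /val_inj.
move=> [[j1 j2] j3] [[k1 k2] k3] [] e1 e2 e3.
by congr ((_, _), _); [exact: key e1|exact: key e2|exact: key e3].
Qed.

Let fejer3_hart N (x y : pt3 R) : fejer3 N (y - x) = N%:R^-1 ^+ 3 *
  \sum_(i : 'I_N * 'I_N * 'I_N) \sum_(j : 'I_N * 'I_N * 'I_N) hart (fr i j) x * hart (fr i j) y.
Proof.
have -> : fejer3 N (y - x) = fejer N (y.1.1 - x.1.1) * fejer N (y.1.2 - x.1.2) * fejer N (y.2 - x.2) by [].
rewrite !fejer_cas; set A := \sum_(i < N) _; set B := \sum_(i < N) _; set D := \sum_(i < N) _.
transitivity (N%:R^-1 ^+ 3 * ((A * B) * D)); first by ring.
congr (_ * _); rewrite /A /B dbl /D dbl; apply: eq_bigr => i _; apply: eq_bigr => j _.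
by rewrite /hart /tens /fr/=; ring.
Qed.

Let fejer_coef N g : L1 (tor3 R) g -> (0 < N)%N ->
  \int[tor3 R]_x (g x * \int[tor3 R]_y (fejer3 N y * p (x + y))) = N%:R^-1 ^+ 3 *
  \sum_(i : 'I_N * 'I_N * 'I_N) \sum_(j : 'I_N * 'I_N * 'I_N) coef p (fr i j) * coef g (fr i j).
Proof.
move=> gi N0.
have hi (i : 'I_N * 'I_N * 'I_N) (c : 'I_N * 'I_N * 'I_N -> R) (f : pt3 R -> R) : L1 (tor3 R) f ->
    L1 (tor3 R) (fun x => \sum_(j : 'I_N * 'I_N * 'I_N) c j * (f x * hart (fr i j) x)).
  by move=> fi; apply: L1_sum => j _; apply: L1Z; exact: L1_Mhart.
have sg x : \int[tor3 R]_y (fejer3 N y * p (x + y)) = N%:R^-1 ^+ 3 *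
    \sum_(i : 'I_N * 'I_N * 'I_N) \sum_(j : 'I_N * 'I_N * 'I_N) hart (fr i j) x * coef p (fr i j).
  pose F y := N%:R^-1 ^+ 3 * \sum_(i : 'I_N * 'I_N * 'I_N) \sum_(j : 'I_N * 'I_N * 'I_N)
    hart (fr i j) x * (p y * hart (fr i j) y).
  have FE y : fejer3 N (y - x) * p y = F y.
    rewrite fejer3_hart -mulrA mulr_suml; congr (_ * _); apply: eq_bigr => i _.
    rewrite mulr_suml; apply: eq_bigr => j _; ring.
  have Fi : L1 (tor3 R) F by apply: L1Z; apply: L1_sum => i _; exact: hi.
  have pF : periodic F.
    apply/periodicP => a b c; rewrite -!FE; have /periodicP pP := pp; have [-> -> ->] := pP a b c.
    have fp (s t : R) : fejer N (s + 1 - t) = fejer N (s - t).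
      rewrite /fejer; congr (_ * _); apply: eq_bigr => i _; apply: eq_bigr => j _.
      by rewrite addrAC cos_wave_per.
    by rewrite /fejer3 /tens/= !fp.
  transitivity (\int[tor3 R]_y F (y + x)).
    by apply: eq_Int => y; rewrite -FE addrK addrC.
  rewrite (Int_shift3 x pF Fi) /F IntZ; last by apply: L1_sum => i _; exact: hi.
  congr (_ * _); rewrite Int_sum; last by move=> i _; exact: hi.
  apply: eq_bigr => i _; rewrite Int_sum; last by move=> j _; apply: L1Z; exact: L1_Mhart.
  by apply: eq_bigr => j _; rewrite IntZ//; exact: L1_Mhart.
transitivity (\int[tor3 R]_x (N%:R^-1 ^+ 3 * \sum_(i : 'I_N * 'I_N * 'I_N) \sum_(j : 'I_N * 'I_N * 'I_N)
    coef p (fr i j) * (g x * hart (fr i j) x))).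
  apply: eq_Int => x; rewrite sg mulrCA; congr (_ * _); rewrite mulr_sumr.
  by apply: eq_bigr => i _; rewrite mulr_sumr; apply: eq_bigr => j _; ring.
rewrite IntZ; last by apply: L1_sum => i _; exact: hi.
congr (_ * _); rewrite Int_sum; last by move=> i _; exact: hi.
apply: eq_bigr => i _; rewrite Int_sum; last by move=> j _; apply: L1Z; exact: L1_Mhart.
by apply: eq_bigr => j _; rewrite IntZ//; exact: L1_Mhart.
Qed.

Variable M : R.
Hypothesis pM : forall (J : finType) (f : J -> freq), injective f ->
  \sum_j coef p (f j) ^+ 2 <= M.

(** The weights of the Fejer kernel average over translates of one block of
    frequencies, and Bessel's inequality bounds each translate. *)
Let pairing_le g (B : R) : measurable_fun setT g -> (forall x, `|g x| <= B) ->
  \int[tor3 R]_x (g x * p x) <= M / 2 + (\int[tor3 R]_x g x ^+ 2) / 2.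
Proof.
move=> mg gB; have t3 : (tor3 R setT < +oo)%E by have := tor3_setT R => /= ->; exact: ltry.
have gi : L1 (tor3 R) g by exact: (L1_bounded t3 mg gB).
have g2 : L1 (tor3 R) (fun x => g x ^+ 2).
  apply: (@L1_bounded _ _ _ (tor3 R) _ (B ^+ 2) t3) => [|x]; first exact: measurable_funX.
  by rewrite normrX lerXn2r ?nnegrE// (le_trans _ (gB x)).
have B0 : 0 <= B := le_trans (normr_ge0 _) (gB 0).
apply/ler_addgt0Pr => e e0.
have e1 : 0 < e / (B + 1) by rewrite divr_gt0// ltr_wpDl.
have [N N0 HN] := fejer_close e1.
pose s (x : pt3 R) := \int[tor3 R]_y (fejer3 N y * p (x + y)).
have i1 x : L1 (tor3 R) (fun y => fejer3 N y * p x).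
  by apply: eq_L1 (L1Z (p x) (L1_fejer3 R N)) => y; rewrite mulrC.
have fb : exists K : R, forall y : pt3 R, `|fejer3 N y| <= K.
  have f1 (r : R) : `|fejer N r| <= N%:R^-1 * (N%:R * N%:R).
    rewrite normrM ger0_norm ?invr_ge0// ler_wpM2l ?invr_ge0//.
    apply: le_trans (ler_norm_sum _ _ _) _; rewrite mulr_natl.
    rewrite -[X in _ *+ X](card_ord N) -sumr_const; apply: ler_sum => i _.
    apply: le_trans (ler_norm_sum _ _ _) _; rewrite -[X in _ <= X%:R](card_ord N) -sumr_const.
    by apply: ler_sum => j _; exact: cos_max.
  exists ((N%:R^-1 * (N%:R * N%:R)) ^+ 3) => y; rewrite /fejer3 /tens exprS expr2 mulrA.
  rewrite (normrM (_ * _)) (normrM (fejer N y.1.1) (fejer N y.1.2)).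
  apply: (ler_pM _ _ (ler_pM _ _ (f1 _) (f1 _)) (f1 _)) => //; exact: mulr_ge0.
have [K fK] := fb.
have i2 x : L1 (tor3 R) (fun y => fejer3 N y * p (x + y)).
  apply: (L1_Mbounded _ (L1_measurable (L1_fejer3 R N)) fK).
  by apply: eq_L1 (L1_shift3 x pp pi) => y; rewrite addrC.
have gap_eq x : p x = s x - \int[tor3 R]_y H N (x, y).
  rewrite /s -(IntB (i2 x)); last first.
    by apply: eq_L1 (L1B (i2 x) (i1 x)) => y; rewrite /H/=; ring.
  transitivity (\int[tor3 R]_y (p x * fejer3 N y)).
    by rewrite (IntZ _ (L1_fejer3 R N)) Int_fejer3// mulr1.
  by apply: eq_Int => y; rewrite /H/=; ring.
have iH := L1_Int1 (L1_H N).
have igp : L1 (tor3 R) (fun x => g x * p x) := L1_Mbounded pi mg gB.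
have igH : L1 (tor3 R) (fun x => g x * \int[tor3 R]_y H N (x, y)) := L1_Mbounded iH mg gB.
have igs : L1 (tor3 R) (fun x => g x * s x).
  by apply: eq_L1 (L1D igp igH) => x; rewrite gap_eq; ring.
have -> : \int[tor3 R]_x (g x * p x) = \int[tor3 R]_x (g x * s x) -
    \int[tor3 R]_x (g x * \int[tor3 R]_y H N (x, y)).
  by rewrite -(IntB igs igH); apply: eq_Int => x; rewrite gap_eq; ring.
apply: lerD.
  rewrite /s (fejer_coef gi N0).
  have blk (i : 'I_N * 'I_N * 'I_N) : \sum_(j : 'I_N * 'I_N * 'I_N) coef p (fr i j) * coef g (fr i j) <=
      M / 2 + (\int[tor3 R]_x g x ^+ 2) / 2.
    have h1 := pM (@fr_inj N i); have h2 := bessel (@fr_inj N i) gi g2.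
    apply: (@le_trans _ _ (\sum_(j : 'I_N * 'I_N * 'I_N) (coef p (fr i j) ^+ 2 / 2 + coef g (fr i j) ^+ 2 / 2))).
      apply: ler_sum => j _; have := sqr_ge0 (coef p (fr i j) - coef g (fr i j)); rewrite sqrrB; nra.
    by rewrite big_split/= -!mulr_suml; apply: lerD; rewrite ler_wpM2r.
  have NR : 0 < N%:R :> R by rewrite ltr0n.
  apply: le_trans (ler_wpM2l _ (ler_sum _ (fun i _ => blk i))) _; first by rewrite exprn_ge0// invr_ge0.
  rewrite sumr_const card_prod card_prod card_ord -(mulr_natl (M / 2 + _)) !natrM.
  rewrite (_ : N%:R^-1 ^+ 3 * _ = (N%:R^-1 * N%:R) ^+ 3 * (M / 2 + (\int[tor3 R]_x g x ^+ 2) / 2)); last by ring.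
  by rewrite mulVf ?gt_eqF// expr1n mul1r.
have iHn := L1_Int1 (L1_norm (L1_H N)).
have iHc := L1Z B iHn.
apply: le_trans (ler_norm _) _; rewrite normrN.
apply: le_trans (norm_Int_le igH iHc _) _ => [x|].
  rewrite normrM; apply: ler_pM => //; apply: le_normr_Rintegral => //.
  have : L1 (tor3 R) (fun y => H N (x, y)).
    by apply: eq_L1 (L1B (i2 x) (i1 x)) => y; rewrite /H/=; ring.
  by [].
rewrite (IntZ _ iHn) -(Int_prod12 (L1_norm (L1_H N))).
apply: le_trans (ler_wpM2l B0 HN) _; rewrite mulrA ler_pdivrMr ?ltr_wpDl//.
by rewrite mulrDr mulr1 mulrC lerDl ltW.
Qed.

(** The function is paired with its own truncation [g]. Up to a small error it may be
    replaced by a Fejer mean, and then Bessel's inequality bounds the pairing by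
    half of [M] plus half of the square norm of [g]. Since the pairing dominates the
    square norm of [g], that norm is at most [M]; then the truncation is removed. *)
Theorem sqr_integrable_of_coefs :
  L1 (tor3 R) (fun x => p x ^+ 2) /\ \int[tor3 R]_x p x ^+ 2 <= M.
Proof.
have t3 : (tor3 R setT < +oo)%E by have := tor3_setT R => /= ->; exact: ltry.
have mt n : measurable_fun setT (fun x => trunc n (p x)) := measurableT_comp (@measurable_trunc R n) mp.
have tb n x := trunc_bound n (p x).
have ti n : L1 (tor3 R) (fun x => trunc n (p x) ^+ 2).
  apply: (@L1_bounded _ _ _ (tor3 R) _ (n%:R ^+ 2) t3) => [|x]; first by apply: measurable_funX; exact: mt.
  by rewrite normrX lerXn2r ?nnegrE ?trunc_bound.
apply: L1_sqr_trunc => // n; have := pairing_le (mt n) (tb n).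
have tpi : L1 (tor3 R) (fun x => trunc n (p x) * p x) := L1_Mbounded pi (mt n) (tb n).
have : \int[tor3 R]_x trunc n (p x) ^+ 2 <= \int[tor3 R]_x (trunc n (p x) * p x).
  by apply: le_Int => // x; rewrite [leRHS]mulrC; exact: trunc_sqr_le.
set a := \int[_]_x _; set b := \int[_]_x _ => ab hb.
have : a <= M / 2 + a / 2 := le_trans ab hb.
move=> h; have : a - a / 2 <= M / 2 by rewrite lerBlDr.
have -> : a - a / 2 = a / 2 by field.
by rewrite ler_pM2r// invr_gt0.
Qed.

End square_summable_coefficients.

(** * Integrability of the square of the pressure *)

Section vanishing_time_averages.
Variable R : realType.

(** The bumps tend to indicators of intervals, and a function whose integrals over all
    subintervals vanish is zero almost everywhere. *)
Lemma ae_zero_of_bump (T : R) (f : R -> R) : L1 (leb1 R) f ->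
  (forall a b n, 0 < a -> b < T -> \int[leb1 R]_t (bump a b n t * f t) = 0) ->
  {ae leb1 R, forall t, 0 < t < T -> f t = 0}.
Proof.
move=> fi f0; have mf := L1_measurable fi.
have locf : locally_integrable setT f by apply: open_integrable_locally => //; exact: openT.
have mb a b n : measurable_fun setT (bump a b n : R -> R).
  by apply: continuous_measurable_fun; exact: (smooth_continuous (smooth_bump a b n)).
have itv0 (a b : R) : 0 < a -> b < T -> \int[leb1 R]_(t in `]a, b]) f t = 0.
  move=> a0 bT; have iab : (leb1 R).-integrable `]a, b[ (EFin \o f).
    exact: integrableS fi.
  rewrite -Rintegral_itv_bndo_bndc// /Rintegral integral_mkcond -/(Rintegral _ _ _).
  pose g (t : R) := (if a < t < b then 1 else 0) * f t.
  have mg : measurable_fun setT g.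
    apply: measurable_funM => //; apply: measurable_fun_ifT => //.
    by apply: measurable_and; apply: measurable_fun_ltr.
  have -> : fine (\int[leb1 R]_t ((fun x => (f x)%:E) \_ `]a, b[) t)%E = \int[leb1 R]_t g t.
    congr fine; apply: eq_integral => t _; rewrite patchE /g mem_setE in_itv/=.
    by case: ifP => _; rewrite ?mul1r ?mul0r.
  have C := @Int_cvg_dominated _ _ _ (leb1 R) (fun n t => bump a b n t * f t) g (fun t => `|f t|).
  have {}C : (fun n => \int[leb1 R]_t (bump a b n t * f t)) @ \oo --> \int[leb1 R]_t g t.
    apply: C => [n||||].
    - by apply: measurable_funM => //; exact: mb.
    - exact: mg.
    - exact: (L1_norm fi).
    - apply: aeW => t n; rewrite normrM ler_piMl//.
      by have /andP[b0 b1] := bump_itv a b n t; rewrite ger0_norm.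
    - by apply: aeW => t; apply: cvgM; [exact: bump_cvg|exact: cvg_cst].
  have E : (fun n => \int[leb1 R]_t (bump a b n t * f t)) = fun=> 0.
    by apply/funext => n; exact: f0.
  by rewrite E in C; exact: (cvg_unique _ C (cvg_cst _)).
have := lebesgue_differentiation locf.
apply: filterS; first exact: (ae_filter_ringOfSetsType (leb1 R)).
move=> t lt /andP[t0 tT].
pose a := t / 2; have a0 : 0 < a by rewrite divr_gt0.
have at' : a < t by rewrite /a; lra.
have [] := @FTC1_lebesgue_pt R f (BRight a) t T tT _ _ lt; last 1 first.
- move=> dF <-; rewrite derive1E.
  rewrite (_ : 'D_1 _ t = 'D_1 (fun _ : R => 0 : R) t); first exact: derive_cst.
  apply: near_eq_derive; near=> y; apply: itv0 => //.
  near: y; exact: lt_nbhsl.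
- exact: integrableS fi.
- by [].
Unshelve. all: by end_near. Qed.

(** The bound on slices is only used under an integral in the second variable. *)
Lemma L1_prod21_ae d1 d2 (X : measurableType d1) (Y : measurableType d2)
    (m1 : {sigma_finite_measure set X -> \bar R}) (m2 : {sigma_finite_measure set Y -> \bar R})
    (f : X * Y -> R) (c : Y -> R) : measurable_fun setT f -> L1 m2 c ->
  {ae m2, forall y, L1 m1 (fun x => f (x, y)) /\ \int[m1]_x `|f (x, y)| <= c y} ->
  L1 (prodm m1 m2) f.
Proof.
move=> mf ci fc; apply/integrable21ltyP; first exact/measurable_EFinP.
have mf' : measurable_fun setT (EFin \o f) by exact/measurable_EFinP.
apply: le_lt_trans (integrable_lty measurableT (L1_norm ci)).
apply: ae_ge0_le_integral => //.
- by move=> y _; exact: integral_ge0.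
- have := @measurable_fun_fubini_tonelli_G _ _ _ _ _ m1 (fun z => `|(EFin \o f) z|%E).
  by apply => //; exact: measurableT_comp.
- by move=> y _; rewrite /= lee_fin.
- exact: measurable_int (L1_norm ci).
- apply: filterS fc => y [fi fcy] _.
  have := fcy; rewrite -lee_fin EFin_Int; last exact: L1_norm fi.
  by move=> h; apply: le_trans h _; rewrite /= lee_fin ler_norm.
Qed.

End vanishing_time_averages.

Section projections_of_smooth_functions.
Variables (R : realType) (V : normedModType R).

Lemma smooth_proj (c : V -> R) (f : R -> R) : continuous c ->
  (forall (h : R) d y, c (h *: d + y) = h * c d + c y) -> smooth f ->
  smooth (fun q => f (c q)).
Proof.
by move=> cc cl sf; apply: (smooth_affine (A := c) (L := c) cc _ sf) => h d y; rewrite cl.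
Qed.

Lemma is_derive_proj (c : V -> R) (f : R -> R) d q (a : R) :
  (forall (h : R) d y, c (h *: d + y) = h * c d + c y) ->
  is_derive (c q) 1 f a -> is_derive q d (fun q => f (c q)) (c d * a).
Proof.
move=> cl fa; have [df Df] := is_derive_dir (c d) fa.
have Ad (h : R) : c (h *: d + q) = h *: c d + c q by rewrite cl.
apply: DeriveDef; first exact: (derivable_affine Ad df).
by rewrite (derive_affine f Ad).
Qed.

Lemma derive_proj (c : V -> R) (f : R -> R) d q (a : R) :
  (forall (h : R) d y, c (h *: d + y) = h * c d + c y) ->
  is_derive (c q) 1 f a -> 'D_d (fun q => f (c q)) q = c d * a.
Proof. by move=> cl fa; have [] := is_derive_proj d cl fa. Qed.

End projections_of_smooth_functions.

Section modes.
Variable R : realType.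
Notation freq := (int * int * int)%type.
Implicit Types (k : freq) (chi : R -> R) (F : pt4 R -> R).

Lemma is_derive_cas m (s : R) : is_derive s 1 (cas m) (2 * pi * m%:~R * cas (- m) s).
Proof.
have wl (h d y : R) : wave m (h *: d + y) = h * wave m d + wave m y by rewrite /wave /GRing.scale/=; ring.
have w1 : wave m 1 = 2 * pi * m%:~R :> R by rewrite /wave mulr1.
have dc := is_derive_proj (V := R) 1 wl (is_derive_cos (wave m s)).
have ds := is_derive_proj (V := R) 1 wl (is_derive_sin (wave m s)).
rewrite (_ : cas m = (fun s => cos (wave m s)) + (fun s => sin (wave m s))); last by apply/funext.
apply: is_derive_eq; rewrite /cas (_ : wave (- m) s = - wave m s).
  by rewrite cosN sinN w1; ring.
by rewrite /wave mulrNz mulrN mulNr.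
Qed.

Lemma smooth_cas m : smooth (cas m : R -> R).
Proof.
apply: smooth_family => i; exists (2 * pi * i%:~R), 0, (- i), i => x.
by rewrite mul0r addr0; exact: is_derive_cas.
Qed.

Definition mode chi k (q : pt4 R) : R := chi q.2 * hart k q.1.

Let px (q : pt4 R) : R := q.1.1.1.
Let py (q : pt4 R) : R := q.1.1.2.
Let pz (q : pt4 R) : R := q.1.2.
Let pt (q : pt4 R) : R := q.2.

Let cpt : continuous pt. Proof. by move=> q; exact: cvg_snd. Qed.
Let cp1 : continuous (fun q : pt4 R => q.1). Proof. by move=> q; exact: cvg_fst. Qed.
Let after1 (W : topologicalType) (f : pt3 R -> W) : continuous f -> continuous (fun q : pt4 R => f q.1).
Proof. by move=> cf q; apply: (@cvg_comp _ _ _ (fun q : pt4 R => q.1) f _ (nbhs q.1)); [exact: cp1|exact: cf]. Qed.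
Let after11 (f : R * R -> R) : continuous f -> continuous (fun q : pt4 R => f q.1.1).
Proof.
move=> cf; apply: (after1 (f := fun x : pt3 R => f x.1)) => x.
by apply: (@cvg_comp _ _ _ (fun x : pt3 R => x.1) f _ (nbhs x.1)); [exact: cvg_fst|exact: cf].
Qed.
Let cpz : continuous pz. Proof. by apply: (after1 (f := snd)) => x; exact: cvg_snd. Qed.
Let cpx : continuous px. Proof. by apply: (after11 (f := fst)) => x; exact: cvg_fst. Qed.
Let cpy : continuous py. Proof. by apply: (after11 (f := snd)) => x; exact: cvg_snd. Qed.

Let modeE chi k : mode chi k =
  fun q => chi (pt q) * (cas k.1.1 (px q) * (cas k.1.2 (py q) * cas k.2 (pz q))).
Proof. by apply/funext => q; rewrite /mode /hart /tens -!mulrA. Qed.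

Variables (T a b : R) (chi : R -> R).
Hypotheses (sc : smooth chi) (a0 : 0 < a) (bT : b < T) (cab : forall t, chi t != 0 -> a <= t <= b).

Let scas (c : pt4 R -> R) m : continuous c ->
  (forall (h : R) d y, c (h *: d + y) = h * c d + c y) -> smooth (fun q => cas m (c q)).
Proof. by move=> cc cl; apply: smooth_proj => //; exact: smooth_cas. Qed.

Let schi : smooth (fun q => chi (pt q)). Proof. exact: smooth_proj. Qed.
Let sz m : smooth (fun q => cas m (pz q)). Proof. exact: scas. Qed.
Let sx m : smooth (fun q => cas m (px q)). Proof. exact: scas. Qed.
Let sy m : smooth (fun q => cas m (py q)). Proof. exact: scas. Qed.
Let syz m n : smooth (fun q => cas m (py q) * cas n (pz q)). Proof. exact: smoothM. Qed.
Let sxyz k : smooth (fun q => cas k.1.1 (px q) * (cas k.1.2 (py q) * cas k.2 (pz q))).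
Proof. exact: smoothM. Qed.

Lemma smooth_mode k : smooth (mode chi k).
Proof. by rewrite modeE; exact: smoothM. Qed.

Lemma periodic_hart k : periodic (hart k : pt3 R -> R).
Proof. by apply/periodicP => x y z; rewrite /hart /tens/= !cas_per. Qed.

Lemma test_mode k : test_fun T (mode chi k).
Proof.
split; first exact: smooth_mode.
  by move=> t x; rewrite /mode/=; have [-> -> ->] := periodic_hart k x.
exists a, b; split => // x t; rewrite /mode mulf_eq0 negb_or => /andP[h _]; exact: cab.
Qed.

Definition freq_at (i : 'I_5) k : R :=
  match val i with 2%N => k.1.1%:~R | 3%N => k.1.2%:~R | 4%N => k.2%:~R | _ => 0 end.

Definition flip (i : 'I_5) k : freq :=
  match val i with
  | 2%N => ((- k.1.1, k.1.2), k.2) | 3%N => ((k.1.1, - k.1.2), k.2)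
  | 4%N => ((k.1.1, k.1.2), - k.2) | _ => k end.

Let Dcas (c : pt4 R -> R) m d q : (forall (h : R) d y, c (h *: d + y) = h * c d + c y) ->
  'D_d (fun q => cas m (c q)) q = c d * (2 * pi * m%:~R * cas (- m) (c q)).
Proof. by move=> cl; apply: derive_proj => //; exact: is_derive_cas. Qed.

Let Dchi d q : 'D_d (fun q => chi (pt q)) q = pt d * 'D_1 chi (pt q).
Proof. by apply: derive_proj => //; apply: DeriveDef => //; exact: smooth_derivable. Qed.

Lemma Dop_mode_space (i : 'I_5) k q : (1 < i)%N ->
  Dop i (mode chi k) q = 2 * pi * freq_at i k * mode chi (flip i k) q.
Proof.
rewrite (modeE chi k); case: i => -[|[|[|[|[|]]]]]//= i5 _; rewrite /Dop/=.
all: rewrite smooth_deriveM// Dchi smooth_deriveM// smooth_deriveM// !Dcas//.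
all: by rewrite /mode /hart /tens /flip /px /py /pz /pt /freq_at /=; ring.
Qed.

Lemma Dop_mode_time k q : Dop (inord 1) (mode chi k) q = mode ('D_1 chi) k q.
Proof.
rewrite /Dop /= inordK//= modeE smooth_deriveM// Dchi smooth_deriveM// smooth_deriveM// !Dcas//.
by rewrite modeE /px /py /pz /pt /=; ring.
Qed.

End modes.

Section fluxes.
Variable R : realType.

Definition flux5 (f0 ft fx fy fz : pt4 R -> R) (i : 'I_5) : pt4 R -> R :=
  match val i with 0%N => f0 | 1%N => ft | 2%N => fx | 3%N => fy | _ => fz end.

Lemma flux5_ind (P : (pt4 R -> R) -> Prop) f0 ft fx fy fz i :
  P f0 -> P ft -> P fx -> P fy -> P fz -> P (flux5 f0 ft fx fy fz i).
Proof. by rewrite /flux5; case: (val i) => [|[|[|[|n]]]]. Qed.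

Let o5 (n : nat) (n5 : (n < 5)%N) : 'I_5 := Ordinal n5.

Lemma sum5 (f : 'I_5 -> R) : \sum_i f i =
  f (@o5 0 isT) + f (@o5 1 isT) + f (@o5 2 isT) + f (@o5 3 isT) + f (@o5 4 isT).
Proof.
rewrite !big_ord_recl big_ord0 addr0 !addrA.
by congr (f _ + f _ + f _ + f _ + f _); apply: val_inj.
Qed.

Lemma flux5E f0 ft fx fy fz (theta : pt4 R -> R) (q : pt4 R) :
  \sum_(i < 5) flux5 f0 ft fx fy fz i q * Dop i theta q =
  f0 q * theta q + ft q * 'D_(et4 R) theta q + fx q * 'D_(ex4 R) theta q
  + fy q * 'D_(ey4 R) theta q + fz q * 'D_(ez4 R) theta q.
Proof. exact: (sum5 (fun i => flux5 f0 ft fx fy fz i q * Dop i theta q)). Qed.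

Definition slab (T : R) (q : pt4 R) : R := if 0 < q.2 < T then 1 else 0.

(** A weak solution in which every field is defined on the whole of space-time,
    periodic, and zero outside the time interval. *)
Record torus_solution (T Om M0 : R) (U V W P : pt4 R -> R) : Prop := TorusSolution {
  ts_per : [/\ per4 U, per4 V, per4 W & per4 P];
  ts_out : forall q, ~~ (0 < q.2 < T) -> [/\ U q = 0, V q = 0, W q = 0 & P q = 0];
  ts_meas : [/\ measurable_fun setT U, measurable_fun setT V & measurable_fun setT W];
  ts_int : [/\ L1 (tor4 R) (fun q => U q ^+ 4), L1 (tor4 R) (fun q => V q ^+ 4),
               L1 (tor4 R) (fun q => W q ^+ 2) & L1 (tor4 R) P];
  ts_slice : {ae leb1 R, forall t, `|\int[tor3 R]_x P (x, t)| <= M0};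
  ts_eqU : flux_eq T (flux5 (fun q => Om * V q) U (fun q => U q ^+ 2 + P q)
             (fun q => U q * V q) (fun q => U q * W q));
  ts_eqV : flux_eq T (flux5 (fun q => - Om * U q) V (fun q => U q * V q)
             (fun q => V q ^+ 2 + P q) (fun q => V q * W q));
  ts_div : flux_eq T (flux5 (fun=> 0) (fun=> 0) U V W);
  ts_dz : flux_eq T (flux5 (fun=> 0) (fun=> 0) (fun=> 0) (fun=> 0) P) }.

Lemma L1_slab T : L1 (tor4 R) (slab T).
Proof.
have h1 : L1 (tor3 R) (fun=> 1 : R).
  apply: (@L1_bounded _ _ _ (tor3 R) _ 1) => //; last by move=> x; rewrite normr1.
  by have := tor3_setT R => /= ->; exact: ltry.
have h2 : L1 (leb1 R) (fun t : R => if 0 < t < T then 1 else 0).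
  have hI : L1 (leb1 R) (\1_(`]0, T[ : set R) : R -> R) by exact: integrable_indic_itv.
  by apply: eq_L1 hI => t; rewrite indicE mem_setE in_itv/=; case: ifP.
by apply: eq_L1 (L1_tensor h1 h2) => q; rewrite mul1r.
Qed.

Lemma flux_integrand T (F : 'I_5 -> pt4 R -> R) theta : (forall i, L1 (tor4 R) (F i)) ->
  test_fun T theta -> L1 (tor4 R) (fun q => \sum_(i < 5) F i q * Dop i theta q).
Proof.
move=> Fi tt; apply: L1_sum => i _; have tD := Dop_test i tt.
have [D D0 thD] := test_fun_bounded tD.
by apply: eq_L1 (L1_Mbounded (Fi i) (test_fun_measurable tD) thD) => q; rewrite mulrC.
Qed.

End fluxes.

Section integrability.
Variables (R : realType) (T Om M0 : R) (U V W P : pt4 R -> R).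
Hypothesis sol : torus_solution T Om M0 U V W P.

Let mU : measurable_fun setT U. Proof. by have [] := ts_meas sol. Qed.
Let mV : measurable_fun setT V. Proof. by have [] := ts_meas sol. Qed.
Let mW : measurable_fun setT W. Proof. by have [] := ts_meas sol. Qed.

Definition bulk (q : pt4 R) : R := slab T q + U q ^+ 4 + V q ^+ 4.

Lemma L1_bulk : L1 (tor4 R) bulk.
Proof. by have [h1 h2 _ _] := ts_int sol; exact: (L1D (L1D (L1_slab T) h1) h2). Qed.

(** Outside the slab all fields vanish, so lower powers are dominated. *)
Lemma bulk_ge (q : pt4 R) : [/\ U q ^+ 2 <= bulk q, V q ^+ 2 <= bulk q, U q ^+ 4 <= bulk q,
  V q ^+ 4 <= bulk q & (U q * V q) ^+ 2 <= bulk q].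
Proof.
rewrite /bulk /slab; case: ifPn => qT; last first.
  by have [-> -> _ _] := ts_out sol qT; rewrite !expr0n/= mul0r expr0n !addr0.
move: (U q) (V q) => a b.
have := sqr_ge0 (a ^+ 2 - b ^+ 2); have := sqr_ge0 (a ^+ 2 - 1); have := sqr_ge0 (b ^+ 2 - 1).
have := sqr_ge0 a; have := sqr_ge0 b; have := sqr_ge0 (a ^+ 2); have := sqr_ge0 (b ^+ 2).
rewrite !sqrrB -!exprM !exprMn !expr1n; split; nra.
Qed.

Lemma bulk_ge_abs (q : pt4 R) : [/\ `|U q| <= bulk q, `|V q| <= bulk q & `|U q * V q| <= bulk q].
Proof.
rewrite /bulk /slab; case: ifPn => qT; last first.
  by have [-> -> _ _] := ts_out sol qT; rewrite !expr0n/= mul0r normr0 !addr0.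
rewrite normrM -(normr_id (U q)) -(normr_id (V q)).
have e4 (x : R) : x ^+ 4 = `|x| ^+ 4 by rewrite -normrX ger0_norm// exprn_even_ge0.
rewrite !normr_id (e4 (U q)) (e4 (V q)).
have := normr_ge0 (U q); have := normr_ge0 (V q); move: `|U q| `|V q| => a b b0 a0.
have := sqr_ge0 (a ^+ 2 - 2^-1); have := sqr_ge0 (b ^+ 2 - 2^-1); have := sqr_ge0 (a - 2^-1).
have := sqr_ge0 (b - 2^-1); have := sqr_ge0 (a - b); have := sqr_ge0 (a ^+ 2); have := sqr_ge0 (b ^+ 2).
rewrite !sqrrB -!exprM; split; nra.
Qed.

Lemma L1_low (f : pt4 R -> R) : measurable_fun setT f -> (forall q : pt4 R, `|f q| <= bulk q) ->
  L1 (tor4 R) f.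
Proof. by move=> mf fb; apply: (@L1_le _ _ _ (tor4 R) f bulk mf L1_bulk) => q; exact: fb. Qed.

Lemma L1_U : L1 (tor4 R) U. Proof. by apply: L1_low => // q; have [] := bulk_ge_abs q. Qed.
Lemma L1_V : L1 (tor4 R) V. Proof. by apply: L1_low => // q; have [] := bulk_ge_abs q. Qed.
Lemma L1_UV : L1 (tor4 R) (fun q => U q * V q).
Proof. by apply: L1_low => [|q]; [exact: measurable_funM|have [] := bulk_ge_abs q]. Qed.
Lemma L1_U2 : L1 (tor4 R) (fun q => U q ^+ 2).
Proof.
apply: L1_low => [|q]; first exact: measurable_funX.
by rewrite ger0_norm ?sqr_ge0//; have [] := bulk_ge q.
Qed.
Lemma L1_V2 : L1 (tor4 R) (fun q => V q ^+ 2).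
Proof.
apply: L1_low => [|q]; first exact: measurable_funX.
by rewrite ger0_norm ?sqr_ge0//; have [] := bulk_ge q.
Qed.
Lemma L1_UV2 : L1 (tor4 R) (fun q => (U q * V q) ^+ 2).
Proof.
apply: L1_low => [|q]; first by apply: measurable_funX; exact: measurable_funM.
by rewrite ger0_norm ?sqr_ge0//; have [] := bulk_ge q.
Qed.

Let W2b (q : pt4 R) : `|W q| <= slab T q + W q ^+ 2.
Proof.
rewrite /slab; case: ifPn => qT; last first.
  by have [_ _ -> _] := ts_out sol qT; rewrite normr0 expr0n.
have e : W q ^+ 2 = `|W q| ^+ 2 by rewrite real_normK// num_real.
by rewrite e; have := sqr_ge0 (`|W q| - 2^-1); rewrite sqrrB; nra.
Qed.

Lemma L1_W : L1 (tor4 R) W.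
Proof. by have [_ _ h _] := ts_int sol; apply: (@L1_le _ _ _ (tor4 R) W _ mW (L1D (L1_slab T) h)) => q; exact: W2b. Qed.

Let prodW (f : pt4 R -> R) : measurable_fun setT f -> L1 (tor4 R) (fun q => f q ^+ 2) ->
  L1 (tor4 R) (fun q => f q * W q).
Proof.
move=> mf f2; have [_ _ h _] := ts_int sol.
apply: (@L1_le _ _ _ (tor4 R) _ _ _ (L1D f2 h)) => [|q]; first exact: measurable_funM.
have e (x : R) : x ^+ 2 = `|x| ^+ 2 by rewrite real_normK// num_real.
rewrite (e (f q)) (e (W q)) normrM; have := sqr_ge0 (`|f q| - `|W q|); rewrite sqrrB.
have := sqr_ge0 `|f q|; have := sqr_ge0 `|W q|; nra.
Qed.

Lemma L1_UW : L1 (tor4 R) (fun q => U q * W q). Proof. exact: prodW mU L1_U2. Qed.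
Lemma L1_VW : L1 (tor4 R) (fun q => V q * W q). Proof. exact: prodW mV L1_V2. Qed.

End integrability.

Section pressure_on_a_slice.
Variable R : realType.
Notation freq := (int * int * int)%type.

Lemma cauchy5 (t1 t2 t3 t4 t5 : R) :
  (t1 + t2 + t3 + t4 + t5) ^+ 2 <= 5 * (t1 ^+ 2 + t2 ^+ 2 + t3 ^+ 2 + t4 ^+ 2 + t5 ^+ 2).
Proof.
have := sqr_ge0 (t1 - t2); have := sqr_ge0 (t1 - t3); have := sqr_ge0 (t1 - t4).
have := sqr_ge0 (t1 - t5); have := sqr_ge0 (t2 - t3); have := sqr_ge0 (t2 - t4).
have := sqr_ge0 (t2 - t5); have := sqr_ge0 (t3 - t4); have := sqr_ge0 (t3 - t5).
have := sqr_ge0 (t4 - t5); rewrite !sqrrB !expr2; lra.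
Qed.

Lemma int_le_sqr (k : int) : `|k%:~R| <= (k%:~R : R) ^+ 2.
Proof.
have e : (k%:~R : R) ^+ 2 = `|k%:~R| ^+ 2 by rewrite real_normK// num_real.
rewrite e -intr_norm expr2; have [->|k0] := eqVneq k 0; first by rewrite normr0 mul0r.
by rewrite ler_peMl ?ler0z// ler1z -gtz0_ge1 normr_gt0.
Qed.

Let shrink (c s t : R) : 0 < s -> `|c| <= s -> (c / s * t) ^+ 2 <= t ^+ 2.
Proof.
move=> s0 cs; rewrite exprMn ler_piMl ?sqr_ge0// -[leLHS]real_normK ?num_real//.
by rewrite exprn_ile1// normrM normfV (gtr0_norm s0) ler_pdivrMr// mul1r.
Qed.

(** The symbol of the pressure operator is bounded by one. *)
Lemma symbol_bound (k1 k2 : int) (Om ph a b c d e : R) : (k1 != 0) || (k2 != 0) ->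
  Om * (k1%:~R * d - k2%:~R * e) - 2 * pi * (k1%:~R ^+ 2 * a + k2%:~R ^+ 2 * b +
    (k1%:~R ^+ 2 + k2%:~R ^+ 2) * ph - 2 * k1%:~R * k2%:~R * c) = 0 ->
  ph ^+ 2 <= 5 * (a ^+ 2 + b ^+ 2 + c ^+ 2 + Om ^+ 2 * d ^+ 2 + Om ^+ 2 * e ^+ 2).
Proof.
move=> k0 E; have hx := int_le_sqr k1; have hy := int_le_sqr k2.
have p1 : 1 <= 2 * pi :> R by have := @pi_ge2 R; lra.
have S0 : 0 < (k1%:~R : R) ^+ 2 + k2%:~R ^+ 2.
  case/orP: k0 => h.
    have : 0 < `|k1%:~R : R| by rewrite normr_gt0 intr_eq0.
    by move=> h1; have := sqr_ge0 (k2%:~R : R); lra.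
  have : 0 < `|k2%:~R : R| by rewrite normr_gt0 intr_eq0.
  by move=> h1; have := sqr_ge0 (k1%:~R : R); lra.
move: hx hy S0 E; move: (k1%:~R : R) (k2%:~R : R) => x y hx hy S0 E.
have x2 := sqr_ge0 x; have y2 := sqr_ge0 y; set S := x ^+ 2 + y ^+ 2 in S0 E.
have pS : 0 < 2 * pi * S by rewrite mulr_gt0//; lra.
have SpS : S <= 2 * pi * S by rewrite ler_peMl// ltW.
have Sn : S != 0 by rewrite gt_eqF.
have pn : pi != 0 :> R by rewrite gt_eqF// pi_gt0.
have phE : ph = - x ^+ 2 / S * a + (- y ^+ 2 / S * b) + (2 * x * y) / S * c +
    x / (2 * pi * S) * (Om * d) + (- y) / (2 * pi * S) * (Om * e).
  have E2 : 2 * pi * S * ph = Om * (x * d - y * e) - 2 * pi * (x ^+ 2 * a + y ^+ 2 * b - 2 * x * y * c).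
    by move: E; rewrite mulrBr; lra.
  apply: (@mulfI _ (2 * pi * S)); first by rewrite gt_eqF.
  by rewrite E2; move: (S) (pi) Sn pn => s P sn pn; field; rewrite sn pn.
rewrite phE; apply: le_trans (cauchy5 _ _ _ _ _) _; rewrite ler_pM2l//.
rewrite -!exprMn !lerD//; apply: shrink => //.
- by rewrite normrN ger0_norm// /S; lra.
- by rewrite normrN ger0_norm// /S; lra.
- rewrite ler_norml /S; have := sqr_ge0 (x - y); have := sqr_ge0 (x + y).
  by rewrite sqrrB sqrrD => h1 h2; apply/andP; split; lra.
- by apply: le_trans hx _; apply: le_trans SpS; rewrite /S; lra.
- by rewrite normrN; apply: le_trans hy _; apply: le_trans SpS; rewrite /S; lra.
Qed.

Variables (u v p : pt3 R -> R) (Om M0 : R).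
Hypotheses (pp : periodic p) (pi1 : L1 (tor3 R) p).
Hypotheses (ui : L1 (tor3 R) u) (vi : L1 (tor3 R) v)
  (u2i : L1 (tor3 R) (fun x => u x ^+ 2)) (v2i : L1 (tor3 R) (fun x => v x ^+ 2))
  (uvi : L1 (tor3 R) (fun x => u x * v x))
  (u4i : L1 (tor3 R) (fun x => u x ^+ 4)) (v4i : L1 (tor3 R) (fun x => v x ^+ 4))
  (uv2i : L1 (tor3 R) (fun x => (u x * v x) ^+ 2)).
Hypothesis p_mean : `|\int[tor3 R]_x p x| <= M0.
Hypothesis p_flat : forall k : freq, k.2 != 0 -> coef p k = 0.
Hypothesis p_symbol : forall k1 k2 : int,
  Om * (k1%:~R * coef v ((- k1, k2), 0) - k2%:~R * coef u ((k1, - k2), 0))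
  - 2 * pi * (k1%:~R ^+ 2 * coef (fun x => u x ^+ 2) ((k1, k2), 0)
    + k2%:~R ^+ 2 * coef (fun x => v x ^+ 2) ((k1, k2), 0)
    + (k1%:~R ^+ 2 + k2%:~R ^+ 2) * coef p ((k1, k2), 0)
    - 2 * k1%:~R * k2%:~R * coef (fun x => u x * v x) ((- k1, - k2), 0)) = 0.

Let n1 (k : freq) : freq := ((- k.1.1, k.1.2), k.2).
Let n2 (k : freq) : freq := ((k.1.1, - k.1.2), k.2).
Let n12 (k : freq) : freq := ((- k.1.1, - k.1.2), k.2).
Let n1I : injective n1. Proof. by move=> [[a b] c] [[a' b'] c'] [] /oppr_inj -> -> ->. Qed.
Let n2I : injective n2. Proof. by move=> [[a b] c] [[a' b'] c'] [] -> /oppr_inj -> ->. Qed.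
Let n12I : injective n12. Proof. by move=> [[a b] c] [[a' b'] c'] [] /oppr_inj -> /oppr_inj -> ->. Qed.

Let E (k : freq) := coef (fun x => u x ^+ 2) k ^+ 2 + coef (fun x => v x ^+ 2) k ^+ 2 +
  coef (fun x => u x * v x) (n12 k) ^+ 2 + Om ^+ 2 * coef v (n1 k) ^+ 2 + Om ^+ 2 * coef u (n2 k) ^+ 2.

Let E_ge0 k : 0 <= E k.
Proof. by rewrite /E !addr_ge0// ?sqr_ge0// mulr_ge0// sqr_ge0. Qed.

Let coef_le (k : freq) : coef p k ^+ 2 <= (if k == 0 then M0 ^+ 2 else 0) + 5 * E k.
Proof.
have E5 : 0 <= 5 * E k by rewrite mulr_ge0.
case: ifPn => [/eqP k0|k0].
  rewrite -[leLHS]addr0 lerD// -[leLHS]real_normK ?num_real// lerXn2r ?nnegrE//.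
    by exact: le_trans p_mean.
  rewrite (_ : coef p k = \int[tor3 R]_x p x)//; apply: eq_Int => x.
  by rewrite k0 /hart /tens /cas /wave/= !mulr0 !mul0r cos0 sin0 !addr0 !mulr1.
rewrite add0r; have [k3|k3] := eqVneq k.2 0; last by rewrite (p_flat k3) expr0n.
have := k0; case: k k3 {k0 E5} => [[k1 k2] k3]/= -> k0.
apply: (@symbol_bound k1 k2); last exact: p_symbol.
by move: k0; rewrite !xpair_eqE eqxx andbT negb_and.
Qed.

(** The pressure has no coefficients of nonzero vertical frequency, its mean is bounded
    by [M0], and the divergence of the momentum equations expresses every other
    coefficient by coefficients of square integrable functions. *)
Lemma pressure_slice : L1 (tor3 R) (fun x => p x ^+ 2) /\
  \int[tor3 R]_x p x ^+ 2 <= M0 ^+ 2 + 5 * (\int[tor3 R]_x u x ^+ 4 + \int[tor3 R]_x v x ^+ 4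
    + \int[tor3 R]_x (u x * v x) ^+ 2 + Om ^+ 2 * \int[tor3 R]_x v x ^+ 2 + Om ^+ 2 * \int[tor3 R]_x u x ^+ 2).
Proof.
apply: (sqr_integrable_of_coefs pp pi1) => J f fI.
have sq (g : pt3 R -> R) : L1 (tor3 R) (fun x => g x ^+ 4) -> L1 (tor3 R) (fun x => (g x ^+ 2) ^+ 2).
  by apply: eq_L1 => x; rewrite -exprM.
have s4 (g : pt3 R -> R) : \int[tor3 R]_x g x ^+ 4 = \int[tor3 R]_x (g x ^+ 2) ^+ 2.
  by apply: eq_Int => x; rewrite -exprM.
apply: le_trans (ler_sum _ (fun j _ => coef_le (f j))) _; rewrite big_split/=; apply: lerD.
  have [j0 /eqP j00|noj] := pickP (fun j => f j == 0).
    rewrite (bigD1 j0)//= j00 eqxx big1 ?addr0// => j jj0.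
    by rewrite -j00 (inj_eq fI) (negbTE jj0).
  by rewrite big1 ?sqr_ge0// => j _; rewrite noj.
rewrite -mulr_sumr ler_pM2l// /E !big_split/= -!mulr_sumr !s4.
have b1 := bessel fI u2i (sq _ u4i); have b2 := bessel fI v2i (sq _ v4i).
have b3 := bessel (inj_comp n12I fI) uvi uv2i.
have b4 := bessel (inj_comp n1I fI) vi v2i; have b5 := bessel (inj_comp n2I fI) ui u2i.
apply: lerD; last by apply: ler_wpM2l; [exact: sqr_ge0|exact: b5].
apply: lerD; last by apply: ler_wpM2l; [exact: sqr_ge0|exact: b4].
apply: lerD; last exact: b3.
by apply: lerD.
Qed.

End pressure_on_a_slice.

Lemma ae_imp d (X : measurableType d) (R : realType) (m : {measure set X -> \bar R})
    (A B : X -> Prop) : (forall x, A x -> B x) -> {ae m, forall x, A x} -> {ae m, forall x, B x}.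
Proof. by move=> AB; apply: filterS. Qed.

Lemma ae_and d (X : measurableType d) (R : realType) (m : {measure set X -> \bar R})
    (A B : X -> Prop) : {ae m, forall x, A x} -> {ae m, forall x, B x} ->
  {ae m, forall x, A x /\ B x}.
Proof. by apply: filterS2. Qed.

Section pressure_in_L2.
Variables (R : realType) (T Om M0 : R) (U V W P : pt4 R -> R).
Hypothesis sol : torus_solution T Om M0 U V W P.
Notation freq := (int * int * int)%type.

Lemma derive_mode_t_at (chi : R -> R) (k : freq) q : smooth chi ->
  'D_(et4 R) (mode chi k) q = mode ('D_1 chi) k q.
Proof.
move=> sc; have := Dop_mode_time sc k q.
by rewrite /Dop /= inordK.
Qed.

Lemma derive_mode_t (chi : R -> R) (k : freq) : smooth chi ->
  'D_(et4 R) (mode chi k) = mode ('D_1 chi) k.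
Proof. by move=> sc; apply/funext => q; exact: derive_mode_t_at. Qed.

Lemma derive_mode_x (chi : R -> R) (k : freq) q : smooth chi ->
  'D_(ex4 R) (mode chi k) q = 2 * pi * k.1.1%:~R * mode chi ((- k.1.1, k.1.2), k.2) q.
Proof. move=> sc; exact: (@Dop_mode_space R chi sc (@Ordinal 5 2 isT) k q isT). Qed.

Lemma derive_mode_y (chi : R -> R) (k : freq) q : smooth chi ->
  'D_(ey4 R) (mode chi k) q = 2 * pi * k.1.2%:~R * mode chi ((k.1.1, - k.1.2), k.2) q.
Proof. move=> sc; exact: (@Dop_mode_space R chi sc (@Ordinal 5 3 isT) k q isT). Qed.

Lemma derive_mode_z (chi : R -> R) (k : freq) q : smooth chi ->
  'D_(ez4 R) (mode chi k) q = 2 * pi * k.2%:~R * mode chi ((k.1.1, k.1.2), - k.2) q.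
Proof. move=> sc; exact: (@Dop_mode_space R chi sc (@Ordinal 5 4 isT) k q isT). Qed.

Lemma L1_hart4 (F : pt4 R -> R) (k : freq) : L1 (tor4 R) F -> L1 (tor4 R) (fun q => F q * hart k q.1).
Proof.
move=> Fi; have mh : measurable_fun setT (fun q : pt4 R => hart k q.1).
  exact: (measurableT_comp (measurable_hart k) measurable_fst).
have h := @L1_Mbounded _ _ _ (tor4 R) F (fun q => hart k q.1) 8 Fi mh (fun q => hart_bound k q.1).
by apply: eq_L1 h => q; rewrite mulrC.
Qed.

Lemma slice_vanish (Z : pt4 R -> R) : L1 (tor4 R) Z ->
  (forall a b n, 0 < a -> b < T -> \int[tor4 R]_q (bump a b n q.2 * Z q) = 0) ->
  {ae leb1 R, forall t, 0 < t < T -> \int[tor3 R]_x Z (x, t) = 0}.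
Proof.
move=> Zi Z0; have zi : L1 (leb1 R) (fun t => \int[tor3 R]_x Z (x, t)) by exact: (L1_Int2 Zi).
apply: (ae_zero_of_bump zi) => a b n a0 bT; rewrite -[RHS](Z0 a b n a0 bT).
have mb : measurable_fun setT (bump a b n : R -> R).
  by apply: continuous_measurable_fun; exact: (smooth_continuous (smooth_bump a b n)).
have bb (t : R) : `|bump a b n t| <= 1 by have /andP[b0 b1] := bump_itv a b n t; rewrite ger0_norm.
have bZ : L1 (tor4 R) (fun q => bump a b n q.2 * Z q).
  by apply: (L1_Mbounded Zi (measurableT_comp mb measurable_snd) (M := 1)) => q; exact: bb.
have := @Int_prod21 _ _ _ _ R (tor3 R) (leb1 R) _ bZ => ->.
apply: ae_eq_Int.
- by apply: (L1_Mbounded zi mb (M := 1)) => t; exact: bb.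
- exact: (L1_Int2 bZ).
have := @ae_integrable2 _ _ _ _ R (tor3 R) (leb1 R) _ Zi.
by apply: ae_imp => t Zt /=; rewrite -IntZ.
Qed.

Let iP : L1 (tor4 R) P. Proof. by have [] := ts_int sol. Qed.
Let iU := L1_U sol.
Let iV := L1_V sol.
Let iW := L1_W sol.
Let iUV := L1_UV sol.
Let iU2 := L1_U2 sol.
Let iV2 := L1_V2 sol.

Let tmode a b n k : 0 < a -> b < T -> test_fun T (mode (bump a b n) k).
Proof.
move=> a0 bT; apply: (test_mode (smooth_bump a b n) a0 bT) => t.
by apply: contra_neqT => tab; rewrite bump_out//; apply: contra tab => /andP[/ltW -> /ltW ->].
Qed.

Let flat_mode (k : freq) : k.2 != 0 ->
  {ae leb1 R, forall t, 0 < t < T -> \int[tor3 R]_x (P (x, t) * hart k x) = 0}.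
Proof.
move=> k3; apply: (slice_vanish (L1_hart4 k iP)) => a b n a0 bT.
have sb := smooth_bump a b n.
have t1 := tmode n ((k.1.1, k.1.2), - k.2) a0 bT.
have E := ts_dz sol t1; apply: (@mulfI _ (- (2 * pi * k.2%:~R))).
  by rewrite oppr_eq0 !mulf_neq0// ?intr_eq0// gt_eqF// pi_gt0.
have bP : L1 (tor4 R) (fun q => bump a b n q.2 * (P q * hart k q.1)).
  have mb : measurable_fun setT (bump a b n : R -> R).
    by apply: continuous_measurable_fun; exact: smooth_continuous.
  apply: (L1_Mbounded (L1_hart4 k iP) (measurableT_comp mb measurable_snd) (M := 1)) => q.
  by have /andP[b0 b1] := bump_itv a b n q.2; rewrite ger0_norm.
rewrite mulr0 -[RHS]E -(IntZ _ bP); apply: eq_Int => q.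
rewrite flux5E (derive_mode_z _ q sb).
move: (mode _ _ q) ('D_(et4 R) _ q) ('D_(ex4 R) _ q) ('D_(ey4 R) _ q) => m0 dt dx dy.
rewrite /mode /= opprK mulrNz.
by case: (k) => [[? ?] ?] /=; ring.
Qed.

Let symbol (k1 k2 : int) (q : pt4 R) : R :=
  Om * (k1%:~R * (V q * hart ((- k1, k2), 0) q.1) - k2%:~R * (U q * hart ((k1, - k2), 0) q.1))
  - 2 * pi * (k1%:~R ^+ 2 * (U q ^+ 2 * hart ((k1, k2), 0) q.1)
    + k2%:~R ^+ 2 * (V q ^+ 2 * hart ((k1, k2), 0) q.1)
    + (k1%:~R ^+ 2 + k2%:~R ^+ 2) * (P q * hart ((k1, k2), 0) q.1)
    - 2 * k1%:~R * k2%:~R * (U q * V q * hart ((- k1, - k2), 0) q.1)).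

Let L1_symbol k1 k2 : L1 (tor4 R) (symbol k1 k2).
Proof.
pose h F k Fi : L1 (tor4 R) (fun q => F q * hart k q.1) := @L1_hart4 F k Fi.
apply: L1B; apply: L1Z.
  by apply: L1B; apply: L1Z; [exact: h iV|exact: h iU].
by apply: L1B; [apply: L1D; [apply: L1D|]|]; apply: L1Z;
  [exact: h iU2|exact: h iV2|exact: h iP|exact: h iUV].
Qed.

(** Testing the two momentum equations with the two components of a gradient, the
    time derivatives cancel because of incompressibility. *)
Let symbol_vanish k1 k2 :
  {ae leb1 R, forall t, 0 < t < T -> \int[tor3 R]_x symbol k1 k2 (x, t) = 0}.
Proof.
apply: (slice_vanish (L1_symbol k1 k2)) => a b n a0 bT.
have sb := smooth_bump a b n; have sb' : smooth ('D_1 (bump a b n)) by exact: smooth_derive.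
have t1 := tmode n ((- k1, k2), 0) a0 bT; have t2 := tmode n ((k1, - k2), 0) a0 bT.
have t3 := test_fun_derive (et4 R) (tmode n ((k1, k2), 0) a0 bT).
have E1 := ts_eqU sol t1; have E2 := ts_eqV sol t2; have E3 := ts_div sol t3.
have [h1 h2 h3] : [/\ L1 (tor4 R) (fun q => \sum_(i < 5) flux5 (fun q => Om * V q) U (fun q => U q ^+ 2 + P q)
             (fun q => U q * V q) (fun q => U q * W q) i q * Dop i (mode (bump a b n) ((- k1, k2), 0)) q),
    L1 (tor4 R) (fun q => \sum_(i < 5) flux5 (fun q => - Om * U q) V (fun q => U q * V q)
             (fun q => V q ^+ 2 + P q) (fun q => V q * W q) i q * Dop i (mode (bump a b n) ((k1, - k2), 0)) q) &
    L1 (tor4 R) (fun q => \sum_(i < 5) flux5 (fun=> 0) (fun=> 0) U V W i q *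
      Dop i ('D_(et4 R) (mode (bump a b n) ((k1, k2), 0))) q)].
  split; [apply: (flux_integrand _ t1)|apply: (flux_integrand _ t2)|apply: (flux_integrand _ t3)] => i;
    apply: (@flux5_ind R (L1 (tor4 R))); try assumption; try exact: L1_0.
  - exact: L1Z.
  - exact: L1D.
  - exact: (L1_UW sol).
  - exact: L1Z.
  - exact: L1D.
  - exact: (L1_VW sol).
have i12 := L1D (L1Z k1%:~R h1) (L1Z k2%:~R h2).
have i12' := L1Z (2 * pi) i12.
have mb : measurable_fun setT (bump a b n : R -> R).
  by apply: continuous_measurable_fun; exact: smooth_continuous.
have bS : L1 (tor4 R) (fun q => bump a b n q.2 * symbol k1 k2 q).
  apply: (L1_Mbounded (L1_symbol k1 k2) (measurableT_comp mb measurable_snd) (M := 1)) => q.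
  by have /andP[b0 b1] := bump_itv a b n q.2; rewrite ger0_norm.
have tp : 2 * pi != 0 :> R by rewrite mulf_neq0// gt_eqF// pi_gt0.
apply: (mulfI tp); rewrite -(IntZ _ bS) mulr0.
have := IntB i12' h3; rewrite (IntZ _ i12) (IntD (L1Z _ h1) (L1Z _ h2)) (IntZ _ h1) (IntZ _ h2).
rewrite {}E1 {}E2 {}E3 !mulr0 addr0 mulr0 subr0 => <-.
apply: eq_Int => q; rewrite !flux5E (derive_mode_t ((k1, k2), 0) sb) !(derive_mode_t_at _ _ sb) !(derive_mode_x _ _ sb) !(derive_mode_x _ _ sb').
rewrite !(derive_mode_y _ _ sb) !(derive_mode_y _ _ sb') !(derive_mode_z _ _ sb) !(derive_mode_z _ _ sb').
move: ('D_(et4 R) _ _) (mode _ ((k1, k2), 0) _) => d3 m3.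
rewrite /symbol /mode; move: ('D_1 (bump a b n) q.2) (bump a b n q.2) => dchi chi.
by rewrite /= !opprK !mulrNz !mulr0z; ring.
Qed.

Let ae_freq (A : freq -> R -> Prop) : (forall k, {ae leb1 R, forall t, A k t}) ->
  {ae leb1 R, forall t, forall k, A k t}.
Proof.
move=> Ak; have : {ae leb1 R, forall t, forall n : nat, if unpickle n is Some k then A k t else True}.
  apply/ae_foralln => n; case: (unpickle n) => [k|]; first exact: Ak.
  exact: aeW.
by apply: ae_imp => t H k; have := H (pickle k); rewrite pickleK.
Qed.

Let slices (F : pt4 R -> R) : L1 (tor4 R) F ->
  {ae leb1 R, forall t, L1 (tor3 R) (fun x => F (x, t))}.
Proof. by move=> Fi; exact: (@ae_integrable2 _ _ _ _ R (tor3 R) (leb1 R) _ Fi). Qed.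

(** The relations between coefficients hold for almost every time and each frequency,
    hence for almost every time and all of the countably many frequencies. The
    resulting bound on slices is integrable in time because the horizontal velocity
    has integrable fourth powers. *)
Theorem pressure_L2 : L1 (tor4 R) (fun q => P q ^+ 2).
Proof.
have [i4U i4V _ _] := ts_int sol; have [pU pV _ pP] := ts_per sol.
pose Mt (t : R) : R := M0 ^+ 2 * (if 0 < t < T then 1 else 0) + 5 * (\int[tor3 R]_x U (x, t) ^+ 4 +
    \int[tor3 R]_x V (x, t) ^+ 4 + \int[tor3 R]_x (U (x, t) * V (x, t)) ^+ 2
    + Om ^+ 2 * \int[tor3 R]_x V (x, t) ^+ 2 + Om ^+ 2 * \int[tor3 R]_x U (x, t) ^+ 2).
have it (F : pt4 R -> R) : L1 (tor4 R) F -> L1 (leb1 R) (fun t => \int[tor3 R]_x F (x, t)).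
  by move=> Fi; exact: (L1_Int2 Fi).
have iM : L1 (leb1 R) Mt.
  have hI : L1 (leb1 R) (\1_(`]0, T[ : set R) : R -> R) by exact: integrable_indic_itv.
  apply: L1D; apply: L1Z.
    by apply: eq_L1 hI => t; rewrite indicE mem_setE in_itv/=; case: ifP.
  apply: L1D; [apply: L1D; [apply: L1D; [apply: L1D|]|]|]; do ?apply: L1Z.
  - exact: it i4U.
  - exact: it i4V.
  - exact: it (L1_UV2 sol).
  - exact: it iV2.
  - exact: it iU2.
apply: (@L1_prod21_ae _ _ _ _ _ (tor3 R) (leb1 R) _ Mt) => //.
  by apply: measurable_funX; exact: L1_measurable iP.
have a1 : {ae leb1 R, forall t, forall k : freq, k.2 != 0 -> 0 < t < T -> \int[tor3 R]_x (P (x, t) * hart k x) = 0}.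
  apply: ae_freq => k; have [k3|k3] := eqVneq k.2 0; first by apply: aeW => t.
  by apply: ae_imp (flat_mode k3) => t h _.
have a2 : {ae leb1 R, forall t, forall k : freq, 0 < t < T -> \int[tor3 R]_x symbol k.1.1 k.1.2 (x, t) = 0}.
  by apply: ae_freq => k; exact: symbol_vanish.
have s1 := slices iP; have s2 := slices iU; have s3 := slices iV; have s4 := slices iUV.
have s5 := slices iU2; have s6 := slices iV2; have s7 := slices i4U; have s8 := slices i4V.
have s9 := slices (L1_UV2 sol).
have := ts_slice sol.
move=> s0; have := ae_and s0 (ae_and s1 (ae_and s2 (ae_and s3 (ae_and s4 (ae_and s5 (ae_and s6
  (ae_and s7 (ae_and s8 (ae_and s9 (ae_and a1 a2)))))))))).
apply: ae_imp => t [mean [iPt [iUt [iVt [iUVt [iU2t [iV2t [i4Ut [i4Vt [iUV2t [flatt symt]]]]]]]]]]].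
have sqn (x : pt3 R) : `|P (x, t) ^+ 2| = P (x, t) ^+ 2 by rewrite ger0_norm ?sqr_ge0.
have [tT|tT] := boolP (0 < t < T); last first.
  have P0 x : P (x, t) ^+ 2 = 0 by have [_ _ _ ->] := ts_out sol (q := (x, t)) tT; rewrite expr0n.
  split; first by apply: eq_L1 (L1_0 (tor3 R)) => x; rewrite P0.
  rewrite (_ : \int[tor3 R]_x _ = 0); last first.
    by rewrite -[RHS](Int0 (tor3 R)); apply: eq_Int => x; rewrite sqn P0.
  rewrite /Mt (negbTE tT) mulr0 add0r; apply: mulr_ge0; first by [].
  have I2 (f : pt3 R -> R) : 0 <= \int[tor3 R]_x f x ^+ 2 by apply: Int_ge0 => x; exact: sqr_ge0.
  have I4 (f : pt3 R -> R) : 0 <= \int[tor3 R]_x f x ^+ 4 by apply: Int_ge0 => x; exact: exprn_even_ge0.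
  apply: addr_ge0; last by apply: mulr_ge0; [exact: sqr_ge0|exact: I2].
  apply: addr_ge0; last by apply: mulr_ge0; [exact: sqr_ge0|exact: I2].
  by apply: addr_ge0; [apply: addr_ge0; exact: I4|exact: I2].
have hrt (g : pt3 R -> R) (k : freq) : L1 (tor3 R) g -> L1 (tor3 R) (fun x => g x * hart k x).
  exact: L1_Mhart.
have := @pressure_slice R (fun x => U (x, t)) (fun x => V (x, t)) (fun x => P (x, t)) Om M0 (pP t)
  iPt iUt iVt iU2t iV2t iUVt i4Ut i4Vt iUV2t mean.
case => [k k3|k1 k2|iP2 leP2].
- exact: flatt.
- rewrite -[RHS](symt ((k1, k2), 0) tT) /symbol /coef /=.
  have hU := hrt _ ((k1, - k2), 0) iUt; have hV := hrt _ ((- k1, k2), 0) iVt.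
  have hP := hrt _ ((k1, k2), 0) iPt; have hU2 := hrt _ ((k1, k2), 0) iU2t.
  have hV2 := hrt _ ((k1, k2), 0) iV2t; have hUV := hrt _ ((- k1, - k2), 0) iUVt.
  have c1 := L1B (L1Z k1%:~R hV) (L1Z k2%:~R hU).
  have c2 := L1D (L1Z (k1%:~R ^+ 2) hU2) (L1Z (k2%:~R ^+ 2) hV2).
  have c3 := L1D c2 (L1Z (k1%:~R ^+ 2 + k2%:~R ^+ 2) hP).
  have c4 := L1B c3 (L1Z (2 * k1%:~R * k2%:~R) hUV).
  rewrite (IntB (L1Z Om c1) (L1Z (2 * pi) c4)) (IntZ _ c1) (IntZ _ c4).
  rewrite (IntB (L1Z _ hV) (L1Z _ hU)) (IntB c3 (L1Z _ hUV)) (IntD c2 (L1Z _ hP)) (IntD (L1Z _ hU2) (L1Z _ hV2)).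
  by rewrite !(IntZ _ hU, IntZ _ hV, IntZ _ hP, IntZ _ hU2, IntZ _ hV2, IntZ _ hUV).
split; first exact: iP2.
rewrite /Mt tT mulr1; apply: le_trans leP2; rewrite le_eqVlt; apply/orP; left; apply/eqP.
by apply: eq_Int => x; exact: sqn.
Qed.

End pressure_in_L2.

(** * Products of fields at two points *)

Section tame_functions.
Variables (R : realType) (X : Type) (G : X -> R) (d : X -> X -> R).
Hypotheses (G0 : forall a, 0 <= G a) (d0 : forall a b, 0 <= d a b).

Lemma young (x y e : R) : 0 < e -> x * y <= (e * x ^+ 2 + e^-1 * y ^+ 2) / 2.
Proof.
move=> e0; have h : 0 <= e^-1 * (e * x - y) ^+ 2 by rewrite mulr_ge0 ?sqr_ge0// invr_ge0 ltW.
have E : e^-1 * (e * x - y) ^+ 2 = e * x ^+ 2 + e^-1 * y ^+ 2 - 2 * (x * y).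
  by field; rewrite gt_eqF.
rewrite E in h; lra.
Qed.

(** [L4c], [L2c] and [L1c] describe functions of two points that behave like functions in
    L^4, L^2 and L^1: their size is controlled by a weight [G] at both points, and
    their change in the second point by a distance [d], up to a small multiple of the
    weight. Products behave as Hoelder's inequality predicts. *)
Definition L4c (Z : X -> X -> R) :=
  (exists2 c : R, 0 <= c & forall a b, Z a b ^+ 4 <= c * (G a + G b)) /\
  (exists2 c : R, 0 <= c & forall a b b', (Z a b' - Z a b) ^+ 4 <= c * d b b').

Definition L2c (Y : X -> X -> R) :=
  (exists2 c : R, 0 <= c & forall a b, Y a b ^+ 2 <= c * (G a + G b)) /\
  (forall e : R, 0 < e -> exists2 C : R, 0 <= C & forall a b b',
     (Y a b' - Y a b) ^+ 2 <= e * (G a + G b + G b') + C * d b b').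

Definition L1c (F : X -> X -> R) :=
  (exists2 c : R, 0 <= c & forall a b, `|F a b| <= c * (G a + G b)) /\
  (forall e : R, 0 < e -> exists2 C : R, 0 <= C & forall a b b',
     `|F a b' - F a b| <= e * (G a + G b + G b') + C * d b b').

Let SG (a b b' : X) : 0 <= G a + G b + G b'. Proof. by rewrite !addr_ge0. Qed.

Let sqr_add (x y : R) : (x + y) ^+ 2 <= 2 * (x ^+ 2 + y ^+ 2).
Proof. have := sqr_ge0 (x - y); rewrite sqrrB sqrrD; lra. Qed.

Let pow4_sub (x y : R) : (x - y) ^+ 4 <= 8 * (x ^+ 4 + y ^+ 4).
Proof.
have h1 := sqr_add x (- y); rewrite sqrrN in h1.
have h2 := sqr_add (x ^+ 2) (y ^+ 2); rewrite -!exprM in h2.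
have h3 : ((x - y) ^+ 2) ^+ 2 <= (2 * (x ^+ 2 + y ^+ 2)) ^+ 2.
  by rewrite lerXn2r ?nnegrE ?sqr_ge0// mulr_ge0// addr_ge0// sqr_ge0.
rewrite -exprM exprMn in h3; lra.
Qed.

Lemma L4cB Z1 Z2 : L4c Z1 -> L4c Z2 -> L4c (fun a b => Z1 a b - Z2 a b).
Proof.
move=> [[c1 c10 h1] [k1 k10 l1]] [[c2 c20 h2] [k2 k20 l2]]; split.
  exists (8 * (c1 + c2)); first by rewrite mulr_ge0// addr_ge0.
  by move=> a b; have := pow4_sub (Z1 a b) (Z2 a b); have := h1 a b; have := h2 a b; lra.
exists (8 * (k1 + k2)); first by rewrite mulr_ge0// addr_ge0.
move=> a b b'; have := pow4_sub (Z1 a b' - Z1 a b) (Z2 a b' - Z2 a b).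
have := l1 a b b'; have := l2 a b b'.
by rewrite (_ : Z1 a b' - Z2 a b' - (Z1 a b - Z2 a b) = Z1 a b' - Z1 a b - (Z2 a b' - Z2 a b)); [lra|ring].
Qed.

Lemma L2cM Z1 Z2 : L4c Z1 -> L4c Z2 -> L2c (fun a b => Z1 a b * Z2 a b).
Proof.
move=> [[c1 c10 h1] [k1 k10 l1]] [[c2 c20 h2] [k2 k20 l2]]; split.
  exists (c1 + c2); first exact: addr_ge0.
  move=> a b; have := h1 a b; have := h2 a b; rewrite exprMn.
  have := young (Z1 a b ^+ 2) (Z2 a b ^+ 2) (ltr01 : 0 < (1 : R)).
  rewrite -!exprM invr1 !mul1r; have := exprn_even_ge0 (Z1 a b) (isT : ~~ odd 4).
  by have := exprn_even_ge0 (Z2 a b) (isT : ~~ odd 4); lra.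
move=> e e0; have c0 : 0 < c1 + c2 + 1 by rewrite ltr_wpDl// addr_ge0.
pose n := e / (c1 + c2 + 1); have n0 : 0 < n by rewrite divr_gt0.
exists (n^-1 * (k1 + k2)); first by rewrite mulr_ge0 ?addr_ge0// invr_ge0 ltW.
move=> a b b'; set x := Z1 a b' - Z1 a b; set y := Z2 a b' - Z2 a b.
have -> : Z1 a b' * Z2 a b' - Z1 a b * Z2 a b = x * Z2 a b' + Z1 a b * y by rewrite /x /y; ring.
apply: le_trans (sqr_add _ _) _; rewrite !exprMn.
have e1 := young (Z2 a b' ^+ 2) (x ^+ 2) n0; have e2 := young (Z1 a b ^+ 2) (y ^+ 2) n0.
rewrite -!exprM in e1 e2; have f1 := l1 a b b'; have f2 := l2 a b b'; have f3 := h1 a b; have f4 := h2 a b'.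
rewrite -/x in f1; rewrite -/y in f2.
have m1 : n * Z2 a b' ^+ 4 <= n * (c2 * (G a + G b')) by rewrite ler_pM2l.
have m2 : n * Z1 a b ^+ 4 <= n * (c1 * (G a + G b)) by rewrite ler_pM2l.
have m3 : n^-1 * x ^+ 4 <= n^-1 * (k1 * d b b') by rewrite ler_pM2l// invr_gt0.
have m4 : n^-1 * y ^+ 4 <= n^-1 * (k2 * d b b') by rewrite ler_pM2l// invr_gt0.
have m5 : n * (c2 * (G a + G b')) + n * (c1 * (G a + G b)) <= e * (G a + G b + G b').
  rewrite -mulrDr [leRHS](_ : _ = n * ((c1 + c2 + 1) * (G a + G b + G b'))).
    rewrite ler_pM2l//; have ga := G0 a; have gb := G0 b; have gb' := G0 b'.
    have := mulr_ge0 c10 gb'; have := mulr_ge0 c20 gb; lra.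
  by rewrite /n; field; rewrite gt_eqF.
by rewrite mulrDr mulrDl; lra.
Qed.

Lemma L2cD Y1 Y2 : L2c Y1 -> L2c Y2 -> L2c (fun a b => Y1 a b + Y2 a b).
Proof.
move=> [[c1 c10 h1] l1] [[c2 c20 h2] l2]; split.
  exists (2 * (c1 + c2)); first by rewrite mulr_ge0// addr_ge0.
  by move=> a b; have := sqr_add (Y1 a b) (Y2 a b); have := h1 a b; have := h2 a b; lra.
move=> e e0; have e4 : 0 < e / 4 by rewrite divr_gt0.
have [C1 C10 k1] := l1 _ e4; have [C2 C20 k2] := l2 _ e4.
exists (2 * (C1 + C2)); first by rewrite mulr_ge0// addr_ge0.
move=> a b b'; have := sqr_add (Y1 a b' - Y1 a b) (Y2 a b' - Y2 a b).
have := k1 a b b'; have := k2 a b b'.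
by rewrite (_ : Y1 a b' + Y2 a b' - (Y1 a b + Y2 a b) = Y1 a b' - Y1 a b + (Y2 a b' - Y2 a b)); [lra|ring].
Qed.

Lemma L2cN Y : L2c Y -> L2c (fun a b => - Y a b).
Proof.
move=> [[c c0 h] l]; split; first by exists c => // a b; rewrite sqrrN.
move=> e /l[C C0 k]; exists C => // a b b'.
by rewrite (_ : - Y a b' - - Y a b = - (Y a b' - Y a b)) ?sqrrN//; ring.
Qed.

(** Hoelder's inequality, as a modulus of continuity. *)
Lemma L1cM Y1 Y2 : L2c Y1 -> L2c Y2 -> L1c (fun a b => Y1 a b * Y2 a b).
Proof.
have yng (x y n : R) : 0 < n -> `|x * y| <= (n * x ^+ 2 + n^-1 * y ^+ 2) / 2.
  move=> n0; rewrite normrM; apply: le_trans (young `|x| `|y| n0) _.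
  by rewrite !real_normK ?num_real.
move=> [[c1 c10 h1] l1] [[c2 c20 h2] l2]; split.
  exists (c1 + c2); first exact: addr_ge0.
  move=> a b; have := h1 a b; have := h2 a b.
  have := yng (Y1 a b) (Y2 a b) 1 ltr01.
  by rewrite invr1 !mul1r; have := sqr_ge0 (Y1 a b); have := sqr_ge0 (Y2 a b); lra.
move=> e e0; have c0 : 0 < c1 + c2 + 2 by rewrite ltr_wpDl// addr_ge0.
pose n := e / (c1 + c2 + 2); have n0 : 0 < n by rewrite divr_gt0.
have [C1 C10 k1] := l1 _ (exprn_gt0 2 n0); have [C2 C20 k2] := l2 _ (exprn_gt0 2 n0).
exists (n^-1 * (C1 + C2)); first by rewrite mulr_ge0 ?addr_ge0// invr_ge0 ltW.
move=> a b b'; set x := Y1 a b' - Y1 a b; set y := Y2 a b' - Y2 a b.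
have -> : Y1 a b' * Y2 a b' - Y1 a b * Y2 a b = Y2 a b' * x + Y1 a b * y by rewrite /x /y; ring.
apply: le_trans (ler_normD _ _) _.
have e1 := yng (Y2 a b') x _ n0; have e2 := yng (Y1 a b) y _ n0.
have f1 := k1 a b b'; have f2 := k2 a b b'; have f3 := h1 a b; have f4 := h2 a b'.
rewrite -/x in f1; rewrite -/y in f2.
have m1 : n * Y2 a b' ^+ 2 <= n * (c2 * (G a + G b')) by rewrite ler_pM2l.
have m2 : n * Y1 a b ^+ 2 <= n * (c1 * (G a + G b)) by rewrite ler_pM2l.
set S := G a + G b + G b' in f1 f2 *.
have nv : n^-1 * (n ^+ 2 * S) = n * S by field; rewrite gt_eqF.
have m3 : n^-1 * x ^+ 2 <= n * S + n^-1 * (C1 * d b b').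
  by rewrite -nv -mulrDr ler_pM2l// invr_gt0.
have m4 : n^-1 * y ^+ 2 <= n * S + n^-1 * (C2 * d b b').
  by rewrite -nv -mulrDr ler_pM2l// invr_gt0.
have m5 : n * (c2 * (G a + G b')) + n * (c1 * (G a + G b)) + 2 * (n * S) <= e * S.
  rewrite -mulrDr [X in _ + X]mulrCA -mulrDr [leRHS](_ : _ = n * ((c1 + c2 + 2) * S)).
    rewrite ler_pM2l// /S; have ga := G0 a; have gb := G0 b; have gb' := G0 b'.
    have := mulr_ge0 c10 gb'; have := mulr_ge0 c20 gb; lra.
  by rewrite /n; field; rewrite gt_eqF.
have s1 : 0 <= e * S by apply: mulr_ge0; [exact: ltW|exact: SG].
have s2 : 0 <= n^-1 * (C1 * d b b') by rewrite !mulr_ge0// invr_ge0 ltW.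
have s3 : 0 <= n^-1 * (C2 * d b b') by rewrite !mulr_ge0// invr_ge0 ltW.
have -> : n^-1 * (C1 + C2) * d b b' = n^-1 * (C1 * d b b') + n^-1 * (C2 * d b b') by ring.
lra.
Qed.

Lemma L1cD F1 F2 : L1c F1 -> L1c F2 -> L1c (fun a b => F1 a b + F2 a b).
Proof.
move=> [[c1 c10 h1] l1] [[c2 c20 h2] l2]; split.
  exists (c1 + c2); first by rewrite addr_ge0.
  by move=> a b; have := ler_normD (F1 a b) (F2 a b); have := h1 a b; have := h2 a b; lra.
move=> e e0; have e2 : 0 < e / 2 by rewrite divr_gt0.
have [C1 C10 k1] := l1 _ e2; have [C2 C20 k2] := l2 _ e2.
exists (C1 + C2); first by rewrite addr_ge0.
move=> a b b'; have := ler_normD (F1 a b' - F1 a b) (F2 a b' - F2 a b).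
have := k1 a b b'; have := k2 a b b'.
by rewrite (_ : F1 a b' + F2 a b' - (F1 a b + F2 a b) = F1 a b' - F1 a b + (F2 a b' - F2 a b)); [lra|ring].
Qed.

Lemma L1cZ k F : L1c F -> L1c (fun a b => k * F a b).
Proof.
move=> [[c c0 h] l]; split.
  exists (`|k| * c); first by rewrite mulr_ge0.
  by move=> a b; rewrite normrM -mulrA ler_wpM2l.
move=> e e0; have k0 : 0 < `|k| + 1 by rewrite ltr_wpDl.
have [C C0 h'] := l _ (divr_gt0 e0 k0); exists (`|k| * C); first by rewrite mulr_ge0.
move=> a b b'; rewrite -mulrBr normrM; apply: le_trans (ler_wpM2l (normr_ge0 k) (h' a b b')) _.
set S := G a + G b + G b'; set w := e / (`|k| + 1).
have wS : 0 <= w * S by apply: mulr_ge0; [exact/ltW/divr_gt0|exact: SG].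
have eS : (`|k| + 1) * w = e by rewrite /w; field; rewrite gt_eqF.
rewrite -eS mulrDr mulrDl mul1r mulrDl !mulrA -/(w * S) -addrA lerD2l addrC lerDl.
exact: wS.
Qed.

End tame_functions.

Section tame_integrals.
Variables (R : realType) (G : pt4 R -> R) (d : pt4 R -> pt4 R -> R).
Hypotheses (G0 : forall a : pt4 R, 0 <= G a) (Gi : L1 (tor4 R) G) (pG : per4 G).
Hypothesis pd : forall z : pt4 R, per4 (fun q => d q (q + z)).
Hypothesis d_small : forall e : R, 0 < e -> exists2 r : R, 0 < r & forall z : pt4 R, `|z| <= r ->
  L1 (tor4 R) (fun q => d q (q + z)) /\ \int[tor4 R]_q d q (q + z) <= e.
Variable F : pt4 R -> pt4 R -> R.
Hypothesis tF : L1c G d F.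
Hypothesis mF : measurable_fun setT (fun z : pt4 R * pt4 R => F z.1 (z.1 + z.2)).

Lemma measurable_slice2 (z : pt4 R) : measurable_fun setT (fun q : pt4 R => F q (q + z)).
Proof.
have mp : measurable_fun setT (fun q : pt4 R => (q, z)) by exact: measurable_fun_pair.
exact: (measurableT_comp mF mp).
Qed.

Lemma tame_L1 (z : pt4 R) : L1 (tor4 R) (fun q => F q (q + z)).
Proof.
have [[c c0 h] _] := tF.
apply: (@L1_le _ _ _ (tor4 R) _ _ (measurable_slice2 z) (L1Z c (L1D Gi (L1_shift4 z pG Gi)))) => q.
exact: h.
Qed.

Lemma tame_bounded : exists2 C : R, 0 <= C & forall z : pt4 R, \int[tor4 R]_q `|F q (q + z)| <= C.
Proof.
have [[c c0 h] _] := tF; exists (c * (\int[tor4 R]_q G q + \int[tor4 R]_q G q)).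
  by rewrite mulr_ge0// addr_ge0// Int_ge0.
move=> z; have i2 := L1_shift4 z pG Gi; have i := L1D Gi i2.
apply: (le_trans (le_Int (L1_norm (tame_L1 z)) (L1Z c i) (fun q => h q (q + z)))).
by rewrite (IntZ _ i) (IntD Gi i2) (Int_shift4 z pG Gi).
Qed.

(** Translation is continuous in the mean on every tame product of fields. *)
Lemma tame_small (e : R) : 0 < e -> exists2 r : R, 0 < r & forall z z' : pt4 R, `|z' - z| <= r ->
  \int[tor4 R]_q `|F q (q + z') - F q (q + z)| <= e.
Proof.
move=> e0; have [_ h] := tF; pose g := \int[tor4 R]_q G q.
have g0 : 0 <= g by exact: Int_ge0.
have g6 : 0 < 6 * (g + 1) by rewrite mulr_gt0// ltr_wpDl.
have [C C0 hC] := h _ (divr_gt0 e0 g6).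
have C1 : 0 < 2 * (C + 1) by rewrite mulr_gt0// ltr_wpDl.
have [r r0 hr] := d_small (divr_gt0 e0 C1).
exists r => // z z' /hr[di dle].
have i2 := L1_shift4 z pG Gi; have i3 := L1_shift4 z' pG Gi; have i12 := L1D Gi i2; have i := L1D i12 i3.
have ds := L1_shift4 z (@pd (z' - z)) di.
have dsE (q : pt4 R) : d (q + z) (q + z + (z' - z)) = d (q + z) (q + z').
  by congr d; rewrite -addrA [z + _]addrC subrK.
have ds' : L1 (tor4 R) (fun q => d (q + z) (q + z')) by apply: eq_L1 ds => q; exact: dsE.
have dI : \int[tor4 R]_q d (q + z) (q + z') <= e / (2 * (C + 1)).
  apply: le_trans dle; rewrite -(Int_shift4 z (@pd (z' - z)) di) le_eqVlt; apply/orP; left.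
  by apply/eqP/eq_Int => q; rewrite dsE.
have iR := L1D (L1Z (e / (6 * (g + 1))) i) (L1Z C ds').
apply: (le_trans (le_Int (L1_norm (L1B (tame_L1 z') (tame_L1 z))) iR (fun q => hC q (q + z) (q + z')))).
rewrite (IntD (L1Z _ i) (L1Z _ ds')) (IntZ _ i) (IntZ _ ds') (IntD i12 i3) (IntD Gi i2).
rewrite (Int_shift4 z pG Gi) (Int_shift4 z' pG Gi) -/g.
have h1 : e / (6 * (g + 1)) * (g + g + g) <= e / 2.
  rewrite mulrAC ler_pdivrMr// (_ : e / 2 * (6 * (g + 1)) = e * (3 * (g + 1))); last by field.
  by rewrite ler_pM2l//; lra.
have h2 : C * \int[tor4 R]_q d (q + z) (q + z') <= e / 2.
  apply: le_trans (ler_wpM2l C0 dI) _.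
  rewrite mulrA ler_pdivrMr// (_ : e / 2 * (2 * (C + 1)) = e * (C + 1)); last by field.
  by rewrite mulrC ler_pM2l//; lra.
lra.
Qed.

End tame_integrals.

(** * The energy identity for increments *)

Section null_functions.
Context d (X : measurableType d) (R : realType) (m : {measure set X -> \bar R}).

Definition null (J : X -> R) := L1 m J /\ \int[m]_x J x = 0.

Lemma nullD J1 J2 : null J1 -> null J2 -> null (fun x => J1 x + J2 x).
Proof. by move=> [i1 e1] [i2 e2]; split; [exact: L1D|rewrite (IntD i1 i2) e1 e2 addr0]. Qed.

Lemma nullZ k J : null J -> null (fun x => k * J x).
Proof. by move=> [i e]; split; [exact: L1Z|rewrite (IntZ _ i) e mulr0]. Qed.

Lemma eq_null J1 J2 : (forall x, J1 x = J2 x) -> null J1 -> null J2.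
Proof. by move=> /funext ->. Qed.

End null_functions.

Section explicit_terms.
Variable R : realType.
Implicit Types (K phi g : pt4 R -> R) (z : pt4 R * pt4 R).

Let sum4 (f : 'I_5 -> R) : \sum_(i < 5 | i != ord0) f i =
  f (@Ordinal 5 1 isT) + f (@Ordinal 5 2 isT) + f (@Ordinal 5 3 isT) + f (@Ordinal 5 4 isT).
Proof. by rewrite big_mkcond sum5 /= add0r. Qed.

Lemma XtermE (f0 ft fx fy fz : pt4 R -> R) K phi g z : Xterm (flux5 f0 ft fx fy fz) K phi g z =
  K z.2 * (f0 (z.1 + z.2) * (phi z.1 * g z.1))
  + 'D_(et4 R) K z.2 * (ft (z.1 + z.2) * (phi z.1 * g z.1))
  + 'D_(ex4 R) K z.2 * (fx (z.1 + z.2) * (phi z.1 * g z.1))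
  + 'D_(ey4 R) K z.2 * (fy (z.1 + z.2) * (phi z.1 * g z.1))
  + 'D_(ez4 R) K z.2 * (fz (z.1 + z.2) * (phi z.1 * g z.1)).
Proof.
exact: (sum5 (fun i => Dop i K z.2 * (flux5 f0 ft fx fy fz i (z.1 + z.2) * (phi z.1 * g z.1)))).
Qed.

Lemma YtermE (f0 ft fx fy fz : pt4 R -> R) K phi g z : Yterm (flux5 f0 ft fx fy fz) K phi g z =
  f0 z.1 * phi z.1 * K z.2 * g (z.1 + z.2)
  + (ft z.1 * ('D_(et4 R) phi z.1 * K z.2 - phi z.1 * 'D_(et4 R) K z.2) * g (z.1 + z.2)
  + fx z.1 * ('D_(ex4 R) phi z.1 * K z.2 - phi z.1 * 'D_(ex4 R) K z.2) * g (z.1 + z.2)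
  + fy z.1 * ('D_(ey4 R) phi z.1 * K z.2 - phi z.1 * 'D_(ey4 R) K z.2) * g (z.1 + z.2)
  + fz z.1 * ('D_(ez4 R) phi z.1 * K z.2 - phi z.1 * 'D_(ez4 R) K z.2) * g (z.1 + z.2)).
Proof.
rewrite /Yterm; apply: congr2; first exact: erefl.
exact: (sum4 (fun i => flux5 f0 ft fx fy fz i z.1 * (Dop i phi z.1 * K z.2 - phi z.1 * Dop i K z.2) * g (z.1 + z.2))).
Qed.

(** The flux of a constant field is divergence free. *)
Lemma Int_derive_slab T phi (e : pt3 R) : test_fun T phi -> \int[tor4 R]_q 'D_((e, 0) : pt4 R) phi q = 0.
Proof.
move=> tp; set D : pt4 R := (e, 0); have td := test_fun_derive D tp.
have [C C0 hC] := test_fun_bounded (test_fun_derive D td).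
have L1t (th : pt4 R -> R) : test_fun T th -> L1 (tor4 R) th.
  move=> tt; have [c c0 hc] := test_fun_bounded tt.
  apply: (@L1_le _ _ _ (tor4 R) _ _ (test_fun_measurable tt) (L1Z c (@L1_slab R T))) => q.
  rewrite /slab; case: ifPn => qT; first by rewrite mulr1.
  by rewrite (test_fun_out tt qT) normr0 mulr0.
have i0 := L1t _ tp; have i1 := L1t _ td; have pp := test_fun_per4 tp.
have key (s : R) : 0 < s -> `|\int[tor4 R]_q 'D_D phi q| <= s * (C * \int[tor4 R]_q slab T q).
  move=> s0; pose J (q : pt4 R) := phi (q + s *: D) - phi q - s * 'D_D phi q.
  have iS := L1_shift4 (s *: D) pp i0.
  have iB := L1B iS i0; have iJ : L1 (tor4 R) J := L1B iB (L1Z s i1).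
  have JI : \int[tor4 R]_q J q = - (s * \int[tor4 R]_q 'D_D phi q).
    by rewrite /J (IntB iB (L1Z s i1)) (IntB iS i0) (Int_shift4 _ pp i0) subrr sub0r (IntZ _ i1).
  have iC := L1Z (s ^+ 2 * C) (@L1_slab R T).
  have := norm_Int_le iJ iC _; rewrite JI normrN normrM (gtr0_norm s0) (IntZ _ (@L1_slab R T)) => H.
  rewrite -(ler_pM2l s0); apply: le_trans (H _) _ => [q|].
    rewrite /slab; case: ifPn => qT.
      by rewrite mulr1 -(gtr0_norm s0); exact: (smooth_taylor q s (test_fun_smooth tp) hC).
    have qT' : ~~ (0 < (q + s *: D).2 < T) by rewrite /= scaler0 addr0.
    by rewrite /J (test_fun_out tp qT) (test_fun_out tp qT') (test_fun_out td qT) mulr0 !subr0 normr0 mulr0.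
  by rewrite le_eqVlt; apply/orP; left; apply/eqP; ring.
apply/eqP; rewrite -normr_le0; apply/ler_addgt0Pr => x x0; rewrite add0r.
set S := C * _ in key; have S0 : 0 <= S by rewrite mulr_ge0// Int_ge0// => q; rewrite /slab; case: ifP.
have S1 : 0 < S + 1 by rewrite ltr_wpDl.
apply: le_trans (key _ (divr_gt0 x0 S1)) _.
by rewrite mulrAC ler_pdivrMr// ler_pM2l// lerDl.
Qed.

End explicit_terms.


Section moduli_of_a_solution.
Variables (R : realType) (T Om M0 : R) (U V W P : pt4 R -> R).
Hypothesis sol : torus_solution T Om M0 U V W P.

Definition mass (q : pt4 R) : R := bulk T U V q + W q ^+ 2 + P q ^+ 2.

Definition gap_of_fields (b b' : pt4 R) : R :=
  (U b' - U b) ^+ 4 + (V b' - V b) ^+ 4 + (U b' - U b) ^+ 2 + (V b' - V b) ^+ 2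
  + (W b' - W b) ^+ 2 + (P b' - P b) ^+ 2.

Local Notation G := mass.
Local Notation d := gap_of_fields.

Let pU : per4 U. Proof. by have [] := ts_per sol. Qed.
Let pV : per4 V. Proof. by have [] := ts_per sol. Qed.
Let pW : per4 W. Proof. by have [] := ts_per sol. Qed.
Let pP : per4 P. Proof. by have [] := ts_per sol. Qed.
Let mU : measurable_fun setT U. Proof. by have [] := ts_meas sol. Qed.
Let mV : measurable_fun setT V. Proof. by have [] := ts_meas sol. Qed.
Let mW : measurable_fun setT W. Proof. by have [] := ts_meas sol. Qed.
Let mP : measurable_fun setT P. Proof. by have [_ _ _ h] := ts_int sol; exact: L1_measurable h. Qed.

Let e4 (x : R) : 0 <= x ^+ 4. Proof. exact: exprn_even_ge0. Qed.
Let e2 (x : R) : 0 <= x ^+ 2. Proof. exact: sqr_ge0. Qed.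

Lemma bulk_ge0 (q : pt4 R) : 0 <= bulk T U V q.
Proof. by have [h _ _ _ _] := bulk_ge sol q; exact: le_trans h. Qed.

Lemma mass_ge0 (q : pt4 R) : 0 <= G q.
Proof. by apply: addr_ge0; [apply: addr_ge0; [exact: bulk_ge0|exact: e2]|exact: e2]. Qed.

Let mass3 (a b b' : pt4 R) : 0 <= G a + G b + G b'.
Proof. exact: (addr_ge0 (addr_ge0 (mass_ge0 a) (mass_ge0 b)) (mass_ge0 b')). Qed.

Lemma L1_mass : L1 (tor4 R) G.
Proof. by have [_ _ h _] := ts_int sol; exact: (L1D (L1D (L1_bulk sol) h) (pressure_L2 sol)). Qed.

Lemma per4_mass : per4 G.
Proof.
move=> t x; rewrite /mass /bulk /slab.
by have [-> -> ->] := pU t x; have [-> -> ->] := pV t x; have [-> -> ->] := pW t x; have [-> -> ->] := pP t x.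
Qed.

Lemma gap_of_fields_ge0 a b : 0 <= d a b.
Proof. by rewrite /gap_of_fields !addr_ge0 ?e4 ?e2. Qed.

Lemma per4_gap_of_fields (z : pt4 R) : per4 (fun q => d q (q + z)).
Proof.
move=> t x; rewrite /gap_of_fields.
have s (f : pt4 R -> R) (pf : per4 f) := per4_shift z pf t x.
have [-> -> ->] := pU t x; have [-> -> ->] := pV t x; have [-> -> ->] := pW t x; have [-> -> ->] := pP t x.
by have [-> -> ->] := s _ pU; have [-> -> ->] := s _ pV; have [-> -> ->] := s _ pW; have [-> -> ->] := s _ pP.
Qed.

(** Translations are continuous in L^4 on the horizontal velocity, and in L^2 on the
    vertical velocity and the pressure; the latter is why the pressure has to be
    square integrable. *)
Lemma gap_of_fields_small (e : R) : 0 < e -> exists2 r : R, 0 < r & forall z : pt4 R, `|z| <= r ->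
  L1 (tor4 R) (fun q => d q (q + z)) /\ \int[tor4 R]_q d q (q + z) <= e.
Proof.
move=> e0; have e6 : 0 < e / 6 by rewrite divr_gt0.
have s4 (f : pt4 R -> R) : per4 f -> measurable_fun setT f -> L1 (tor4 R) (fun q => f q ^+ 4) ->
    exists2 r : R, 0 < r & forall z : pt4 R, `|z| <= r -> L1 (tor4 R) (fun q => (f (q + z) - f q) ^+ 4) /\
      \int[tor4 R]_q (f (q + z) - f q) ^+ 4 <= e / 6.
  by move=> pf mf fi; apply: (@shift_small_pow R f 4 8 (e / 6)) => //; exact: pow4_diff_le.
have s2 (f : pt4 R -> R) : per4 f -> measurable_fun setT f -> L1 (tor4 R) (fun q => f q ^+ 2) ->
    exists2 r : R, 0 < r & forall z : pt4 R, `|z| <= r -> L1 (tor4 R) (fun q => (f (q + z) - f q) ^+ 2) /\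
      \int[tor4 R]_q (f (q + z) - f q) ^+ 2 <= e / 6.
  move=> pf mf fi; apply: (@shift_small_pow R f 2 2 (e / 6)) => // a b /=.
  by rewrite !expr1; exact: sqr_diff_le.
have [i1 i2 i3 _] := ts_int sol.
have [r1 r10 h1] := s4 _ pU mU i1; have [r2 r20 h2] := s4 _ pV mV i2.
have [r3 r30 h3] := s2 _ pU mU (L1_U2 sol); have [r4 r40 h4] := s2 _ pV mV (L1_V2 sol).
have [r5 r50 h5] := s2 _ pW mW i3; have [r6 r60 h6] := s2 _ pP mP (pressure_L2 sol).
exists (Num.min r1 (Num.min r2 (Num.min r3 (Num.min r4 (Num.min r5 r6))))).
  by rewrite !lt_min r10 r20 r30 r40 r50 r60.
move=> z; rewrite !le_min => /andP[z1 /andP[z2 /andP[z3 /andP[z4 /andP[z5 z6]]]]].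
have [j1 k1] := h1 _ z1; have [j2 k2] := h2 _ z2; have [j3 k3] := h3 _ z3.
have [j4 k4] := h4 _ z4; have [j5 k5] := h5 _ z5; have [j6 k6] := h6 _ z6.
have j12 := L1D j1 j2; have j123 := L1D j12 j3; have j1234 := L1D j123 j4; have j15 := L1D j1234 j5.
split; first exact: (L1D j15 j6).
rewrite (IntD j15 j6) (IntD j1234 j5) (IntD j123 j4) (IntD j12 j3) (IntD j1 j2).
have -> : e = e / 6 + e / 6 + e / 6 + e / 6 + e / 6 + e / 6 by field.
by do 5 (apply: lerD => //).
Qed.

Lemma L2c_left (f : pt4 R -> R) : (forall q : pt4 R, f q ^+ 2 <= G q) -> L2c G d (fun a _ => f a).
Proof.
move=> fG; split.
  by exists 1 => // a b; rewrite mul1r; apply: le_trans (fG a) _; rewrite lerDl mass_ge0.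
move=> e e0; exists 0 => // a b b'; rewrite subrr expr0n mul0r addr0 mulr_ge0 ?(ltW e0)//.
Qed.

Lemma L2c_right (f : pt4 R -> R) : (forall q : pt4 R, f q ^+ 2 <= G q) ->
  (forall b b' : pt4 R, (f b' - f b) ^+ 2 <= d b b') -> L2c G d (fun _ b => f b).
Proof.
move=> fG fd; split.
  by exists 1 => // a b; rewrite mul1r; apply: le_trans (fG b) _; rewrite lerDr mass_ge0.
move=> e e0; exists 1 => // a b b'; rewrite mul1r; apply: le_trans (fd b b') _.
by rewrite lerDr mulr_ge0 ?(ltW e0).
Qed.

Lemma L4c_left (f : pt4 R -> R) : (forall q : pt4 R, f q ^+ 4 <= G q) -> L4c G d (fun a _ => f a).
Proof.
move=> fG; split.
  by exists 1 => // a b; rewrite mul1r; apply: le_trans (fG a) _; rewrite lerDl mass_ge0.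
by exists 0 => // a b b'; rewrite subrr expr0n mul0r.
Qed.

Lemma L4c_right (f : pt4 R -> R) : (forall q : pt4 R, f q ^+ 4 <= G q) ->
  (forall b b' : pt4 R, (f b' - f b) ^+ 4 <= d b b') -> L4c G d (fun _ b => f b).
Proof.
move=> fG fd; split.
  by exists 1 => // a b; rewrite mul1r; apply: le_trans (fG b) _; rewrite lerDr mass_ge0.
by exists 1 => // a b b'; rewrite mul1r.
Qed.

Let bulk_mass (q : pt4 R) : bulk T U V q <= G q.
Proof. by rewrite /mass -addrA lerDl addr_ge0. Qed.

Let U4 (q : pt4 R) : U q ^+ 4 <= G q.
Proof. by have [_ _ h _ _] := bulk_ge sol q; exact: le_trans h (bulk_mass q). Qed.
Let V4 (q : pt4 R) : V q ^+ 4 <= G q.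
Proof. by have [_ _ _ h _] := bulk_ge sol q; exact: le_trans h (bulk_mass q). Qed.
Let U2 (q : pt4 R) : U q ^+ 2 <= G q.
Proof. by have [h _ _ _ _] := bulk_ge sol q; exact: le_trans h (bulk_mass q). Qed.
Let V2 (q : pt4 R) : V q ^+ 2 <= G q.
Proof. by have [_ h _ _ _] := bulk_ge sol q; exact: le_trans h (bulk_mass q). Qed.
Let W2 (q : pt4 R) : W q ^+ 2 <= G q.
Proof. by rewrite /mass addrAC lerDr; apply: addr_ge0; [exact: bulk_ge0|exact: e2]. Qed.
Let P2 (q : pt4 R) : P q ^+ 2 <= G q.
Proof. by rewrite /mass lerDr; apply: addr_ge0; [exact: bulk_ge0|exact: e2]. Qed.

Let dle (b b' : pt4 R) : [/\ (U b' - U b) ^+ 4 <= d b b', (V b' - V b) ^+ 4 <= d b b',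
  (U b' - U b) ^+ 2 <= d b b', (V b' - V b) ^+ 2 <= d b b' &
  (W b' - W b) ^+ 2 <= d b b' /\ (P b' - P b) ^+ 2 <= d b b'].
Proof.
rewrite /gap_of_fields; have := e4 (U b' - U b); have := e4 (V b' - V b); have := e2 (U b' - U b).
have := e2 (V b' - V b); have := e2 (W b' - W b); have := e2 (P b' - P b).
by move=> *; split; [lra|lra|lra|lra|split; lra].
Qed.

Lemma L4_U : L4c G d (fun a _ => U a) /\ L4c G d (fun _ b => U b).
Proof. by split; [exact: L4c_left|apply: L4c_right => // b b'; have [] := dle b b']. Qed.
Lemma L4_V : L4c G d (fun a _ => V a) /\ L4c G d (fun _ b => V b).
Proof. by split; [exact: L4c_left|apply: L4c_right => // b b'; have [] := dle b b']. Qed.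
Lemma L2_U : L2c G d (fun a _ => U a) /\ L2c G d (fun _ b => U b).
Proof. by split; [exact: L2c_left|apply: L2c_right => // b b'; have [] := dle b b']. Qed.
Lemma L2_V : L2c G d (fun a _ => V a) /\ L2c G d (fun _ b => V b).
Proof. by split; [exact: L2c_left|apply: L2c_right => // b b'; have [] := dle b b']. Qed.
Lemma L2_W : L2c G d (fun a _ => W a) /\ L2c G d (fun _ b => W b).
Proof. by split; [exact: L2c_left|apply: L2c_right => // b b'; have [_ _ _ _ []] := dle b b']. Qed.
Lemma L2_P : L2c G d (fun a _ => P a) /\ L2c G d (fun _ b => P b).
Proof. by split; [exact: L2c_left|apply: L2c_right => // b b'; have [_ _ _ _ []] := dle b b']. Qed.

Definition corr (a b : pt4 R) : R := U a * U b + V a * V b.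
Definition kin (a : pt4 R) : R := U a ^+ 2 + V a ^+ 2.
Definition incr_flux (f : pt4 R -> R) (a b : pt4 R) : R :=
  (f b - f a) * ((U b - U a) ^+ 2 + (V b - V a) ^+ 2).
(** The flux that accompanies twice the two-point energy [corr]: transport of [corr] by
    the field at the first point, transport of the energy at the second point by the
    increment, and the work of the pressure. *)
Definition bal_flux (f : pt4 R -> R) (a b : pt4 R) : R :=
  2 * corr a b * f a + (f b - f a) * kin b + 2 * (P b * f a + P a * f b).

Definition L2_field (f : pt4 R -> R) := L2c G d (fun a _ => f a) /\ L2c G d (fun _ b => f b).

Let D2 Y1 Y2 : L2c G d Y1 -> L2c G d Y2 -> L2c G d (fun a b => Y1 a b + Y2 a b).
Proof. by move=> h1 h2; apply: L2cD. Qed.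
Let M2 Z1 Z2 : L4c G d Z1 -> L4c G d Z2 -> L2c G d (fun a b => Z1 a b * Z2 a b).
Proof. by move=> h1 h2; apply: L2cM => //; exact: mass_ge0. Qed.
Let M1 Y1 Y2 : L2c G d Y1 -> L2c G d Y2 -> L1c G d (fun a b => Y1 a b * Y2 a b).
Proof. by move=> h1 h2; apply: L1cM => //; [exact: mass_ge0|exact: gap_of_fields_ge0]. Qed.
Let D1 F1 F2 : L1c G d F1 -> L1c G d F2 -> L1c G d (fun a b => F1 a b + F2 a b).
Proof. by move=> h1 h2; apply: L1cD. Qed.
Let Z1 k F : L1c G d F -> L1c G d (fun a b => k * F a b).
Proof. by move=> h; apply: L1cZ => //; exact: mass_ge0. Qed.

Lemma L2_corr : L2c G d corr.
Proof. by have [u1 u2] := L4_U; have [v1 v2] := L4_V; exact: (D2 (M2 u1 u2) (M2 v1 v2)). Qed.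

Lemma L2_kin_right : L2c G d (fun _ b => kin b).
Proof. by have [u1 u2] := L4_U; have [v1 v2] := L4_V; exact: (D2 (M2 u2 u2) (M2 v2 v2)). Qed.

Let L2_sub (f : pt4 R -> R) : L2_field f -> L2c G d (fun a b => f b - f a).
Proof. by move=> [f1 f2]; exact: (D2 f2 (L2cN f1)). Qed.

Lemma tame_corr : L1c G d corr.
Proof.
have [u1 u2] := L2_U; have [v1 v2] := L2_V.
exact: (D1 (M1 u1 u2) (M1 v1 v2)).
Qed.

Lemma tame_incr_flux (f : pt4 R -> R) : L2_field f -> L1c G d (incr_flux f).
Proof.
move=> hf; have [u1 u2] := L4_U; have [v1 v2] := L4_V.
have du := L4cB u2 u1; have dv := L4cB v2 v1.
exact: (M1 (L2_sub hf) (D2 (M2 du du) (M2 dv dv))).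
Qed.

Lemma tame_bal_flux (f : pt4 R -> R) : L2_field f -> L1c G d (bal_flux f).
Proof.
move=> hf; have [f1 f2] := hf; have [p1 p2] := L2_P.
have h1 : L1c G d (fun a b => 2 * (corr a b * f a)) := Z1 2 (M1 L2_corr f1).
have h2 := M1 (L2_sub hf) L2_kin_right.
have h3 := Z1 2 (D1 (M1 p2 f1) (M1 p1 f2)).
have := D1 (D1 h1 h2) h3.
rewrite /bal_flux; congr (L1c _ _ _); apply/funext => a; apply/funext => b.
by rewrite mulrA.
Qed.

Lemma measurable_incr_flux (f : pt4 R -> R) : measurable_fun setT f ->
  measurable_fun setT (fun z : pt4 R * pt4 R => incr_flux f z.1 (z.1 + z.2)).
Proof.
move=> mf; apply: measurable_funM.
  exact: (measurable_funB (measurable_at12 mf) (measurable_at1 mf)).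
apply: measurable_funD; apply: measurable_funX.
  exact: (measurable_funB (measurable_at12 mU) (measurable_at1 mU)).
exact: (measurable_funB (measurable_at12 mV) (measurable_at1 mV)).
Qed.

Lemma measurable_corr : measurable_fun setT (fun z : pt4 R * pt4 R => corr z.1 (z.1 + z.2)).
Proof.
apply: measurable_funD.
  exact: (measurable_funM (measurable_at1 mU) (measurable_at12 mU)).
exact: (measurable_funM (measurable_at1 mV) (measurable_at12 mV)).
Qed.

Lemma measurable_bal_flux (f : pt4 R -> R) : measurable_fun setT f ->
  measurable_fun setT (fun z : pt4 R * pt4 R => bal_flux f z.1 (z.1 + z.2)).
Proof.
move=> mf; have f1 := measurable_at1 mf; have f2 := measurable_at12 mf.
apply: measurable_funD; [apply: measurable_funD|]; apply: measurable_funM => //.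
- by apply: measurable_funM => //; exact: measurable_corr.
- exact: measurable_funB.
- by apply: measurable_funD; apply: measurable_funX; [exact: measurable_at12 mU|exact: measurable_at12 mV].
- apply: measurable_funD; apply: measurable_funM => //; [exact: measurable_at12 mP|exact: measurable_at1 mP].
Qed.

End moduli_of_a_solution.

Lemma slab_algebra (R : realType) (k gA gB sA sB kd f fd : R) :
  sA * fd = fd -> sA * f = f -> sB * (kd * f) = kd * f ->
  kd * (sB * (f * gA)) + sA * (fd * k - f * kd) * gB = kd * f * gA + (fd * k - f * kd) * gB.
Proof.
move=> h1 h2 h3; rewrite (_ : kd * (sB * (f * gA)) = sB * (kd * f) * gA); last by ring.
by rewrite h3 mulrBr !mulrA h1 h2.
Qed.

Section increment_identity.
Variables (R : realType) (T Om M0 : R) (U V W P : pt4 R -> R).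
Hypothesis sol : torus_solution T Om M0 U V W P.

Local Notation G := (mass T U V W P).
Local Notation d := (gap_of_fields U V W P).
Local Notation E := (kin U V).

Variables (K : pt4 R -> R) (M h : R).
Hypotheses (sK : smooth K) (suK : supported M K).
Hypothesis Kh : forall z, h < `|z.2| -> K z = 0.
Variables (phi : pt4 R -> R) (a b : R).
Hypotheses (tphi : test_fun T phi) (h0 : 0 < h) (ah : 0 < a - h) (bh : b + h < T).
Hypothesis phi_ab : forall x t, phi (x, t) != 0 -> a <= t <= b.

Let pU : per4 U. Proof. by have [] := ts_per sol. Qed.
Let pV : per4 V. Proof. by have [] := ts_per sol. Qed.
Let pW : per4 W. Proof. by have [] := ts_per sol. Qed.
Let pP : per4 P. Proof. by have [] := ts_per sol. Qed.
Let mU : measurable_fun setT U. Proof. by have [] := ts_meas sol. Qed.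
Let mV : measurable_fun setT V. Proof. by have [] := ts_meas sol. Qed.
Let mW : measurable_fun setT W. Proof. by have [] := ts_meas sol. Qed.
Let iP : L1 (tor4 R) P. Proof. by have [_ _ _ i] := ts_int sol. Qed.
Let mP : measurable_fun setT P. Proof. exact: L1_measurable iP. Qed.

Let perD (f g : pt4 R -> R) : per4 f -> per4 g -> per4 (fun q => f q + g q).
Proof. by move=> pf pg t x; have [-> -> ->] := pf t x; have [-> -> ->] := pg t x. Qed.
Let perM (f g : pt4 R -> R) : per4 f -> per4 g -> per4 (fun q => f q * g q).
Proof. by move=> pf pg t x; have [-> -> ->] := pf t x; have [-> -> ->] := pg t x. Qed.
Let pE : per4 E. Proof. exact: (perD (perM pU pU) (perM pV pV)). Qed.
Let mE : measurable_fun setT E. Proof. by apply: measurable_funD; exact: measurable_funX. Qed.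

Definition dominated (f g : pt4 R -> R) :=
  exists2 c : R, 0 <= c & forall A B : pt4 R, `|f A * g B| <= c * (G A + G B).

Let domE (f g : pt4 R -> R) F : (forall A B : pt4 R, f A * g B = F A B) -> L1c G d F -> dominated f g.
Proof. by move=> fE [[c c0 hc] _]; exists c => // A B; rewrite fE. Qed.

Let dom0 (g : pt4 R -> R) : dominated (fun=> 0) g.
Proof.
exists 0 => // A B; by rewrite !mul0r normr0.
Qed.

Let dbl (f0 ft fx fy fz g : pt4 R -> R) : let F := flux5 f0 ft fx fy fz in
  (forall i, L1 (tor4 R) (F i)) -> (forall i, per4 (F i)) -> flux_eq T F ->
  measurable_fun setT g -> per4 g -> (forall i, dominated (F i) g) ->
  null (pairs R) (fun z => Xterm F K phi g z + Yterm F K phi g z).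
Proof.
move=> F Fi pF FE mg pg dm.
have /choice[c cP] : forall i, exists c : R, 0 <= c /\ forall A B : pt4 R, `|F i A * g B| <= c * (G A + G B).
  by move=> i; have [c c0 hc] := dm i; exists c.
have c0 i := (cP i).1; have hc i := (cP i).2.
pose C := \sum_i c i.
have hC i A B : `|F i A * g B| <= C * (G A + G B).
  apply: le_trans (hc i A B) _; apply: ler_wpM2r; first exact: (addr_ge0 (mass_ge0 sol _) (mass_ge0 sol _)).
  by rewrite /C (bigD1 i)//= lerDl sumr_ge0.
have X := doubling_X Fi pF FE sK suK Kh tphi h0 ah bh phi_ab (L1_mass sol) (per4_mass sol) mg pg hC.
have Y := doubling_Y Fi pF FE sK suK tphi (L1_mass sol) (per4_mass sol) mg pg hC.
exact: nullD X Y.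
Qed.

Let D2 Y1 Y2 : L2c G d Y1 -> L2c G d Y2 -> L2c G d (fun a b => Y1 a b + Y2 a b).
Proof. by move=> h1 h2; apply: L2cD. Qed.
Let M2 Z1 Z2 : L4c G d Z1 -> L4c G d Z2 -> L2c G d (fun a b => Z1 a b * Z2 a b).
Proof. by move=> h1 h2; apply: L2cM => //; exact: mass_ge0 sol. Qed.
Let M1 Y1 Y2 : L2c G d Y1 -> L2c G d Y2 -> L1c G d (fun a b => Y1 a b * Y2 a b).
Proof. by move=> h1 h2; apply: L1cM => //; [exact: mass_ge0 sol|exact: gap_of_fields_ge0]. Qed.
Let Z1 k F : L1c G d F -> L1c G d (fun a b => k * F a b).
Proof. by move=> hF; apply: L1cZ => //; exact: mass_ge0 sol. Qed.

Let flux_all (Q : (pt4 R -> R) -> Prop) f0 ft fx fy fz :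
  Q f0 -> Q ft -> Q fx -> Q fy -> Q fz -> forall i, Q (flux5 f0 ft fx fy fz i).
Proof. by move=> *; exact: flux5_ind. Qed.

Let i0 := L1_0 (tor4 R).
Let u41 := (L4_U sol).1. Let u42 := (L4_U sol).2. Let v41 := (L4_V sol).1. Let v42 := (L4_V sol).2.
Let u1 := (L2_U sol).1. Let u2 := (L2_U sol).2. Let v1 := (L2_V sol).1. Let v2 := (L2_V sol).2.
Let w1 := (L2_W sol).1. Let w2 := (L2_W sol).2. Let p1 := (L2_P sol).1. Let p2 := (L2_P sol).2.

Let nU : null (pairs R) (fun z => Xterm (flux5 (fun q => Om * V q) U (fun q => U q ^+ 2 + P q)
  (fun q => U q * V q) (fun q => U q * W q)) K phi U z + Yterm (flux5 (fun q => Om * V q) U (fun q => U q ^+ 2 + P q)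
  (fun q => U q * V q) (fun q => U q * W q)) K phi U z).
Proof.
apply: dbl => //; first apply: (flux_all (Q := L1 (tor4 R))).
- exact: (L1Z _ (L1_V sol)).
- exact: L1_U sol.
- exact: (L1D (L1_U2 sol) iP).
- exact: L1_UV sol.
- exact: L1_UW sol.
- apply: (flux_all (Q := per4 (R := R))) => //; [exact: perM|exact: (perD (perM pU pU))|exact: perM|exact: perM].
- exact: ts_eqU sol.
apply: (flux_all (Q := dominated ^~ U)).
- by apply: domE (Z1 Om (M1 v1 u2)) => A B; rewrite mulrA.
- exact: domE (M1 u1 u2).
- exact: domE (M1 (D2 (M2 u41 u41) p1) u2).
- exact: domE (M1 (M2 u41 v41) u2).
- by apply: domE (M1 (M2 u41 u42) w1) => A B; rewrite mulrAC.
Qed.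

Let nV : null (pairs R) (fun z => Xterm (flux5 (fun q => - Om * U q) V (fun q => U q * V q)
  (fun q => V q ^+ 2 + P q) (fun q => V q * W q)) K phi V z + Yterm (flux5 (fun q => - Om * U q) V
  (fun q => U q * V q) (fun q => V q ^+ 2 + P q) (fun q => V q * W q)) K phi V z).
Proof.
apply: dbl => //; first apply: (flux_all (Q := L1 (tor4 R))).
- exact: (L1Z _ (L1_U sol)).
- exact: L1_V sol.
- exact: L1_UV sol.
- exact: (L1D (L1_V2 sol) iP).
- exact: L1_VW sol.
- apply: (flux_all (Q := per4 (R := R))) => //; [exact: perM|exact: perM|exact: (perD (perM pV pV))|exact: perM].
- exact: ts_eqV sol.
apply: (flux_all (Q := dominated ^~ V)).
- by apply: domE (Z1 (- Om) (M1 u1 v2)) => A B; rewrite mulrA.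
- exact: domE (M1 v1 v2).
- exact: domE (M1 (M2 u41 v41) v2).
- exact: domE (M1 (D2 (M2 v41 v41) p1) v2).
- by apply: domE (M1 (M2 v41 v42) w1) => A B; rewrite mulrAC.
Qed.

Let ndiv (g : pt4 R -> R) : measurable_fun setT g -> per4 g -> L2c G d (fun _ b => g b) ->
  null (pairs R) (fun z => Xterm (flux5 (fun=> 0) (fun=> 0) U V W) K phi g z +
    Yterm (flux5 (fun=> 0) (fun=> 0) U V W) K phi g z).
Proof.
move=> mg pg g2; apply: dbl => //; first apply: (flux_all (Q := L1 (tor4 R))) => //.
- exact: L1_U sol.
- exact: L1_V sol.
- exact: L1_W sol.
- exact: (flux_all (Q := per4 (R := R))).
- exact: ts_div sol.
apply: (flux_all (Q := dominated ^~ g)) => //.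
- exact: domE (M1 u1 g2).
- exact: domE (M1 v1 g2).
- exact: domE (M1 w1 g2).
Qed.

Let nz : null (pairs R) (fun z => Xterm (flux5 (fun=> 0) (fun=> 0) (fun=> 0) (fun=> 0) P) K phi W z +
    Yterm (flux5 (fun=> 0) (fun=> 0) (fun=> 0) (fun=> 0) P) K phi W z).
Proof.
apply: dbl => //; first exact: (flux_all (Q := L1 (tor4 R))).
- exact: (flux_all (Q := per4 (R := R))).
- exact: ts_dz sol.
apply: (flux_all (Q := dominated ^~ W)) => //; exact: domE (M1 p1 w2).
Qed.

Let slab1 (q : pt4 R) : a - h <= q.2 <= b + h -> slab T q = 1.
Proof. by move=> /andP[q1 q2]; rewrite /slab (lt_le_trans ah q1) (le_lt_trans q2 bh). Qed.

Let slab_phi (z : pt4 R) e : slab T z * 'D_e phi z = 'D_e phi z /\ slab T z * phi z = phi z.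
Proof.
rewrite /slab; case: ifPn => qT; first by rewrite !mul1r.
by rewrite (test_fun_out tphi qT) (test_fun_out (test_fun_derive e tphi) qT) !mulr0.
Qed.

Let DK0 e z : h < `|z.2| -> 'D_e K z = 0.
Proof.
move=> hz; have -> : 'D_e K z = 'D_e (fun _ : pt4 R => 0 : R) z; last exact: derive_cst.
apply: near_eq_derive.
have cs : (fun q : pt4 R => `|q.2|) @ z --> `|z.2| by apply: cvg_norm; exact: cvg_snd.
have : \forall y \near z, h < `|y.2| by exact: (cvgr_gt _ cs).
by apply: filterS => y; exact: Kh.
Qed.

(** On the support of the integrand both points lie in the time interval. *)
Let slab_K e (z : pt4 R * pt4 R) : slab T (z.1 + z.2) * ('D_e K z.2 * phi z.1) = 'D_e K z.2 * phi z.1.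
Proof.
have [hz|hz] := ltP h `|z.2.2|; first by rewrite (DK0 e hz) mul0r mulr0.
have [->|p0] := eqVneq (phi z.1) 0; first by rewrite !mulr0.
rewrite slab1 ?mul1r//=.
have /andP[t1 t2] : a <= z.1.2 <= b by apply: (@phi_ab z.1.1); case: (z.1) p0.
by move: hz; rewrite ler_norml => /andP[s1 s2]; apply/andP; split; lra.
Qed.

Let ncst (D : pt4 R) (e : pt3 R) (f : pt4 R -> R) fx fy fz : D = (e, 0) ->
  measurable_fun setT f -> per4 f -> L2c G d (fun _ b => f b) ->
  (forall i, L1 (tor4 R) (flux5 (fun=> 0) (fun=> 0) fx fy fz i)) ->
  (forall i, flux5 (fun=> 0) (fun=> 0) fx fy fz i = (fun=> 0) \/
             flux5 (fun=> 0) (fun=> 0) fx fy fz i = slab T) ->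
  (forall (theta : pt4 R -> R) (q : pt4 R), fx q * 'D_(ex4 R) theta q + fy q * 'D_(ey4 R) theta q
    + fz q * 'D_(ez4 R) theta q = slab T q * 'D_D theta q) ->
  null (pairs R) (fun z => Xterm (flux5 (fun=> 0) (fun=> 0) fx fy fz) K phi (fun q => f q * E q) z +
    Yterm (flux5 (fun=> 0) (fun=> 0) fx fy fz) K phi (fun q => f q * E q) z).
Proof.
move=> De mf pf f2 Fi Fs Fe; apply: dbl => //.
- by move=> i; case: (Fs i) => ->.
- move=> theta tt; have td := test_fun_derive D tt.
  have I0 : \int[tor4 R]_q 'D_D theta q = 0 by rewrite De; exact: Int_derive_slab e tt.
  rewrite -[RHS]I0; apply: eq_Int => q; rewrite flux5E !mul0r !add0r Fe.
  by rewrite /slab; case: ifPn => qT; rewrite ?mul1r// (test_fun_out td qT) mulr0.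
- exact: measurable_funM.
- exact: perM.
have hfE := M1 f2 (L2_kin_right sol).
have [c c0 hc] := hfE.1.
move=> i; exists c => // A B; apply: le_trans (hc A B); rewrite normrM ler_piMl//.
by case: (Fs i) => ->; rewrite ?normr0// /slab; case: ifP; rewrite ?normr0 ?normr1.
Qed.

Definition increment_balance (z : pt4 R * pt4 R) : R :=
  'D_(ex4 R) K z.2 * (phi z.1 * incr_flux U V U z.1 (z.1 + z.2))
  + 'D_(ey4 R) K z.2 * (phi z.1 * incr_flux U V V z.1 (z.1 + z.2))
  + 'D_(ez4 R) K z.2 * (phi z.1 * incr_flux U V W z.1 (z.1 + z.2))
  - (K z.2 * ('D_(et4 R) phi z.1 * (2 * corr U V z.1 (z.1 + z.2)))
    + K z.2 * ('D_(ex4 R) phi z.1 * bal_flux U V P U z.1 (z.1 + z.2))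
    + K z.2 * ('D_(ey4 R) phi z.1 * bal_flux U V P V z.1 (z.1 + z.2))
    + K z.2 * ('D_(ez4 R) phi z.1 * bal_flux U V P W z.1 (z.1 + z.2))).

(** Both momentum equations are tested with the other point's velocity, the
    divergence equation with the energy and the pressure of the other point, the
    vertical pressure equation with the vertical velocity, and the trivial equation
    for a constant field with the flux of the energy. In this combination the
    Coriolis terms cancel, the pressure terms become fluxes, and the terms with
    derivatives of the kernel form the cubic expression in the increments. *)
Theorem increment_identity : null (pairs R) increment_balance.
Proof.
have iS := @L1_slab R T.
have nx := @ncst (ex4 R) (ex3 R) U (slab T) (fun=> 0) (fun=> 0) erefl mU pU u2.
have ny := @ncst (ey4 R) (ey3 R) V (fun=> 0) (slab T) (fun=> 0) erefl mV pV v2.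
have nw := @ncst (ez4 R) (ez3 R) W (fun=> 0) (fun=> 0) (slab T) erefl mW pW w2.
have {}nx : null (pairs R) (fun z => 'D_(ex4 R) K z.2 * phi z.1 * (U z.1 * E z.1) +
   ('D_(ex4 R) phi z.1 * K z.2 - phi z.1 * 'D_(ex4 R) K z.2) * (U (z.1 + z.2) * E (z.1 + z.2))).
  apply: eq_null (nx _ _ _) => [z|i|i|th q].
  - have [s1 s2] := slab_phi z.1 (ex4 R); have s3 := slab_K (ex4 R) z; rewrite XtermE YtermE.
    apply: etrans (slab_algebra (K z.2) (U z.1 * E z.1) (U (z.1 + z.2) * E (z.1 + z.2)) s1 s2 s3).
    move: (U z.1) (V z.1) (W z.1) (E z.1) (U (z.1 + z.2)) (V (z.1 + z.2)) (W (z.1 + z.2)) (E (z.1 + z.2)).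
    move: (slab T z.1) (slab T (z.1 + z.2)) (K z.2) ('D_(et4 R) K z.2) ('D_(ex4 R) K z.2) ('D_(ey4 R) K z.2).
    move: ('D_(ez4 R) K z.2) (phi z.1) ('D_(et4 R) phi z.1) ('D_(ex4 R) phi z.1) ('D_(ey4 R) phi z.1).
    by move: ('D_(ez4 R) phi z.1) => {s1 s2 s3} *; ring.
  - exact: (@flux5_ind R (L1 (tor4 R))).
  - by apply: (@flux5_ind R (fun f => f = (fun=> 0) \/ f = slab T)); (left + right).
  - by move: ('D_(ex4 R) th q) ('D_(ey4 R) th q) ('D_(ez4 R) th q) => *; ring.
have {}ny : null (pairs R) (fun z => 'D_(ey4 R) K z.2 * phi z.1 * (V z.1 * E z.1) +
   ('D_(ey4 R) phi z.1 * K z.2 - phi z.1 * 'D_(ey4 R) K z.2) * (V (z.1 + z.2) * E (z.1 + z.2))).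
  apply: eq_null (ny _ _ _) => [z|i|i|th q].
  - have [s1 s2] := slab_phi z.1 (ey4 R); have s3 := slab_K (ey4 R) z; rewrite XtermE YtermE.
    apply: etrans (slab_algebra (K z.2) (V z.1 * E z.1) (V (z.1 + z.2) * E (z.1 + z.2)) s1 s2 s3).
    move: (U z.1) (V z.1) (W z.1) (E z.1) (U (z.1 + z.2)) (V (z.1 + z.2)) (W (z.1 + z.2)) (E (z.1 + z.2)).
    move: (slab T z.1) (slab T (z.1 + z.2)) (K z.2) ('D_(et4 R) K z.2) ('D_(ex4 R) K z.2) ('D_(ey4 R) K z.2).
    move: ('D_(ez4 R) K z.2) (phi z.1) ('D_(et4 R) phi z.1) ('D_(ex4 R) phi z.1) ('D_(ey4 R) phi z.1).
    by move: ('D_(ez4 R) phi z.1) => {s1 s2 s3} *; ring.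
  - exact: (@flux5_ind R (L1 (tor4 R))).
  - by apply: (@flux5_ind R (fun f => f = (fun=> 0) \/ f = slab T)); (left + right).
  - by move: ('D_(ex4 R) th q) ('D_(ey4 R) th q) ('D_(ez4 R) th q) => *; ring.
have {}nw : null (pairs R) (fun z => 'D_(ez4 R) K z.2 * phi z.1 * (W z.1 * E z.1) +
   ('D_(ez4 R) phi z.1 * K z.2 - phi z.1 * 'D_(ez4 R) K z.2) * (W (z.1 + z.2) * E (z.1 + z.2))).
  apply: eq_null (nw _ _ _) => [z|i|i|th q].
  - have [s1 s2] := slab_phi z.1 (ez4 R); have s3 := slab_K (ez4 R) z; rewrite XtermE YtermE.
    apply: etrans (slab_algebra (K z.2) (W z.1 * E z.1) (W (z.1 + z.2) * E (z.1 + z.2)) s1 s2 s3).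
    move: (U z.1) (V z.1) (W z.1) (E z.1) (U (z.1 + z.2)) (V (z.1 + z.2)) (W (z.1 + z.2)) (E (z.1 + z.2)).
    move: (slab T z.1) (slab T (z.1 + z.2)) (K z.2) ('D_(et4 R) K z.2) ('D_(ex4 R) K z.2) ('D_(ey4 R) K z.2).
    move: ('D_(ez4 R) K z.2) (phi z.1) ('D_(et4 R) phi z.1) ('D_(ex4 R) phi z.1) ('D_(ey4 R) phi z.1).
    by move: ('D_(ez4 R) phi z.1) => {s1 s2 s3} *; ring.
  - exact: (@flux5_ind R (L1 (tor4 R))).
  - by apply: (@flux5_ind R (fun f => f = (fun=> 0) \/ f = slab T)); (left + right).
  - by move: ('D_(ex4 R) th q) ('D_(ey4 R) th q) ('D_(ez4 R) th q) => *; ring.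
have N := nullD (nullD (nullD (nullD (nullZ (- 2) (nullD nU nV)) (ndiv mE pE (L2_kin_right sol)))
  (nullZ (- 1) (nullD (nullD nx ny) nw))) (nullZ (- 2) (ndiv mP pP p2))) (nullZ (- 2) nz).
apply: eq_null N => z; rewrite !XtermE !YtermE /increment_balance /incr_flux /bal_flux /corr /kin.
move: (U z.1) (V z.1) (W z.1) (P z.1) (U (z.1 + z.2)) (V (z.1 + z.2)) (W (z.1 + z.2)) (P (z.1 + z.2)).
move: (K z.2) ('D_(et4 R) K z.2) ('D_(ex4 R) K z.2) ('D_(ey4 R) K z.2) ('D_(ez4 R) K z.2).
move: (phi z.1) ('D_(et4 R) phi z.1) ('D_(ex4 R) phi z.1) ('D_(ey4 R) phi z.1) ('D_(ez4 R) phi z.1).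
by move=> *; ring.
Qed.

End increment_identity.

(** ** Removing the time mollification *)

Section time_kernel.
Variable R : realType.

Lemma Int_box1 (M : R) : 0 <= M -> \int[leb1 R]_t box1 M t = 2 * M.
Proof.
move=> M0; rewrite /Rintegral integral_indic//= setIT lebesgue_measure_itv/= lte_fin.
case: ifPn => [_|]; first by rewrite /=; ring.
by rewrite -leNgt => h; rewrite /=; lra.
Qed.

Let raw (h : R) := bump (- h) h 0.

Let L1_raw h : L1 (leb1 R) (raw h).
Proof.
apply: (@L1_le _ _ _ (leb1 R) _ _ _ (L1_box1 h)) => [|t].
  by apply: continuous_measurable_fun; exact: (smooth_continuous (smooth_bump _ _ _)).
have [th|th] := leP `|t| h.
  by rewrite box1_in//; have /andP[b0 b1] := bump_itv (- h) h 0 t; rewrite ger0_norm.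
rewrite /raw bump_out ?normr0 ?box1_ge0//; apply: contraL th => /andP[h1 h2].
by rewrite -leNgt ler_norml !ltW.
Qed.

Let raw_gt0 h : 0 < h -> 0 < \int[leb1 R]_t raw h t.
Proof.
move=> h0; have h2 : 0 < h / 2 by rewrite divr_gt0.
pose c := expR (- (h / 2)^-1) * expR (- (h / 2)^-1) : R.
have c0 : 0 < c by rewrite mulr_gt0 ?expR_gt0.
apply: (@lt_le_trans _ _ (\int[leb1 R]_t (c * box1 (h / 2) t))).
  by rewrite (IntZ _ (L1_box1 (h / 2))) (Int_box1 (ltW h2)); apply: mulr_gt0 => //; exact: mulr_gt0.
apply: (le_Int (L1Z c (L1_box1 (h / 2))) (L1_raw h)) => t.
have [th|th] := leP `|t| (h / 2); last first.
  have -> : box1 (h / 2) t = 0.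
    rewrite /box1 indicE; case: (boolP (t \in _)) => //; rewrite mem_setE in_itv/= -ler_norml.
    by rewrite leNgt th.
  by rewrite mulr0; have /andP[] := bump_itv (- h) h 0 t.
rewrite box1_in// mulr1 /raw /bump /c.
have fl (y : R) : h / 2 <= y -> expR (- (h / 2)^-1) <= flat 0 y.
  move=> hy; have y0 : 0 < y := lt_le_trans h2 hy.
  by rewrite /flat y0 expr0 mul1r ler_expR lerN2 lef_pV2.
move: th; rewrite ler_norml => /andP[t1 t2].
by apply: ler_pM; rewrite ?expR_ge0//; apply: fl; rewrite mul1r; lra.
Qed.

(** A smooth probability density supported in a short time interval. *)
Definition eta (h t : R) : R := (\int[leb1 R]_s raw h s)^-1 * raw h t.

Lemma smooth_eta h : smooth (eta h).
Proof. by apply: smoothM; [exact: smooth_cst|exact: smooth_bump]. Qed.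

Lemma eta_ge0 h t : 0 < h -> 0 <= eta h t.
Proof.
move=> /raw_gt0/ltW i0; rewrite mulr_ge0 ?invr_ge0//.
by have /andP[] := bump_itv (- h) h 0 t.
Qed.

Lemma eta_out h t : h <= `|t| -> eta h t = 0.
Proof.
move=> ht; rewrite /eta /raw bump_out ?mulr0//; apply: contraL ht => /andP[h1 h2].
by rewrite -ltNge ltr_norml h1.
Qed.

Lemma L1_eta h : L1 (leb1 R) (eta h). Proof. exact: L1Z. Qed.

Lemma Int_eta h : 0 < h -> \int[leb1 R]_t eta h t = 1.
Proof. by move=> /raw_gt0 i0; rewrite (IntZ _ (L1_raw h)) mulVf// gt_eqF. Qed.

(** ** Kernels in space times densities in time *)

Definition stk (k : pt3 R -> R) (h : R) (z : pt4 R) : R := k z.1 * eta h z.2.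

Variables (k : pt3 R -> R) (M : R).
Hypotheses (sk : smooth k) (suk : supported M k).

Let sk1 : smooth (fun z : pt4 R => k z.1).
Proof. by apply: (smooth_affine (A := fst) (L := fst) _ _ sk) => // z; exact: cvg_fst. Qed.

Let se2 h : smooth (fun z : pt4 R => eta h z.2).
Proof. by apply: (smooth_proj (c := snd)) => //; [move=> z; exact: cvg_snd|exact: smooth_eta]. Qed.

Lemma smooth_stk h : smooth (stk k h).
Proof. exact: smoothM. Qed.

Lemma supported_stk h : supported (Num.max M h) (stk k h).
Proof.
move=> z zM; rewrite /stk; have [z2|z2] := leP h `|z.2|; first by rewrite eta_out ?mulr0.
have [z1|z1] := leP `|z.1| (Num.max M h); last first.
  by rewrite suk ?mul0r//; apply: le_lt_trans z1; rewrite le_max lexx.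
move: zM; rewrite ltNge; case: z z1 z2 => x t z1 z2.
by rewrite (norm_pair_ge z1)//= le_max (ltW z2) orbT.
Qed.

Lemma derive_stk h (e : pt3 R) (D : pt4 R) z : D = (e, 0) ->
  'D_D (stk k h) z = 'D_e k z.1 * eta h z.2.
Proof.
move=> De; rewrite (smooth_deriveM _ _ sk1 (se2 h)).
rewrite (@derive_affine _ _ _ fst k D e z) => [|r]; last by rewrite De.
have de : is_derive z.2 1 (eta h) ('D_1 (eta h) z.2).
  by apply: DeriveDef => //; apply: smooth_derivable; exact: smooth_eta.
have -> := @derive_proj R (pt4 R) snd (eta h) D z ('D_1 (eta h) z.2) _ de; last by [].
by rewrite De /= mul0r mulr0 add0r mulrC.
Qed.

End time_kernel.

Section instantaneous_limit.
Variables (R : realType) (G : pt4 R -> R) (d : pt4 R -> pt4 R -> R).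
Hypotheses (G0 : forall a : pt4 R, 0 <= G a) (Gi : L1 (tor4 R) G) (pG : per4 G).
Hypothesis pd : forall z : pt4 R, per4 (fun q => d q (q + z)).
Hypothesis d_small : forall e : R, 0 < e -> exists2 r : R, 0 < r & forall z : pt4 R, `|z| <= r ->
  L1 (tor4 R) (fun q => d q (q + z)) /\ \int[tor4 R]_q d q (q + z) <= e.
Variables (F : pt4 R -> pt4 R -> R).
Hypothesis tF : L1c G d F.
Hypothesis mF : measurable_fun setT (fun z : pt4 R * pt4 R => F z.1 (z.1 + z.2)).
Variables (k : pt3 R -> R) (psi : pt4 R -> R) (C : R).
Hypotheses (ki : L1 (leb3m R) k) (mpsi : measurable_fun setT psi) (psiC : forall q, `|psi q| <= C).

Definition pairs3 := prodm (tor4 R) (leb3m R).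

Definition at_once (q : pt4 R) (x : pt3 R) : R := F q (q + (x, 0)).

Definition tm (z : pt4 R * pt3 R) : R := k z.2 * (psi z.1 * at_once z.1 z.2).

Let a (z : pt4 R) : R := \int[tor4 R]_q (psi q * F q (q + z)).

Let C0 : 0 <= C. Proof. exact: le_trans (normr_ge0 _) (psiC 0). Qed.

Let ai (z : pt4 R) : L1 (tor4 R) (fun q => psi q * F q (q + z)).
Proof. exact: (L1_Mbounded (tame_L1 Gi pG tF mF z) mpsi psiC). Qed.

Lemma measurable_at_once : measurable_fun setT (fun z : pt4 R * pt3 R => at_once z.1 z.2).
Proof.
have m : measurable_fun setT (fun z : pt4 R * pt3 R => (z.1, (z.2, 0 : R))).
  by apply: measurable_fun_pair => //; exact: measurable_fun_pair.
exact: (measurableT_comp mF m).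
Qed.

Let abs_int (z : pt4 R) (c : R) :
  \int[tor4 R]_q `|c * (psi q * F q (q + z))| <= (C * \int[tor4 R]_q `|F q (q + z)|) * `|c|.
Proof.
have iF := L1_norm (tame_L1 Gi pG tF mF z).
rewrite -(IntZ _ iF) mulrC -(IntZ _ (L1Z C iF)).
apply: (le_Int (L1_norm (L1Z c (ai z))) (L1Z _ (L1Z C iF))) => q.
by rewrite normrM ler_wpM2l// normrM ler_wpM2r.
Qed.

Lemma L1_tm : L1 pairs3 tm.
Proof.
have [B B0 hB] := tame_bounded G0 Gi pG tF mF.
apply: (@L1_prod21 _ _ _ _ _ (tor4 R) (leb3m R) _ (fun x => (C * B) * `|k x|)).
- apply: measurable_funM; first exact: (measurableT_comp (L1_measurable ki) measurable_snd).
  by apply: measurable_funM; [exact: (measurableT_comp mpsi measurable_fst)|exact: measurable_at_once].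
- exact: (L1Z _ (L1_norm ki)).
- by move=> x; exact: (L1Z (k x) (ai (x, 0))).
- move=> x; apply: le_trans (abs_int (x, 0) (k x)) _; rewrite ler_wpM2r// ler_wpM2l//.
Qed.

Let tmh (h : R) (z : pt4 R * pt4 R) : R := (k z.2.1 * eta h z.2.2) * (psi z.1 * F z.1 (z.1 + z.2)).

Let L1_tmh h : L1 (pairs R) (tmh h).
Proof.
have [B B0 hB] := tame_bounded G0 Gi pG tF mF.
have kei := L1_tensor ki (L1_eta h).
apply: (@L1_prod21 _ _ _ _ _ (tor4 R) (leb4m R) _ (fun z => (C * B) * `|k z.1 * eta h z.2|)).
- apply: measurable_funM; first exact: (measurableT_comp (L1_measurable kei) measurable_snd).
  by apply: measurable_funM; [exact: (measurableT_comp mpsi measurable_fst)|exact: mF].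
- exact: (L1Z _ (L1_norm kei)).
- by move=> z; exact: (L1Z (k z.1 * eta h z.2) (ai z)).
- move=> z; apply: le_trans (abs_int z (k z.1 * eta h z.2)) _; rewrite ler_wpM2r// ler_wpM2l//.
Qed.

(** The integral over the torus is continuous in the shift, so averages over short time
    shifts tend to the value without time shift. *)
Lemma instantaneous_limit (e : R) : 0 < e -> exists2 r : R, 0 < r & forall h, 0 < h -> h <= r ->
  L1 (pairs R) (tmh h) /\ `|\int[pairs R]_z tmh h z - \int[pairs3]_z tm z| <= e.
Proof.
move=> e0; pose nk := \int[leb3m R]_x `|k x|.
have nk0 : 0 <= nk by exact: Int_ge0.
have N1 : 0 < C * nk + 1 by rewrite ltr_wpDl// mulr_ge0.
have e1 : 0 < e / (C * nk + 1) by rewrite divr_gt0.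
have [r r0 hr] := tame_small G0 Gi pG pd d_small tF mF e1; exists r => // h h0 hle.
split; first exact: L1_tmh.
have kn := L1_norm ki; have ei := L1_eta h.
have i1 : L1 (leb4m R) (fun z => \int[tor4 R]_q tmh h (q, z)) by exact: (L1_Int2 (L1_tmh h)).
have i3 : L1 (leb3m R) (fun x => \int[tor4 R]_q tm (q, x)) by exact: (L1_Int2 L1_tm).
have i2 := L1_tensor i3 ei.
have ib := L1Z (C * (e / (C * nk + 1))) (L1_tensor kn ei).
have e2 : \int[pairs3]_z tm z = \int[leb4m R]_z ((\int[tor4 R]_q tm (q, z.1)) * eta h z.2).
  have := Int_prod21 L1_tm => /= ->; have := Int_tensor i3 ei => /= ->.
  by rewrite Int_eta// mulr1.
rewrite e2; have := Int_prod21 (L1_tmh h) => /= ->; rewrite -(IntB i1 i2).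
have E1 z : \int[tor4 R]_q tmh h (q, z) = k z.1 * eta h z.2 * a z := IntZ (k z.1 * eta h z.2) (ai z).
have E2 x : \int[tor4 R]_q tm (q, x) = k x * a (x, 0) := IntZ (k x) (ai (x, 0)).
have bnd z : `|\int[tor4 R]_q tmh h (q, z) - (\int[tor4 R]_q tm (q, z.1)) * eta h z.2| <=
    C * (e / (C * nk + 1)) * (`|k z.1| * eta h z.2).
  rewrite E1 E2 (_ : _ - _ = k z.1 * eta h z.2 * (a z - a (z.1, 0))); last by ring.
  rewrite normrM normrM [`|eta h z.2|]ger0_norm ?eta_ge0// [leRHS]mulrC.
  have [ht|ht] := leP h `|z.2|; first by rewrite eta_out// !mulr0 !mul0r.
  apply: ler_wpM2l; first by apply: mulr_ge0 => //; exact: eta_ge0.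
  have hz : `|z - (z.1, 0)| <= r.
    rewrite (_ : z - (z.1, 0) = (0, z.2)); last by case: (z) => x t; congr (_, _); rewrite /= ?subrr ?subr0.
    by apply: norm_pair_ge; rewrite ?normr0 ?(ltW r0)// (le_trans (ltW ht)).
  have iB := L1B (tame_L1 Gi pG tF mF z) (tame_L1 Gi pG tF mF (z.1, 0)).
  have aB : a z - a (z.1, 0) = \int[tor4 R]_q (psi q * F q (q + z) - psi q * F q (q + (z.1, 0))).
    exact: esym (IntB (ai z) (ai (z.1, 0))).
  have iC := L1Z C (L1_norm iB).
  have le1 : `|a z - a (z.1, 0)| <= \int[tor4 R]_q (C * `|F q (q + z) - F q (q + (z.1, 0))|).
    rewrite aB; apply: (norm_Int_le (L1B (ai z) (ai (z.1, 0))) iC) => q.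
    by rewrite -mulrBr normrM ler_wpM2r.
  apply: le_trans le1 _; rewrite (IntZ _ (L1_norm iB)); apply: ler_wpM2l => //; exact: hr.
apply: le_trans (norm_Int_le (L1B i1 i2) ib bnd) _.
rewrite (IntZ _ (L1_tensor kn ei)) (Int_tensor kn ei) Int_eta// mulr1 -/nk.
rewrite mulrAC mulrA ler_pdivrMr// mulrC.
by rewrite ler_pM2l// lerDl.
Qed.

End instantaneous_limit.

Section space_kernels.
Variables (R : realType) (k : pt3 R -> R) (M : R).
Hypotheses (sk : smooth k) (suk : supported M k).

Lemma bounded_kernel3 : exists2 C : R, 0 <= C & forall x, `|k x| <= C.
Proof.
pose B : set (pt3 R) := `[- M, M] `*` `[- M, M] `*` `[- M, M].
have cB : compact B by do 2 (apply: compact_setX; last exact: segment_compact); exact: segment_compact.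
have /compact_bounded [C [_ HC]] : compact (k @` B).
  by apply: continuous_compact => //; apply: continuous_subspaceT; exact: smooth_continuous.
exists (`|C| + 1) => [|x]; first by rewrite addr_ge0.
have [xM|xM] := leP `|x| M; last by rewrite suk// normr0 addr_ge0.
apply: HC; first by rewrite (le_lt_trans (ler_norm C))// ltrDl.
exists x => //; case: x xM => [[x y] z] /norm_pair_le[/norm_pair_le[hx hy] hz].
by split; [split|]; rewrite /= in_itv/= -ler_norml.
Qed.

Lemma L1_kernel3 : L1 (leb3m R) k.
Proof.
have mk : measurable_fun setT k by apply: measurable_continuous3; exact: smooth_continuous.
have [C C0 kC] := bounded_kernel3.
apply: (@L1_le _ _ _ (leb3m R) k (fun x => C * box3 M x) mk (L1Z C (L1_box3 M))) => x.
have [xM|xM] := leP `|x| M; first by rewrite box3_in// mulr1.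
by rewrite suk// normr0 mulr_ge0// box3_ge0.
Qed.

End space_kernels.

Section space_identity.
Variables (R : realType) (T Om M0 : R) (U V W P : pt4 R -> R).
Hypothesis sol : torus_solution T Om M0 U V W P.

Local Notation G := (mass T U V W P).
Local Notation d := (gap_of_fields U V W P).

Variables (phi : pt4 R -> R).
Hypotheses (tphi : test_fun T phi).
Variables (k : pt3 R -> R) (M : R).
Hypotheses (sk : smooth k) (suk : supported M k).

Let mU : measurable_fun setT U. Proof. by have [] := ts_meas sol. Qed.
Let mV : measurable_fun setT V. Proof. by have [] := ts_meas sol. Qed.
Let mW : measurable_fun setT W. Proof. by have [] := ts_meas sol. Qed.

Let ki := L1_kernel3 sk suk.
Let dki e : L1 (leb3m R) ('D_e k).
Proof. by apply: (@L1_kernel3 _ _ M); [exact: smooth_derive|exact: supported_derive]. Qed.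

Let corr2 (a b : pt4 R) := 2 * corr U V a b.
Let t2 : L1c G d corr2. Proof. by apply: L1cZ; [exact: mass_ge0 sol|exact: tame_corr sol]. Qed.
Let m2 : measurable_fun setT (fun z : pt4 R * pt4 R => corr2 z.1 (z.1 + z.2)).
Proof. by apply: measurable_funM => //; exact: measurable_corr sol. Qed.

(** The seven terms of the identity, as kernel, weight and product of fields. *)
Let kern (i : 'I_7) : pt3 R -> R :=
  match val i with 0%N => 'D_(ex3 R) k | 1%N => 'D_(ey3 R) k | 2%N => 'D_(ez3 R) k
  | _ => fun x => - k x end.
Let wgt (i : 'I_7) : pt4 R -> R :=
  match val i with 3%N => 'D_(et4 R) phi | 4%N => 'D_(ex4 R) phi | 5%N => 'D_(ey4 R) phi
  | 6%N => 'D_(ez4 R) phi | _ => phi end.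
Let fld (i : 'I_7) : pt4 R -> pt4 R -> R :=
  match val i with 0%N => incr_flux U V U | 1%N => incr_flux U V V | 2%N => incr_flux U V W
  | 3%N => corr2 | 4%N => bal_flux U V P U | 5%N => bal_flux U V P V | _ => bal_flux U V P W end.

Let kern_i i : L1 (leb3m R) (kern i).
Proof. by rewrite /kern; case: (val i) => [|[|[|n]]]; [exact: dki|exact: dki|exact: dki|exact: L1N]. Qed.

Let wgt_t i : test_fun T (wgt i).
Proof. by rewrite /wgt; case: (val i) => [|[|[|[|[|[|[|n]]]]]]] //; exact: test_fun_derive. Qed.

Let fU := L2_U sol. Let fV := L2_V sol. Let fW := L2_W sol.

Let fld_t i : L1c G d (fld i).
Proof.
rewrite /fld; case: (val i) => [|[|[|[|[|[|n]]]]]];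
  [apply: (tame_incr_flux sol); exact: fU|apply: (tame_incr_flux sol); exact: fV|apply: (tame_incr_flux sol); exact: fW|exact: t2
  |apply: (tame_bal_flux sol); exact: fU|apply: (tame_bal_flux sol); exact: fV|apply: (tame_bal_flux sol); exact: fW].
Qed.

Let fld_m i : measurable_fun setT (fun z : pt4 R * pt4 R => fld i z.1 (z.1 + z.2)).
Proof.
rewrite /fld; case: (val i) => [|[|[|[|[|[|n]]]]]];
  [apply: (measurable_incr_flux sol); exact: mU|apply: (measurable_incr_flux sol); exact: mV|apply: (measurable_incr_flux sol); exact: mW|exact: m2
  |apply: (measurable_bal_flux sol); exact: mU|apply: (measurable_bal_flux sol); exact: mV|apply: (measurable_bal_flux sol); exact: mW].
Qed.

Let term i (z : pt4 R * pt3 R) : R := tm (fld i) (kern i) (wgt i) z.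

Let g0 := mass_ge0 sol. Let gi := L1_mass sol. Let pg := per4_mass sol.
Let pd := per4_gap_of_fields sol. Let ds := gap_of_fields_small sol.

Let L1_term i : L1 (pairs3 R) (term i).
Proof.
have [C C0 wC] := test_fun_bounded (wgt_t i).
exact: (L1_tm g0 gi pg (fld_t i) (fld_m i) (kern_i i) (test_fun_measurable (wgt_t i)) wC).
Qed.

Let sum7 (f : 'I_7 -> R) : \sum_i f i = f (@Ordinal 7 0 isT) + f (@Ordinal 7 1 isT) +
  f (@Ordinal 7 2 isT) + f (@Ordinal 7 3 isT) + f (@Ordinal 7 4 isT) + f (@Ordinal 7 5 isT) + f (@Ordinal 7 6 isT).
Proof.
rewrite !big_ord_recl big_ord0 addr0 !addrA.
by congr (f _ + f _ + f _ + f _ + f _ + f _ + f _); apply: val_inj.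
Qed.

Let null_sum : \sum_i \int[pairs3 R]_z term i z = 0.
Proof.
have [sf pf [a [b [a0 bT ab]]]] := tphi.
apply/eqP; rewrite -normr_le0; apply/ler_addgt0Pr => e e0; rewrite add0r.
have e7 : 0 < e / 7 by rewrite divr_gt0.
have /choice[r rP] : forall i, exists r : R, 0 < r /\ forall h, 0 < h -> h <= r ->
    L1 (pairs R) (fun z => (kern i z.2.1 * eta h z.2.2) * (wgt i z.1 * fld i z.1 (z.1 + z.2))) /\
    `|\int[pairs R]_z ((kern i z.2.1 * eta h z.2.2) * (wgt i z.1 * fld i z.1 (z.1 + z.2)))
      - \int[pairs3 R]_z term i z| <= e / 7.
  move=> i; have [C C0 wC] := test_fun_bounded (wgt_t i).
  have [r r0 hr] := instantaneous_limit g0 gi pg pd ds (fld_t i) (fld_m i) (kern_i i)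
    (test_fun_measurable (wgt_t i)) wC e7.
  by exists r.
pose h := Num.min (Num.min (a / 2) ((T - b) / 2)) (\big[Num.min/1]_i r i).
have hb : 0 < \big[Num.min/1]_i r i.
  by apply: (big_ind (fun x : R => 0 < x)) => // [x y x0 y0|i _]; [rewrite lt_min x0|exact: (rP i).1].
have h0 : 0 < h by rewrite !lt_min hb !divr_gt0//= subr_gt0.
have hr i : h <= r i by rewrite /h ge_min; apply/orP; right; exact: bigmin_le_cond.
have ha : 0 < a - h.
  rewrite subr_gt0; apply: (@le_lt_trans _ _ (a / 2)); last by rewrite ltr_pdivrMr//; lra.
  by rewrite /h !ge_min lexx.
have hT : b + h < T.
  rewrite addrC -ltrBrDr; apply: (@le_lt_trans _ _ ((T - b) / 2)); last by rewrite ltr_pdivrMr//; lra.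
  by rewrite /h !ge_min lexx orbT.
have Kh (z : pt4 R) : h < `|z.2| -> stk k h z = 0 by move=> hz; rewrite /stk eta_out ?mulr0// ltW.
have [_ I0] := increment_identity sol (smooth_stk sk h) (supported_stk suk (h := h)) Kh tphi h0 ha hT ab.
pose J i (z : pt4 R * pt4 R) := (kern i z.2.1 * eta h z.2.2) * (wgt i z.1 * fld i z.1 (z.1 + z.2)).
have Ji i : L1 (pairs R) (J i) := ((rP i).2 h h0 (hr i)).1.
have S0 : \sum_i \int[pairs R]_z J i z = 0.
  have := @Int_sum _ _ _ 'I_7 (index_enum _) xpredT (pairs R) J (fun i _ => Ji i) => <-.
  apply: etrans I0; apply: eq_Int => z.
  have -> : \sum_i J i z = 'D_(ex3 R) k z.2.1 * eta h z.2.2 * (phi z.1 * incr_flux U V U z.1 (z.1 + z.2))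
    + 'D_(ey3 R) k z.2.1 * eta h z.2.2 * (phi z.1 * incr_flux U V V z.1 (z.1 + z.2))
    + 'D_(ez3 R) k z.2.1 * eta h z.2.2 * (phi z.1 * incr_flux U V W z.1 (z.1 + z.2))
    + - k z.2.1 * eta h z.2.2 * ('D_(et4 R) phi z.1 * (2 * corr U V z.1 (z.1 + z.2)))
    + - k z.2.1 * eta h z.2.2 * ('D_(ex4 R) phi z.1 * bal_flux U V P U z.1 (z.1 + z.2))
    + - k z.2.1 * eta h z.2.2 * ('D_(ey4 R) phi z.1 * bal_flux U V P V z.1 (z.1 + z.2))
    + - k z.2.1 * eta h z.2.2 * ('D_(ez4 R) phi z.1 * bal_flux U V P W z.1 (z.1 + z.2)).
    exact: (sum7 (fun i => J i z)).
  rewrite /increment_balance.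
  rewrite (derive_stk sk h z.2 (erefl : ex4 R = (ex3 R, 0))) (derive_stk sk h z.2 (erefl : ey4 R = (ey3 R, 0))).
  rewrite (derive_stk sk h z.2 (erefl : ez4 R = (ez3 R, 0))).
  rewrite /stk; move: (k z.2.1) (eta h z.2.2) (phi z.1) => k0 e0' f0.
  move: ('D_(ex3 R) k z.2.1) ('D_(ey3 R) k z.2.1) ('D_(ez3 R) k z.2.1) ('D_(et4 R) phi z.1)
    ('D_(ex4 R) phi z.1) ('D_(ey4 R) phi z.1) ('D_(ez4 R) phi z.1) => kx ky kz pt px py pz.
  move: (incr_flux U V U _ _) (incr_flux U V V _ _) (incr_flux U V W _ _) (corr U V _ _) => f1 f2 f3 f4.
  move: (bal_flux U V P U _ _) (bal_flux U V P V _ _) (bal_flux U V P W _ _) => f5 f6 f7.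
  by ring.
have -> : \sum_i \int[pairs3 R]_z term i z = - \sum_i (\int[pairs R]_z J i z - \int[pairs3 R]_z term i z).
  by rewrite sumrB S0 sub0r opprK.
rewrite normrN; apply: le_trans (ler_norm_sum _ _ _) _.
apply: (@le_trans _ _ (\sum_(i < 7) (e / 7))).
  by apply: ler_sum => i _; exact: ((rP i).2 h h0 (hr i)).2.
by rewrite sumr_const card_ord -[_ *+ _]mulr_natr divfK.
Qed.

Let neg_sum (k0 x y z w : R) : - 1 * (- k0 * x + - k0 * y + - k0 * z + - k0 * w) =
  k0 * x + k0 * y + k0 * z + k0 * w.
Proof. by ring. Qed.

(** Take the kernel of the increment identity as a product of [k] and a density in
    time, and let the latter concentrate at the origin. *)
Theorem space_identity :
  \int[pairs3 R]_z ('D_(ex3 R) k z.2 * (phi z.1 * at_once (incr_flux U V U) z.1 z.2)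
    + 'D_(ey3 R) k z.2 * (phi z.1 * at_once (incr_flux U V V) z.1 z.2)
    + 'D_(ez3 R) k z.2 * (phi z.1 * at_once (incr_flux U V W) z.1 z.2)) =
  \int[pairs3 R]_z (k z.2 * ('D_(et4 R) phi z.1 * at_once corr2 z.1 z.2)
    + k z.2 * ('D_(ex4 R) phi z.1 * at_once (bal_flux U V P U) z.1 z.2)
    + k z.2 * ('D_(ey4 R) phi z.1 * at_once (bal_flux U V P V) z.1 z.2)
    + k z.2 * ('D_(ez4 R) phi z.1 * at_once (bal_flux U V P W) z.1 z.2)).
Proof.
have t n (h : (n < 7)%N) := L1_term (Ordinal h).
have S0 := etrans (esym (sum7 (fun i => \int[pairs3 R]_z term i z))) null_sum.
have i01 := L1D (t 0 isT) (t 1 isT); have i012 := L1D i01 (t 2 isT).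
have i34 := L1D (t 3 isT) (t 4 isT); have i345 := L1D i34 (t 5 isT); have i3456 := L1D i345 (t 6 isT).
pose b n (h : (n < 7)%N) : R := \int[pairs3 R]_z term (Ordinal h) z.
have {}S0 : b 0 isT + b 1 isT + b 2 isT + b 3 isT + b 4 isT + b 5 isT + b 6 isT = 0 by exact: S0.
apply: (etrans (y := b 0 isT + b 1 isT + b 2 isT)).
  exact: etrans (IntD i01 (t 2 isT)) (congr1 (fun x => x + b 2 isT) (IntD (t 0 isT) (t 1 isT))).
apply: (etrans (y := - 1 * (b 3 isT + b 4 isT + b 5 isT + b 6 isT))).
  move: S0; move: (b 0 isT) (b 1 isT) (b 2 isT) (b 3 isT) (b 4 isT) (b 5 isT) (b 6 isT).
  by move=> *; lra.
have Q : \int[pairs3 R]_z (- 1 * (term (@Ordinal 7 3 isT) z + term (@Ordinal 7 4 isT) z +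
    term (@Ordinal 7 5 isT) z + term (@Ordinal 7 6 isT) z)) = - 1 * (b 3 isT + b 4 isT + b 5 isT + b 6 isT).
  rewrite (IntZ _ i3456); congr (_ * _).
  by rewrite (IntD i345 (t 6 isT)) (IntD i34 (t 5 isT)) (IntD (t 3 isT) (t 4 isT)).
rewrite -Q; apply: eq_Int => z.
have tE (i : 'I_7) (c : pt4 R -> R) (f : pt4 R -> pt4 R -> R) : kern i = (fun x => - k x) -> wgt i = c -> fld i = f ->
    term i z = - k z.2 * (c z.1 * at_once f z.1 z.2) by rewrite /term /tm => -> -> ->.
rewrite (tE (@Ordinal 7 3 isT) _ _ erefl erefl erefl) (tE (@Ordinal 7 4 isT) _ _ erefl erefl erefl).
rewrite (tE (@Ordinal 7 5 isT) _ _ erefl erefl erefl) (tE (@Ordinal 7 6 isT) _ _ erefl erefl erefl).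
exact: neg_sum.
Qed.

End space_identity.

(** * The negative Sobolev norm *)

Section negative_norm.
Variables (R : realType) (T : R).

Let e1 (x : pt3 R) (t : R) (h : R) (d : pt3 R) : ((h *: d + x, t) : pt4 R) = h *: ((d, 0) : pt4 R) + (x, t).
Proof. by congr (_, _); rewrite /= scaler0 add0r. Qed.

Lemma derive_section (phi : pt4 R -> R) (e : pt3 R) (D : pt4 R) x t : D = (e, 0) ->
  'D_e (fun x => phi (x, t)) x = 'D_D phi (x, t).
Proof.
move=> De; apply: (@derive_affine _ _ _ (fun x : pt3 R => ((x, t) : pt4 R)) phi e D x) => h.
by rewrite De e1.
Qed.

Lemma test_section (phi : pt4 R -> R) t : test_fun T phi -> test_torus (fun x => phi (x, t)).
Proof.
move=> [sf pf _]; split; last exact: pf.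
apply: (smooth_affine (A := fun x : pt3 R => ((x, t) : pt4 R)) (L := fun d : pt3 R => ((d, 0) : pt4 R)) _ _ sf).
  by apply: (@continuous_pair1 _ R (pt4 R) (fun z => z) t) => z; exact: cvg_id.
by move=> h d y; rewrite e1.
Qed.

Lemma Int_cube (f : pt3 R -> R) : measurable_fun setT f ->
  \int[leb3 R]_(x in cube R) f x = \int[tor3 R]_x f x.
Proof.
move=> mf; transitivity (\int[leb3m R]_(x in cube R) f x); first by [].
exact/esym/(Int_restricts (tor3_restricts R) mf).
Qed.

Lemma integrable_cube (f : pt3 R -> R) : L1 (tor3 R) f -> (leb3 R).-integrable (cube R) (EFin \o f).
Proof. by move=> fi; exact: (restricts_L1 (tor3_restricts R) fi). Qed.

Lemma L1_norm_torusE (f : pt3 R -> R) : L1 (tor3 R) f ->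
  L1_norm_torus f = (\int[tor3 R]_x `|f x|)%:E.
Proof.
move=> fi; rewrite (EFin_Int (L1_norm fi)).
transitivity (\int[leb3m R]_(x in cube R) `|f x|%:E)%E; first by [].
apply/esym; apply: (integral_restricts (tor3_restricts R)).
by apply/measurable_EFinP; apply: measurableT_comp => //; exact: L1_measurable fi.
Qed.

Lemma Wm11_norm_ge0 L : (0 <= Wm11_norm L :> \bar R)%E.
Proof.
apply: le_ereal_inf_tmp => _ [g0 [g1 [g2 [g3 [_ ->]]]]].
have h g : (0 <= L1_norm_torus g :> \bar R)%E by apply: integral_ge0 => x _; rewrite lee_fin.
by apply: adde_ge0 => //; apply: adde_ge0 => //; apply: adde_ge0.
Qed.

Lemma torus_test_bounded (psi : pt3 R -> R) : test_torus psi ->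
  measurable_fun setT psi /\ exists2 C : R, 0 <= C & forall x, `|psi x| <= C.
Proof.
move=> [sp pp]; split; first by apply: measurable_continuous3; exact: smooth_continuous.
have cB : compact (`[0, 1] `*` `[0, 1] `*` `[0, 1] : set (pt3 R)).
  by do 2 (apply: compact_setX; last exact: segment_compact); exact: segment_compact.
have /compact_bounded [C [_ HC]] : compact (psi @` (`[0, 1] `*` `[0, 1] `*` `[0, 1])).
  by apply: continuous_compact => //; apply: continuous_subspaceT; exact: smooth_continuous.
exists (`|C| + 1) => [|x]; first by rewrite addr_ge0.
apply: HC; first by rewrite (le_lt_trans (ler_norm C))// ltrDl.
exists (frac3 x); last exact: periodic_frac.
have fr (s : R) : 0 <= frac s <= 1 by have /andP[-> /ltW ->] := frac_itv s.
by split; [split|]; rewrite /= in_itv/= fr.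
Qed.

Lemma distr_torusE (g psi : pt3 R -> R) : L1 (tor3 R) g -> test_torus psi ->
  L1 (tor3 R) (fun x => g x * psi x) /\ distr_torus g psi = \int[tor3 R]_x (g x * psi x).
Proof.
move=> gi tp; have [mp [C C0 pC]] := torus_test_bounded tp.
have i : L1 (tor3 R) (fun x => g x * psi x).
  by apply: eq_L1 (L1_Mbounded gi mp pC) => x; rewrite mulrC.
split; first exact: i.
exact: Int_cube (L1_measurable i).
Qed.

Lemma test_torus_derive psi (e : pt3 R) : test_torus psi -> test_torus ('D_e psi).
Proof.
move=> [sp pp]; split; first exact: smooth_derive.
have key (c : pt3 R) : (forall y, psi (y + c) = psi y) -> forall x, 'D_e psi (x + c) = 'D_e psi x.
  move=> pc x; have Ad (h : R) : h *: e + x + c = h *: e + (x + c) by rewrite addrA.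
  rewrite -(@derive_affine _ _ _ (fun q => q + c) psi e e x Ad); congr ('D_e _ x).
  by apply/funext => y /=; rewrite pc.
by move=> x; split; apply: key => y; have [] := pp y.
Qed.

(** The norm of a slice has to be bounded for every time, while Fubini's theorem
    provides integrable slices for almost every time: the other slices are set to
    zero. *)
Lemma good_slices (f : pt4 R -> R) : L1 (tor4 R) f -> exists2 g : pt4 R -> R,
  L1 (tor4 R) g & (forall t, L1 (tor3 R) (fun x => g (x, t))) /\
  {ae leb1 R, forall t, forall x, g (x, t) = f (x, t)}.
Proof.
move=> fi; pose N (t : R) := (\int[tor3 R]_x `|f (x, t)|%:E)%E.
have mf := L1_measurable fi.
have mN : measurable_fun setT N.
  have := @measurable_fun_fubini_tonelli_G _ _ _ _ R (tor3 R) (fun z : pt4 R => `|f z|%:E).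
  by apply => //; apply/measurable_EFinP; exact: measurableT_comp.
pose good : set (measurableTypeR R) := [set t | (N t < +oo)%E].
have mgood : measurable good.
  by rewrite (_ : good = setT `&` [set t | (N t < +oo)%E]); [exact: emeasurable_fun_infty_o|rewrite setTI].
pose g (q : pt4 R) : R := \1_good q.2 * f q.
have mi : measurable_fun setT (fun q : pt4 R => \1_good q.2 : R).
  by apply: (measurableT_comp (f := \1_good : measurableTypeR R -> R)) => //; exact: measurable_indic.
have i1 (t : R) : `|\1_good t : R| <= 1 by rewrite indicE; case: (_ \in _); rewrite ?normr1 ?normr0.
exists g; first exact: (L1_Mbounded fi mi (fun q => i1 q.2)).
split=> [t|].
  rewrite /g /= indicE; have [tg|tg] := boolP (t \in good); last first.
    by apply: eq_L1 (L1_0 (tor3 R)) => x; rewrite mul0r.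
  have mft : measurable_fun setT (fun x => f (x, t)).
    have mp : measurable_fun setT (fun x : pt3 R => (x, t)) by exact: measurable_fun_pair.
    exact: (measurableT_comp mf mp).
  apply: (@eq_L1 _ _ _ (tor3 R) (fun x => f (x, t))) => [x|]; first by rewrite mul1r.
  by rewrite inE in tg; apply/integrableP; split; [exact/measurable_EFinP|exact: tg].
have := @ae_integrable2 _ _ _ _ R (tor3 R) (leb1 R) _ fi.
apply: ae_imp => t /integrableP[_ lt] x; rewrite /g /= indicE.
by rewrite mem_set ?mul1r.
Qed.

(** ** Decompositions slice by slice *)

Definition dec (h0 h1 h2 h3 : pt4 R -> R) (t : R) (psi : pt3 R -> R) : R :=
  distr_torus (fun x => h0 (x, t)) psi
  + dderive (ex3 R) (distr_torus (fun x => h1 (x, t))) psi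
  + dderive (ey3 R) (distr_torus (fun x => h2 (x, t))) psi
  + dderive (ez3 R) (distr_torus (fun x => h3 (x, t))) psi.

Section slicewise_decomposition.
Variables h0 h1 h2 h3 : pt4 R -> R.
Hypotheses (i0 : L1 (tor4 R) h0) (i1 : L1 (tor4 R) h1) (i2 : L1 (tor4 R) h2) (i3 : L1 (tor4 R) h3).
Hypotheses (s0 : forall t, L1 (tor3 R) (fun x => h0 (x, t))) (s1 : forall t, L1 (tor3 R) (fun x => h1 (x, t)))
  (s2 : forall t, L1 (tor3 R) (fun x => h2 (x, t))) (s3 : forall t, L1 (tor3 R) (fun x => h3 (x, t))).

Let N (t : R) : R := \int[tor3 R]_x `|h0 (x, t)| + \int[tor3 R]_x `|h1 (x, t)|
  + \int[tor3 R]_x `|h2 (x, t)| + \int[tor3 R]_x `|h3 (x, t)|.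

Definition mass4 : R := \int[tor4 R]_q `|h0 q| + \int[tor4 R]_q `|h1 q|
  + \int[tor4 R]_q `|h2 q| + \int[tor4 R]_q `|h3 q|.

Let dec_le t : (Wm11_norm (dec h0 h1 h2 h3 t) <= (N t)%:E :> \bar R)%E.
Proof.
apply: ereal_inf_lbound; exists (fun x => h0 (x, t)), (fun x => h1 (x, t)), (fun x => h2 (x, t)), (fun x => h3 (x, t)).
split; first by split=> //; exact: integrable_cube.
by rewrite !L1_norm_torusE// -!EFinD.
Qed.

Let iN (h : pt4 R -> R) : L1 (tor4 R) h -> L1 (leb1 R) (fun t => \int[tor3 R]_x `|h (x, t)|).
Proof. by move=> hi; exact: (L1_Int2 (L1_norm hi)). Qed.

Let L1N : L1 (leb1 R) N.
Proof. exact: (L1D (L1D (L1D (iN i0) (iN i1)) (iN i2)) (iN i3)). Qed.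

Let IntN : \int[leb1 R]_t N t = mass4.
Proof.
have F (h : pt4 R -> R) (hi : L1 (tor4 R) h) := Int_prod21 (L1_norm hi).
have j01 := L1D (iN i0) (iN i1); have j012 := L1D j01 (iN i2).
rewrite /N (IntD j012 (iN i3)) (IntD j01 (iN i2)) (IntD (iN i0) (iN i1)) /mass4.
by have := F _ i0; have := F _ i1; have := F _ i2; have := F _ i3 => /= -> -> -> ->.
Qed.

Let slice_le : (\int[leb1 R]_(t in `]0%R, T[) Wm11_norm (dec h0 h1 h2 h3 t) <= mass4%:E)%E.
Proof.
apply: (@le_trans _ _ (\int[leb1 R]_(t in `]0%R, T[) (N t)%:E)%E).
  by apply: ge0_le_integral_nonmeasurable => t _; [exact: Wm11_norm_ge0|exact: dec_le].
rewrite -IntN (EFin_Int L1N); apply: ge0_subset_integral; do ?[exact: measurable_itv|exact: measurable_int L1N|exact: subsetT|by []].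
by move=> t _; rewrite lee_fin /N; apply: addr_ge0; [apply: addr_ge0; [apply: addr_ge0|]|]; exact: Int_ge0.
Qed.

Let dec_int (f0 f1 f2 f3 : pt3 R -> R) t psi : test_torus psi ->
  f0 = psi -> f1 = 'D_(ex3 R) psi -> f2 = 'D_(ey3 R) psi -> f3 = 'D_(ez3 R) psi ->
  dec h0 h1 h2 h3 t psi = \int[tor3 R]_x (h0 (x, t) * f0 x - h1 (x, t) * f1 x - h2 (x, t) * f2 x - h3 (x, t) * f3 x).
Proof.
move=> tp -> -> -> ->; have [j0 e0] := distr_torusE (s0 t) tp.
have [j1 e1'] := distr_torusE (s1 t) (test_torus_derive (ex3 R) tp).
have [j2 e2'] := distr_torusE (s2 t) (test_torus_derive (ey3 R) tp).
have [j3 e3'] := distr_torusE (s3 t) (test_torus_derive (ez3 R) tp).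
rewrite /dec /dderive e0 e1' e2' e3'.
by have j01 := L1B j0 j1; have j012 := L1B j01 j2; rewrite (IntB j012 j3) (IntB j01 j2) (IntB j0 j1).
Qed.

Let L1_four (f0 f1 f2 f3 : pt4 R -> R) (C : R) :
  measurable_fun setT f0 -> measurable_fun setT f1 -> measurable_fun setT f2 -> measurable_fun setT f3 ->
  (forall q, `|f0 q| <= C) -> (forall q, `|f1 q| <= C) -> (forall q, `|f2 q| <= C) -> (forall q, `|f3 q| <= C) ->
  L1 (tor4 R) (fun q => h0 q * f0 q - h1 q * f1 q - h2 q * f2 q - h3 q * f3 q).
Proof.
move=> m0 m1 m2 m3 b0 b1 b2 b3.
have M (h f : pt4 R -> R) : L1 (tor4 R) h -> measurable_fun setT f -> (forall q, `|f q| <= C) ->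
    L1 (tor4 R) (fun q => h q * f q).
  by move=> hi mf fb; apply: eq_L1 (L1_Mbounded hi mf fb) => q; rewrite mulrC.
exact: (L1B (L1B (L1B (M _ _ i0 m0 b0) (M _ _ i1 m1 b1)) (M _ _ i2 m2 b2)) (M _ _ i3 m3 b3)).
Qed.

Lemma dec_L1Wm11 : L1Wm11 T (dec h0 h1 h2 h3) /\ (L1Wm11_norm T (dec h0 h1 h2 h3) <= mass4%:E)%E.
Proof.
split; last exact: slice_le.
split; last exact: le_lt_trans slice_le (ltry _).
- move=> psi tp; have [m0 [C0 _ b0]] := torus_test_bounded tp.
  have [m1 [C1 _ b1]] := torus_test_bounded (test_torus_derive (ex3 R) tp).
  have [m2 [C2 _ b2]] := torus_test_bounded (test_torus_derive (ey3 R) tp).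
  have [m3 [C3 _ b3]] := torus_test_bounded (test_torus_derive (ez3 R) tp).
  pose C := Num.max (Num.max C0 C1) (Num.max C2 C3).
  have up (f : pt3 R -> R) (c : R) : (forall x, `|f x| <= c) -> c <= C -> forall q : pt4 R, `|f q.1| <= C.
    by move=> fc cC q; exact: le_trans (fc _) cC.
  have l1 (f : pt3 R -> R) : measurable_fun setT f -> measurable_fun setT (fun q : pt4 R => f q.1).
    by move=> mf; exact: (measurableT_comp mf measurable_fst).
  have j := L1_four (l1 _ m0) (l1 _ m1) (l1 _ m2) (l1 _ m3) (up _ _ b0 _) (up _ _ b1 _) (up _ _ b2 _) (up _ _ b3 _).
  have {}j : L1 (tor4 R) (fun q => h0 q * psi q.1 - h1 q * 'D_(ex3 R) psi q.1 - h2 q * 'D_(ey3 R) psi q.1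
      - h3 q * 'D_(ez3 R) psi q.1) by apply: j; rewrite /C !le_max lexx ?orbT.
  have := L1_measurable (L1_Int2 j); rewrite (_ : (fun t => _) = fun t => dec h0 h1 h2 h3 t psi).
    by move=> m; exact: measurable_funTS m.
  by apply/funext => t; rewrite (dec_int t tp erefl erefl erefl erefl).
- by apply: aeW => t _; apply: le_lt_trans (dec_le t) (ltry _).
Qed.

Lemma dec_time phi : test_fun T phi -> distr_time T (dec h0 h1 h2 h3) phi =
  \int[tor4 R]_q (h0 q * phi q - h1 q * 'D_(ex4 R) phi q - h2 q * 'D_(ey4 R) phi q - h3 q * 'D_(ez4 R) phi q).
Proof.
move=> tp; have tx := test_fun_derive (ex4 R) tp; have ty := test_fun_derive (ey4 R) tp.
have tz := test_fun_derive (ez4 R) tp.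
have [C0 _ b0] := test_fun_bounded tp; have [C1 _ b1] := test_fun_bounded tx.
have [C2 _ b2] := test_fun_bounded ty; have [C3 _ b3] := test_fun_bounded tz.
pose C := Num.max (Num.max C0 C1) (Num.max C2 C3).
have j : L1 (tor4 R) (fun q => h0 q * phi q - h1 q * 'D_(ex4 R) phi q - h2 q * 'D_(ey4 R) phi q - h3 q * 'D_(ez4 R) phi q).
  apply: (@L1_four _ _ _ _ C); do 1?exact: test_fun_measurable tp.
  - exact: test_fun_measurable tx.
  - exact: test_fun_measurable ty.
  - exact: test_fun_measurable tz.
  - by move=> q; apply: le_trans (b0 q) _; rewrite /C !le_max lexx.
  - by move=> q; apply: le_trans (b1 q) _; rewrite /C !le_max lexx ?orbT.
  - by move=> q; apply: le_trans (b2 q) _; rewrite /C !le_max lexx ?orbT.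
  - by move=> q; apply: le_trans (b3 q) _; rewrite /C !le_max lexx ?orbT.
have := Int_prod21 j => /= ->.
rewrite /distr_time /Rintegral integral_mkcond; congr fine; apply: eq_integral => t _; rewrite patchE.
case: ifPn => tT; last first.
  congr EFin; rewrite -[LHS](Int0 (tor3 R)); apply: eq_Int => x.
  have out : ~~ (0 < ((x, t) : pt4 R).2 < T) by move: tT; rewrite mem_setE in_itv.
  by rewrite (test_fun_out tp out) (test_fun_out tx out) (test_fun_out ty out) (test_fun_out tz out) !mulr0 !subr0.
congr EFin; apply: dec_int; first exact: test_section tp.
- by [].
- by apply/funext => x; rewrite (derive_section phi x t (erefl : ex4 R = (ex3 R, 0))).
- by apply/funext => x; rewrite (derive_section phi x t (erefl : ey4 R = (ey3 R, 0))).
- by apply/funext => x; rewrite (derive_section phi x t (erefl : ez4 R = (ez3 R, 0))).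
Qed.

End slicewise_decomposition.

(** The space derivatives form the first part of a decomposition, and the time
    derivative the second. *)
Lemma Wm11Wm11_norm_le (L : (pt4 R -> R) -> R) (gt gx gy gz : pt4 R -> R) :
  L1 (tor4 R) gt -> L1 (tor4 R) gx -> L1 (tor4 R) gy -> L1 (tor4 R) gz ->
  (forall phi, test_fun T phi -> L phi = \int[tor4 R]_q (gt q * 'D_(et4 R) phi q + gx q * 'D_(ex4 R) phi q
     + gy q * 'D_(ey4 R) phi q + gz q * 'D_(ez4 R) phi q)) ->
  (Wm11Wm11_norm T L <= (\int[tor4 R]_q `|gt q| + \int[tor4 R]_q `|gx q| + \int[tor4 R]_q `|gy q|
     + \int[tor4 R]_q `|gz q|)%:E)%E.
Proof.
move=> it ix iy iz LE.
have nice (g : pt4 R -> R) : L1 (tor4 R) g -> exists h : pt4 R -> R, [/\ L1 (tor4 R) h,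
    forall t, L1 (tor3 R) (fun x => h (x, t)), \int[tor4 R]_q `|h q| = \int[tor4 R]_q `|g q| &
    forall phi, test_fun T phi -> \int[tor4 R]_q (h q * phi q) = - \int[tor4 R]_q (g q * phi q)].
  move=> gi; have [h hi [hs hE]] := good_slices gi; exists (fun q => - h q); split.
  - exact: L1N.
  - by move=> t; exact: L1N.
  - have := Int_prod21 (L1_norm hi); have := Int_prod21 (L1_norm gi) => /= -> E.
    transitivity (\int[tor4 R]_q `|h q|); first by apply: eq_Int => q; rewrite normrN.
    rewrite E; apply: ae_eq_Int; [exact: (L1_Int2 (L1_norm hi))|exact: (L1_Int2 (L1_norm gi))|].
    by apply: ae_imp hE => t ht; apply: eq_Int => x; rewrite ht.
  - move=> phi tp; have [C _ pC] := test_fun_bounded tp.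
    have M (f : pt4 R -> R) : L1 (tor4 R) f -> L1 (tor4 R) (fun q => f q * phi q).
      by move=> fi; apply: eq_L1 (L1_Mbounded fi (test_fun_measurable tp) pC) => q; rewrite mulrC.
    transitivity (- 1 * \int[tor4 R]_q (h q * phi q)).
      by rewrite -(IntZ _ (M _ hi)); apply: eq_Int => q; ring.
    rewrite mulN1r; congr (- _); have := Int_prod21 (M _ hi); have := Int_prod21 (M _ gi) => /= -> ->.
    apply: ae_eq_Int; [exact: (L1_Int2 (M _ hi))|exact: (L1_Int2 (M _ gi))|].
    by apply: ae_imp hE => t ht; apply: eq_Int => x; rewrite ht.
have [ht [jt st nt Et]] := nice _ it; have [hx [jx sx nx Ex]] := nice _ ix.
have [hy [jy sy ny Ey]] := nice _ iy; have [hz [jz sz nz Ez]] := nice _ iz.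
have z4 := L1_0 (tor4 R); have z3 := fun t : R => L1_0 (tor3 R).
have [w0 n0] := @dec_L1Wm11 (fun=> 0) hx hy hz z4 jx jy jz z3 sx sy sz.
have [w1 n1] := @dec_L1Wm11 ht (fun=> 0) (fun=> 0) (fun=> 0) jt z4 z4 z4 st z3 z3 z3.
have m0 : \int[tor4 R]_q `|0 : R| = 0 by rewrite normr0 Int0.
apply: (@le_trans _ _ (L1Wm11_norm T (dec (fun=> 0%R) hx hy hz)
    + L1Wm11_norm T (dec ht (fun=> 0%R) (fun=> 0%R) (fun=> 0%R)))%E); last first.
  apply: le_trans (leeD n0 n1) _.
  by rewrite /mass4 m0 nt nx ny nz -EFinD lee_fin !addr0 add0r addrC !addrA.
apply: ereal_inf_lbound; exists (dec (fun=> 0) hx hy hz), (dec ht (fun=> 0) (fun=> 0) (fun=> 0)).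
split => // phi tp; have td := test_fun_derive (et4 R) tp.
rewrite /dderive (@dec_time (fun=> 0) hx hy hz z4 jx jy jz z3 sx sy sz _ tp).
rewrite (@dec_time ht (fun=> 0) (fun=> 0) (fun=> 0) jt z4 z4 z4 st z3 z3 z3 _ td) LE//.
have tx := test_fun_derive (ex4 R) tp; have ty := test_fun_derive (ey4 R) tp; have tz := test_fun_derive (ez4 R) tp.
have M (f th : pt4 R -> R) : L1 (tor4 R) f -> test_fun T th -> L1 (tor4 R) (fun q => f q * th q).
  move=> fi tt; have [C _ pC] := test_fun_bounded tt.
  by apply: eq_L1 (L1_Mbounded fi (test_fun_measurable tt) pC) => q; rewrite mulrC.
have A : \int[tor4 R]_q (gt q * 'D_(et4 R) phi q + gx q * 'D_(ex4 R) phi q + gy q * 'D_(ey4 R) phi q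
    + gz q * 'D_(ez4 R) phi q) = - (\int[tor4 R]_q (ht q * 'D_(et4 R) phi q) + \int[tor4 R]_q (hx q * 'D_(ex4 R) phi q)
    + \int[tor4 R]_q (hy q * 'D_(ey4 R) phi q) + \int[tor4 R]_q (hz q * 'D_(ez4 R) phi q)).
  have neg4 (a b c d a' b' c' d' : R) : a' = - a -> b' = - b -> c' = - c -> d' = - d ->
      a + b + c + d = - (a' + b' + c' + d') by move=> -> -> -> ->; ring.
  have a1 := L1D (M _ _ it td) (M _ _ ix tx); have a2 := L1D a1 (M _ _ iy ty).
  rewrite (IntD a2 (M _ _ iz tz)) (IntD a1 (M _ _ iy ty)) (IntD (M _ _ it td) (M _ _ ix tx)).
  exact: neg4 (Et _ td) (Ex _ tx) (Ey _ ty) (Ez _ tz).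
have B : \int[tor4 R]_q (0 * phi q - hx q * 'D_(ex4 R) phi q - hy q * 'D_(ey4 R) phi q - hz q * 'D_(ez4 R) phi q) =
    - (\int[tor4 R]_q (hx q * 'D_(ex4 R) phi q) + \int[tor4 R]_q (hy q * 'D_(ey4 R) phi q)
       + \int[tor4 R]_q (hz q * 'D_(ez4 R) phi q)).
  have a1 := L1D (M _ _ jx tx) (M _ _ jy ty); have a2 := L1D a1 (M _ _ jz tz).
  transitivity (\int[tor4 R]_q (- 1 * (hx q * 'D_(ex4 R) phi q + hy q * 'D_(ey4 R) phi q + hz q * 'D_(ez4 R) phi q))).
    apply: eq_Int => q; move: ('D_(ex4 R) phi q) ('D_(ey4 R) phi q) ('D_(ez4 R) phi q) => *; ring.
  by rewrite (IntZ _ a2) (IntD a1 (M _ _ jz tz)) (IntD (M _ _ jx tx) (M _ _ jy ty)) mulN1r.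
have D : \int[tor4 R]_q (ht q * 'D_(et4 R) phi q - 0 * 'D_(ex4 R) ('D_(et4 R) phi) q - 0 * 'D_(ey4 R) ('D_(et4 R) phi) q
    - 0 * 'D_(ez4 R) ('D_(et4 R) phi) q) = \int[tor4 R]_q (ht q * 'D_(et4 R) phi q).
  apply: eq_Int => q; move: ('D_(ex4 R) ('D_(et4 R) phi) q) ('D_(ey4 R) ('D_(et4 R) phi) q).
  move: ('D_(ez4 R) ('D_(et4 R) phi) q) ('D_(et4 R) phi q) => *; ring.
have comb (a b c d x y : R) : x = - (b + c + d) -> y = a -> - (a + b + c + d) = x - y.
  by move=> -> ->; ring.
exact: (etrans A (comb _ _ _ _ _ _ B D)).
Qed.

End negative_norm.

(** * Weak solutions on the fundamental domain *)

Section from_the_cylinder.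
Variables (R : realType) (T : R).

Lemma ext_slice (f : pt4 R -> R) t x : ext T f (x, t) = if 0 < t < T then f (frac3 x, t) else 0.
Proof.
rewrite /ext patchE; case: (boolP (0 < t < T)) => tT.
  by rewrite mem_set//; split; [exact: frac3_cube|rewrite /= in_itv].
by rewrite memNset// => -[_ /=]; rewrite in_itv/= (negbTE tT).
Qed.

Lemma measurable_section (f : pt4 R -> R) t : measurable_fun setT f ->
  measurable_fun setT (fun x : pt3 R => f (x, t)).
Proof.
move=> mf; have mp : measurable_fun setT (fun x : pt3 R => (x, t)) by exact: measurable_fun_pair.
exact: (measurableT_comp mf mp).
Qed.

(** The norms in the hypotheses are those of restrictions to the cube; estimates on
    the torus need periodic extensions. *)
Lemma integral_slice (f : pt4 R -> R) (r : R) t : r != 0 -> measurable_fun (cylinder T) f -> 0 < t < T ->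
  (\int[leb3 R]_x (`|((fun x => (f (x, t))%:E) \_ (cube R)) x| `^ r) =
   \int[tor3 R]_x (`|ext T f (x, t)| `^ r)%:E)%E.
Proof.
move=> r0 mf tT; have ms := measurable_section t (measurable_ext mf).
have mG : measurable_fun setT (fun x : pt3 R => (`|ext T f (x, t)| `^ r)%:E).
  apply/measurable_EFinP; apply: (measurableT_comp (measurable_powR r)).
  exact: measurableT_comp.
apply: (etrans _ (esym (integral_restricts (tor3_restricts R) mG))); apply: (etrans _ (esym (integral_mkcond _ _))).
transitivity (\int[leb3m R]_x (`|((fun x => (f (x, t))%:E) \_ (cube R)) x| `^ r))%E; first by [].
apply: eq_integral => x _; rewrite !patchE; case: ifPn => xc.
  by rewrite ext_slice tT frac3_id; [|rewrite inE in xc].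
by rewrite /= normr0 powR0.
Qed.

Let Lnorm_slice (f : pt4 R -> R) (r : R) t : r != 0 -> measurable_fun (cylinder T) f -> 0 < t < T ->
  (`|'N[leb3 R]_(r%:E)[(fun x => (f (x, t))%:E) \_ (cube R)]| `^ r =
   \int[tor3 R]_x (`|ext T f (x, t)| `^ r)%:E)%E.
Proof.
move=> r0 mf tT; have E2 := poweR_Lnorm (leb3 R) ((fun x => (f (x, t))%:E) \_ (cube R)) r0.
have E1 := gee0_abs (Lnorm_ge0 (leb3 R) r%:E ((fun x => (f (x, t))%:E) \_ (cube R))).
exact: etrans (congr1 (fun y => (y `^ r)%E) E1) (etrans E2 (integral_slice r0 mf tT)).
Qed.

Let le_of_eq (a b : \bar R) : a = b -> (a <= b)%E. Proof. by move=> ->. Qed.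

Lemma LpLq_integral (f : pt4 R -> R) (n : nat) : (0 < n)%N -> ~~ odd n -> field_on_torus T f ->
  (LpLq_norm T n%:R%:E n%:R%:E f < +oo)%E -> L1 (tor4 R) (fun q => ext T f q ^+ n).
Proof.
move=> n0 en [_ mf] fn; have nR : n%:R != 0 :> R by rewrite pnatr_eq0 -lt0n.
have me := measurable_ext mf.
apply/integrable21ltyP; first by apply/measurable_EFinP; exact: measurable_funX.
have := poweR_lty n%:R fn; rewrite /LpLq_norm poweR_Lnorm//; apply: le_lt_trans.
apply: ge0_le_integral_nonmeasurable => t _; first exact: integral_ge0.
rewrite patchE; have [tT|tT] := boolP (0 < t < T).
  rewrite mem_set; last by rewrite /= in_itv.
  apply: le_of_eq; apply: (etrans _ (esym (Lnorm_slice nR mf tT))).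
  by apply: eq_integral => x _; rewrite /= powR_mulrn// normrX.
rewrite memNset; last by rewrite /= in_itv/= (negbTE tT).
rewrite (_ : (\int[tor3 R]_x _ = 0)%E) ?poweR_ge0//.
apply: integral0_eq => x _; rewrite /= ext_slice (negbTE tT) expr0n.
by rewrite (gtn_eqF n0) normr0.
Qed.

Lemma L2_integral (f : pt4 R -> R) : field_on_torus T f -> (L2_norm T f < +oo)%E ->
  L1 (tor4 R) (fun q => ext T f q ^+ 2).
Proof.
move=> [pf mf] fn; have me := measurable_ext mf.
apply: L1_ge0P => [|q|]; [exact: measurable_funX|exact: sqr_ge0|].
have two : 2 != 0 :> R by [].
have E2 := poweR_Lnorm (leb4 R) ((EFin \o f) \_ (cylinder T)) two.
have lt := poweR_lty 2 fn.
have h : (\int[leb4 R]_(q in cylinder T) (f q ^+ 2)%:E =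
    \int[leb4 R]_x (`|((EFin \o f) \_ (cylinder T)) x| `^ 2))%E.
  apply: (etrans (integral_mkcond _ _)); apply: eq_integral => q _; rewrite !patchE; case: ifPn => _.
    by rewrite /= (powR_mulrn 2)// real_normK// num_real.
  by rewrite /= normr0 powR0.
have h' := etrans h (esym E2).
have h2 : (\int[leb4 R]_(q in cylinder T) (f q ^+ 2)%:E = \int[tor4 R]_q (ext T f q ^+ 2)%:E)%E; last first.
  exact: le_lt_trans (le_of_eq (etrans (esym h2) h')) lt.
apply: integral_cylinder.
- by apply/measurable_EFinP; exact: measurable_funX.
- by move=> q qT; rewrite extE.
- by move=> q qT; rewrite ext_out// expr0n.
Qed.

Lemma Linfty_L1 (f : pt4 R -> R) : field_on_torus T f -> (LpLq_norm T +oo 1%:E f < +oo)%E ->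
  exists M0 : R, L1 (tor4 R) (ext T f) /\
    {ae leb1 R, forall t, `|\int[tor3 R]_x ext T f (x, t)| <= M0}.
Proof.
move=> [pf mf] fn; have me := measurable_ext mf.
have LE (h : R -> \bar R) : 'N[leb1 R]_+oo[h]%E =
    (if (0 < leb1 R setT)%E then ess_sup (leb1 R) (abse \o h) else 0%E) by rewrite unlock.
move: fn; rewrite /LpLq_norm LE.
have -> : (0 < leb1 R setT)%E.
  apply: (@lt_le_trans _ _ (leb1 R `]0%R, 1%R]%classic)).
    by rewrite lebesgue_measure_itv/= lte_fin ltr01 -EFinD lte_fin subr0.
  by apply: le_measure; rewrite ?inE//; exact: measurable_itv.
set g := (X in ess_sup _ X) => gn.
pose M0 := fine (ess_sup (leb1 R) g).
have gM : {ae leb1 R, forall t, (g t <= M0%:E)%E}.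
  have := ess_sup_ge (leb1 R) g; apply: ae_imp => t; rewrite /M0.
  move: gn; case: (ess_sup _ _) => [r _|//|_]; first by [].
  by move=> h; apply: le_trans h _; rewrite leNye.
have slice : {ae leb1 R, forall t, L1 (tor3 R) (fun x => ext T f (x, t)) /\
    \int[tor3 R]_x `|ext T f (x, t)| <= (if 0 < t < T then `|M0| else 0)}.
  apply: ae_imp gM => t gt; have ms := measurable_section t me.
  have [tT|tT] := boolP (0 < t < T); last first.
    have z x : ext T f (x, t) = 0 by rewrite ext_slice (negbTE tT).
    split; first by apply: eq_L1 (L1_0 (tor3 R)) => x; rewrite z.
    by rewrite (_ : \int[tor3 R]_x _ = 0)// -[RHS](Int0 (tor3 R)); apply: eq_Int => x; rewrite z normr0.
  have : (\int[tor3 R]_x `|ext T f (x, t)|%:E <= M0%:E)%E.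
    move: gt; rewrite /g /= patchE mem_set; last by rewrite /= in_itv.
    move=> gt; have h := Lnorm_slice (oner_neq0 R) mf tT; rewrite poweRe1 in h; last exact: abse_ge0.
    have -> : (\int[tor3 R]_x `|ext T f (x, t)|%:E = \int[tor3 R]_x (`|ext T f (x, t)| `^ 1)%:E)%E.
      by apply: eq_integral => x _; rewrite powRr1.
    by rewrite -h; exact: gt.
  move=> h; have i : L1 (tor3 R) (fun x => ext T f (x, t)).
    apply/integrableP; split; first exact/measurable_EFinP.
    exact: le_lt_trans h (ltry _).
  by split=> //; rewrite -lee_fin (EFin_Int (L1_norm i)); apply: le_trans h _; rewrite lee_fin ler_norm.
have hI : L1 (leb1 R) (\1_(`]0, T[ : set R) : R -> R) by exact: integrable_indic_itv.
have ic : L1 (leb1 R) (fun t => if 0 < t < T then `|M0| else 0).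
  by apply: eq_L1 (L1Z `|M0| hI) => t; rewrite indicE mem_setE in_itv/=; case: ifP; rewrite ?mulr1 ?mulr0.
exists `|M0|; split.
  exact: (@L1_prod21_ae _ _ _ _ _ (tor3 R) (leb1 R) _ _ me ic slice).
apply: ae_imp slice => t [i le]; apply: le_trans (norm_Int_le i (L1_norm i) (fun x => lexx _)) _.
by apply: le_trans le _; case: ifP.
Qed.

(** Test functions vanish outside the time interval, so the fields may be set to
    zero there. *)
Lemma flux_cylinder (f0 ft fx fy fz g0 gt gx gy gz : pt4 R -> R) :
  [/\ measurable_fun setT f0, measurable_fun setT ft, measurable_fun setT fx, measurable_fun setT fy & measurable_fun setT fz] ->
  (forall q, 0 < q.2 < T -> [/\ f0 q = g0 q, ft q = gt q, fx q = gx q, fy q = gy q & fz q = gz q]) ->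
  (forall theta, test_fun T theta -> \int[leb4 R]_(q in cylinder T) (g0 q * theta q + gt q * 'D_(et4 R) theta q
     + gx q * 'D_(ex4 R) theta q + gy q * 'D_(ey4 R) theta q + gz q * 'D_(ez4 R) theta q) = 0) ->
  flux_eq T (flux5 f0 ft fx fy fz).
Proof.
move=> [m0 mt mx my mz] fg H theta tt; rewrite -[RHS](H theta tt).
have td e := test_fun_derive e tt; have md e := test_fun_measurable (td e).
transitivity (\int[tor4 R]_q (f0 q * theta q + ft q * 'D_(et4 R) theta q
     + fx q * 'D_(ex4 R) theta q + fy q * 'D_(ey4 R) theta q + fz q * 'D_(ez4 R) theta q)).
  by apply: eq_Int => q; exact: flux5E.
apply/esym/Int_cylinder.
- have mt' := test_fun_measurable tt.
  apply: measurable_funD; last exact: measurable_funM.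
  apply: measurable_funD; last exact: measurable_funM.
  apply: measurable_funD; last exact: measurable_funM.
  by apply: measurable_funD; exact: measurable_funM.
- by move=> q /fg[-> -> -> -> ->].
- move=> q qT; rewrite (test_fun_out tt qT) (test_fun_out (td _) qT) (test_fun_out (td _) qT).
  by rewrite (test_fun_out (td _) qT) (test_fun_out (td _) qT) !mulr0 !addr0.
Qed.

(** The fields are restricted to the fundamental cylinder, extended periodically in
    space, and by zero in time. *)
Theorem torus_solution_of (Om : R) (u v w p : pt4 R -> R) : type_I_weak_solution T Om u v w p ->
  (LpLq_norm T 4%:E 4%:E u < +oo)%E -> (LpLq_norm T 4%:E 4%:E v < +oo)%E ->
  exists M0, torus_solution T Om M0 (ext T u) (ext T v) (ext T w) (ext T p).
Proof.
move=> [[fu fv fw fp] [[_ _ w2] [_ _ p1]] weak _] u4 v4.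
have [M0 [iP sP]] := Linfty_L1 fp p1; exists M0.
have mu := measurable_ext fu.2; have mv := measurable_ext fv.2; have mw := measurable_ext fw.2.
have mp := measurable_ext fp.2.
have eqs q : 0 < q.2 < T -> [/\ ext T u q = u q, ext T v q = v q, ext T w q = w q & ext T p q = p q].
  by move=> qT; rewrite !extE//; [exact: fp.1|exact: fw.1|exact: fv.1|exact: fu.1].
split.
- by split; exact: per4_ext.
- by move=> q qT; rewrite !ext_out.
- by [].
- by split; [exact: (@LpLq_integral u 4)|exact: (@LpLq_integral v 4)|exact: L2_integral|].
- exact: sP.
- apply: (flux_cylinder (g0 := fun q => Om * v q) (gt := u) (gx := fun q => u q ^+ 2 + p q)
    (gy := fun q => u q * v q) (gz := fun q => u q * w q)) => [|q qT|theta tt].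
  + split => //; [exact: measurable_funM|apply: measurable_funD => //; exact: measurable_funX|exact: measurable_funM|exact: measurable_funM].
  + by have [-> -> -> ->] := eqs q qT.
  + have [E _ _ _] := weak _ _ _ _ tt tt tt tt; rewrite -[RHS]E; apply: eq_Rintegral => q _.
    by move: ('D_(et4 R) theta q) ('D_(ex4 R) theta q) ('D_(ey4 R) theta q) ('D_(ez4 R) theta q) => *; ring.
- apply: (flux_cylinder (g0 := fun q => - Om * u q) (gt := v) (gx := fun q => u q * v q)
    (gy := fun q => v q ^+ 2 + p q) (gz := fun q => v q * w q)) => [|q qT|theta tt].
  + split => //; [exact: measurable_funM|exact: measurable_funM|apply: measurable_funD => //; exact: measurable_funX|exact: measurable_funM].
  + by have [-> -> -> ->] := eqs q qT.
  + have [_ E _ _] := weak _ _ _ _ tt tt tt tt; rewrite -[RHS]E; apply: eq_Rintegral => q _.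
    by move: ('D_(et4 R) theta q) ('D_(ex4 R) theta q) ('D_(ey4 R) theta q) ('D_(ez4 R) theta q) => *; ring.
- apply: (flux_cylinder (g0 := fun=> 0) (gt := fun=> 0) (gx := u) (gy := v) (gz := w)) => [|q qT|theta tt].
  + by split.
  + by have [-> -> -> _] := eqs q qT.
  + have [_ _ _ E] := weak _ _ _ _ tt tt tt tt; rewrite -[RHS]E; apply: eq_Rintegral => q _.
    by move: ('D_(et4 R) theta q) ('D_(ex4 R) theta q) ('D_(ey4 R) theta q) ('D_(ez4 R) theta q) => *; ring.
- apply: (flux_cylinder (g0 := fun=> 0) (gt := fun=> 0) (gx := fun=> 0) (gy := fun=> 0) (gz := p)) => [|q qT|theta tt].
  + by split.
  + by have [_ _ _ ->] := eqs q qT.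
  + have [_ _ E _] := weak _ _ _ _ tt tt tt tt; rewrite -[RHS]E; apply: eq_Rintegral => q _.
    by move: ('D_(et4 R) theta q) ('D_(ex4 R) theta q) ('D_(ey4 R) theta q) ('D_(ez4 R) theta q) => *; ring.
Qed.

End from_the_cylinder.

(** ** Dilations *)

Section dilation.
Context d (X : measurableType d) (R : realType).

Definition dilates (c : {nonneg R}) (m : {measure set X -> \bar R}) (S : X -> X) :=
  measurable_fun setT S /\ (forall A, measurable A -> (c%:num%:E * m (S @^-1` A))%E = m A).

Variables (c : {nonneg R}) (m : {measure set X -> \bar R}) (S : X -> X).
Hypothesis mcS : dilates c m S.

Let Int_dilates_ge0 (f : X -> R) : (forall x, 0 <= f x) -> L1 m f -> L1 m (f \o S) ->
  c%:num * \int[m]_x f (S x) = \int[m]_x f x.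
Proof.
have [mS E] := mcS; move=> f0 fi fSi; apply: EFin_inj; rewrite EFinM (EFin_Int fi).
have mf : measurable_fun setT (EFin \o f) := measurable_int _ fi.
have f0' x : setT x -> (0 <= (EFin \o f) x)%E by rewrite /= lee_fin.
have h := ge0_integral_pushforward mS (mscale c m) measurableT mf.
have {}h := h (fun x _ => f0' _ I); rewrite preimage_setT in h.
have -> : (\int[m]_x (f x)%:E = \int[pushforward (mscale c m) S]_x (f x)%:E)%E.
  by apply: eq_measure_integral => A mA _; exact: esym (E A mA).
rewrite h ge0_integral_mscale//; [|exact: (measurableT_comp mf mS)|by move=> x _; exact: f0'].
by congr (_ * _)%E; rewrite (EFin_Int fSi).
Qed.

Lemma Int_dilates (f : X -> R) : L1 m f -> L1 m (f \o S) -> c%:num * \int[m]_x f (S x) = \int[m]_x f x.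
Proof.
move=> fi fSi; have ni := L1_norm fi; have nSi := L1_norm fSi.
have p0 x : 0 <= f x + `|f x| by have := ler_norm (- f x); rewrite normrN; lra.
have h1 := Int_dilates_ge0 p0 (L1D fi ni) (L1D fSi nSi).
have h2 := Int_dilates_ge0 (fun x => normr_ge0 (f x)) ni nSi.
have e1 := IntD fi ni; have e2 := IntD fSi nSi.
move: h1 h2; rewrite e1; have -> : \int[m]_x (f (S x) + `|f (S x)|) = \int[m]_x f (S x) + \int[m]_x `|f (S x)| by exact: e2.
by rewrite mulrDr => h1 h2; move: h1; rewrite h2 => /addIr.
Qed.

End dilation.

Section dilation_product.
Context d1 d2 (X : measurableType d1) (Y : measurableType d2) (R : realType).
Variables (m1 : {sigma_finite_measure set X -> \bar R})
  (m2 : {sigma_finite_measure set Y -> \bar R}).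

Lemma dilates_prod (c c1 c2 : {nonneg R}) (S1 : X -> X) (S2 : Y -> Y) : c%:num = c1%:num * c2%:num ->
  dilates c1 m1 S1 -> dilates c2 m2 S2 ->
  dilates c (prodm m1 m2) (fun z => (S1 z.1, S2 z.2)).
Proof.
move=> cE [mS1 S1E] [mS2 S2E].
have mS : measurable_fun [set: X * Y] (fun z : X * Y => (S1 z.1, S2 z.2)).
  apply: measurable_fun_pair.
    exact: (measurableT_comp mS1 measurable_fst).
  exact: (measurableT_comp mS2 measurable_snd).
split=> // A mA.
pose S (z : X * Y) := (S1 z.1, S2 z.2).
have := @prodm_unique _ _ _ _ _ m1 m2 (pushforward (mscale c (prodm m1 m2)) S).
move=> /(_ mS) E; apply/esym; apply: E => // B C mB mC.
have mB' : measurable (S1 @^-1` B) by rewrite -[_ @^-1` _]setTI; exact: mS1.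
have mC' : measurable (S2 @^-1` C) by rewrite -[_ @^-1` _]setTI; exact: mS2.
have E1 : prodm m1 m2 (S @^-1` (B `*` C)) = (m1 (S1 @^-1` B) * m2 (S2 @^-1` C))%E := prodmE m1 m2 mB' mC'.
transitivity (c%:num%:E * prodm m1 m2 (S @^-1` (B `*` C)))%E; first by [].
by rewrite E1 cE EFinM muleACA S1E// S2E.
Qed.

End dilation_product.

Section dilation_space.
Variable R : realType.

Lemma dilates_line (s : {nonneg R}) : 0 < s%:num -> dilates s (leb1 R) (fun x => s%:num * x).
Proof.
move=> s0; have sn : s%:num != 0 by rewrite gt_eqF.
have mS : measurable_fun setT (fun x : measurableTypeR R => (s%:num * x : measurableTypeR R)).
  exact: measurable_funM.
split=> // A mA; have := @lebesgue_measure_unique R (pushforward (mscale s (leb1 R)) ((fun x => s%:num * x) : _ -> measurableTypeR R)).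
move=> /(_ mS) H; apply/esym; apply: H => // _ [[a b]] _ <-.
have L (x y : R) : leb1 R `]x, y]%classic = (if x < y then (y - x)%:E else 0%E).
  by rewrite lebesgue_measure_itv/= lte_fin EFinB.
have pre : (fun x : R => s%:num * x) @^-1` `]a, b]%classic = `]a / s%:num, b / s%:num]%classic.
  by apply/seteqP; split => x /=; rewrite !in_itv/= ltr_pdivrMr// ler_pdivlMr// ![_ * s%:num]mulrC.
apply: (etrans (L a b)); apply: esym.
transitivity (s%:num%:E * leb1 R ((fun x : R => (s%:num * x)%R) @^-1` `]a, b]%classic))%E; first by [].
rewrite pre L ltr_pM2r ?invr_gt0//; case: ifPn => _; last by rewrite mule0.
by rewrite -EFinM -mulrBl mulrC divfK.
Qed.

Lemma Int_rescale (rho : pt3 R -> R) (M e : R) : smooth rho -> supported M rho -> 0 < e ->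
  [/\ smooth (rescale rho e), supported (e * M) (rescale rho e) &
      \int[leb3m R]_x rescale rho e x = \int[leb3m R]_x rho x].
Proof.
move=> sr sur e0; have e0' : 0 < e^-1 by rewrite invr_gt0.
have en : e != 0 by rewrite gt_eqF.
have sS : smooth (fun x : pt3 R => rho (e^-1 *: x)).
  apply: (smooth_affine (A := fun x : pt3 R => e^-1 *: x) (L := fun x : pt3 R => e^-1 *: x) _ _ sr).
    exact: scaler_continuous.
  by move=> h d y; rewrite scalerDr scalerA mulrC -scalerA.
have suS : supported (e * M) (fun x : pt3 R => rho (e^-1 *: x)).
  by move=> x xM; apply: sur; rewrite normrZ gtr0_norm// mulrC ltr_pdivlMr// mulrC.
split.
- by apply: smoothM; [exact: smooth_cst|exact: sS].
- by move=> x xM; rewrite /rescale suS// mulr0.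
have h1 := ltW e0'; have h2 := mulr_ge0 h1 h1; have h3 := mulr_ge0 h2 h1.
have d1 := @dilates_line (NngNum h1) e0'.
have d2 := @dilates_prod _ _ _ _ _ (leb1 R) (leb1 R) (NngNum h2) (NngNum h1) (NngNum h1) _ _ erefl d1 d1.
have d3 := @dilates_prod _ _ _ _ _ (leb2m R) (leb1 R) (NngNum h3) (NngNum h2) (NngNum h1) _ _ erefl d2 d1.
have i1 := L1_kernel3 sr sur; have i2 := L1_kernel3 sS suS.
rewrite /rescale (IntZ _ i2) -(Int_dilates d3 i1 i2) /=; congr (_ * _).
by rewrite -exprVn exprS expr2 mulrA.
Qed.

(** The factor [e ^- 3] cancels the volume of the box that carries the rescaled
    kernel. *)
Lemma rescale_mass (rho : pt3 R -> R) (M : R) : smooth rho -> supported M rho -> 0 <= M ->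
  exists2 C : R, 0 <= C & forall e : R, 0 < e -> \int[leb3m R]_x `|rescale rho e x| <= C.
Proof.
move=> sr sur M0; have [C C0 hC] := bounded_kernel3 sr sur.
exists (C * (2 * M) ^+ 3); first by rewrite mulr_ge0// exprn_ge0// mulr_ge0.
move=> e e0; have [se sue _] := Int_rescale sr sur e0.
have eM : 0 <= e * M by rewrite mulr_ge0// ltW.
have ib := L1Z (e ^- 3 * C) (L1_box3 (e * M)).
apply: le_trans (le_Int (L1_norm (L1_kernel3 se sue)) ib _) _ => [x|].
  have [xM|xM] := leP `|x| (e * M); last by rewrite sue// normr0 !mulr_ge0 ?box3_ge0// invr_ge0 exprn_ge0// ltW.
  rewrite box3_in// mulr1 /rescale normrM ger0_norm ?invr_ge0 ?exprn_ge0 ?(ltW e0)//.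
  by rewrite ler_wpM2l// invr_ge0 exprn_ge0// ltW.
rewrite (IntZ _ (L1_box3 (e * M))).
have b1 := L1_box1 (e * M); have b2 := L1_tensor b1 b1.
have -> : \int[leb3m R]_x box3 (e * M) x = (2 * (e * M)) ^+ 3.
  have := Int_tensor b2 b1; have := Int_tensor b1 b1 => /= -> h.
  by apply: (etrans h); rewrite Int_box1//; ring.
rewrite le_eqVlt; apply/orP; left; apply/eqP; field; exact: lt0r_neq0.
Qed.

Lemma mollifier_supported (rho : pt3 R -> R) : compact (closure [set xi | rho xi != 0]) ->
  exists2 M : R, 0 <= M & supported M rho.
Proof.
move=> /compact_bounded [C [_ HC]]; exists (`|C| + 1); first by rewrite addr_ge0.
move=> x xM; apply/eqP; apply: contraLR xM => rx; rewrite -leNgt.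
apply: (HC (`|C| + 1)); first by rewrite (le_lt_trans (ler_norm C))// ltrDl.
exact: subset_closure.
Qed.

End dilation_space.

(** * The dissipation functional *)

Section four_terms.
Context d (X : measurableType d) (R : realType) (m : {measure set X -> \bar R}).

Lemma Int4 (a b c e : X -> R) : L1 m a -> L1 m b -> L1 m c -> L1 m e ->
  \int[m]_x (a x + b x + c x + e x) = \int[m]_x a x + \int[m]_x b x + \int[m]_x c x + \int[m]_x e x.
Proof.
move=> ia ib ic ie; have iab := L1D ia ib.
by rewrite (IntD (L1D iab ic) ie) (IntD iab ic) (IntD ia ib).
Qed.

Lemma Int_lin2 (r s : R) (a b : X -> R) : L1 m a -> L1 m b ->
  \int[m]_x (r * a x + s * b x) = r * \int[m]_x a x + s * \int[m]_x b x.
Proof. by move=> ia ib; rewrite (IntD (L1Z r ia) (L1Z s ib)) (IntZ r ia) (IntZ s ib). Qed.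

End four_terms.

Lemma sum4_le (R : realType) (a b c d x : R) : a <= x -> b <= x -> c <= x -> d <= x ->
  a + b + c + d <= 4 * x.
Proof. lra. Qed.

Lemma split_sum4 (R : realType) (A1 A2 A3 A4 B1 B2 B3 B4 C1 C2 C3 C4 S D E : R) :
  S = A1 + A2 + A3 + A4 -> A1 = B1 + C1 -> A2 = B2 + C2 -> A3 = B3 + C3 -> A4 = B4 + C4 ->
  D = B1 + B2 + B3 + B4 -> E = C1 + C2 + C3 + C4 -> S = D + E.
Proof. by move=> -> -> -> -> -> -> ->; ring. Qed.

Section marginals.
Variable R : realType.

(** Fubini's theorem gives integrable slices only almost everywhere, so the weight can
    be taken out of the inner integral only there. *)
Lemma weighted_marginal (H : pt4 R * pt3 R -> R) (phi : pt4 R -> R) (C : R) :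
  L1 (pairs3 R) H -> measurable_fun setT phi -> (forall q, `|phi q| <= C) ->
  \int[pairs3 R]_z (phi z.1 * H z) = \int[tor4 R]_q (phi q * \int[leb3m R]_x H (q, x)).
Proof.
move=> hi mphi phiC.
have mp : measurable_fun setT (fun z : pt4 R * pt3 R => phi z.1).
  exact: (measurableT_comp mphi measurable_fst).
have pi := L1_Mbounded hi mp (fun z => phiC z.1).
apply: (etrans (Int_prod12 pi)).
apply: ae_eq_Int; [exact: (L1_Int1 pi)|exact: (L1_Mbounded (L1_Int1 hi) mphi phiC)|].
have := @ae_integrable1 _ _ _ _ R (tor4 R) (leb3m R) _ hi.
apply: ae_imp => q qi; have qi' : L1 (leb3m R) (fun x => H (q, x)) := qi.
exact: (IntZ (phi q) qi').
Qed.

Lemma norm_marginal (H : pt4 R * pt3 R -> R) : L1 (pairs3 R) H ->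
  \int[tor4 R]_q `|\int[leb3m R]_x H (q, x)| <= \int[pairs3 R]_z `|H z|.
Proof.
move=> hi; have ni := L1_norm hi.
pose B q := \int[leb3m R]_x `|H (q, x)|; pose c q := `|\int[leb3m R]_x H (q, x)|.
have Bi : L1 (tor4 R) B := L1_Int1 ni; have ci : L1 (tor4 R) c := L1_norm (L1_Int1 hi).
have E : \int[tor4 R]_q c q = \int[tor4 R]_q (B q - `|B q - c q|).
  apply: ae_eq_Int; [exact: ci|exact: (L1B Bi (L1_norm (L1B Bi ci)))|].
  have := @ae_integrable1 _ _ _ _ R (tor4 R) (leb3m R) _ hi; apply: ae_imp => q qi'; have qi : L1 (leb3m R) (fun x => H (q, x)) := qi'.
  have h : c q <= B q by exact: (norm_Int_le qi (L1_norm qi) (fun x => lexx _)).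
  by rewrite ger0_norm ?subr_ge0// subKr.
rewrite (_ : \int[pairs3 R]_z `|H z| = \int[tor4 R]_q B q); last exact: (Int_prod12 ni).
rewrite -/c E; apply: le_Int; [exact: (L1B Bi (L1_norm (L1B Bi ci)))|exact: Bi|].
by move=> q; rewrite gerBl.
Qed.

End marginals.

Section commutators.
Variables (R : realType) (T Om M0 : R) (U V W P : pt4 R -> R).
Hypothesis sol : torus_solution T Om M0 U V W P.
Local Notation G := (mass T U V W P).
Local Notation d := (gap_of_fields U V W P).
Let g0 := mass_ge0 sol.
Let gi := L1_mass sol.
Let pg := per4_mass sol.

(** The error made in replacing the average of [F q (q + xi)] against a kernel by
    the diagonal value [F q q]. *)
Definition comm (F : pt4 R -> pt4 R -> R) (k : pt3 R -> R) (q : pt4 R) : R :=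
  \int[leb3m R]_x (k x * (at_once F q x - F q q)).

Variable F : pt4 R -> pt4 R -> R.
Hypothesis tF : L1c G d F.
Hypothesis mF : measurable_fun setT (fun z : pt4 R * pt4 R => F z.1 (z.1 + z.2)).

Lemma L1_diag : L1 (tor4 R) (fun q => F q q).
Proof. by have h := tame_L1 gi pg tF mF 0; apply: eq_L1 h => q; rewrite addr0. Qed.

Variables (k : pt3 R -> R) (r : R).
Hypotheses (ki : L1 (leb3m R) k) (suk : supported r k).

Let shifted : L1 (pairs3 R) (fun z => k z.2 * (1 * at_once F z.1 z.2)).
Proof.
have c1 (q : pt4 R) : `|(1 : R)| <= 1 by rewrite normr1.
exact: (L1_tm g0 gi pg tF mF ki (@measurable_cst _ _ _ _ setT (1 : R)) c1).
Qed.

Let differ : L1 (pairs3 R) (fun z => k z.2 * (at_once F z.1 z.2 - F z.1 z.1)).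
Proof. by apply: eq_L1 (L1B shifted (L1_tensor L1_diag ki)) => z /=; ring. Qed.

Lemma L1_comm : L1 (tor4 R) (comm F k).
Proof. exact: (L1_Int1 differ). Qed.

(** After exchanging the integrals, only shifts in the support of the kernel matter. *)
Lemma comm_small (e : R) : 0 <= e ->
  (forall x : pt3 R, `|x| <= r -> \int[tor4 R]_q `|F q (q + (x, 0)) - F q q| <= e) ->
  \int[tor4 R]_q `|comm F k q| <= (\int[leb3m R]_x `|k x|) * e.
Proof.
move=> e0 He; apply: le_trans (norm_marginal differ) _.
rewrite (_ : \int[pairs3 R]_z _ = \int[leb3m R]_x \int[tor4 R]_q `|k x * (at_once F q x - F q q)|); last first.
  exact: (Int_prod21 (L1_norm differ)).
rewrite mulrC -(IntZ _ (L1_norm ki)).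
apply: le_Int; [exact: (L1_Int2 (L1_norm differ))|exact: (L1Z e (L1_norm ki))|] => x.
have E : \int[tor4 R]_q `|k x * (at_once F q x - F q q)| = `|k x| * \int[tor4 R]_q `|F q (q + (x, 0)) - F q q|.
  by rewrite -(IntZ _ (L1_norm (L1B (tame_L1 gi pg tF mF (x, 0)) L1_diag))); apply: eq_Int => q; rewrite normrM.
rewrite E mulrC; have [xr|xr] := leP `|x| r; first by rewrite ler_wpM2r// He.
by rewrite suk// normr0 !mulr0.
Qed.

Lemma tm_split (psi : pt4 R -> R) (C : R) : \int[leb3m R]_x k x = 1 ->
  measurable_fun setT psi -> (forall q, `|psi q| <= C) ->
  \int[pairs3 R]_z (k z.2 * (psi z.1 * at_once F z.1 z.2)) =
  \int[tor4 R]_q (F q q * psi q + comm F k q * psi q).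
Proof.
move=> k1 mpsi psiC; have ti := L1_tensor L1_diag ki.
have e1 := weighted_marginal differ mpsi psiC; have e2 := weighted_marginal ti mpsi psiC.
have mp : measurable_fun setT (fun z : pt4 R * pt3 R => psi z.1).
  exact: (measurableT_comp mpsi measurable_fst).
have i1 := L1_Mbounded differ mp (fun z => psiC z.1); have i2 := L1_Mbounded ti mp (fun z => psiC z.1).
transitivity (\int[pairs3 R]_z (psi z.1 * (F z.1 z.1 * k z.2)) +
    \int[pairs3 R]_z (psi z.1 * (k z.2 * (at_once F z.1 z.2 - F z.1 z.1)))).
  by rewrite -(IntD i2 i1); apply: eq_Int => z; ring.
have j1 : L1 (tor4 R) (fun q => F q q * psi q).
  by apply: eq_L1 (L1_Mbounded L1_diag mpsi psiC) => q; rewrite mulrC.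
have j2 : L1 (tor4 R) (fun q => comm F k q * psi q).
  by apply: eq_L1 (L1_Mbounded L1_comm mpsi psiC) => q; rewrite mulrC.
rewrite e1 e2 (IntD j1 j2); congr (_ + _); apply: eq_Int => q; last by rewrite mulrC.
by rewrite (IntZ (F q q) ki) k1 mulr1 mulrC.
Qed.

End commutators.

Section dissipation.
Variables (R : realType) (T Om M0 : R) (U V W P : pt4 R -> R).
Hypothesis sol : torus_solution T Om M0 U V W P.
Local Notation G := (mass T U V W P).
Local Notation d := (gap_of_fields U V W P).
Let g0 := mass_ge0 sol.
Let gi := L1_mass sol.
Let pg := per4_mass sol.
Let pd := per4_gap_of_fields sol.
Let ds := gap_of_fields_small sol.
Let mU : measurable_fun setT U. Proof. by have [] := ts_meas sol. Qed.
Let mV : measurable_fun setT V. Proof. by have [] := ts_meas sol. Qed.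
Let mW : measurable_fun setT W. Proof. by have [] := ts_meas sol. Qed.
Let mP : measurable_fun setT P. Proof. by have [_ _ _ h] := ts_int sol; exact: L1_measurable h. Qed.

Definition twice_corr (a b : pt4 R) : R := 2 * corr U V a b.

(** Twice the energy and its flux, tested with the gradient: the value that the
    energy balance assigns to the defect. *)
Definition dissipation (phi : pt4 R -> R) : R :=
  \int[tor4 R]_q (twice_corr q q * 'D_(et4 R) phi q + bal_flux U V P U q q * 'D_(ex4 R) phi q
     + bal_flux U V P V q q * 'D_(ey4 R) phi q + bal_flux U V P W q q * 'D_(ez4 R) phi q).

Let tt : L1c G d twice_corr. Proof. by apply: L1cZ; [exact: g0|exact: tame_corr sol]. Qed.
Let mt : measurable_fun setT (fun z : pt4 R * pt4 R => twice_corr z.1 (z.1 + z.2)).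
Proof. by apply: measurable_funM; [exact: measurable_cst|exact: measurable_corr sol]. Qed.
Let tx : L1c G d (bal_flux U V P U). Proof. by apply: (tame_bal_flux sol); exact: (L2_U sol). Qed.
Let ty : L1c G d (bal_flux U V P V). Proof. by apply: (tame_bal_flux sol); exact: (L2_V sol). Qed.
Let tz : L1c G d (bal_flux U V P W). Proof. by apply: (tame_bal_flux sol); exact: (L2_W sol). Qed.
Let mx : measurable_fun setT (fun z : pt4 R * pt4 R => bal_flux U V P U z.1 (z.1 + z.2)).
Proof. by apply: (measurable_bal_flux sol); exact: mU. Qed.
Let my : measurable_fun setT (fun z : pt4 R * pt4 R => bal_flux U V P V z.1 (z.1 + z.2)).
Proof. by apply: (measurable_bal_flux sol); exact: mV. Qed.
Let mz : measurable_fun setT (fun z : pt4 R * pt4 R => bal_flux U V P W z.1 (z.1 + z.2)).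
Proof. by apply: (measurable_bal_flux sol); exact: mW. Qed.

Lemma dissipation_finite : (Wm11Wm11_norm T dissipation < +oo)%E.
Proof.
apply: le_lt_trans (ltry _).
exact: (Wm11Wm11_norm_le (L1_diag sol tt mt) (L1_diag sol tx mx) (L1_diag sol ty my) (L1_diag sol tz mz)
  (fun phi _ => erefl)).
Qed.

Lemma fluxes_small (e : R) : 0 < e -> exists2 r : R, 0 < r & forall x : pt3 R, `|x| <= r ->
  [/\ \int[tor4 R]_q `|twice_corr q (q + (x, 0)) - twice_corr q q| <= e,
      \int[tor4 R]_q `|bal_flux U V P U q (q + (x, 0)) - bal_flux U V P U q q| <= e,
      \int[tor4 R]_q `|bal_flux U V P V q (q + (x, 0)) - bal_flux U V P V q q| <= e &
      \int[tor4 R]_q `|bal_flux U V P W q (q + (x, 0)) - bal_flux U V P W q q| <= e].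
Proof.
move=> e0.
have S F : L1c G d F -> measurable_fun setT (fun z : pt4 R * pt4 R => F z.1 (z.1 + z.2)) ->
    exists2 r : R, 0 < r & forall x : pt3 R, `|x| <= r -> \int[tor4 R]_q `|F q (q + (x, 0)) - F q q| <= e.
  move=> tF mF; have [r r0 hr] := tame_small g0 gi pg pd ds tF mF e0; exists r => // x xr.
  rewrite (_ : \int[tor4 R]_q _ = \int[tor4 R]_q `|F q (q + (x, 0)) - F q (q + 0)|).
    by apply: hr; rewrite subr0; apply: norm_pair_ge => //; rewrite normr0 (le_trans _ xr).
  by apply: eq_Int => q; rewrite addr0.
have [r1 r10 h1] := S _ tt mt; have [r2 r20 h2] := S _ tx mx.
have [r3 r30 h3] := S _ ty my; have [r4 r40 h4] := S _ tz mz.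
exists (Num.min (Num.min r1 r2) (Num.min r3 r4)); first by rewrite !lt_min r10 r20 r30 r40.
move=> x; rewrite !le_min => /andP[/andP[x1 x2] /andP[x3 x4]].
by split; [exact: h1|exact: h2|exact: h3|exact: h4].
Qed.

Section one_kernel.
Variables (k : pt3 R -> R) (r : R).
Hypotheses (sk : smooth k) (suk : supported r k) (k1 : \int[leb3m R]_x k x = 1).
Let ki := L1_kernel3 sk suk.
Let dki e : L1 (leb3m R) ('D_e k) := L1_kernel3 (smooth_derive e sk) (supported_derive e suk).

Let at1 F (h : pt3 R -> R) : L1c G d F -> measurable_fun setT (fun z : pt4 R * pt4 R => F z.1 (z.1 + z.2)) ->
  L1 (leb3m R) h -> L1 (pairs3 R) (fun z => h z.2 * (1 * at_once F z.1 z.2)).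
Proof.
move=> tF mF hi; have c1 (q : pt4 R) : `|(1 : R)| <= 1 by rewrite normr1.
exact: (L1_tm g0 gi pg tF mF hi (@measurable_cst _ _ _ _ setT (1 : R)) c1).
Qed.

Definition raw_defect (z : pt4 R * pt3 R) : R :=
  'D_(ex3 R) k z.2 * (1 * at_once (incr_flux U V U) z.1 z.2)
  + 'D_(ey3 R) k z.2 * (1 * at_once (incr_flux U V V) z.1 z.2)
  + 'D_(ez3 R) k z.2 * (1 * at_once (incr_flux U V W) z.1 z.2).

Lemma L1_raw_defect : L1 (pairs3 R) raw_defect.
Proof.
have iU := tame_incr_flux sol (L2_U sol); have nU := measurable_incr_flux sol mU.
have iV := tame_incr_flux sol (L2_V sol); have nV := measurable_incr_flux sol mV.
have iW := tame_incr_flux sol (L2_W sol); have nW := measurable_incr_flux sol mW.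
exact: (L1D (L1D (at1 iU nU (dki _)) (at1 iV nV (dki _))) (at1 iW nW (dki _))).
Qed.

(** In the space identity each flux splits into its diagonal value, and these add up
    to the dissipation, and a commutator. *)
Lemma raw_defect_dissipation (phi : pt4 R -> R) : test_fun T phi ->
  \int[tor4 R]_q (phi q * \int[leb3m R]_x raw_defect (q, x)) = dissipation phi +
  \int[tor4 R]_q (comm twice_corr k q * 'D_(et4 R) phi q + comm (bal_flux U V P U) k q * 'D_(ex4 R) phi q
     + comm (bal_flux U V P V) k q * 'D_(ey4 R) phi q + comm (bal_flux U V P W) k q * 'D_(ez4 R) phi q).
Proof.
move=> tp; have [C _ pC] := test_fun_bounded tp.
rewrite -(weighted_marginal L1_raw_defect (test_fun_measurable tp) pC).
have SI := space_identity sol tp sk suk.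
transitivity (\int[pairs3 R]_z ('D_(ex3 R) k z.2 * (phi z.1 * at_once (incr_flux U V U) z.1 z.2)
    + 'D_(ey3 R) k z.2 * (phi z.1 * at_once (incr_flux U V V) z.1 z.2)
    + 'D_(ez3 R) k z.2 * (phi z.1 * at_once (incr_flux U V W) z.1 z.2))).
  apply: eq_Int => z; rewrite /raw_defect.
  move: ('D_(ex3 R) k z.2) ('D_(ey3 R) k z.2) ('D_(ez3 R) k z.2) => *; ring.
apply: (etrans SI).
have B F psi : L1c G d F -> measurable_fun setT (fun z : pt4 R * pt4 R => F z.1 (z.1 + z.2)) ->
    test_fun T psi -> [/\ L1 (pairs3 R) (fun z => k z.2 * (psi z.1 * at_once F z.1 z.2)),
      L1 (tor4 R) (fun q => F q q * psi q), L1 (tor4 R) (fun q => comm F k q * psi q) &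
      \int[pairs3 R]_z (k z.2 * (psi z.1 * at_once F z.1 z.2)) =
      \int[tor4 R]_q (F q q * psi q) + \int[tor4 R]_q (comm F k q * psi q)].
  move=> tF mF ts; have [C' _ sC] := test_fun_bounded ts; have ms := test_fun_measurable ts.
  have j1 : L1 (tor4 R) (fun q => F q q * psi q).
    by apply: eq_L1 (L1_Mbounded (L1_diag sol tF mF) ms sC) => q; rewrite mulrC.
  have j2 : L1 (tor4 R) (fun q => comm F k q * psi q).
    by apply: eq_L1 (L1_Mbounded (L1_comm sol tF mF ki) ms sC) => q; rewrite mulrC.
  split; [exact: (L1_tm g0 gi pg tF mF ki ms sC)|exact: j1|exact: j2|].
  by rewrite -(IntD j1 j2); exact: (tm_split sol tF mF ki k1 ms sC).
have [a1 b1 c1 E1] := B _ _ tt mt (test_fun_derive (et4 R) tp).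
have [a2 b2 c2 E2] := B _ _ tx mx (test_fun_derive (ex4 R) tp).
have [a3 b3 c3 E3] := B _ _ ty my (test_fun_derive (ey4 R) tp).
have [a4 b4 c4 E4] := B _ _ tz mz (test_fun_derive (ez4 R) tp).
exact: (split_sum4 (Int4 a1 a2 a3 a4) E1 E2 E3 E4 (Int4 b1 b2 b3 b4) (Int4 c1 c2 c3 c4)).
Qed.

(** The error is a sum of first derivatives of commutators, and its norm is bounded by
    their integrals. *)
Lemma defect_error_le (L : (pt4 R -> R) -> R) (c e : R) : 0 <= e -> \int[leb3m R]_x `|k x| <= c ->
  (forall phi, test_fun T phi -> L phi = \int[tor4 R]_q (phi q * \int[leb3m R]_x raw_defect (q, x))) ->
  (forall x : pt3 R, `|x| <= r ->
  [/\ \int[tor4 R]_q `|twice_corr q (q + (x, 0)) - twice_corr q q| <= e,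
      \int[tor4 R]_q `|bal_flux U V P U q (q + (x, 0)) - bal_flux U V P U q q| <= e,
      \int[tor4 R]_q `|bal_flux U V P V q (q + (x, 0)) - bal_flux U V P V q q| <= e &
      \int[tor4 R]_q `|bal_flux U V P W q (q + (x, 0)) - bal_flux U V P W q q| <= e]) ->
  (Wm11Wm11_norm T (fun phi => (L phi - dissipation phi)%R) <= (4 * (c * e))%:E)%E.
Proof.
move=> e0 kc LE He.
have j1 := L1_comm sol tt mt ki; have j2 := L1_comm sol tx mx ki.
have j3 := L1_comm sol ty my ki; have j4 := L1_comm sol tz mz ki.
apply: le_trans (Wm11Wm11_norm_le j1 j2 j3 j4 _) _.
  by move=> phi tp; rewrite LE// raw_defect_dissipation// addrC addKr.
have S F : L1c G d F -> measurable_fun setT (fun z : pt4 R * pt4 R => F z.1 (z.1 + z.2)) ->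
    (forall x : pt3 R, `|x| <= r -> \int[tor4 R]_q `|F q (q + (x, 0)) - F q q| <= e) ->
    \int[tor4 R]_q `|comm F k q| <= c * e.
  move=> tF mF h; apply: le_trans (comm_small sol tF mF ki suk e0 h) _.
  by rewrite ler_wpM2r.
have h1 := S _ tt mt (fun x xr => let: And4 h _ _ _ := He x xr in h).
have h2 := S _ tx mx (fun x xr => let: And4 _ h _ _ := He x xr in h).
have h3 := S _ ty my (fun x xr => let: And4 _ _ h _ := He x xr in h).
have h4 := S _ tz mz (fun x xr => let: And4 _ _ _ h := He x xr in h).
rewrite lee_fin; exact: sum4_le h1 h2 h3 h4.
Qed.

End one_kernel.

End dissipation.

(** * The local energy balance *)

Lemma balance_arith (R : realType) (d0 d1 d2 d3 f1 f2 f3 I0 I1 I2 I3 J1 J2 J3 S A0 A1 A2 A3 : R) :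
  d0 = I0 -> d1 = I1 -> d2 = I2 -> d3 = I3 -> f1 = J1 -> f2 = J2 -> f3 = J3 ->
  S = A0 + A1 + A2 + A3 -> A0 = 2 * I0 -> A1 = 2 * I1 + 4 * J1 -> A2 = 2 * I2 + 4 * J2 ->
  A3 = 2 * I3 + 4 * J3 ->
  - d0 + (- d1 + - d2 + - d3) + 2 * (- f1 + - f2 + - f3) + 2^-1 * S = 0.
Proof. by move=> -> -> -> -> -> -> -> -> -> -> -> ->; field. Qed.

Lemma integrable_restricts_sub d (X : measurableType d) (R : realType) (n m : {measure set X -> \bar R})
    (D D' : set X) (F f : X -> R) : restricts n m D -> measurable D' -> D' `<=` D -> L1 n F ->
  (forall x, D' x -> F x = f x) -> m.-integrable D' (EFin \o f).
Proof.
move=> nm mD' sub Fi Ff; have h1 := restricts_L1 nm Fi.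
have h2 := integrableS nm.1 mD' sub h1.
by apply: eq_integrable h2 => // x; rewrite inE => /Ff /= ->.
Qed.

Section balance.
Variables (R : realType) (T Om M0 : R) (u v w p : pt4 R -> R).
Local Notation U := (ext T u).
Local Notation V := (ext T v).
Local Notation W := (ext T w).
Local Notation P := (ext T p).
Hypotheses (pu : per4 u) (pv : per4 v) (pw : per4 w) (pp : per4 p).
Hypothesis sol : torus_solution T Om M0 U V W P.
Let mU : measurable_fun setT U. Proof. by have [] := ts_meas sol. Qed.
Let mV : measurable_fun setT V. Proof. by have [] := ts_meas sol. Qed.
Let mW : measurable_fun setT W. Proof. by have [] := ts_meas sol. Qed.
Let mP : measurable_fun setT P. Proof. by have [_ _ _ h] := ts_int sol; exact: L1_measurable h. Qed.

Let eqs q : 0 < q.2 < T -> [/\ U q = u q, V q = v q, W q = w q & P q = p q].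
Proof. by move=> qT; split; exact: extE. Qed.

Lemma Wm11Wm11_norm_ge0 L : (0 <= Wm11Wm11_norm T L :> \bar R)%E.
Proof.
apply: le_ereal_inf_tmp => _ [G0 [G1 [_ _ _ ->]]].
by apply: adde_ge0; apply: integral_ge0 => t _; exact: Wm11_norm_ge0.
Qed.

(** Inside the time interval a translation in space stays there, so increments of the
    fields and of their extensions agree. *)
Lemma distr_defect (rho : pt3 R -> R) (e r : R) phi : smooth (rescale rho e) ->
  supported r (rescale rho e) -> test_fun T phi -> distr T (defect rho e u v w) phi =
  \int[tor4 R]_q (phi q * \int[leb3m R]_x raw_defect U V W (rescale rho e) (q, x)).
Proof.
move=> sk suk tp; apply: Int_cylinder.
- apply: measurable_funM; first exact: test_fun_measurable tp.
  exact: L1_measurable (L1_Int1 (L1_raw_defect sol sk suk)).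
- move=> q qT.
  have E : \int[leb3m R]_x raw_defect U V W (rescale rho e) (q, x) = defect rho e u v w q; last by rewrite E mulrC.
  transitivity (\int[leb3m R]_x (('D_(ex3 R) (rescale rho e) x * increment u x q
      + 'D_(ey3 R) (rescale rho e) x * increment v x q + 'D_(ez3 R) (rescale rho e) x * increment w x q)
     * (`|increment u x q| ^+ 2 + `|increment v x q| ^+ 2))); last by [].
  apply: eq_Int => x; rewrite /raw_defect -[(q, x).1]/q -[(q, x).2]/x.
  have sh : q + (x, 0) = (q.1 + x, q.2).
    by transitivity (q.1 + x, q.2 + 0); [by []|rewrite addr0].
  have [hu hv hw _] := @eqs (q.1 + x, q.2) qT; have [gu gv gw _] := eqs qT.
  rewrite /at_once /incr_flux sh hu hv hw gu gv gw /increment !real_normK ?num_real//.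
  move: ('D_(ex3 R) (rescale rho e) x) ('D_(ey3 R) (rescale rho e) x) ('D_(ez3 R) (rescale rho e) x) => *; ring.
- by move=> q qT; rewrite (test_fun_out tp qT) mul0r.
Qed.

(** On a kernel of small support every commutator is small, and the mass of the
    rescaled kernels stays bounded. *)
Lemma defect_cvg (rho : pt3 R -> R) : mollifier rho ->
  Wm11Wm11_norm T (fun phi => (distr T (defect rho eps u v w) phi - dissipation U V W P phi)%R)
    @[eps --> (0 : R)^'+] --> 0%E.
Proof.
move=> [sr cr _ i1]; have [M Mge sur] := mollifier_supported cr.
have i1' : \int[leb3m R]_x rho x = 1 := i1.
have [c c0 kc] := rescale_mass sr sur Mge.
have key (e : R) : 0 < e -> exists2 s, 0 < s & forall eps, 0 < eps -> eps < s ->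
    (Wm11Wm11_norm T (fun phi => (distr T (defect rho eps u v w) phi - dissipation U V W P phi)%R) <= e%:E)%E.
  move=> e0; have c1 : 0 < 4 * (c + 1) by lra.
  have [r r0 hr] := fluxes_small sol (divr_gt0 e0 c1).
  have M1 : 0 < M + 1 by lra.
  exists (r / (M + 1)) => [|eps ep es]; first exact: divr_gt0.
  have [sk suk k1] := Int_rescale sr sur ep; rewrite i1' in k1.
  have er : eps * M <= r.
    by move: es; rewrite ltr_pdivlMr// mulrDr mulr1; lra.
  apply: le_trans (defect_error_le sol sk suk k1 (ltW (divr_gt0 e0 c1)) (kc _ ep) _
    (fun x xr => hr x (le_trans xr er))) _.
    by move=> phi tp; exact: (distr_defect sk suk tp).
  rewrite lee_fin (_ : 4 * (c * (e / (4 * (c + 1)))) = e * (c / (c + 1))); last by field; lra.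
  by rewrite ler_piMr ?ltW// ltr_pdivrMr; lra.
apply/fine_cvgP; split.
  have [s s0 hs] := key 1 ltr01; near=> eps.
  rewrite ge0_fin_numE ?Wm11Wm11_norm_ge0//; apply: le_lt_trans (hs eps _ _) (ltry _); near: eps.
    exact: nbhs_right_gt.
  exact: nbhs_right_lt.
apply/cvgrPdist_le => e e0; have [s s0 hs] := key e e0; near=> eps.
have h : (Wm11Wm11_norm T (fun phi => (distr T (defect rho eps u v w) phi - dissipation U V W P phi)%R) <= e%:E)%E.
  by apply: hs; near: eps; [exact: nbhs_right_gt|exact: nbhs_right_lt].
have f : Wm11Wm11_norm T (fun phi => (distr T (defect rho eps u v w) phi - dissipation U V W P phi)%R) \is a fin_num.
  by rewrite ge0_fin_numE ?Wm11Wm11_norm_ge0//; exact: le_lt_trans h (ltry _).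
by rewrite sub0r normrN ger0_norm ?fine_ge0 ?Wm11Wm11_norm_ge0// -lee_fin fineK.
Unshelve. all: by end_near. Qed.

Let L1_product (f g : pt4 R -> R) : measurable_fun setT f -> measurable_fun setT g ->
  (forall q, f q ^+ 2 <= 2 * mass T U V W P q) -> (forall q, g q ^+ 2 <= mass T U V W P q) ->
  L1 (tor4 R) (fun q => f q * g q).
Proof.
move=> mf mg fm gm; apply: (@L1_le _ _ _ (tor4 R) _ (fun q => 2 * mass T U V W P q)).
- exact: measurable_funM.
- exact: (L1Z 2 (L1_mass sol)).
- move=> q; have := fm q; have := gm q; have := mass_ge0 sol q; have := sqr_ge0 (`|f q| - `|g q|).
  rewrite normrM sqrrB !real_normK ?num_real// -mulr_natl.
  move: (mass _ _ _ _ _ _) (f q ^+ 2) (g q ^+ 2) (`|f q| * `|g q|) => *; lra.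
Qed.

Let squares q : [/\ U q ^+ 2 <= mass T U V W P q, V q ^+ 2 <= mass T U V W P q, W q ^+ 2 <= mass T U V W P q,
  P q ^+ 2 <= mass T U V W P q & kin U V q ^+ 2 <= 2 * mass T U V W P q].
Proof.
have [b1 b2 b3 b4 _] := bulk_ge sol q; have b0 := le_trans (sqr_ge0 (U q)) b1.
have w0 := sqr_ge0 (W q); have p0 := sqr_ge0 (P q); rewrite /mass.
have k0 : kin U V q ^+ 2 <= 2 * bulk T U V q.
  have s0 : 0 <= slab T q by rewrite /slab; case: ifP.
  have := sqr_ge0 (U q ^+ 2 - V q ^+ 2); rewrite /kin /bulk.
  by move: s0; move: (slab T q) (U q) (V q) => s a b; nra.
by split; move: b0 b1 b2 w0 p0 k0; move: (bulk T U V q) (U q ^+ 2) (V q ^+ 2) (W q ^+ 2) (P q ^+ 2) (kin U V q ^+ 2) => *; lra.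
Qed.

Let mK : measurable_fun setT (kin U V).
Proof. by apply: measurable_funD; exact: measurable_funX. Qed.

Let iK : L1 (tor4 R) (kin U V).
Proof. exact: (L1D (L1_U2 sol) (L1_V2 sol)). Qed.

Let energy_flux (f : pt4 R -> R) : measurable_fun setT f -> (forall q, f q ^+ 2 <= mass T U V W P q) ->
  L1 (tor4 R) (fun q => kin U V q * f q) /\ L1 (tor4 R) (fun q => P q * f q).
Proof.
move=> mf fm; split; apply: L1_product => // q; first by have [] := squares q.
have [_ _ _ h _] := squares q; have := mass_ge0 sol q; move: h.
by move: (mass _ _ _ _ _ _) (P q ^+ 2) => *; lra.
Qed.

Lemma loc_integrable_of (F f : pt4 R -> R) : L1 (tor4 R) F -> (forall q, 0 < q.2 < T -> F q = f q) ->
  loc_integrable T f.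
Proof.
move=> Fi Ff a b a0 bT; have mc := @measurable_cube R.
have mD : measurable (cube R `*` `[a, b]) by apply: measurableX => //; exact: measurable_itv.
have sub : cube R `*` `[a, b] `<=` cube R `*` setT by move=> q [].
have h : (leb4m R).-integrable (cube R `*` `[a, b]) (EFin \o f).
  apply: (integrable_restricts_sub (tor4_restricts R) mD sub Fi) => q [_].
  rewrite /= in_itv/= => /andP[aq qb].
  by apply: Ff; rewrite (lt_le_trans a0)// (le_lt_trans qb).
exact: h.
Qed.

Let distr_of (F f theta : pt4 R -> R) : L1 (tor4 R) F -> (forall q, 0 < q.2 < T -> F q = f q) ->
  test_fun T theta -> L1 (tor4 R) (fun q => F q * theta q) /\ distr T f theta = \int[tor4 R]_q (F q * theta q).
Proof.
move=> Fi Ff tt; have [C _ tC] := test_fun_bounded tt; have mt := test_fun_measurable tt.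
have i : L1 (tor4 R) (fun q => F q * theta q).
  by apply: eq_L1 (L1_Mbounded Fi mt tC) => q; rewrite mulrC.
split; first exact: i.
apply: Int_cylinder; first exact: L1_measurable i.
  by move=> q /Ff ->.
by move=> q qT; rewrite (test_fun_out tt qT) mulr0.
Qed.

Lemma energy_balance (E : pt4 R -> R) : (forall q, E q = u q ^+ 2 + v q ^+ 2) ->
  [/\ loc_integrable T E
      /\ [/\ loc_integrable T (E \* u), loc_integrable T (E \* v) & loc_integrable T (E \* w)],
      [/\ loc_integrable T (p \* u), loc_integrable T (p \* v) & loc_integrable T (p \* w)] &
      forall phi, test_fun T phi ->
        dderive (et4 R) (distr T E) phi + distr_div T (E \* u) (E \* v) (E \* w) phi
        + 2 * distr_div T (p \* u) (p \* v) (p \* w) phi + 2^-1 * dissipation U V W P phi = 0].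
Proof.
move=> EE.
have [KU PU] := energy_flux mU (fun q => let: And5 h _ _ _ _ := squares q in h).
have [KV PV] := energy_flux mV (fun q => let: And5 _ h _ _ _ := squares q in h).
have [KW PW] := energy_flux mW (fun q => let: And5 _ _ h _ _ := squares q in h).
have eK q : 0 < q.2 < T -> kin U V q = E q by move=> /eqs[e1 e2 _ _]; rewrite EE /kin e1 e2.
have eU q : 0 < q.2 < T -> kin U V q * U q = (E \* u) q by move=> qT; have [e _ _ _] := eqs qT; rewrite eK// e.
have eV q : 0 < q.2 < T -> kin U V q * V q = (E \* v) q by move=> qT; have [_ e _ _] := eqs qT; rewrite eK// e.
have eW q : 0 < q.2 < T -> kin U V q * W q = (E \* w) q by move=> qT; have [_ _ e _] := eqs qT; rewrite eK// e.
have fU q : 0 < q.2 < T -> P q * U q = (p \* u) q by move=> qT; have [e _ _ e'] := eqs qT; rewrite e' e.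
have fV q : 0 < q.2 < T -> P q * V q = (p \* v) q by move=> qT; have [_ e _ e'] := eqs qT; rewrite e' e.
have fW q : 0 < q.2 < T -> P q * W q = (p \* w) q by move=> qT; have [_ _ e e'] := eqs qT; rewrite e' e.
split.
- split; first exact: loc_integrable_of iK eK.
  by split; [exact: loc_integrable_of KU eU|exact: loc_integrable_of KV eV|exact: loc_integrable_of KW eW].
- by split; [exact: loc_integrable_of PU fU|exact: loc_integrable_of PV fV|exact: loc_integrable_of PW fW].
move=> phi tp; have dt := test_fun_derive (et4 R) tp; have dx := test_fun_derive (ex4 R) tp.
have dy := test_fun_derive (ey4 R) tp; have dz := test_fun_derive (ez4 R) tp.
have [j0 E0] := distr_of iK eK dt.
have [j1 E1] := distr_of KU eU dx; have [j2 E2] := distr_of KV eV dy; have [j3 E3] := distr_of KW eW dz.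
have [l1 F1] := distr_of PU fU dx; have [l2 F2] := distr_of PV fV dy; have [l3 F3] := distr_of PW fW dz.
have m1 := L1D (L1Z 2 j1) (L1Z 4 l1); have m2 := L1D (L1Z 2 j2) (L1Z 4 l2); have m3 := L1D (L1Z 2 j3) (L1Z 4 l3).
have DE : dissipation U V W P phi =
  \int[tor4 R]_q (2 * (kin U V q * 'D_(et4 R) phi q)
    + (2 * (kin U V q * U q * 'D_(ex4 R) phi q) + 4 * (P q * U q * 'D_(ex4 R) phi q))
    + (2 * (kin U V q * V q * 'D_(ey4 R) phi q) + 4 * (P q * V q * 'D_(ey4 R) phi q))
    + (2 * (kin U V q * W q * 'D_(ez4 R) phi q) + 4 * (P q * W q * 'D_(ez4 R) phi q))).
  apply: eq_Int => q; rewrite /twice_corr /bal_flux /corr /kin.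
  move: ('D_(et4 R) phi q) ('D_(ex4 R) phi q) ('D_(ey4 R) phi q) ('D_(ez4 R) phi q).
  move: (U q) (V q) (W q) (P q) => *; ring.
rewrite /distr_div /dderive.
exact: (balance_arith E0 E1 E2 E3 F1 F2 F3 (etrans DE (Int4 (L1Z 2 j0) m1 m2 m3)) (IntZ 2 j0)
  (Int_lin2 2 4 j1 l1) (Int_lin2 2 4 j2 l2) (Int_lin2 2 4 j3 l3)).
Qed.

End balance.

Theorem theorem2p5 (R : realType) (T Omega : R) (u v w p : pt4 R -> R)
  (T_gt0 : 0 < T)
  (symm : hydrostatic_symmetry T u v w p)
  (sol : type_I_weak_solution T Omega u v w p)
  (u_L4L4 : (LpLq_norm T 4%:E 4%:E u < +oo)%E)
  (v_L4L4 : (LpLq_norm T 4%:E 4%:E v < +oo)%E) :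
  exists D : (pt4 R -> R) -> R,
    [/\ (Wm11Wm11_norm T D < +oo)%E,
        forall rho : pt3 R -> R, mollifier rho ->
          Wm11Wm11_norm T
            (fun phi => distr T (defect rho eps u v w) phi - D phi)
            @[eps --> (0 : R)^'+] --> 0%E &
        local_energy_balance T u v w p D].
Proof.
have [M0 tsol] := torus_solution_of sol u_L4L4 v_L4L4.
have [[fu fv fw fp] _ _ _] := sol.
exists (dissipation (ext T u) (ext T v) (ext T w) (ext T p)); split.
- exact: (dissipation_finite tsol).
- by move=> rho mrho; exact: (defect_cvg fu.1 fv.1 fw.1 fp.1 tsol mrho).
- exact: (energy_balance fu.1 fv.1 fw.1 fp.1 tsol (fun q => erefl)).
Qed.
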